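(* Let $T_N=2N$. For every $M\ge 1$, every sequence $\{N_m\}_{m=1}^{M+1}$ of positive integers, every strictly increasing sequence $s_1<s_2<\dots<s_{M+1}$ of nonpositive real numbers with $s_{M+1}=0$, and all real points $x^{(m)}_i$ ($1\le m\le M+1$, $1\le i\le N_m$), the limit $$\rho\big(s_1,\{x^{(1)}_i\}_{i=1}^{N_1};\dots;s_M,\{x^{(M)}_i\}_{i=1}^{N_M};0,\{x^{(M+1)}_i\}_{i=1}^{N_{M+1}}\big)\equiv\lim_{N\to\infty}\rho^{T_N}_N\big(T_N+s_1,\{x^{(1)}_i\}_{i=1}^{N_1};\,T_N+s_2,\{x^{(2)}_i\}_{i=1}^{N_2};\dots;\,T_N,\{x^{(M+1)}_i\}_{i=1}^{N_{M+1}}\big)$$ exists and equals ${\rm Tdet}\,\mathbb{Q}$, where $\mathbb Q$ is the $\sum_m N_m\times\sum_m N_m$ quaternion matrix defined below.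
   Context: Finite-$N$ correlation functions. Let $p_t(x,y)=(2\pi t)^{-1/2}e^{-(x-y)^2/(2t)}$ for $t>0$. For $N\ge1$ let $W_N=\{x\in\mathbb R^N:x_1<x_2<\dots<x_N\}$, $h_N(x)=\prod_{1\le i<j\le N}(x_j-x_i)$, $f_N(t,x,y)=\det_{1\le i,j\le N}(p_t(x_i,y_j))$, $\mathcal N_N(t,x)=\int_{W_N}f_N(t,x,y)\,dy$ for $t>0$ and $\mathcal N_N(0,x)=1$. For $T>0$, $0<s<t\le T$ and $x,y\in W_N$ put $g^T_N(s,x;t,y)=f_N(t-s,x,y)\mathcal N_N(T-t,y)/\mathcal N_N(T-s,x)$, and for $0<t\le T$, $y\in W_N$ put $g^T_N(0,0;t,y)=C(N,T,t)h_N(y)\mathcal N_N(T-t,y)\prod_{i=1}^Np_t(0,y_i)$ with $C(N,T,t)=\pi^{N/2}\big(\prod_{j=1}^N\Gamma(j/2)\big)^{-1}T^{N(N-1)/4}t^{-N(N-1)/2}$. (This is the transition density of $N$ Brownian motions started at the origin and conditioned not to collide during $[0,T]$.) Given $M\ge1$ and times $0<t_1<\dots<t_M<t_{M+1}=T$, for $x^{(m)}\in W_N$ define $\rho^T_N(t_1,x^{(1)};\dots;t_{M+1},x^{(M+1)})=g^T_N(0,0;t_1,x^{(1)})\prod_{m=1}^{M}g^T_N(t_m,x^{(m)};t_{m+1},x^{(m+1)})$; extend it to $x^{(m)}\in\mathbb R^N$ by evaluating at the increasing rearrangements of the $x^{(m)}$ if each $x^{(m)}$ has pairwise distinct coordinates,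 and by $0$ otherwise (so it depends only on the sets $\{x^{(m)}_1,\dots,x^{(m)}_N\}$). For integers $1\le N_m\le N$ the multitime correlation function is $$\rho^T_N\big(t_1,\{x^{(1)}_i\}_{i=1}^{N_1};\dots;t_{M+1},\{x^{(M+1)}_i\}_{i=1}^{N_{M+1}}\big)=\int_{\prod_{m}\mathbb R^{N-N_m}}\prod_{m=1}^{M+1}\Big(\frac{1}{(N-N_m)!}\prod_{i=N_m+1}^{N}dx^{(m)}_i\Big)\,\rho^T_N(t_1,x^{(1)};\dots;t_{M+1},x^{(M+1)}),$$ where $x^{(m)}=(x^{(m)}_1,\dots,x^{(m)}_N)$. Quaternions. A quaternion is $q=q_0+q_1e_1+q_2e_2+q_3e_3$ with $q_i\in\mathbb C$, identified via the injective linear map $C$ with $C(1)=I_2$, $C(e_1)=\begin{pmatrix}0&-1\\1&0\end{pmatrix}$, $C(e_2)=\begin{pmatrix}0&-\sqrt{-1}\\-\sqrt{-1}&0\end{pmatrix}$, $C(e_3)=\begin{pmatrix}\sqrt{-1}&0\\0&-\sqrt{-1}\end{pmatrix}$ (so each $2\times2$ complex matrix is $C(q)$ for a unique $q$; multiplication corresponds to matrix multiplication). The dual is $q^\dagger=q_0-\sum_{i=1}^3q_ie_i$; for a quaternion matrix $Q=(q_{ij})$, $(Q^\dagger)_{ij}=q_{ji}^\dagger$, and $Q$ is self-dual if $Q^\dagger=Q$. For an $n\times n$ self-dual quaternion matrix, ${\rm Tdet}\,Q=\sum_{\pi\in S_n}(-1)^{n-\ell(\pi)}\prod_{1}^{\ell(\pi)}q_{ab}q_{bc}\cdots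 q_{da}$, where the product runs over the $\ell(\pi)$ disjoint cycles $(a\to b\to c\to\dots\to d\to a)$ of $\pi$; the result is a scalar (multiple of $1$), identified with a complex number. The kernel. Define $\widetilde{\mathbb S}(s,x;t,y)=\frac1\pi\int_0^1 \cos(\lambda(x-y))e^{-\lambda^2(t-s)/2}d\lambda$ if $s>t$; $=\frac{\sin(x-y)}{\pi(x-y)}$ if $s=t$; $=-\frac1\pi\int_1^\infty\cos(\lambda(x-y))e^{-\lambda^2(t-s)/2}d\lambda$ if $s<t$; $\mathbb D(s,x;t,y)=-\frac1\pi\int_0^1\lambda\sin(\lambda(x-y))e^{-(s+t)\lambda^2/2}d\lambda$; $\widetilde{\mathbb I}(s,x;t,y)=-\frac1\pi\int_1^\infty\frac1\lambda\sin(\lambda(x-y))e^{(s+t)\lambda^2/2}d\lambda$. Let ${\bf q}^{m,n}(x,y)$ be the quaternion with $C({\bf q}^{m,n}(x,y))=\begin{pmatrix}\widetilde{\mathbb S}(s_m,x;s_n,y)&\widetilde{\mathbb I}(s_m,x;s_n,y)\\ \mathbb D(s_m,x;s_n,y)&\widetilde{\mathbb S}(s_n,y;s_m,x)\end{pmatrix}$. Then $\mathbb Q$ is the self-dual block quaternion matrix $(\mathbb Q^{m,n})_{1\le m,n\le M+1}$ whose $(m,n)$ block is the $N_m\times N_n$ matrix $\big({\bf q}^{m,n}(x^{(m)}_i,x^{(n)}_j)\big)_{1\le i\le N_m,1\le j\le N_n}$. *)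

(* Defs.v *)
From HB Require Import structures.
From mathcomp Require Import all_boot all_order all_algebra all_fingroup.
From mathcomp Require Import all_classical all_reals all_analysis.
Set Implicit Arguments. Unset Strict Implicit. Unset Printing Implicit Defensive.
Import Order.TTheory GRing.Theory Num.Theory.
Import numFieldNormedType.Exports.
Local Open Scope classical_set_scope.
Local Open Scope ring_scope.

Section Defs.
Variable R : realType.
Local Notation leb := (@lebesgue_measure R).

Definition int01 (f : R -> R) : R := Rintegral leb `[0, 1] f.
Definition int1oo (f : R -> R) : R :=
  lim ((fun b : R => Rintegral leb `[1, b] f) @ +oo_R).

Definition Gamma (a : R) : R :=
  fine (\int[leb]_(u in [set u : R | (0 < u)%R]) ((u `^ (a - 1) * expR (- u))%R)%:E)%E.

Definition ptd (t x y : R) : R :=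
  (2 * pi * t) `^ (- 2^-1) * expR (- ((x - y) ^+ 2) / (2 * t)).

Definition fN (n : nat) (t : R) (x y : 'I_n -> R) : R :=
  \det (\matrix_(i, j) ptd t (x i) (y j)).

Definition inW (n : nat) (x : 'I_n -> R) : bool :=
  [forall i : 'I_n, forall j : 'I_n, (i < j)%N ==> (x i < x j)].
Definition hN (n : nat) (y : 'I_n -> R) : R :=
  \prod_(i < n) \prod_(j < n | (i < j)%N) (y j - y i).

(** Iterated Lebesgue integral over the variables z 0, ..., z (n-1)
    (outermost integral in z 0). *)
Fixpoint iint (n : nat) (F : (nat -> R) -> \bar R) : \bar R :=
  match n with
  | 0 => F (fun _ => 0)
  | k.+1 => (\int[leb]_(u in setT)
               iint k (fun z => F (fun j => if j is j'.+1 then z j' else u)))%E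
  end.

Definition intRn (n : nat) (G : ('I_n -> R) -> \bar R) : \bar R :=
  iint n (fun z => G (fun i => z (nat_of_ord i))).

(** N_N(t,x) (finite, so we take its real value). *)
Definition NN (n : nat) (t : R) (x : 'I_n -> R) : R :=
  if t == 0 then 1
  else fine (intRn (fun y => if inW y then (fN t x y)%:E else 0%E)).

Definition CNT (n : nat) (T t : R) : R :=
  pi `^ (n%:R / 2) / (\prod_(j < n) Gamma (j.+1%:R / 2))
  * T `^ (n%:R * (n%:R - 1) / 4) * t `^ (- (n%:R * (n%:R - 1) / 2)).

Definition g0 (n : nat) (T t : R) (y : 'I_n -> R) : R :=
  CNT n T t * hN y * NN (T - t) y * \prod_(i < n) ptd t 0 (y i).
Definition gT (n : nat) (T s : R) (x : 'I_n -> R) (t : R) (y : 'I_n -> R) : R :=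
  fN (t - s) x y * NN (T - t) y / NN (T - s) x.

Definition srt (n : nat) (x : 'I_n -> R) : 'I_n -> R :=
  fun i => nth 0 (sort <=%R [seq x j | j <- enum 'I_n]) i.
Definition distinct (n : nat) (x : 'I_n -> R) : bool :=
  uniq [seq x j | j <- enum 'I_n].

(** rho^T_N(t_1,x^(1);...;t_{M+1},x^(M+1)) extended to R^N by symmetry;
    index m : 'I_M.+1 stands for time index m+1. *)
Definition rhoN (n M : nat) (T : R) (tt : 'I_M.+1 -> R)
    (X : 'I_M.+1 -> 'I_n -> R) : R :=
  if [forall m, distinct (X m)] then
    g0 T (tt ord0) (srt (X ord0)) *
    \prod_(m < M) gT T (tt (inord m)) (srt (X (inord m)))
                        (tt (inord m.+1)) (srt (X (inord m.+1)))
  else 0.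

(** Multitime correlation function: the first Nm m coordinates of the m-th
    configuration are the given points, the remaining n - Nm m coordinates
    are integrated out (with weight 1/(n - Nm m)!). *)
Definition corr (n M : nat) (T : R) (tt : 'I_M.+1 -> R) (Nm : 'I_M.+1 -> nat)
    (x : forall m : 'I_M.+1, 'I_(Nm m) -> R) : \bar R :=
  let off (m : 'I_M.+1) := (\sum_(l < M.+1 | (l < m)%N) (n - Nm l))%N in
  let K := (\sum_(l < M.+1) (n - Nm l))%N in
  ((\prod_(m < M.+1) ((n - Nm m)`!%:R)^-1)%:E *
   iint K (fun z => (rhoN T tt (fun m (j : 'I_n) =>
      match (insub (nat_of_ord j) : option 'I_(Nm m)) with
      | Some i => x m i
      | None => z (off m + (j - Nm m))%N
      end))%:E))%E.

Definition Stil (s x t y : R) : R :=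
  if t < s then pi^-1 * int01 (fun l => cos (l * (x - y)) * expR (- (l ^+ 2 * (t - s)) / 2))
  else if s == t then (if x == y then pi^-1 else sin (x - y) / (pi * (x - y)))
  else - pi^-1 * int1oo (fun l => cos (l * (x - y)) * expR (- (l ^+ 2 * (t - s)) / 2)).
Definition DD (s x t y : R) : R :=
  - pi^-1 * int01 (fun l => l * sin (l * (x - y)) * expR (- ((s + t) * l ^+ 2) / 2)).
Definition Itil (s x t y : R) : R :=
  - pi^-1 * int1oo (fun l => l^-1 * sin (l * (x - y)) * expR ((s + t) * l ^+ 2 / 2)).

(** The quaternion q^{m,n}(x,y) represented by its 2x2 matrix C(q). *)
Definition qmat (s x t y : R) : 'M[R]_2 :=
  \matrix_(i, j)
    if (i : nat) == 0%N then (if (j : nat) == 0%N then Stil s x t y else Itil s x t y)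
    else (if (j : nat) == 0%N then DD s x t y else Stil t y s x).

(** Quaternion determinant (Dyson), quaternions given by their 2x2 matrices.
    For a cycle a -> p a -> ... -> a the product q_{a,pa} q_{pa,p^2a} ... is
    taken and its scalar part (half the trace of C(.)) is used. *)
Definition cycprod (I : finType) (q : I -> I -> 'M[R]_2) (p : {perm I})
    (O : {set I}) : 'M[R]_2 :=
  match [pick a in O] with
  | Some a => \prod_(k < #|O|) q ((p ^+ k)%g a) ((p ^+ k.+1)%g a)
  | None => 1
  end.
Definition Tdet (I : finType) (q : I -> I -> 'M[R]_2) : R :=
  \sum_(p : {perm I}) (-1) ^+ (#|I| - #|porbits p|)%N *
     \prod_(O in porbits p) (2^-1 * \tr (cycprod q p O)).

Definition Qmat (M : nat) (Nm : 'I_M.+1 -> nat) (s : 'I_M.+1 -> R)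
    (x : forall m : 'I_M.+1, 'I_(Nm m) -> R)
    (a b : {m : 'I_M.+1 & 'I_(Nm m)}) : 'M[R]_2 :=
  qmat (s (tag a)) (x (tag a) (tagged a)) (s (tag b)) (x (tag b) (tagged b)).

End Defs.

(* Main.v *)
(* De Bruijn's formula writes the generating function of the correlations as a Pfaffian of pairings against the
   sign kernel. Its square is a determinant which is a finite-rank perturbation of the bare one, hence equals
   det (1 + eps Q) for a self-dual quaternion kernel Q; comparing multilinear coefficients in eps gives
   corr = Tdet Q at finite N. In a basis of rescaled Hermite functions and their derivatives the pairings at the
   final time are explicit. Indexing by a with 4a/T close to l^2, the normalised basis functions converge to
   cos (l x) exp (- s l^2/2) and its x-derivative and x-primitive, and by Wallis' formula the kernel sums become
   Riemann sums in l over [0, 1]; for odd N the extra terms are alternating sums, which vanish in the limit.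
   Gaussian and Dirichlet integrals turn the remaining terms into the integrals over [1, oo). *)
Require Import Defs.
From HB Require Import structures.
From mathcomp Require Import all_boot all_order all_algebra all_fingroup.
From mathcomp Require Import all_classical all_reals all_analysis.
From mathcomp Require Import measurable_realfun zify ring lra.
Set Implicit Arguments. Unset Strict Implicit. Unset Printing Implicit Defensive.
Import Order.TTheory GRing.Theory Num.Theory.
Import numFieldNormedType.Exports.
Local Open Scope classical_set_scope.
Local Open Scope ring_scope.

Local Notation mfunT := (measurable_fun setT).
Local Notation fset0 := finset.set0.
Local Notation fsubsetP := fintype.subsetP.
Local Notation fsetP := finset.setP.
Local Notation fsetT := finset.setT.
Local Notation mfunM := measurable_funM.
Local Notation sqrt := Num.sqrt.
Local Notation mcomp := measurableT_comp.

(** A Pfaffian needs an even number of rows, so for odd N a frozen particle is added at a point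
    outside the line. This is why the integration theory is written for an abstract space carrying
    Lebesgue measure along a map [io] plus finitely many atoms. The same atoms give the generating
    function: a mass eps_i is put at each prescribed point of its time level. The integrand vanishes
    when two particles of a level coincide, so each atom is used at most once, and the dependence on
    eps is multilinear with the correlations as coefficients. Passing to the square avoids a
    Pfaffian calculus for quaternions: the scalar part of a cycle is half a trace, squaring turns
    each half into a whole because a permutation splits in two along its cycles in 2^cycles ways,
    and sums of products of traces are what det (1 + eps Q) expands into. With constant term 1 the
    square determines all coefficients. The normalising constant is likewise computed only through
    its square; its sign comes from nonnegativity of the density. *)

Lemma le_of_eq d (T : porderType d) (u v : T) : u = v -> (u <= v)%O. by move=> ->. Qed.

Lemma cvg_eq_near (U : Type) (F : set_system U) {FF : Filter F} (T : topologicalType) (f g : U -> T) (l : T) :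
 f @ F --> l -> (\forall n \near F, f n = g n) -> g @ F --> l.
by move=> fl fg; apply: cvg_trans fl; exact: near_eq_cvg. Qed.

Lemma continuous_mfun (R : realType) (f : R -> R) : continuous f -> mfunT f.
exact: continuous_measurable_fun. Qed.
Lemma natr_double1 (R : realType) k : (k.*2.+1)%:R = 2 * k%:R + 1 :> R.
by rewrite -addn1 natrD -mul2n natrM. Qed.
Lemma natr_double2 (R : realType) k : (k.*2.+2)%:R = 2 * k%:R + 2 :> R.
by rewrite -addn2 natrD -mul2n natrM. Qed.

(** * Lebesgue integrals over the real line and Fubini's theorem *)

Section RealIntegral.
Variable R : realType.
Implicit Types (f g : R -> R).
Notation leb := (@lebesgue_measure R).

Definition itg f := leb.-integrable setT (EFin \o f).
Definition Ri f : R := Rintegral leb setT f.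
Lemma itg_meas f : itg f -> mfunT f.
by move=> /integrableP[/measurable_EFinP]. Qed.

Lemma itgD f g : itg f -> itg g -> itg (fun x => f x + g x).
move=> hf hg.
rewrite /itg (_ : _ \o _ = ((EFin \o f) \+ (EFin \o g))%E); last by apply/funext => x /=; rewrite EFinD.
exact: integrableD.
Qed.

Lemma itgZ c f : itg f -> itg (fun x => c * f x).
move=> hf; rewrite /itg (_ : _ \o _ = (fun x => c%:E * (EFin \o f) x)%E); last by apply/funext => x /=; rewrite EFinM.
exact: integrableZl.
Qed.

Lemma itg_dom f g : mfunT f -> itg g -> (forall x, `|f x| <= g x) -> itg f.
move=> mf ig h; apply: (le_integrable measurableT _ _ ig); first exact/measurable_EFinP.
by move=> x _ /=; rewrite lee_fin (le_trans (h x))// ler_norm.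
Qed.

Lemma RiD f g : itg f -> itg g -> Ri (fun x => f x + g x) = Ri f + Ri g.
by move=> *; rewrite /Ri RintegralD. Qed.
Lemma RiZ c f : itg f -> Ri (fun x => c * f x) = c * Ri f.
by move=> *; rewrite /Ri RintegralZl. Qed.
Lemma Ri_le f g : itg f -> itg g -> (forall x, f x <= g x) -> Ri f <= Ri g.
by move=> *; apply: le_Rintegral. Qed.
Lemma Ri_norm f : itg f -> `|Ri f| <= Ri (fun x => `|f x|).
by move=> *; apply: le_normr_Rintegral. Qed.
Lemma itg_abs f : itg f -> itg (fun x => `|f x|).
by move=> /integrable_abse. Qed.
Lemma EFin_Ri f : itg f -> (Ri f)%:E = (\int[leb]_x (f x)%:E)%E.
by move=> hf; rewrite /Ri /Rintegral fineK//; apply: integrable_fin_num. Qed.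

Lemma mcomp2 d1 d2 d3 d4 (T1 : measurableType d1) (T2 : measurableType d2)
  (T3 : measurableType d3) (T4 : measurableType d4) (f : T1 -> T2 -> T3)
  (a : T4 -> T1) (b : T4 -> T2) :
 mfunT (fun x : T1 * T2 => f x.1 x.2) ->
 mfunT a -> mfunT b -> mfunT (fun t => f (a t) (b t)).
move=> mf ma mb.
exact: (mcomp mf (measurable_fun_pair ma mb)).
Qed.

(** Tonelli is applied to the positive and the negative part separately, so no integrability of [f]
    is required: [fine] gives a measurable value in every case. *)
Lemma measurable_Ri d (A : measurableType d) (f : A * R -> R) :
 mfunT f -> mfunT (fun a => Ri (fun u => f (a, u))).
move=> mf; rewrite /Ri /Rintegral.
apply: (@mcomp _ _ _ _ _ _ (@fine R)); first exact: fine_measurable.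
under eq_fun do rewrite integralE.
apply: emeasurable_funB.
- rewrite [X in measurable_fun _ X](_ : _ = fubini_F leb ((EFin \o f)^\+)%E); last first.
  by apply/funext => a; apply: eq_integral => u _; rewrite !funeposE.
 apply: measurable_fun_fubini_tonelli_F; last by move=> x; exact: funepos_ge0.
 by apply: measurable_funepos; exact/measurable_EFinP.
- rewrite [X in measurable_fun _ X](_ : _ = fubini_F leb ((EFin \o f)^\-)%E); last first.
  by apply/funext => a; apply: eq_integral => u _; rewrite !funenegE.
 apply: measurable_fun_fubini_tonelli_F; last by move=> x; exact: funeneg_ge0.
 by apply: measurable_funeneg; exact/measurable_EFinP.
Qed.

(** The product bound makes the double integral of the absolute value at most the integral of [h]
    times that of [|g|], which is what Fubini asks for. *)
Lemma Ri_swap (f : R -> R -> R) (g h : R -> R) :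
 mfunT (fun x : R * R => f x.1 x.2) -> itg g -> itg h ->
 (forall y, 0 <= h y) -> (forall x y, `|f x y| <= g x * h y) ->
 Ri (fun x => Ri (f x)) = Ri (fun y => Ri (f^~ y)).
move=> mf ig ih hge0 b.
have mx x : mfunT (f x) := measurable_fun_pair2 x mf.
have my y : mfunT (f^~ y) := measurable_fun_pair1 y mf.
have ix x : itg (f x) by apply: (@itg_dom _ (fun y => g x * h y)) => //; exact: itgZ.
have iy y : itg (f^~ y).
 by apply: (@itg_dom _ (fun x => h y * g x)) => //; [exact: itgZ|move=> x; rewrite mulrC].
rewrite {1}/Ri {3}/Ri /Rintegral; congr fine.
under eq_integral do rewrite (EFin_Ri (ix _)).
under [in RHS]eq_integral do rewrite (EFin_Ri (iy _)).
apply: (@Fubini _ _ _ _ R leb leb (fun x : R * R => (f x.1 x.2)%:E)).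
apply/integrable12ltyP; first exact/measurable_EFinP.
apply: (@le_lt_trans _ _ (\int[leb]_x (Ri h * `|g x|)%:E)%E); last first.
 by rewrite -(EFin_Ri (itgZ (Ri h) (itg_abs ig))) ltry.
apply: ge0_le_integral => //.
- by move=> x _; apply: integral_ge0.
- apply: (@measurable_fun_fubini_tonelli_F _ _ _ _ R leb (fun z : R * R => `|(f z.1 z.2)%:E|%E)) => //.
 by apply: mcomp => //; exact/measurable_EFinP.
- by apply/measurable_EFinP; apply: itg_meas; apply: itgZ; exact: itg_abs.
move=> x _; rewrite mulrC -RiZ// (EFin_Ri (itgZ _ ih)); apply: ge0_le_integral => //.
- by apply: (mcomp (f := abse)) => //; apply/measurable_EFinP; exact: mx.
- by apply/measurable_EFinP; apply: itg_meas; apply: itgZ.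
- by move=> y _; rewrite /= lee_fin (le_trans (b _ _))// ler_wpM2r// ler_norm.
Qed.

Lemma Ri_eq f g : (forall x, f x = g x) -> Ri f = Ri g.
by move=> e; rewrite /Ri (_ : f = g)//; apply/funext. Qed.
Lemma itg_gauss : itg (fun x => expR (- x ^+ 2)).
exact: integrableT_gauss. Qed.

Lemma itg_cauchy : itg (fun x => (1 + x ^+ 2)^-1).
have m : mfunT (fun x : R => (1 + x ^+ 2)^-1).
 by apply: continuous_mfun; exact: continuous_oneDsqrV.
have h : (\int[leb]_x ((1 + x ^+ 2)^-1)%:E = (2%:E * \int[leb]_(x in `[0%R, +oo[) ((1 + x ^+ 2)^-1)%:E))%E.
 rewrite set_itvcy; apply: ge0_symfun_integralT.
 - by move=> x; rewrite invr_ge0 addr_ge0// sqr_ge0.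
 - exact: continuous_oneDsqrV.
 - by move=> x /=; rewrite sqrrN.
apply/integrableP; split; first exact/measurable_EFinP.
under eq_integral => x _ do rewrite /= ger0_norm ?invr_ge0 ?addr_ge0 ?sqr_ge0//.
by rewrite h integral0y_oneDsqr -EFinM ltry.
Qed.
End RealIntegral.

(** * Iterated integrals against Lebesgue measure plus finitely many atoms *)

Section IteratedIntegral.
Variables (R : realType) (d : measure_display) (X : measurableType d).
Variables (io : R -> X) (om : X -> R).
Hypotheses (mio : mfunT io) (mom : mfunT om).
Hypotheses (om1 : forall x, 1 <= om x) (iom : itg (fun u => (om (io u))^-1)).
Implicit Types (B : seq (X * R)) (f g : X -> R) (F G : (nat -> X) -> R).

Local Notation wt x := ((om x)^-1).

Lemma wt_gt0 x : 0 < wt x.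
by rewrite invr_gt0 (lt_le_trans ltr01). Qed.
Lemma wt_ge0 x : 0 <= wt x. exact/ltW/wt_gt0. Qed.
Lemma wt_le1 x : wt x <= 1.
by rewrite invf_le1 // (lt_le_trans ltr01). Qed.
(** The integral against the image of Lebesgue measure under [io] plus an atom of mass [b.2], of
    either sign, at each [b.1]. *)
Definition Lf B f : R := Ri (fun u => f (io u)) + \sum_(b <- B) b.2 * f b.1.
(** The weight [1 / om] is integrable along [io] and at most 1, so this bound controls the Lebesgue
    part and the atoms of [Lf] at once. *)
Definition tame f := mfunT f /\ exists C, 0 <= C /\ forall x, `|f x| <= C * wt x.

Lemma tame_itg f : tame f -> itg (fun u => f (io u)).
move=> [mf [C [C0 h]]]; apply: (@itg_dom _ _ (fun u => C * wt (io u))).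
- exact: (mcomp mf).
- exact: itgZ.
- by move=> x; exact: h.
Qed.

Lemma tameD f g : tame f -> tame g -> tame (fun x => f x + g x).
move=> [mf [C [C0 h]]] [mg [D [D0 k]]]; split; first exact: measurable_funD.
exists (C + D); split; first exact: addr_ge0.
by move=> x; rewrite mulrDl (le_trans (ler_normD _ _))// lerD.
Qed.

Lemma tameZ c f : tame f -> tame (fun x => c * f x).
move=> [mf [C [C0 h]]]; split; first exact: mfunM.
exists (`|c| * C); split; first exact: mulr_ge0.
by move=> x; rewrite normrM -mulrA ler_wpM2l.
Qed.

Lemma tame0 : tame (fun=> 0).
split=> //; exists 0; split=> // x; by rewrite normr0 mul0r.
Qed.

Lemma LfD B f g : tame f -> tame g -> Lf B (fun x => f x + g x) = Lf B f + Lf B g.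
move=> tf tg; rewrite /Lf RiD; [|exact: tame_itg|exact: tame_itg].
by under eq_bigr do rewrite mulrDr; rewrite big_split/= addrACA.
Qed.

Lemma LfZ B c f : tame f -> Lf B (fun x => c * f x) = c * Lf B f.
move=> tf; rewrite /Lf RiZ; last exact: tame_itg.
by rewrite mulrDr mulr_sumr; congr (_ + _); apply: eq_bigr => b _; rewrite mulrCA.
Qed.

Lemma Lf_eq B f g : (forall x, f x = g x) -> Lf B f = Lf B g.
by move=> e; rewrite (_ : f = g)//; apply/funext. Qed.

Lemma Lf0 B : Lf B (fun=> 0) = 0.
transitivity (Lf B (fun x : X => 0 * 0)); last by rewrite (LfZ B 0 tame0) mul0r.
by apply: Lf_eq => x; rewrite mul0r.
Qed.

Lemma tame_sum (I : Type) (s : seq I) (f : I -> X -> R) :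
 (forall i, tame (f i)) -> tame (fun x => \sum_(i <- s) f i x).
move=> tf; elim: s => [|i s IH].
 by under eq_fun do rewrite big_nil; exact: tame0.
by under eq_fun do rewrite big_cons; exact: tameD.
Qed.

Lemma Lf_sum B (I : Type) (s : seq I) (f : I -> X -> R) : (forall i, tame (f i)) ->
 Lf B (fun x => \sum_(i <- s) f i x) = \sum_(i <- s) Lf B (f i).
move=> tf; elim: s => [|i s IH].
 by rewrite big_nil -[RHS](Lf0 B); apply: Lf_eq => x; rewrite big_nil.
rewrite big_cons -IH -LfD//; last exact: tame_sum.
by apply: Lf_eq => x; rewrite big_cons.
Qed.

Definition Lmass B : R := Ri (fun u => wt (io u)) + \sum_(b <- B) `|b.2|.

Lemma Lmass_ge0 B : 0 <= Lmass B.
rewrite addr_ge0//; last by apply: sumr_ge0.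
by apply: Rintegral_ge0 => x _; exact: wt_ge0.
Qed.

Lemma Lf_bound B f C : 0 <= C -> mfunT f -> (forall x, `|f x| <= C * wt x) ->
 `|Lf B f| <= C * Lmass B.
move=> C0 mf h; have tf : tame f by split=> //; exists C.
have i1 := tame_itg tf.
rewrite (le_trans (ler_normD _ _))// mulrDr lerD//.
 rewrite (le_trans (Ri_norm _))// -RiZ//; apply: Ri_le => //.
 - exact: itg_abs.
 - exact: itgZ.
rewrite (le_trans (ler_norm_sum _ _ _))// mulr_sumr; apply: ler_sum => b _.
rewrite normrM mulrC ler_wpM2r// (le_trans (h _))// ler_piMr// wt_le1//.
Qed.

(** Only the Lebesgue-Lebesgue term needs Fubini; the terms with an atom are finite sums and are
    exchanged by linearity. *)
Lemma Lf_swap B1 B2 (f : X -> X -> R) C : 0 <= C ->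
 mfunT (fun x : X * X => f x.1 x.2) ->
 (forall x y, `|f x y| <= C * (wt x * wt y)) ->
 Lf B1 (fun x => Lf B2 (f x)) = Lf B2 (fun y => Lf B1 (f^~ y)).
move=> C0 mf h.
have mx x : mfunT (f x) := measurable_fun_pair2 x mf.
have my y : mfunT (f^~ y) := measurable_fun_pair1 y mf.
have mio2 : mfunT (fun x : X * R => f x.1 (io x.2)).
 by apply: mcomp2 mf _ _ => //; exact: mcomp.
have mio1 : mfunT (fun x : X * R => f (io x.2) x.1).
 by apply: mcomp2 mf _ _ => //; exact: mcomp.
have tx x : tame (f x).
 split=> //; exists (C * wt x); split; first by rewrite mulr_ge0// wt_ge0.
 by move=> y; rewrite -mulrA.
have ty y : tame (f^~ y).
 split=> //; exists (C * wt y); split; first by rewrite mulr_ge0// wt_ge0.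
 by move=> x; rewrite -mulrA [wt y * _]mulrC.
have txi : tame (fun x => Ri (fun v => f x (io v))).
 split; first exact: (@measurable_Ri _ _ _ (fun x : X * R => f x.1 (io x.2))).
 exists (C * Lmass [::]); split; first by rewrite mulr_ge0// Lmass_ge0.
 move=> x; have := @Lf_bound [::] (f x) (C * wt x).
 rewrite /Lf big_nil addr0 mulrAC; apply => //; first by rewrite mulr_ge0// wt_ge0.
 by move=> y; rewrite -mulrA.
have tyi : tame (fun y => Ri (fun u => f (io u) y)).
 split; first exact: (@measurable_Ri _ _ _ (fun x : X * R => f (io x.2) x.1)).
 exists (C * Lmass [::]); split; first by rewrite mulr_ge0// Lmass_ge0.
 move=> y; have := @Lf_bound [::] (f^~ y) (C * wt y).
 rewrite /Lf big_nil addr0 mulrAC; apply => //; first by rewrite mulr_ge0// wt_ge0.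
 by move=> x; rewrite -mulrA [wt y * _]mulrC.
transitivity (Lf B1 (fun x => Ri (fun v => f x (io v))) + \sum_(b <- B2) b.2 * Lf B1 (f^~ b.1)).
 rewrite -[LHS]/(Lf B1 (fun x => Ri (fun v => f x (io v)) + \sum_(b <- B2) b.2 * f x b.1)).
 rewrite LfD //; last by apply: tame_sum => b; exact: tameZ.
 by congr (_ + _); rewrite Lf_sum; [apply: eq_bigr => b _; rewrite LfZ|move=> b; exact: tameZ].
have -> : Lf B2 (fun y => Lf B1 (f^~ y)) =
  Lf B2 (fun y => Ri (fun u => f (io u) y)) + \sum_(b <- B1) b.2 * Lf B2 (f b.1).
 rewrite -[LHS]/(Lf B2 (fun y => Ri (fun u => f (io u) y) + \sum_(b <- B1) b.2 * f b.1 y)).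
 rewrite LfD //; last by apply: tame_sum => b; exact: tameZ.
 by congr (_ + _); rewrite Lf_sum; [apply: eq_bigr => b _; rewrite LfZ|move=> b; exact: tameZ].
rewrite /Lf.
under [X in _ + X = _]eq_bigr do rewrite mulrDr.
under [X in _ = _ + X]eq_bigr do rewrite mulrDr.
rewrite !big_split/= (@Ri_swap _ _ (fun u => C * wt (io u)) (fun u => wt (io u))) //.
- rewrite -!addrA; congr (_ + _); rewrite addrCA; congr (_ + _); rewrite addrC [RHS]addrC; congr (_ + _).
 under eq_bigr do rewrite mulr_sumr.
 rewrite exchange_big/=; apply: eq_bigr => b _; rewrite mulr_sumr.
 by apply: eq_bigr => c _; rewrite mulrCA.
- by apply: mcomp2 mf _ _; exact: mcomp.
- exact: itgZ.
- by move=> y; exact: wt_ge0.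
- by move=> x y; rewrite -mulrA.
Qed.

Definition scons u (z : nat -> X) : nat -> X := fun j => if j is j'.+1 then z j' else u.

Fixpoint lint B k F : R :=
 if k is k'.+1 then Lf B (fun u => lint B k' (fun z => F (scons u z))) else F (fun=> io 0).

(** Sequences of points carry no sigma-algebra here. Measurability of a function of infinitely many
    variables is expressed by composing it with every family whose coordinates are measurable. *)
Definition pm F := forall d' (A : measurableType d') (z : A -> nat -> X),
 (forall i, mfunT (z^~ i)) -> mfunT (fun a => F (z a)).

(** The version with a parameter: after one integration the outer variable has become a parameter of
    the remaining integrand, so this is the form that an induction on the number of variables
    preserves. *)
Definition jm d' (A : measurableType d') (G : A -> (nat -> X) -> R) :=
 forall d'' (A' : measurableType d'') (h : A' -> A) (z : A' -> nat -> X),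
 mfunT h -> (forall i, mfunT (z^~ i)) ->
 mfunT (fun a => G (h a) (z a)).

Lemma jm_lint B k d' (A : measurableType d') (G : A -> (nat -> X) -> R) :
 jm G -> mfunT (fun a => lint B k (G a)).
elim: k d' A G => [|k IH] d' A G jG /=; first by apply: (jG _ A id).
apply: measurable_funD.
- apply: (@measurable_Ri _ _ A (fun x => lint B k (fun z => G x.1 (scons (io x.2) z)))).
 apply: (IH _ _ (fun x z => G x.1 (scons (io x.2) z))) => d'' A' h z mh mz.
 apply: (jG _ _ (fun a => (h a).1) (fun a => scons (io (h a).2) (z a))).
  exact: mcomp.
 case=> [|i]; last exact: mz.
 by apply: mcomp => //; exact: mcomp.
- apply: measurable_sum => b; apply: mfunM => //.
 apply: (IH _ _ (fun a z => G a (scons b.1 z))) => d'' A' h z mh mz.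
 apply: (jG _ _ h (fun a => scons b.1 (z a))) => //.
 by case=> [|i] //; exact: mz.
Qed.

Definition nice k F := pm F /\ exists C, 0 <= C /\ forall z, `|F z| <= C * \prod_(i < k) wt (z i).

Lemma pm_scons F u : pm F -> pm (fun z => F (scons u z)).
move=> pF d' A z mz; apply: (pF _ A (fun a => scons u (z a))).
by case=> [|i] //; exact: mz.
Qed.

Lemma nice_scons k F u : nice k.+1 F -> nice k (fun z => F (scons u z)).
move=> [pF [C [C0 h]]]; split; first exact: pm_scons.
exists (C * wt u); split; first by rewrite mulr_ge0// wt_ge0.
by move=> z; rewrite (le_trans (h _))// big_ord_recl /= mulrA.
Qed.

Lemma lint_bound B k F C : 0 <= C -> pm F -> (forall z, `|F z| <= C * \prod_(i < k) wt (z i)) ->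
 `|lint B k F| <= C * Lmass B ^+ k.
elim: k F C => [|k IH] F C C0 pF h /=.
 by rewrite expr0 mulr1 (le_trans (h _))// big_ord0 mulr1.
rewrite exprSr mulrA; apply: Lf_bound.
- by rewrite mulr_ge0// exprn_ge0// Lmass_ge0.
- apply: (@jm_lint B k _ _ (fun u z => F (scons u z))) => d'' A' h' z mh mz.
 by apply: (pF _ _ (fun a => scons (h' a) (z a))) => -[|i]//; exact: mz.
move=> u; rewrite mulrAC; apply: IH.
- by rewrite mulr_ge0// wt_ge0.
- exact: pm_scons.
- by move=> z; rewrite (le_trans (h _))// big_ord_recl /= mulrA.
Qed.

Lemma nice_tame B k F : nice k.+1 F -> tame (fun u => lint B k (fun z => F (scons u z))).
move=> [pF [C [C0 h]]]; split.
 apply: (@jm_lint B k _ _ (fun u z => F (scons u z))) => d'' A' h' z mh mz.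
 by apply: (pF _ _ (fun a => scons (h' a) (z a))) => -[|i]//; exact: mz.
exists (C * Lmass B ^+ k); split; first by rewrite mulr_ge0// exprn_ge0// Lmass_ge0.
move=> u; rewrite mulrAC; apply: lint_bound.
- by rewrite mulr_ge0// wt_ge0.
- exact: pm_scons.
- by move=> z; rewrite (le_trans (h _))// big_ord_recl /= mulrA.
Qed.

Lemma lint_eq B k F G : (forall z, F z = G z) -> lint B k F = lint B k G.
by move=> e; rewrite (_ : F = G)//; apply/funext. Qed.

Lemma niceD k F G : nice k F -> nice k G -> nice k (fun z => F z + G z).
move=> [mf [C [C0 h]]] [mg [D [D0 h']]]; split.
 by move=> d' A z mz; apply: measurable_funD; [exact: mf|exact: mg].
exists (C + D); split; first exact: addr_ge0.
by move=> x; rewrite mulrDl (le_trans (ler_normD _ _))// lerD.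
Qed.

Lemma niceZ k c F : nice k F -> nice k (fun z => c * F z).
move=> [mf [C [C0 h]]]; split.
 by move=> d' A z mz; apply: mfunM => //; exact: mf.
exists (`|c| * C); split; first exact: mulr_ge0.
by move=> x; rewrite normrM -mulrA ler_wpM2l.
Qed.

Lemma nice0 k : nice k (fun=> 0).
by split=> // ; exists 0; split=> // z; rewrite normr0 mul0r. Qed.

Lemma nice_sum k (I : Type) (s : seq I) (F : I -> (nat -> X) -> R) :
 (forall i, nice k (F i)) -> nice k (fun z => \sum_(i <- s) F i z).
move=> tf; elim: s => [|i s IH].
 by under eq_fun do rewrite big_nil; exact: nice0.
by under eq_fun do rewrite big_cons; exact: niceD.
Qed.

Lemma lintD B k F G : nice k F -> nice k G ->
 lint B k (fun z => F z + G z) = lint B k F + lint B k G.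
elim: k F G => [//|k IH] F G nF nG /=.
rewrite -LfD; [|exact: nice_tame|exact: nice_tame].
by apply: Lf_eq => u; apply: IH; exact: nice_scons.
Qed.

Lemma lintZ B k c F : nice k F -> lint B k (fun z => c * F z) = c * lint B k F.
elim: k F => [//|k IH] F nF /=.
rewrite -LfZ; last exact: nice_tame.
by apply: Lf_eq => u; apply: IH; exact: nice_scons.
Qed.

Lemma lint0 B k : lint B k (fun=> 0) = 0.
transitivity (lint B k (fun=> 0 * 0)); last by rewrite (lintZ B 0 (nice0 k)) mul0r.
by apply: lint_eq => z; rewrite mul0r.
Qed.

Lemma lint_sum B k (I : Type) (s : seq I) (F : I -> (nat -> X) -> R) : (forall i, nice k (F i)) ->
 lint B k (fun z => \sum_(i <- s) F i z) = \sum_(i <- s) lint B k (F i).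
move=> tf; elim: s => [|i s IH].
 by rewrite big_nil -[RHS](lint0 B k); apply: lint_eq => x; rewrite big_nil.
rewrite big_cons -IH -lintD//; last exact: nice_sum.
by apply: lint_eq => x; rewrite big_cons.
Qed.

Definition swp i (z : nat -> X) : nat -> X :=
 fun j => if j == i then z i.+1 else if j == i.+1 then z i else z j.

Lemma swpS i u z : swp i.+1 (scons u z) = scons u (swp i z).
by apply/funext => -[|j]. Qed.
Lemma swp0 u v z : swp 0 (scons u (scons v z)) = scons v (scons u z).
by apply/funext => -[|[|j]]. Qed.

(** For the two outermost variables this is Fubini; deeper exchanges follow by induction on the
    depth. *)
Lemma lint_swp B k F i : (i.+1 < k)%N -> nice k F -> lint B k F = lint B k (fun z => F (swp i z)).
elim: k i F => // k IH [|i] F ik nF.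
 case: k ik nF {IH} => // k _ nF /=.
 have [pF [C [C0 h]]] := nF.
 rewrite (@Lf_swap B B _ (C * Lmass B ^+ k)).
 - by do 2!(apply: Lf_eq => ?); apply: lint_eq => z; rewrite swp0.
 - by rewrite mulr_ge0// exprn_ge0// Lmass_ge0.
 - apply: (@jm_lint B k _ _ (fun (u : X * X) z => F (scons u.1 (scons u.2 z)))) => d'' A' h' z mh mz.
  apply: (pF _ _ (fun a => scons (h' a).1 (scons (h' a).2 (z a)))) => -[|[|j]].
  + exact: mcomp.
  + exact: mcomp.
  + exact: mz.
 - move=> x y; rewrite mulrAC; apply: lint_bound.
  + by rewrite !mulr_ge0// wt_ge0.
  + by apply: (@pm_scons (fun z => F (scons x z))); exact: pm_scons.
  + by move=> z; rewrite (le_trans (h _))// !big_ord_recl /= !mulrA.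
rewrite /=; apply: Lf_eq => u; rewrite (IH i)//; last exact: nice_scons.
by apply: lint_eq => z; rewrite swpS.
Qed.

Lemma Lf_cons B x e f : Lf ((x, e) :: B) f = Lf B f + e * f x.
by rewrite /Lf big_cons /= addrCA addrC. Qed.

(** The expansion in the mass of a new atom stops at first order: two variables at [x] give zero,
    and by symmetry any of the [k] variables may be the one at [x]. *)
Lemma lint_cons B x e k F : nice k F ->
 (forall i z, (i.+1 < k)%N -> F (swp i z) = F z) ->
 (forall i z, (i.+1 < k)%N -> z i = z i.+1 -> F z = 0) ->
 lint ((x, e) :: B) k F = lint B k F + k%:R * e * lint B k.-1 (fun z => F (scons x z)).
elim: k F => [|k IH] F nF sF vF; first by rewrite /= !mul0r addr0.
rewrite [LHS]/= Lf_cons.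
have E u : lint ((x, e) :: B) k (fun z => F (scons u z)) = lint B k (fun z => F (scons u z)) +
  k%:R * e * lint B k.-1 (fun z => F (scons u (scons x z))).
 apply: IH; first exact: nice_scons.
 - by move=> i z ik; rewrite -swpS sF.
 - by move=> i z ik zi; apply: (vF i.+1).
rewrite (Lf_eq B E) E.
case: k IH nF sF vF E => [|k] IH nF sF vF E.
 by rewrite !mul0r !addr0 mul1r /= (Lf_eq B (g := fun u => F (scons u (fun=> io 0))))// => u; rewrite !mul0r addr0.
have n1 : nice k.+2 (fun z => F (swp 0 z)).
 by rewrite (_ : (fun z => _) = F)//; apply/funext => z; rewrite sF.
have n2 : nice k.+1 (fun z => F (scons x z)) by exact: nice_scons.
have s1 u : lint B k (fun z => F (scons u (scons x z))) = lint B k (fun z => F (scons x (scons u z))).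
 by apply: lint_eq => z; rewrite -[in LHS](sF 0%N)// swp0.
rewrite /= LfD; last 2 first.
 - exact: (@nice_tame B k.+1 F).
 - apply: tameZ; rewrite (_ : (fun u => _) = fun u => lint B k (fun z => F (scons x (scons u z)))); last exact/funext.
  exact: (@nice_tame B k _ n2).
have -> : lint B k (fun z => F (scons x (scons x z))) = 0.
 by rewrite -[RHS](lint0 B k); apply: lint_eq => z; apply: (vF 0%N).
rewrite mulr0 addr0 LfZ; last first.
 by rewrite (_ : (fun u => _) = fun u => lint B k (fun z => F (scons x (scons u z)))); [exact: (@nice_tame B k _ n2)|exact/funext].
rewrite (Lf_eq B s1) -addrA; congr (_ + _).
by rewrite -[k.+2%:R]natr1; ring.
Qed.

(** The bridge to the extended-real iterated integral of the definitions; [nice] keeps every inner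
    integral finite. *)
Lemma iintE k F : nice k F ->
 iint k (fun z => (F (fun i => io (z i)))%:E) = (lint [::] k F)%:E.
elim: k F => [|k IH] F nF //=.
rewrite /Lf big_nil addr0 EFin_Ri; last by apply: (@tame_itg (fun u => lint [::] k (fun z => F (scons u z)))); exact: nice_tame.
apply: eq_integral => u _; rewrite -IH; last exact: nice_scons.
congr (iint k _); apply/funext => z; congr (F _)%:E.
by apply/funext => -[|i].
Qed.
End IteratedIntegral.

(** * Indices below 2n grouped in consecutive pairs *)

Section Pairing.
Variable n : nat.

Lemma pix_subproof (i : 'I_n) (b : bool) : (b + i.*2 < n.*2)%N.
by case: b; rewrite ?ltn_Sdouble ?ltn_double ltn_ord. Qed.
Definition pix (p : 'I_n * bool) : 'I_(n.*2) := Ordinal (pix_subproof p.1 p.2).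
Lemma pixV_subproof (j : 'I_(n.*2)) : (j./2 < n)%N.
by rewrite -ltn_double (leq_ltn_trans _ (ltn_ord j))// -[leqRHS]odd_double_half leq_addl. Qed.
Definition pixV (j : 'I_(n.*2)) : 'I_n * bool := (Ordinal (pixV_subproof j), odd j).

Lemma pixK : cancel pix pixV.
case=> i b; rewrite /pixV /pix /=; congr (_, _); last by rewrite oddD odd_double addbF oddb.
by apply/val_inj; rewrite /= half_bit_double.
Qed.

Lemma pixVK : cancel pixV pix.
by move=> j; apply/val_inj; rewrite /= odd_double_half. Qed.
Lemma pix_bij : bijective pix. by exists pixV; [exact: pixK|exact: pixVK]. Qed.
Definition dbl_fun (s : 'S_n) (j : 'I_(n.*2)) := pix (s (pixV j).1, (pixV j).2).

Lemma dbl_inj s : injective (dbl_fun s).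
move=> j k /(can_inj pixK)[/perm_inj e1 e2]; apply: (can_inj pixVK).
by rewrite /pixV e2; congr (_, _).
Qed.

Definition dbl s : 'S_(n.*2) := perm (@dbl_inj s).
Lemma dblE s i b : dbl s (pix (i, b)) = pix (s i, b).
by rewrite permE /dbl_fun pixK. Qed.
Lemma dblM s t : dbl (s * t)%g = (dbl s * dbl t)%g.
by apply/permP => j; rewrite -[j]pixVK; case: (pixV j) => i b; rewrite permM !dblE permM. Qed.
Lemma dbl1 : dbl 1%g = 1%g.
by apply/permP => j; rewrite -[j]pixVK; case: (pixV j) => i b; rewrite dblE !perm1. Qed.

(** A transposition of two pairs is the product of the transpositions of their first and of their
    second members, hence even. *)
Lemma odd_dbl s : odd_perm (dbl s) = false.
have [ts -> _] := prod_tpermP s.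
elim: ts => [|[x y] ts IH]; first by rewrite big_nil dbl1 odd_perm1.
rewrite big_cons dblM odd_permM IH addbF.
have -> : dbl (tperm x y) = (tperm (pix (x, false)) (pix (y, false)) * tperm (pix (x, true)) (pix (y, true)))%g.
 apply/permP => j; rewrite -[j]pixVK; case: (pixV j) => i b; rewrite dblE permM.
 have pe (a b : 'I_n * bool) : (pix a == pix b) = (a == b) := can_eq pixK a b.
 case: tpermP => [->|->|/eqP nx /eqP ny].
 - case: b; last by rewrite tpermL tpermD// pe xpair_eqE andbF.
  by rewrite [tperm (pix (x, false)) _ _]tpermD ?pe ?xpair_eqE ?andbF// tpermL.
 - case: b; last by rewrite tpermR tpermD// pe xpair_eqE andbF.
  by rewrite [tperm (pix (x, false)) _ _]tpermD ?pe ?xpair_eqE ?andbF// tpermR.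
 by rewrite [tperm (pix (x, false)) _ _]tpermD ?tpermD// ?pe ?xpair_eqE ?[_ == i]eq_sym ?(negbTE nx) ?(negbTE ny).
rewrite odd_permM !odd_tperm.
by rewrite !(can_eq pixK) !xpair_eqE !eqxx !andbT addbb.
Qed.

Lemma big_pairs (R : Type) (idx : R) (op : Monoid.com_law idx) (F : 'I_(n.*2) -> R) :
 \big[op/idx]_j F j = \big[op/idx]_i (op (F (pix (i, false))) (F (pix (i, true)))).
rewrite (reindex pix) /=; last exact: onW_bij pix_bij.
rewrite (eq_bigr (fun p => F (pix (p.1, p.2)))) => [|[]//].
rewrite -(pair_bigA _ (fun i b => F (pix (i, b)))) /=.
by apply: eq_bigr => i _; rewrite big_bool /= Monoid.mulmC.
Qed.
End Pairing.

(** * Pfaffians and their behaviour under congruence *)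

Section Pfaffian.
Variable R : comRingType.
Variable n : nat.
Implicit Types (A B : 'M[R]_(n.*2)).

(** One matrix per pair is allowed, so that in [pfs_Jpair] the pairs can be modified one at a
    time. *)
Definition pfsv (A : 'I_n -> 'I_(n.*2) -> 'I_(n.*2) -> R) : R :=
 \sum_(s : 'S_(n.*2)) (-1) ^+ s * \prod_i A i (s (pix (i, false))) (s (pix (i, true))).

(* Unnormalised Pfaffian: n! 2^n times the usual one on alternating matrices. *)
Definition pfs A : R := pfsv (fun _ => A).

Lemma pairs_distr (K : finType) (H : 'I_n -> K -> K -> R) :
 \prod_i \sum_k \sum_l H i k l =
 \sum_(f : {ffun 'I_(n.*2) -> K}) \prod_i H i (f (pix (i, false))) (f (pix (i, true))).
under eq_bigr => i _ do rewrite pair_bigA /=.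
rewrite bigA_distr_bigA /=.
rewrite (reindex (fun f : {ffun 'I_(n.*2) -> K} => [ffun i => (f (pix (i, false)), f (pix (i, true)))])) /=.
 by apply: eq_bigr => f _; apply: eq_bigr => i _; rewrite ffunE.
apply: onW_bij; exists (fun g : {ffun 'I_n -> K * K} =>
  [ffun j => if (pixV j).2 then (g (pixV j).1).2 else (g (pixV j).1).1]) => f.
 by apply/ffunP => j; rewrite !ffunE; have := pixVK j; case: (pixV j) => i [] /= <-.
by apply/ffunP => i; rewrite !ffunE !pixK /= -surjective_pairing.
Qed.

(** A Cauchy-Binet argument: once the inner indices [f] are chosen, the sum over permutations is a
    determinant. *)
Lemma pfs_expand (K : finType) (P : 'I_(n.*2) -> K -> R) (A : 'I_n -> K -> K -> R) :
 pfsv (fun i a b => \sum_k \sum_l P a k * A i k l * P b l) =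
 \sum_(f : {ffun 'I_(n.*2) -> K}) (\prod_i A i (f (pix (i, false))) (f (pix (i, true))))
   * \det (\matrix_(j, a) P a (f j)).
rewrite /pfsv; under eq_bigr => s _ do rewrite pairs_distr mulr_sumr.
rewrite exchange_big /=; apply: eq_bigr => f _; rewrite mulr_sumr; apply: eq_bigr => s _.
rewrite [RHS]mulrCA; congr (_ * _); rewrite [X in _ = _ * X](big_pairs (n := n)) -big_split /=.
by apply: eq_bigr => i _; rewrite !mxE; ring.
Qed.

Lemma det_rows_perm (s : 'S_(n.*2)) B : \det (\matrix_(j, a) B a (s j)) = (-1) ^+ s * \det B.
rewrite -det_tr (_ : _^T = col_perm s B); last by apply/matrixP => i j; rewrite !mxE.
by rewrite col_permE det_mulmx det_perm odd_permV mulrC.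
Qed.

Lemma pfs_mul A B : pfs (B *m A *m B^T) = \det B * pfs A.
rewrite /pfs (_ : pfsv _ = pfsv (fun i a b => \sum_k \sum_l B a k * A k l * B b l)); last first.
 apply: eq_bigr => s _; congr (_ * _); apply: eq_bigr => i _; rewrite mxE.
 under eq_bigr do rewrite mxE mulr_suml; rewrite exchange_big /=.
 by apply: eq_bigr => k _; apply: eq_bigr => l _; rewrite mxE.
(* A choice of indices that is not injective repeats a row of the determinant; the injective ones
   are permutations. *)
rewrite pfs_expand (bigID (fun f : {ffun 'I_(n.*2) -> 'I_(n.*2)} => injectiveb f)) /=.
rewrite [X in _ + X]big1 ?addr0 => [|f /injectivePn [i1 [i2 ne e]]]; last first.
 by rewrite (determinant_alternate ne) ?mulr0// => j; rewrite !mxE e.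
rewrite (reindex (@pval _)) /=; last first.
 pose in_Sn := insubd (1%g : 'S_(n.*2)).
 by exists in_Sn => /= f Uf; first apply: val_inj; apply: insubdK.
rewrite mulr_sumr; apply: eq_big => /= [s | s _]; rewrite ?(valP s) //.
rewrite -pvalE (_ : \matrix_(j, a) _ = \matrix_(j, a) B a (s j)); last by apply/matrixP => i j; rewrite !mxE pvalE.
rewrite det_rows_perm (eq_bigr (fun i => A (s (pix (i, false))) (s (pix (i, true))))) => [|i _]; last by rewrite !pvalE.
by rewrite mulrC [(-1) ^+ _ * \det B]mulrC -mulrA.
Qed.

Lemma pfs_perm (s : 'S_(n.*2)) A : pfs (\matrix_(i, j) A (s i) (s j)) = (-1) ^+ s * pfs A.
rewrite -det_perm -pfs_mul; congr pfs; apply/matrixP => i j.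
by rewrite -row_permE tr_perm_mx -col_permE !mxE.
Qed.

(** Half of the standard symplectic matrix: entries 1 at the positions (2i, 2i + 1). *)
Definition Epair : 'M[R]_(n.*2) := \matrix_(a, b)
 ((~~ (pixV a).2 && (pixV b).2 && ((pixV a).1 == (pixV b).1))%:R).
Definition Jpair : 'M[R]_(n.*2) := Epair - Epair^T.

(** Composition with the transposition inside the pair [i0] exchanges the arguments of its matrix
    and changes the sign. *)
Lemma pfsv_flip (A : 'I_n -> 'I_(n.*2) -> 'I_(n.*2) -> R) i0 :
 pfsv (fun i => if i == i0 then fun a b => - A i b a else A i) = pfsv A.
rewrite /pfsv (reindex_inj (mulgI (tperm (pix (i0, false)) (pix (i0, true))))) /=.
apply: eq_bigr => s _; rewrite odd_mul_tperm (can_eq (@pixK n)) xpair_eqE andbF addTb.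
rewrite signrN mulNr -mulrN; congr (_ * _).
rewrite (bigD1 i0) //= [in RHS](bigD1 i0) //= eqxx !permM tpermL tpermR mulNr opprK; congr (_ * _).
apply: eq_bigr => i ni; rewrite (negbTE ni) !permM !tpermD// (can_eq (@pixK n)) xpair_eqE ?andbF//.
 by rewrite eq_sym (negbTE ni).
by rewrite eq_sym (negbTE ni).
Qed.

(** Only permutations that carry ordered pairs to ordered pairs contribute. They are the [dbl k]:
    all even, and n! in number. *)
Lemma pfs_Epair : pfs Epair = n`!%:R.
rewrite /pfs /pfsv (bigID (fun s => s \in codom (@dbl n))) /= [X in _ + X]big1 ?addr0 => [|s sD].
 rewrite (eq_bigr (fun=> 1)) => [|s /codomP[k ->]]; last first.
  rewrite odd_dbl expr0 mul1r big1 // => i _.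
  by rewrite !dblE mxE !pixK eqxx.
 rewrite sumr_const card_codom; last first.
  move=> s t e; apply/permP => i; have := dblE s i true.
  by rewrite e dblE => /(can_inj (@pixK n))[].
 by rewrite card_Sn.
have [/forallP h|] := boolP [forall i, [&& ~~ (pixV (s (pix (i, false)))).2, (pixV (s (pix (i, true)))).2
   & (pixV (s (pix (i, false)))).1 == (pixV (s (pix (i, true)))).1]].
 have ki : injective (fun i => (pixV (s (pix (i, false)))).1).
  move=> i j e; have /and3P[a1 _ _] := h i; have /and3P[a2 _ _] := h j.
  have : pixV (s (pix (i, false))) = pixV (s (pix (j, false))).
   by rewrite [LHS]surjective_pairing [RHS]surjective_pairing e (negbTE a1) (negbTE a2).
  by move/(can_inj (@pixVK n))/perm_inj/(can_inj (@pixK n)) => -[].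
 case/negP: sD; apply/codomP; exists (perm ki); apply/permP => j; rewrite -[j]pixVK.
 case: (pixV j) => i b; rewrite dblE permE; apply: (can_inj (@pixVK n)); rewrite pixK.
 have /and3P[a1 a2 /eqP a3] := h i.
 by case: b; rewrite [LHS]surjective_pairing; [rewrite a3 a2|rewrite (negbTE a1)].
rewrite negb_forall => /existsP[i hi]; rewrite (bigD1 i) //= mxE.
by rewrite -andbA (negbTE hi) mul0r mulr0.
Qed.

(** Replacing [Epair] by [Jpair] at one pair adds a flipped copy, which by [pfsv_flip] has the same
    value; each pair thus contributes a factor 2. *)
Lemma pfs_Jpair : pfs Jpair = (2 ^ n * n`!)%:R.
rewrite natrM -pfs_Epair.
have H m : (m <= n)%N ->
  pfsv (fun i => if (i < m)%N then (fun a b => Jpair a b) else (fun a b => Epair a b)) = (2 ^ m)%:R * pfs Epair.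
 elim: m => [|m IH] mn; first by rewrite expn0 mul1r.
 rewrite expnS natrM -mulrA -IH ?(ltnW mn)//; pose i0 := Ordinal mn.
 set G := fun i : 'I_n => if (i < m)%N then _ else _.
 have -> : 2%:R * pfsv G = pfsv G + pfsv (fun i => if i == i0 then fun a b => - G i b a else G i).
  by rewrite pfsv_flip; ring.
 rewrite /pfsv -big_split /=; apply: eq_bigr => s _; rewrite -mulrDr; congr (_ * _).
 have e0 : (i0 < m)%N = false by rewrite /= ltnn.
 rewrite (bigD1 i0) //= [X in _ = X + _](bigD1 i0) //= [X in _ = _ + X](bigD1 i0) //= eqxx.
 rewrite /G e0 ltnSn.
 set p1 := \prod_(i | _) _; set p2 := \prod_(i | _) _; set p3 := \prod_(i | _) _.
 have np (i : 'I_n) : i != i0 -> (i < m.+1)%N = (i < m)%N.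
  by move=> ni; rewrite ltnS leq_eqVlt orb_idl// => /eqP e; case/eqP: ni; apply/val_inj.
 have -> : p1 = p2 by apply: eq_bigr => i ni; rewrite np.
 have -> : p3 = p2 by apply: eq_bigr => i ni; rewrite (negbTE ni).
 by rewrite -mulrDl !mxE.
by rewrite -(H n)//; apply: eq_bigr => s _; congr (_ * _); apply: eq_bigr => i _; rewrite ltn_ord.
Qed.
End Pfaffian.

(** * The square of a Pfaffian is a determinant *)

Section PfaffianSquare.
Variable R : numFieldType.

Lemma det_mx2 (A : 'M[R]_2) : \det A = A 0 0 * A 1 1 - A 0 1 * A 1 0.
rewrite (expand_det_row _ 0) !big_ord_recl big_ord0 addr0 /cofactor !det_mx11 !mxE /=.
have -> : lift 0 0 = 1 :> 'I_2 by apply/val_inj.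
have -> : lift 1 0 = 0 :> 'I_2 by apply/val_inj.
by rewrite /= expr0 expr1 mulN1r mul1r mulrN.
Qed.

Lemma mx_block (p q : nat) (f : nat -> nat -> R) :
 (\matrix_(i < p + q, j < p + q) f i j) =
 block_mx (\matrix_(i < p, j < p) f i j) (\matrix_(i < p, j < q) f i (p + j)%N)
      (\matrix_(i < q, j < p) f (p + i)%N j) (\matrix_(i < q, j < q) f (p + i)%N (p + j)%N).
apply/matrixP => i j; rewrite !mxE.
case: splitP => i' ->; rewrite !mxE; case: splitP => j' ->; by rewrite mxE.
Qed.

Lemma det_Jpair n : \det (Jpair R n) = 1.
pose f (i j : nat) : R := (~~ odd i && odd j && (i./2 == j./2))%:R - (~~ odd j && odd i && (j./2 == i./2))%:R.
have E m : Jpair R m = \matrix_(i, j) f i j by apply/matrixP => i j; rewrite !mxE.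
rewrite E {E}; elim: n => [|n IH]; first by rewrite det_mx00.
rewrite (_ : \det _ = \det (\matrix_(i < 2 + n.*2, j < 2 + n.*2) f i j))// mx_block.
have fS (i j : nat) : f (2 + i)%N (2 + j)%N = f i j by rewrite /f !add2n /= !negbK !eqSS.
rewrite (_ : (\matrix_(i, j) f i (2 + j)%N) = 0); last first.
 apply/matrixP => i j; rewrite !mxE /f add2n /= !negbK.
 by case: i => -[|[|]]//= _; rewrite ?andbF ?subrr//= andbT andbF subrr.
rewrite det_lblock (_ : (\matrix_(i, j) f (2 + i)%N (2 + j)%N) = \matrix_(i < n.*2, j < n.*2) f i j); last first.
 by apply/matrixP => i j; rewrite !mxE fS.
by rewrite IH mulr1 det_mx2 !mxE /f /= !subr0 sub0r mulrN1 opprK mulr0 add0r.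
Qed.

Definition sgn_mx n : 'M[R]_(n.*2) := \matrix_(i, j) ((i < j)%N%:R - (j < i)%N%:R).

Lemma det_sgn_mx n : \det (sgn_mx n) = 1.
pose f (i j : nat) : R := (i < j)%N%:R - (j < i)%N%:R.
rewrite (_ : sgn_mx n = \matrix_(i, j) f i j)//; elim: n => [|n IH]; first by rewrite det_mx00.
rewrite (_ : \det _ = \det (\matrix_(i < 2 + n.*2, j < 2 + n.*2) f i j))// mx_block.
have fS (i j : nat) : f (2 + i)%N (2 + j)%N = f i j by rewrite /f !ltn_add2l.
(* Adding row 0 minus row 1 to every later row clears the first two columns. The remaining block is
   unchanged, since rows 0 and 1 agree there. *)
pose W : 'M[R]_(n.*2, 2) := \matrix_(i, j) (if (j : nat) == 0%N then 1 else -1).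
set M := block_mx _ _ _ _.
have D1 : \det (block_mx 1%:M 0 W 1%:M) = 1 by rewrite det_lblock !det1 mulr1.
rewrite -[LHS]mul1r -{1}D1 -det_mulmx mulmx_block !mul1mx !mul0mx !addr0.
rewrite [X in block_mx _ _ X _](_ : _ = 0); last first.
 apply/matrixP => i j; rewrite !mxE !big_ord_recl big_ord0 !mxE /f /=.
 by case: j => -[|[|]]//= _; rewrite /bump ?add2n /=; ring.
rewrite det_ublock [X in _ * \det X](_ : _ = \matrix_(i < n.*2, j < n.*2) f i j); last first.
 apply/matrixP => i j; rewrite !mxE !big_ord_recl big_ord0 !mxE fS /f /=.
 by rewrite addr0 mulN1r mul1r subrr add0r.
by rewrite IH mulr1 det_mx2 !mxE /f /= !subr0 sub0r mulrN1 opprK mulr0 add0r.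
Qed.

Variable n : nat.
Implicit Types (A B : 'M[R]_(n.*2)).
Let c : R := (2 ^ n * n`!)%:R.
Let psq A := pfs A ^+ 2 = c ^+ 2 * \det A.

(** A congruence multiplies both sides by the square of [\det B], so the identity may be checked
    after reduction to a normal form. *)
Let psq_conj A B : \det B != 0 -> psq (B *m A *m B^T) -> psq A.
rewrite /psq => d0; rewrite pfs_mul !det_mulmx det_tr exprMn => h.
apply: (mulfI (x := \det B ^+ 2)); first by rewrite expf_neq0.
by rewrite h; ring.
Qed.

Let alt A := A^T = - A.

Let alt_conj A B : alt A -> alt (B *m A *m B^T).
by rewrite /alt => hA; rewrite !trmx_mul trmxK hA mulNmx mulmxN mulmxA. Qed.
Let altE A i j : alt A -> A j i = - A i j.
by move=> /matrixP/(_ i j); rewrite !mxE. Qed.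

Let zero_row A i : alt A -> (forall j, A i j = 0) -> psq A.
move=> aA h; rewrite /psq (expand_det_row _ i) big1 => [|j _]; last by rewrite h mul0r.
suff -> : pfs A = 0 by rewrite mulr0 expr0n.
rewrite /pfs /pfsv big1 // => s _; apply/eqP; rewrite mulf_eq0; apply/orP; right.
have := permKV s i; rewrite -[(s^-1)%g i]pixVK; case: (pixV _) => q [] si.
- by rewrite (bigD1 q) //= si (altE i _ aA) h oppr0 mul0r.
- by rewrite (bigD1 q) //= si h mul0r.
Qed.

Let JE (i j : 'I_(n.*2)) : Jpair R n i j = (~~ odd i && odd j && (i./2 == j./2))%:R - (~~ odd j && odd i && (j./2 == i./2))%:R.
by rewrite !mxE. Qed.
Let Jalt : alt (Jpair R n). by rewrite /alt raddfB/= trmxK opprB. Qed.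

Let J0 m (i j : 'I_(n.*2)) : (i < m.*2)%N -> (m.*2 <= j)%N -> Jpair R n i j = 0.
move=> im mj; rewrite JE; have : (i./2 < j./2)%N.
 by rewrite (@leq_trans m)// ?ltn_half_double// geq_half_double.
by move=> h; rewrite [j./2 == _]eq_sym ltn_eqF// !andbF subrr.
Qed.

Let veq (i j : 'I_(n.*2)) : (i == j) = (nat_of_ord i == nat_of_ord j). by []. Qed.
Let sum_delta (x : 'I_(n.*2)) (v : 'I_(n.*2) -> R) : \sum_l (l == x)%:R * v l = v x.
by rewrite (bigD1 x) //= eqxx mul1r big1 ?addr0// => l /negbTE ->; rewrite mul0r. Qed.
Let agree k A := forall a b : 'I_(n.*2), ((a < k.*2) || (b < k.*2))%N -> A a b = Jpair R n a b.

(** Skew Gaussian elimination: pair after pair, congruences make rows and columns agree with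
    [Jpair]. If a zero row is met, both sides vanish. *)
Lemma pfs_sq A : A^T = - A -> pfs A ^+ 2 = (2 ^ n * n`!)%:R ^+ 2 * \det A.
move=> aA; rewrite -/c -/(psq A).
(* Induction on the number [k] of pairs still to be treated. *)
suff H k : (k <= n)%N -> forall A, alt A -> agree (n - k) A -> psq A.
 by apply: (H n (leqnn n) A) => // a b; rewrite subnn.
elim: k => [_ {aA}A aA Ag|k IH kn {aA}A aA Ag].
 rewrite subn0 in Ag; rewrite (_ : A = Jpair R n); last first.
  by apply/matrixP => a b; apply: Ag; rewrite ltn_ord.
 by rewrite /psq pfs_Jpair det_Jpair mulr1.
have mn : (n - k.+1 < n)%N by rewrite ltn_subrL (leq_trans _ kn).
set m := (n - k.+1)%N in Ag mn.
have mE : (n - k = m.+1)%N by rewrite /m subnSK.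
pose a : 'I_(n.*2) := pix (Ordinal mn, false); pose b : 'I_(n.*2) := pix (Ordinal mn, true).
have aE : a = m.*2 :> nat by rewrite /= add0n.
have bE : b = m.*2.+1 :> nat by rewrite /= add1n.
have ab : a != b by rewrite veq aE bE neq_ltn ltnSn.
have Jab : Jpair R n a b = 1.
 by rewrite JE aE bE /= odd_double /= uphalf_double doubleK eqxx subr0.
have alt0 A' i : alt A' -> A' i i = 0.
 move=> aA'; have : A' i i *+ 2 == 0 by rewrite mulr2n {1}(altE i i aA') addNr.
 by rewrite mulrn_eq0 /= => /eqP.
have [/forallP h|] := boolP [forall j, A a j == 0].
 by apply: (@zero_row A a) => // j; apply/eqP.
rewrite negb_forall => /existsP[j0 hj0].
have aj0 : (a < j0)%N.
 rewrite ltnNge leq_eqVlt; apply/negP => /orP[/eqP/val_inj e|].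
  by move: hj0; rewrite e alt0 ?eqxx.
 rewrite aE => lt; move: hj0; rewrite (altE j0 a aA) Ag ?lt// (@J0 m j0 a) ?aE//.
 by rewrite oppr0 eqxx.
(* A nonzero entry of row [a] is moved to column [b], where it serves as pivot. *)
pose A1 := perm_mx (tperm b j0) *m A *m (perm_mx (tperm b j0))^T.
have A1E i j : A1 i j = A (tperm b j0 i) (tperm b j0 j).
 by rewrite /A1 -row_permE tr_perm_mx -col_permE !mxE.
apply: (@psq_conj _ (perm_mx (tperm b j0))); first by rewrite det_perm signr_eq0.
rewrite -/A1; have aA1 : alt A1 by exact: alt_conj.
have tb (i : 'I_(n.*2)) : (m.*2 <= i)%N -> (m.*2 <= tperm b j0 i)%N.
 by case: tpermP => // _ _; rewrite -aE ltnW.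
have tlt (i : 'I_(n.*2)) : (i < m.*2)%N -> tperm b j0 i = i.
 move=> im; rewrite tpermD// veq.
  by rewrite bE gtn_eqF// ltnS ltnW.
 by rewrite gtn_eqF// (ltn_trans _ aj0)// aE.
have Ag1 : agree m A1.
 suff H (i j : 'I_(n.*2)) : (i < m.*2)%N -> A1 i j = Jpair R n i j.
  move=> i j /orP[|jm]; first exact: H.
  by rewrite (altE j i aA1) H// (altE j i Jalt).
 move=> im; rewrite A1E (tlt i im); have [jm|mj] := ltnP j m.*2.
  by rewrite (tlt _ jm) Ag ?im.
 by rewrite Ag ?im// !(@J0 m)// tb.
have al0 : A1 a b != 0.
 by rewrite A1E tpermL tpermD// ?[_ == a]eq_sym// veq neq_ltn aj0.
clearbody A1; clear A1E hj0 aj0 tb tlt j0 Ag aA A.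
set al := A1 a b in al0.
(* Row [b] is divided by the pivot. Multiples [u] of row [a] and [w] of row [b] are added to the
   later rows to clear their entries in columns [b] and [a] respectively. *)
pose dd (j : 'I_(n.*2)) : R := if j == b then al^-1 else 1.
pose u (j : 'I_(n.*2)) : R := if (b < j)%N then - (A1 j b / al) else 0.
pose w (j : 'I_(n.*2)) : R := if (b < j)%N then A1 j a / al else 0.
pose B : 'M[R]_(n.*2) := \matrix_(j, l) ((l == j)%:R * dd j + ((l == a)%:R * u j + (l == b)%:R * w j)).
have BE (v : 'I_(n.*2) -> R) j : \sum_l B j l * v l = dd j * v j + u j * v a + w j * v b.
 under eq_bigr => l _ do rewrite mxE !mulrDl -!mulrA.
 by rewrite !big_split /= !sum_delta addrA.
have dB : \det B = al^-1.
 rewrite det_trig; last first.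
  apply/is_trig_mxP => i j ij; rewrite mxE /u /w.
  have -> : (j == i) = false by rewrite veq gtn_eqF.
  rewrite mul0r add0r; case: ifP => [bi|_]; last by rewrite !mulr0 addr0.
  have -> : (j == b) = false by rewrite veq gtn_eqF// (ltn_trans bi).
  by rewrite veq aE gtn_eqF ?mul0r ?addr0// (ltn_trans _ ij)// (leq_ltn_trans _ bi)// bE leqnSn.
 rewrite (bigD1 b) //= big1 ?mulr1 => [|i ib]; rewrite mxE eqxx mul1r /dd /u /w.
  by rewrite eqxx ltnn !mulr0 !addr0.
 rewrite (negbTE ib) mul0r addr0; case: ifP => [bi|_]; last by rewrite mulr0 addr0.
 by rewrite veq aE gtn_eqF ?mul0r ?addr0// (ltn_trans _ bi)// bE.
apply: (@psq_conj _ B); first by rewrite dB invr_eq0.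
have aA2 : alt (B *m A1 *m B^T) by exact: alt_conj.
apply: IH => //; first exact: ltnW.
rewrite mE => i j.
suff H (i' j' : 'I_(n.*2)) : (i' < m.+1.*2)%N -> (B *m A1 *m B^T) i' j' = Jpair R n i' j'.
 move=> /orP[|jm]; first exact: H.
 by rewrite (altE j i aA2) H// (altE j i Jalt).
move=> {i j}.
have -> : (B *m A1 *m B^T) i' j' = \sum_l B j' l * \sum_k B i' k * A1 k l.
 by rewrite mxE; apply: eq_bigr => l _; rewrite !mxE mulrC.
rewrite BE doubleS ltnS leq_eqVlt => /orP[/eqP ib|].
 have {ib} -> : i' = b by apply: ord_inj; rewrite ib bE.
 rewrite !BE /dd eqxx /u /w ltnn !mul0r !addr0.
 have [jb|bj|/val_inj ->] := ltngtP j' b; last first.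
 - by rewrite eqxx (alt0 _ b aA1) (alt0 _ b Jalt) !mulr0 !mul0r !addr0.
 - have -> : (j' == b) = false by rewrite veq gtn_eqF.
  have -> : Jpair R n b j' = 0.
   by apply: (@J0 m.+1).
  rewrite (alt0 _ b aA1) !mulr0 addr0 mul1r (altE a b aA1) -/al (altE j' b aA1).
  by rewrite mulrN mulrN mulVf// mulrNN mulr1 mulrC addNr.
 - have -> : (j' == b) = false by rewrite veq ltn_eqF.
  rewrite !mul0r !addr0 mul1r; have [jm|mj] := ltnP j' m.*2.
   by rewrite Ag1 ?jm ?orbT// (altE j' b Jalt) (@J0 m)// ?bE ?leqnSn// oppr0 mulr0.
  have -> : j' = a by apply/ord_inj/eqP; rewrite aE eqn_leq mj andbT -ltnS -bE.
  by rewrite (altE a b aA1) -/al mulrN mulVf// (altE a b Jalt) Jab.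

rewrite ltnS leq_eqVlt => /orP[/eqP ia|im].
 have {ia} -> : i' = a by apply: ord_inj; rewrite ia aE.
 rewrite !BE /dd (negbTE ab) /u /w [(b < a)%N]ltnNge ltnW ?aE ?bE//= !mul0r !addr0 !mul1r.
 have [jb|bj|/val_inj ->] := ltngtP j' b; last first.
 - by rewrite ?eqxx ?ltnn !mul0r !addr0 -/al mulVf// Jab.
 - have -> : (j' == b) = false by rewrite veq gtn_eqF.
  have -> : Jpair R n a j' = 0.
   by apply: (@J0 m.+1); [rewrite aE ltn_double|exact: bj].
  by rewrite (alt0 _ a aA1) mulr0 addr0 mul1r -/al divfK// (altE a j' aA1) subrr.
 - have -> : (j' == b) = false by rewrite veq ltn_eqF.
  rewrite !mul0r !addr0 mul1r; have [jm|mj] := ltnP j' m.*2; first by rewrite Ag1 ?jm ?orbT.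
  have -> : j' = a by apply/ord_inj/eqP; rewrite aE eqn_leq mj andbT -ltnS -bE.
  by rewrite !alt0.
have nb : (i' == b) = false by rewrite veq ltn_eqF// bE ltnS ltnW.
have nb2 : (b < i')%N = false by apply/negbTE; rewrite -leqNgt bE leqW// ltnW.
rewrite !BE /dd nb /u /w nb2 !mul0r !addr0 !mul1r.
have e x : A1 i' x = Jpair R n i' x by rewrite Ag1 ?im.
have Ja : Jpair R n i' a = 0 by rewrite (@J0 m i' a im)// aE.
have Jb : Jpair R n i' b = 0 by rewrite (@J0 m i' b im)// bE leqnSn.
rewrite !e Ja Jb !mulr0 !addr0.
case: eqP => [->|_]; last by rewrite mul1r.
by rewrite Jb mulr0.
Qed.
End PfaffianSquare.

(** * De Bruijn's integration formula *)

Section DeBruijn.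
Variables (R : realType) (d : measure_display) (X : measurableType d).
Variables (io : R -> X) (om : X -> R).
Hypotheses (mio : mfunT io) (om1 : forall x, 1 <= om x).
Hypothesis iom : itg (fun u => (om (io u))^-1).
Local Notation wt x := ((om x)^-1).
Local Notation lint := (lint io).
Local Notation Lf := (Lf io).
Local Notation nice := (nice om).

Definition actp k (s : 'S_k) (z : nat -> X) : nat -> X :=
 fun i => if insub i is Some j then z (s j) else z i.

Lemma actpE k (s : 'S_k) z (i : 'I_k) : actp s z i = z (s i).
by rewrite /actp valK. Qed.

Lemma actpM k (s t : 'S_k) z : actp (s * t)%g z = actp s (actp t z).
apply/funext => i; rewrite {1 2}/actp; case: insubP => [j _ _|/negbTE h]; first by rewrite actpE permM.
by rewrite /actp insubF.
Qed.

Lemma nice_act k (s : 'S_k) F : nice k F -> nice k (fun z => F (actp s z)).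
move=> [pF [C [C0 h]]]; split.
 move=> d' A z mz; apply: (pF _ A (fun a => actp s (z a))) => i.
 by rewrite /actp; case: insub => [j|]; exact: mz.
exists C; split=> // z; rewrite (le_trans (h _))//.
under eq_bigr do rewrite actpE.
by rewrite [X in _ <= _ * X](reindex_perm s).
Qed.

(** Exchanges of neighbours are given by [lint_swp], a longer transposition is a conjugate of a
    shorter one by a neighbour exchange, and transpositions generate. *)
Lemma lint_perm B k (s : 'S_k) F : nice k F -> lint B k F = lint B k (fun z => F (actp s z)).
pose P (t : 'S_k) := forall F, nice k F -> lint B k F = lint B k (fun z => F (actp t z)).
have PM s1 s2 : P s1 -> P s2 -> P (s1 * s2)%g.
 move=> P1 P2 G nG; rewrite P1// P2; last exact: nice_act.
 by apply: lint_eq => z; rewrite actpM.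
have P1 : P 1%g.
 move=> G nG; apply: lint_eq => z; congr G; apply/funext => i; rewrite /actp.
 by case: insubP => [j _ <-|//]; rewrite perm1.
have Pa (x y : 'I_k) : x.+1 = y -> P (tperm x y).
 move=> xy G nG; have xk : (x.+1 < k)%N by rewrite xy.
 rewrite (lint_swp mio om1 iom B xk nG); apply: lint_eq => z; congr G.
 apply/funext => i; rewrite /swp /actp; case: insubP => [j _ <-|].
  have yx : (val y == val x) = false by rewrite /= -xy gtn_eqF.
  case: tpermP => [->|->|/eqP nx /eqP ny]; rewrite ?eqxx ?xy ?yx ?eqxx//.
  by move: nx ny; rewrite -!val_eqE => /negbTE-> /negbTE->.
 rewrite -leqNgt => ki; have [e|_] := eqVneq i x; first by move: ki; rewrite e leqNgt ltn_ord.
 by have [e|//] := eqVneq i x.+1; move: ki; rewrite e leqNgt xk.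
have Pt m (x y : 'I_k) : (x + m.+1 = y)%N -> P (tperm x y).
 elim: m y => [|m IH] y xy; first by apply: Pa; rewrite -xy addn1.
 have yk : (x + m.+1 < k)%N by rewrite (leq_ltn_trans _ (ltn_ord y))// -xy leq_add2l.
 pose y' := Ordinal yk.
 have -> : tperm x y = (tperm x y' ^ tperm y' y)%g.
  rewrite tpermJ tpermL tpermD// -val_eqE /= gtn_eqF//; first by rewrite addnS ltnS leq_addr.
  by rewrite -xy addnS ltnS leq_addr.
 rewrite conjgE tpermV; apply: (PM); first by apply: Pa; rewrite -xy /= !addnS.
 by apply: (PM); [exact: IH|apply: Pa; rewrite -xy /= !addnS].
have [ts -> dts] := prod_tpermP s.
elim: ts dts F => [|[x y] ts IH] /=; first by rewrite big_nil => _; exact: P1.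
case/andP => xy dts; rewrite big_cons; apply: PM; last exact: IH.
have {}xy : x != y by [].
have [lt|lt|e] := ltngtP x y; last by move: xy; rewrite -val_eqE /= e eqxx.
- by apply: (Pt (y - x).-1); rewrite prednK ?subn_gt0// subnKC// ltnW.
- by rewrite tpermC; apply: (Pt (x - y).-1); rewrite prednK ?subn_gt0// subnKC// ltnW.
Qed.

Definition pairfun n (g : 'I_n -> X -> X -> R) (z : nat -> X) : R := \prod_(i < n) g i (z i.*2) (z i.*2.+1).

Lemma nice_pairfun n (g : 'I_n -> X -> X -> R) C : 0 <= C ->
 (forall i, mfunT (fun x : X * X => g i x.1 x.2)) ->
 (forall i x y, `|g i x y| <= C * (wt x * wt y)) -> nice n.*2 (pairfun g).
move=> C0 mg bg; split.
 by move=> d' A z mz; apply: measurable_prod => i *; exact: (mcomp2 (mg i) (mz _) (mz _)).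
exists (C ^+ n); split; first exact: exprn_ge0.
move=> z; rewrite normr_prod (big_pairs (n := n)) /=.
rewrite -[n in C ^+ n]card_ord -prodr_const -big_split /=; apply: ler_prod => i _; rewrite normr_ge0 /=.
by rewrite add0n add1n; exact: bg.
Qed.

Lemma lint_pairfun B n (g : 'I_n -> X -> X -> R) C : 0 <= C ->
 (forall i, mfunT (fun x : X * X => g i x.1 x.2)) ->
 (forall i x y, `|g i x y| <= C * (wt x * wt y)) ->
 lint B n.*2 (pairfun g) = \prod_i Lf B (fun x => Lf B (g i x)).
elim: n g => [|n IH] g C0 mg bg; first by rewrite big_ord0 /= /pairfun big_ord0.
have ng : nice n.*2 (pairfun (fun i => g (lift ord0 i))) by apply: (@nice_pairfun _ _ C).
have tg x : tame om (g ord0 x).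
 split; first exact: (measurable_fun_pair2 x (mg ord0)).
 exists (C * wt x); split; first by rewrite mulr_ge0// invr_ge0 (le_trans ler01).
 by move=> y; rewrite -mulrA.
have tLg : tame om (fun x => Lf B (g ord0 x)).
 split.
  apply: (@jm_lint _ _ _ _ mio B 1 _ _ (fun x z => g ord0 x (z 0%N))) => d'' A' h z mh mz.
  by apply: mcomp2 (mg ord0) _ _.
 exists (C * Lmass io om B); split; first by rewrite mulr_ge0// Lmass_ge0.
 move=> x; rewrite mulrAC; apply: Lf_bound => //.
 - by rewrite mulr_ge0// invr_ge0 (le_trans ler01).
 - exact: (measurable_fun_pair2 x (mg ord0)).
 - by move=> y; rewrite -mulrA.
rewrite big_ord_recl -IH// mulrC -(LfZ mio iom)//.
rewrite doubleS /=; apply: Lf_eq => x; rewrite -(LfZ mio iom)//; apply: Lf_eq => y.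
rewrite mulrC -(lintZ mio om1 iom)//; apply: lint_eq => z.
rewrite /pairfun big_ord_recl /=; congr (_ * _); exact: eq_bigr.
Qed.

Section Formula.
Variables (n : nat) (p : 'I_(n.*2) -> X -> R) (ka : X -> X -> R) (C : R).
Hypotheses (C0 : 0 <= C) (mp : forall i, mfunT (p i)).
Hypotheses (mk : mfunT (fun x : X * X => ka x.1 x.2)) (bd : forall i j x y, `|p i x * ka x y * p j y| <= C * (wt x * wt y)).

Let g (t : 'S_(n.*2)) (i : 'I_n) x y := p (t (pix (i, false))) x * ka x y * p (t (pix (i, true))) y.

Let mg t i : mfunT (fun x : X * X => g t i x.1 x.2).
apply: mfunM; last exact: mcomp.
by apply: mfunM => //; exact: mcomp.
Qed.

Let integrandE z : \det (\matrix_(i, j) p i (z (val j))) * pfs (\matrix_(i < n.*2, j < n.*2) ka (z i) (z j)) =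
 \sum_(s : 'S_(n.*2)) \sum_(t : 'S_(n.*2)) (-1) ^+ (s * t)%g * pairfun (g (s * t)%g) (actp s z).
rewrite mulrC /pfs /pfsv mulr_suml; apply: eq_bigr => s _; rewrite -det_tr mulr_sumr.
apply: eq_bigr => t _; rewrite mulrACA -signr_addb -odd_permM; congr (_ * _).
rewrite (reindex_perm s) /= [X in _ * X](big_pairs (n := n)) -big_split /=; apply: eq_bigr => i _.
have e1 : actp s z i.*2 = z (s (pix (i, false))) by rewrite -actpE.
have e2 : actp s z i.*2.+1 = z (s (pix (i, true))) by rewrite -actpE.
by rewrite !mxE /g !permM e1 e2; ring.
Qed.

(** Both factors are expanded over permutations. After a change of variables by the permutation from
    the Pfaffian, the integral depends only on the product of the two permutations, so every term of
    the outer sum is the same Pfaffian; hence the factor (2n)!. *)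
Lemma lint_det_pf B : lint B n.*2 (fun z => \det (\matrix_(i, j) p i (z (val j))) *
  pfs (\matrix_(i < n.*2, j < n.*2) ka (z i) (z j))) =
 (n.*2)`!%:R * pfs (\matrix_(i, j) Lf B (fun x => Lf B (fun y => p i x * ka x y * p j y))).
rewrite (lint_eq _ _ _ integrandE).
have np t : nice n.*2 (pairfun (g t)) by apply: (@nice_pairfun _ _ C) => // i x y; rewrite /g; exact: bd.
rewrite (lint_sum mio om1 iom); last first.
 by move=> s; apply: nice_sum => t; apply: niceZ; exact: nice_act.
rewrite (eq_bigr (fun=> pfs (\matrix_(i, j) Lf B (fun x => Lf B (fun y => p i x * ka x y * p j y))))) => [|s _].
 by rewrite sumr_const mulr_natl -(card_Sn n.*2); congr (_ *+ _); apply: eq_card.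
rewrite (lint_sum mio om1 iom); last by move=> t; apply: niceZ; exact: nice_act.
rewrite /pfs /pfsv [RHS](reindex_inj (mulgI s)) /=; apply: eq_bigr => t _.
rewrite (lintZ mio om1 iom); last exact: nice_act.
rewrite -(lint_perm B s (np _)) (@lint_pairfun _ _ _ C)// => [|i x y]; last by rewrite /g; exact: bd.
by congr (_ * _); apply: eq_bigr => i _; rewrite mxE.
Qed.
End Formula.
End DeBruijn.

(** * Determinantal integrals at one time level with some points prescribed *)

Section Nest.
Variables (R : realType) (d : measure_display) (X : measurableType d).
Variables (io : R -> X) (om : X -> R).
Hypotheses (mio : mfunT io) (mom : mfunT om).
Hypotheses (om1 : forall x, 1 <= om x) (iom : itg (fun u => (om (io u))^-1)).
Variable N : nat.
Local Notation wt x := ((om x)^-1).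
Local Notation lint := (lint io).
Local Notation Lf := (Lf io).
Local Notation nice := (nice om).

Lemma om_gt0 x : 0 < om x. exact: lt_le_trans (om1 x). Qed.
Lemma om_ge0 x : 0 <= om x. exact/ltW/om_gt0. Qed.
Local Hint Resolve om_gt0 om_ge0 : core.

Definition goodf (phi : 'I_N -> X -> R) := (forall i, mfunT (phi i)) /\
 forall r : nat, exists C, 0 <= C /\ forall i x, `|phi i x| * om x ^+ r <= C.

(** Decay in the target faster than any power of [om], with a constant that grows like the same
    power at the source. This is what keeps the class [good] stable under a transition. *)
Definition goodp (p : X -> X -> R) := mfunT (fun x : X * X => p x.1 x.2) /\
 forall r : nat, exists C, 0 <= C /\ forall w x, `|p w x| * om x ^+ r <= C * om w ^+ r.

(** The properties that the later levels have as a function of the current configuration. *)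
Definition good (G : (nat -> X) -> R) := [/\ pm G,
 (exists r C, 0 <= C /\ forall z, `|G z| <= C * \prod_(i < N) om (z i) ^+ r) &
 forall i z, (i.+1 < N)%N -> G (swp i z) = - G z].

Definition acat (A : seq X) (z : nat -> X) : nat -> X := foldr (fun x => scons x) z A.
Definition dphi (phi : 'I_N -> X -> R) (y : nat -> X) : R := \det (\matrix_(i, j) phi i (y (val j))).

(** The points of [A] fill the first arguments; the factorial turns the integral over the others
    into one over unordered configurations. *)
Definition nest1 phi A B G : R :=
 ((N - size A)`!%:R)^-1 * lint B (N - size A) (fun z => dphi phi (acat A z) * G (acat A z)).

Lemma goodp_f p (w : nat -> X) : goodp p -> goodf (fun i => p (w i)).
move=> [mp bp]; split=> [i|r]; first exact: (measurable_fun_pair2 (w i) mp).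
have [C [C0 h]] := bp r; exists (C * \sum_(i < N) om (w i) ^+ r); split.
 by rewrite mulr_ge0// sumr_ge0// => i _; rewrite exprn_ge0.
move=> i x; rewrite (le_trans (h _ _))// ler_wpM2l// (bigD1 i)//= lerDl sumr_ge0// => j _.
by rewrite exprn_ge0.
Qed.

Lemma dphi_bound phi (a : 'I_N -> R) (b : X -> R) y : (forall i, 0 <= a i) ->
 (forall i x, `|phi i x| <= a i * b x) -> `|dphi phi y| <= N`!%:R * (\prod_i a i * \prod_(j < N) b (y j)).
move=> a0 h; rewrite /dphi -det_tr (le_trans (ler_norm_sum _ _ _))//.
rewrite -(card_Sn N) mulr_natl -sumr_const; apply: ler_sum => s _.
rewrite normrM normrX normrN1 expr1n mul1r normr_prod.
rewrite [X in _ <= X * _](reindex_perm s) -big_split /=.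
by apply: ler_prod => j _; rewrite normr_ge0 !mxE /=; exact: h.
Qed.

Lemma prod_acat A z k : \prod_(j < k) wt (acat A z j) <= \prod_(i < k - size A) wt (z i).
elim: A k => [|x A IH] k; first by rewrite subn0.
case: k => [|k]; first by rewrite !big_ord0.
rewrite big_ord_recl subSS (le_trans _ (IH k))//= ler_piMl//; first by apply: prodr_ge0 => j _; rewrite invr_ge0.
by rewrite invf_le1.
Qed.

Lemma pm_acat A (F : (nat -> X) -> R) : pm F -> pm (fun z => F (acat A z)).
by elim: A F => [//|x A IH] F pF; exact: (IH (fun z => F (scons x z)) (pm_scons x pF)). Qed.

Lemma pm_dphi phi : (forall i, mfunT (phi i)) -> pm (dphi phi).
move=> mphi d' A z mz; apply: measurable_sum => s; apply: mfunM => //.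
apply: measurable_prod => i _; under eq_fun do rewrite mxE.
exact: mcomp.
Qed.

Lemma pmM (F G : (nat -> X) -> R) : pm F -> pm G -> pm (fun z => F z * G z).
by move=> pF pG d' A z mz; apply: mfunM; [exact: pF|exact: pG]. Qed.

(** One spare power of [om] in the decay of [phi] remains after the growth of [G] has been absorbed,
    and gives the integrable weight. *)
Lemma integrand_bound phi (G : (nat -> X) -> R) (a : 'I_N -> R) r C (y : nat -> X) : 0 <= C -> (forall i, 0 <= a i) ->
 (forall i x, `|phi i x| * om x ^+ r.+1 <= a i) ->
 `|G y| <= C * \prod_(i < N) om (y i) ^+ r ->
 `|dphi phi y * G y| <= (N`!%:R * C * \prod_i a i) * \prod_(j < N) wt (y j).
move=> C0 a0 ha hG.
have h1 : `|dphi phi y| <= N`!%:R * (\prod_i a i * \prod_(j < N) (om (y j) ^+ r.+1)^-1).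
 apply: (dphi_bound (b := fun x => (om x ^+ r.+1)^-1)) => // i x.
 by rewrite ler_pdivlMr ?exprn_gt0.
rewrite normrM; apply: (le_trans (ler_pM _ _ h1 hG)) => //.
rewrite [leLHS](_ : _ = N`!%:R * C * \prod_i a i * \prod_(j < N) ((om (y j) ^+ r.+1)^-1 * om (y j) ^+ r)).
 rewrite ler_wpM2l// ?mulr_ge0// ?prodr_ge0//; apply: ler_prod => j _.
 rewrite mulr_ge0 ?invr_ge0 ?exprn_ge0//= exprS invfM -mulrA mulVf ?mulr1//.
 by rewrite expf_neq0// gt_eqF.
by rewrite big_split /=; ring.
Qed.

Lemma nice_integrand phi A G : goodf phi -> good G ->
 nice (N - size A) (fun z => dphi phi (acat A z) * G (acat A z)).
move=> [mphi bphi] [pG [r [C [C0 hG]]] _]; split.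
 by apply: pmM; apply: pm_acat => //; exact: pm_dphi.
have [a [a0 ha]] := bphi r.+1.
exists (N`!%:R * C * \prod_(i < N) a); split; first by rewrite !mulr_ge0// prodr_ge0.
move=> z; apply: (le_trans (integrand_bound C0 (fun=> a0) ha (hG _))).
by rewrite ler_wpM2l ?prod_acat// !mulr_ge0// prodr_ge0.
Qed.

Lemma dphi_swp phi i y : (i.+1 < N)%N -> dphi phi (swp i y) = - dphi phi y.
move=> iN; pose i0 := Ordinal (ltnW iN); pose i1 := Ordinal iN.
have ne : i0 != i1 by rewrite -val_eqE /= neq_ltn ltnSn.
rewrite /dphi (_ : \matrix_(_, _) _ = (\matrix_(i, j) phi i (y (val j))) *m tperm_mx i0 i1); last first.
 rewrite -xcolE; apply/matrixP => a b; rewrite !mxE /swp; congr (phi a _).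
 case: tpermP => [->|->|/eqP n0 /eqP n1]; rewrite ?eqxx//=.
  by rewrite eqn_leq ltnn.
 by move: n0 n1; rewrite -!val_eqE /= => /negbTE-> /negbTE->.
by rewrite det_mulmx det_perm odd_tperm ne expr1 mulrN1.
Qed.

Lemma alt_vanish (G : (nat -> X) -> R) i z : (forall z, G (swp i z) = - G z) -> z i = z i.+1 -> G z = 0 :> R.
move=> h e; have ez : swp i z = z.
 apply/funext => j; rewrite /swp; case: eqP => [->//|_]; case: eqP => [->//|_]; by [].
have := h z; rewrite ez => /eqP; rewrite -addr_eq0 -mulr2n mulrn_eq0 /= => /eqP.
by [].
Qed.

Lemma acat_swp A i z : acat A (swp i z) = swp (size A + i) (acat A z).
by elim: A => [//|x A IH] /=; rewrite IH swpS. Qed.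
Lemma acat_rcons A x z : acat (rcons A x) z = acat A (scons x z).
by elim: A => [//|y A IH] /=; rewrite IH. Qed.
Lemma acat_cat A1 A2 z : acat (A1 ++ A2) z = acat A1 (acat A2 z).
by elim: A1 => [//|y A IH] /=; rewrite IH. Qed.

(** The determinant and [G] are both antisymmetric, so their product is symmetric and vanishes on
    coinciding variables, as [lint_cons] requires. The factor [k] produced there is absorbed by the
    factorial. *)
Lemma nest1_cons phi A B x e G : goodf phi -> good G -> (size A < N)%N ->
 nest1 phi A ((x, e) :: B) G = nest1 phi A B G + e * nest1 phi (rcons A x) B G.
move=> gphi gG AN; have [_ _ aG] := gG.
rewrite /nest1 (lint_cons mio om1 iom) //; first last.
- move=> i z ik zi; rewrite (@alt_vanish G (size A + i)) ?mulr0//.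
  by move=> y; apply: aG; rewrite -addnS -ltn_subRL.
 by elim: A {AN ik} => [|y A IH].
- move=> i z ik; rewrite acat_swp dphi_swp ?aG ?mulrNN// -addnS -ltn_subRL//.
- exact: nice_integrand.
rewrite mulrDr; congr (_ + _); rewrite size_rcons subnS.
have -> : (N - size A = (N - size A).-1.+1)%N by rewrite prednK// subn_gt0.
set k := (N - size A).-1; rewrite /= factS natrM invfM.
rewrite (lint_eq _ _ _ (fun z => congr1 (fun y => dphi phi y * G y) (acat_rcons A x z))).
have k0 : k.+1%:R != 0 :> R by rewrite pnatr_eq0.
by rewrite [k.+1%:R^-1 / _]mulrC -!mulrA mulKf// mulrCA.
Qed.

Lemma nest1_perm phi A B B' G : perm_eq B B' -> nest1 phi A B G = nest1 phi A B' G.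
move=> h; rewrite /nest1; congr (_ * _).
move: (N - size A)%N (fun z => dphi phi (acat A z) * G (acat A z)) => k F.
elim: k F => [//|k IH] F /=; rewrite /Lf (perm_big _ h) /=.
congr (_ + _); first by apply: Ri_eq => u; apply: IH.
by apply: eq_bigr => b _; congr (_ * _); apply: IH.
Qed.

(** Neighbouring prescribed points may be exchanged, because the determinant and [G] change sign
    together. *)
Lemma nest1_move phi A1 x A2 B G : goodf phi -> good G -> (size (A1 ++ x :: A2) <= N)%N ->
 nest1 phi (A1 ++ x :: A2) B G = nest1 phi (rcons (A1 ++ A2) x) B G.
move=> gphi gG; have [_ _ aG] := gG.
elim: A2 A1 => [|y A2 IH] A1 sN; first by rewrite cats0 cats1.
have -> : nest1 phi (A1 ++ x :: y :: A2) B G = nest1 phi (A1 ++ y :: x :: A2) B G.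
 rewrite /nest1 !size_cat /=; congr (_ * _); apply: lint_eq => z; rewrite !acat_cat /=.
 have -> : acat A1 (scons x (scons y (acat A2 z))) = swp (size A1) (acat A1 (scons y (scons x (acat A2 z)))).
  by rewrite -[in RHS](addn0 (size A1)) -acat_swp swp0.
 by rewrite dphi_swp ?aG ?mulrNN//; move: sN; rewrite size_cat /=; lia.
have := IH (rcons A1 y); rewrite -!cats1 -!catA /= => -> //.
by move: sN; rewrite !size_cat.
Qed.

Lemma nest1D phi A B G1 G2 : goodf phi -> good G1 -> good G2 ->
 nest1 phi A B (fun z => G1 z + G2 z) = nest1 phi A B G1 + nest1 phi A B G2.
move=> gp g1 g2; rewrite /nest1 -mulrDr -(lintD mio om1 iom); [|exact: nice_integrand|exact: nice_integrand].
by congr (_ * _); apply: lint_eq => z; rewrite mulrDr.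
Qed.

Lemma nest1Z phi A B c G : goodf phi -> good G ->
 nest1 phi A B (fun z => c * G z) = c * nest1 phi A B G.
move=> gp g1; rewrite /nest1 [RHS]mulrCA; congr (_ * _).
rewrite -(lintZ mio om1 iom); last exact: nice_integrand.
by apply: lint_eq => z; rewrite mulrCA.
Qed.

Lemma nest1_eq phi A B G1 G2 : (forall z, G1 z = G2 z) -> nest1 phi A B G1 = nest1 phi A B G2.
by move=> h; congr (_ * _); apply: lint_eq => z; rewrite h. Qed.

Lemma goodZ c G : good G -> good (fun z => c * G z).
move=> [pG [r [C [C0 hG]]] aG]; split.
- by move=> d' A z mz; apply: mfunM => //; exact: pG.
- exists r, (`|c| * C); split; first by rewrite mulr_ge0.
 by move=> z; rewrite normrM -mulrA ler_wpM2l.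
- by move=> i z iN; rewrite aG// mulrN.
Qed.

(** Antisymmetry in the earlier configuration comes from the rows of the determinant, polynomial
    growth from the constants in [goodp]. *)
Lemma good_nest p A B G : goodp p -> good G -> good (fun w => nest1 (fun i => p (w i)) A B G).
move=> gp gG; have [mp bp] := gp; have [pG [r [C [C0 hG]]] aG] := gG; split.
- move=> d' T w mw; apply: mfunM => //.
 apply: (@jm_lint _ _ _ _ mio _ _ _ _ (fun a z => dphi (fun i => p (w a i)) (acat A z) * G (acat A z))).
 move=> d'' A' h z mh mz.
 have mz' i : mfunT ((fun a => acat A (z a))^~ i).
  by elim: A i => [//|x A2 IH] [|i] //=; exact: IH.
 apply: mfunM; last exact: pG.
 apply: measurable_sum => s; apply: mfunM => //.
 apply: measurable_prod => i _; under eq_fun do rewrite mxE.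
 by apply: (mcomp2 mp _ (mz' _)); exact: (mcomp (mw i) mh).
- have [a [a0 ha]] := bp r.+1.
 exists r.+1, (((N - size A)`!%:R)^-1 * (N`!%:R * C * a ^+ N * Lmass io om B ^+ (N - size A))); split.
  by rewrite !mulr_ge0 ?invr_ge0 ?exprn_ge0 ?Lmass_ge0.
 move=> w; rewrite /nest1 normrM ger0_norm ?invr_ge0// -!mulrA ler_wpM2l ?invr_ge0// !mulrA.
 have h := @lint_bound _ _ _ _ _ mio om1 iom B (N - size A) (fun z => dphi (fun i => p (w i)) (acat A z) * G (acat A z))
   (N`!%:R * C * \prod_(i < N) (a * om (w i) ^+ r.+1)).
 apply: (le_trans (h _ _ _)).
 + by rewrite !mulr_ge0// prodr_ge0// => i _; rewrite mulr_ge0// exprn_ge0.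
 + apply: pmM; apply: pm_acat => //; apply: pm_dphi => i; exact: (measurable_fun_pair2 (w i) mp).
 + move=> z; apply: (le_trans (integrand_bound (a := fun i => a * om (w i) ^+ r.+1) C0 _ _ (hG _))).
  * by move=> i; rewrite mulr_ge0// exprn_ge0.
  * by move=> i x; exact: ha.
  rewrite ler_wpM2l ?prod_acat// !mulr_ge0// prodr_ge0// => i _; rewrite mulr_ge0// exprn_ge0//.
 rewrite big_split /= prodr_const card_ord; apply: le_of_eq; ring.
- move=> i w iN; rewrite /nest1 -mulrN; congr (_ * _).
 rewrite -[RHS]mulN1r -(lintZ mio om1 iom); last exact: (nice_integrand _ (goodp_f w gp) gG).
 apply: lint_eq => z; rewrite mulN1r -mulNr; congr (_ * _).
 pose i0 := Ordinal (ltnW iN); pose i1 := Ordinal iN.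
 have ne : i0 != i1 by rewrite -val_eqE /= neq_ltn ltnSn.
 rewrite /dphi (_ : \matrix_(_, _) _ = tperm_mx i0 i1 *m (\matrix_(i, j) p (w i) (acat A z (val j)))); last first.
  rewrite -xrowE; apply/matrixP => a b; rewrite !mxE /swp; congr (p _ _).
  case: tpermP => [->|->|/eqP n0 /eqP n1]; rewrite ?eqxx//=.
   by rewrite eqn_leq ltnn.
  by move: n0 n1; rewrite -!val_eqE /= => /negbTE-> /negbTE->.
 by rewrite det_mulmx det_perm odd_tperm ne expr1 mulN1r.
Qed.
End Nest.

(** * Several time levels, and expansion in the masses of the atoms *)

Section Levels.
Variables (R : realType) (d : measure_display) (X : measurableType d).
Variables (io : R -> X) (om : X -> R).
Hypotheses (mio : mfunT io) (mom : mfunT om).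
Hypotheses (om1 : forall x, 1 <= om x) (iom : itg (fun u => (om (io u))^-1)).
Variable n : nat.
Variables (ka : X -> X -> R) (Ck : R).
Hypotheses (mka : mfunT (fun x : X * X => ka x.1 x.2)) (bka : forall x y, `|ka x y| <= Ck).
Local Notation N := (n.*2).
Local Notation lint := (lint io).
Local Notation Lf := (Lf io).
Local Notation good := (good om N).
Local Notation goodf := (@goodf _ _ _ om N).
Local Notation goodp := (@goodp _ _ _ om).
Local Notation nest1 := (@nest1 _ _ _ io N).

(** In the application this is, up to a constant, the sign of the permutation that sorts the final
    configuration. *)
Definition ptop (z : nat -> X) : R := pfs (\matrix_(i < N, j < N) ka (z i) (z j)).

(** A level is a transition kernel, a list of prescribed points and a list of atoms; the result is a
    function of the configuration just before the first level of the list. *)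
Definition nest (lv : seq ((X -> X -> R) * seq X * seq (X * R))) : (nat -> X) -> R :=
 foldr (fun l G (w : nat -> X) => nest1 (fun i => l.1.1 (w i)) l.1.2 l.2 G) ptop lv.

Lemma good_ptop : good ptop.
split.
- move=> d' A z mz; apply: measurable_sum => s; apply: mfunM => //.
 apply: measurable_prod => i _; under eq_fun do rewrite mxE.
 exact: (mcomp2 mka (mz _) (mz _)).
- exists 0%N, (N`!%:R * `|Ck| ^+ n); split; first by rewrite mulr_ge0// exprn_ge0.
 move=> z; rewrite big1 ?mulr1//.
 rewrite (le_trans (ler_norm_sum _ _ _))// -(card_Sn N) mulr_natl -sumr_const; apply: ler_sum => s _.
 rewrite normrM normrX normrN1 expr1n mul1r normr_prod.
 rewrite -[n in _ ^+ n]card_ord -prodr_const; apply: ler_prod => i _.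
 by rewrite normr_ge0 mxE (le_trans (bka _ _))// ler_norm.
- move=> i z iN; pose i0 := Ordinal (ltnW iN); pose i1 := Ordinal iN.
 have ne : i0 != i1 by rewrite -val_eqE /= neq_ltn ltnSn.
 rewrite /ptop -mulN1r -[X in X * _]expr1 -[X in X ^+ _ * _]/(-1).
 have -> : (-1) ^+ 1 = (-1) ^+ (tperm i0 i1) :> R by rewrite odd_tperm ne.
 rewrite -pfs_perm; congr pfs; apply/matrixP => a b; rewrite !mxE.
 suff h (j : 'I_N) : swp i z j = z (tperm i0 i1 j) by rewrite !h.
 rewrite /swp; case: tpermP => [->|->|/eqP n0 /eqP n1]; rewrite ?eqxx//=.
  by rewrite eqn_leq ltnn.
 by move: n0 n1; rewrite -!val_eqE /= => /negbTE-> /negbTE->.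
Qed.

Section Expansion.
Variables (I : finType) (lev : I -> nat) (pos : I -> X) (e : nat -> seq I).
Hypotheses (ue : forall m, uniq (e m)) (eP : forall m i, (i \in e m) = (lev i == m)).
Variables (phi : 'I_N -> X -> R) (p : nat -> X -> X -> R) (A0 : seq X) (B0 : seq (X * R)).
Hypotheses (gphi : goodf phi) (gp : forall m, goodp (p m)) (sN : forall m, (size (e m) + size A0 <= N)%N).

Let gpf m (w : nat -> X) : goodf (fun i => p m (w i)).
exact: (@goodp_f _ _ _ om om1 N (p m) w (gp m)). Qed.

Definition Aof (S : {set I}) m := A0 ++ [seq pos i | i <- e m & i \in S].
Definition Bof (ep : I -> R) (U : {set I}) m := [seq (pos i, ep i) | i <- e m & i \in U] ++ B0.
Definition lvof ep U S ms := [seq (p m, Aof S m, Bof ep U m) | m <- ms].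
(** Points of [S] are prescribed, points of [U] are atoms of mass [ep]. Full [U] with empty [S] is
    the generating function; empty [U] gives its coefficients. *)
Definition Zst ep U S M := nest1 phi (Aof S 0) (Bof ep U 0) (nest (lvof ep U S (iota 1 M))).

Lemma good_lvof ep U S ms : good (nest (lvof ep U S ms)).
elim: ms => [|m ms IH] /=; first exact: good_ptop.
exact: (good_nest mio om1 iom).
Qed.

Lemma Aof_notin S i m : lev i != m -> Aof (i |: S) m = Aof S m.
move=> im; congr (_ ++ map _ _); apply: eq_in_filter => j; rewrite eP !inE => /eqP jm.
by case: eqP => // ji; move: im; rewrite -ji jm eqxx.
Qed.

Lemma Bof_notin ep U i m : lev i != m -> Bof ep (i |: U) m = Bof ep U m.
move=> im; congr (map _ _ ++ _); apply: eq_in_filter => j; rewrite eP !inE => /eqP jm.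
by case: eqP => // ji; move: im; rewrite -ji jm eqxx.
Qed.

Lemma nest1_step (ep : I -> R) (psi : 'I_N -> X -> R) (U S : {set I}) i G : goodf psi -> good G -> i \notin U -> i \notin S ->
 nest1 psi (Aof S (lev i)) (Bof ep (i |: U) (lev i)) G =
 nest1 psi (Aof S (lev i)) (Bof ep U (lev i)) G + ep i * nest1 psi (Aof (i |: S) (lev i)) (Bof ep U (lev i)) G.
move=> gpsi gG iU iS; set m := lev i.
have im : i \in e m by rewrite eP.
have sm := sN m; have um := ue m; rewrite /Aof /Bof.
case/splitPr: im sm um => e1 e2 sm; rewrite cat_uniq /= => /and3P[_ /norP[i1 _] /andP[i2 _]].
have f (V : {set I}) (s : seq I) : i \notin s -> [seq j <- s | j \in i |: V] = [seq j <- s | j \in V].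
 move=> is_; apply: eq_in_filter => j js; rewrite !inE; case: eqP => // ji.
 by move: is_; rewrite -ji js.
rewrite !filter_cat /= !inE eqxx /= !f// (negbTE iU) (negbTE iS) !map_cat /=.
set b1 := map _ _; set b2 := map _ _; set a1 := map _ _; set a2 := map _ _.
have pe : perm_eq ((a1 ++ (pos i, ep i) :: a2) ++ B0) ((pos i, ep i) :: (a1 ++ a2) ++ B0).
 by rewrite -!catA /= perm_sym -cat1s perm_catCA perm_cat2l.
rewrite (@nest1_perm _ _ _ io N psi _ _ _ G pe).
have sz : (size (b1 ++ b2) < size (e1 ++ i :: e2))%N.
 by rewrite !size_cat !size_map /= addnS ltnS leq_add// size_filter count_size.
rewrite (nest1_cons mio om1 iom)//; last first.
 by rewrite size_cat addnC (leq_trans _ sm)// ltn_add2r.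
congr (_ + _ * _); rewrite (catA A0 b1 (pos i :: b2)) (nest1_move iom)// -?catA// size_cat addnC (leq_trans _ sm)// leq_add2r.
by move: sz; rewrite !size_cat /= !addnS.
Qed.

(** The point [i] acts only at its own level; through the levels before it the identity passes by
    linearity of the integral. *)
Lemma nest_step (ep : I -> R) (U S : {set I}) i ms w : uniq ms -> i \notin U -> i \notin S ->
 nest (lvof ep (i |: U) S ms) w = nest (lvof ep U S ms) w +
  (lev i \in ms)%:R * ep i * nest (lvof ep U (i |: S) ms) w.
move=> + iU iS; elim: ms w => [|m ms IH] w /=; first by rewrite !mul0r addr0.
case/andP => nm um; rewrite inE; have [im|im] := eqVneq (lev i) m.
 have e1 : nest (lvof ep (i |: U) S ms) = nest (lvof ep U S ms).
  by apply/funext => z; rewrite IH// im (negbTE nm) !mul0r addr0.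
 have e2 : nest (lvof ep U (i |: S) ms) = nest (lvof ep U S ms).
  congr nest; apply/eq_in_map => m' m'ms; rewrite Aof_notin//.
  by apply: contraNneq nm => em; rewrite -im em.
 by rewrite e1 e2 /= mul1r -im; apply: nest1_step => //; exact: good_lvof.
rewrite /= Bof_notin// (Aof_notin _ im).
rewrite (nest1_eq _ _ _ _ (fun z => IH z um)).
rewrite (nest1D mio om1 iom); [|exact: gpf|exact: good_lvof|]; last first.
 exact: goodZ (good_lvof _ _ _ _).
by rewrite (nest1Z mio om1 iom)//; exact: good_lvof.
Qed.

Lemma Zst_step (ep : I -> R) (U S : {set I}) i M : (lev i <= M)%N -> i \notin U -> i \notin S ->
 Zst ep (i |: U) S M = Zst ep U S M + ep i * Zst ep U (i |: S) M.
move=> iM iU iS; rewrite /Zst; have [i0|i0] := posnP (lev i).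
 have h m V : m \in iota 1 M -> Bof ep (i |: V) m = Bof ep V m.
  by rewrite mem_iota => /andP[m0 _]; apply: Bof_notin; rewrite i0 ltn_eqF.
 have h' m V : m \in iota 1 M -> Aof (i |: V) m = Aof V m.
  by rewrite mem_iota => /andP[m0 _]; apply: Aof_notin; rewrite i0 ltn_eqF.
 have -> : lvof ep (i |: U) S (iota 1 M) = lvof ep U S (iota 1 M).
  by apply/eq_in_map => m mM; rewrite h.
 have -> : lvof ep U (i |: S) (iota 1 M) = lvof ep U S (iota 1 M).
  by apply/eq_in_map => m mM; rewrite h'.
 by rewrite -i0; apply: nest1_step => //; exact: good_lvof.
rewrite Bof_notin ?gtn_eqF// (Aof_notin S) ?gtn_eqF//.
have im : (lev i \in iota 1 M) by rewrite mem_iota i0 add1n ltnS.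
rewrite (nest1_eq _ _ _ _ (fun z => nest_step ep z (iota_uniq _ _) iU iS)).
rewrite (nest1D mio om1 iom)//; [|exact: good_lvof|exact: goodZ (good_lvof _ _ _ _)].
by rewrite (nest1Z mio om1 iom)//; [rewrite im mul1r|exact: good_lvof].
Qed.

Lemma sum_subsetsU1 (V : zmodType) (F : {set I} -> V) (U : {set I}) i : i \notin U ->
 \sum_(T : {set I} | T \subset i |: U) F T =
 \sum_(T : {set I} | T \subset U) F T + \sum_(T : {set I} | T \subset U) F (i |: T).
move=> iU; rewrite (bigID (fun T : {set I} => i \in T)) /= addrC; congr (_ + _).
 apply: eq_bigl => T; apply/andP/idP => [[s iT]|s].
  apply/fsubsetP => j jT; have := fsubsetP s j jT; rewrite !inE => /orP[/eqP ei|//].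
  by move: iT; rewrite -ei jT.
 by split; [exact: fintype.subset_trans s (finset.subsetUr _ _)|apply: contra iU => /(fsubsetP s)].
rewrite (reindex_onto (fun T => i |: T) (fun T => T :\ i)) => [|T /andP[_ iT]]; last by rewrite finset.setD1K.
apply: eq_bigl => T; rewrite finset.setU11 andbT; apply/andP/idP => [[s /eqP eT]|s].
 apply/fsubsetP => j jT; have : j \in i |: T by rewrite !inE jT orbT.
 move=> /(fsubsetP s); rewrite !inE => /orP[/eqP ji|//].
 by move: jT; rewrite ji -eT !inE eqxx.
by split; [exact: finset.setUS|rewrite finset.setU1K//; apply: contra iU => /(fsubsetP s)].
Qed.

(** Points leave [U] one at a time, each being either dropped or prescribed with its mass as a
    factor. *)
Lemma Zst_expand (ep : I -> R) (U S : {set I}) M : (forall i, (lev i <= M)%N) -> (forall i, i \in U -> i \notin S) ->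
 Zst ep U S M = \sum_(T : {set I} | T \subset U) (\prod_(i in T) ep i) * Zst ep fset0 (S :|: T) M.
move=> lM; have [k] := ubnP #|U|; elim: k U S => // k IH U S; rewrite ltnS => cU dUS.
have [->|[i iU]] := finset.set_0Vmem U.
 under eq_bigl do rewrite finset.subset0.
 by rewrite big_pred1_eq big_set0 mul1r finset.setU0.
have e0 : U = i |: (U :\ i) by rewrite finset.setD1K.
have iS : i \notin S by exact: dUS.
have iD : i \notin U :\ i by rewrite !inE eqxx.
have cD : (#|U :\ i| < k)%N by move: cU; rewrite (cardsD1 i) iU.
have dS j : j \in U :\ i -> j \notin S by rewrite !inE => /andP[_ /dUS].
rewrite e0 Zst_step// sum_subsetsU1// -IH//; congr (_ + _).
rewrite IH//; last by move=> j jU; rewrite !inE negb_or dS// andbT; move: jU; rewrite !inE => /andP[].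
rewrite mulr_sumr; apply: eq_bigr => T sT.
have iT : i \notin T by apply: contra iD => /(fsubsetP sT).
rewrite big_setU1//= mulrA; congr (_ * Zst _ _ _ _); apply/fsetP => j.
by rewrite !inE orbA [(j == i) || _]orbC -!orbA.
Qed.

Lemma Zst_ep (ep ep' : I -> R) S M : Zst ep fset0 S M = Zst ep' fset0 S M.
have h m : Bof ep fset0 m = Bof ep' fset0 m.
 by rewrite /Bof (eq_filter (a2 := pred0)) ?filter_pred0// => i; rewrite inE.
rewrite /Zst h; congr (nest1 _ _ _ (nest _)).
by apply: eq_map => m; rewrite h.
Qed.
End Expansion.
End Levels.

(** * Transport of functions and pairings by transition kernels *)

Section Transfer.
Variables (R : realType) (d : measure_display) (X : measurableType d).
Variables (io : R -> X) (om : X -> R).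
Hypotheses (mio : mfunT io) (om1 : forall x, 1 <= om x).
Hypothesis iom : itg (fun u => (om (io u))^-1).
Local Notation wt x := ((om x)^-1).
Local Notation lint := (lint io).
Local Notation Lf := (Lf io).

Let om_gt0 x : 0 < om x. exact: lt_le_trans (om1 x). Qed.
Let om_ge0 x : 0 <= om x. exact/ltW/om_gt0. Qed.
Let wt_ge0 x : 0 <= wt x. by rewrite invr_ge0. Qed.
Local Hint Resolve om_gt0 om_ge0 wt_ge0 : core.

Lemma measurable_Lf d' (A : measurableType d') B (f : A -> X -> R) :
 mfunT (fun x : A * X => f x.1 x.2) -> mfunT (fun a => Lf B (f a)).
move=> mf; apply: (@jm_lint _ _ _ _ mio B 1 _ _ (fun a z => f a (z 0%N))) => d'' A' h z mh mz.
exact: (mcomp2 mf mh (mz 0%N)).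
Qed.

(** Four uses of Fubini, one for each choice of an outer and an inner integral. *)
Lemma Lf_swap4 B1 B2 (F : X -> X -> X -> X -> R) C : 0 <= C ->
 mfunT (fun x : (X * X) * (X * X) => F x.1.1 x.1.2 x.2.1 x.2.2) ->
 (forall x y x' y', `|F x y x' y'| <= C * (wt x * wt y * wt x' * wt y')) ->
 Lf B1 (fun x => Lf B1 (fun y => Lf B2 (fun x' => Lf B2 (fun y' => F x y x' y')))) =
 Lf B2 (fun x' => Lf B2 (fun y' => Lf B1 (fun x => Lf B1 (fun y => F x y x' y')))).
move=> C0 mF bF.
have mc d' (A : measurableType d') (a b a' b' : A -> X) : mfunT a -> mfunT b ->
  mfunT a' -> mfunT b' -> mfunT (fun t => F (a t) (b t) (a' t) (b' t)).
 move=> ma mb ma' mb'.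
 exact: (mcomp mF (measurable_fun_pair (measurable_fun_pair ma mb) (measurable_fun_pair ma' mb'))).
have L0 B : 0 <= Lmass io om B by exact: Lmass_ge0.
transitivity (Lf B1 (fun x => Lf B2 (fun x' => Lf B2 (fun y' => Lf B1 (fun y => F x y x' y'))))).
 apply: Lf_eq => x.
 rewrite (Lf_swap mio om1 iom B1 B2 (f := fun y x' => Lf B2 (fun y' => F x y x' y')) (C := C * wt x * Lmass io om B2)).
 - apply: Lf_eq => x'; rewrite (Lf_swap mio om1 iom B1 B2 (f := fun y y' => F x y x' y') (C := C * wt x * wt x'))//.
  + by rewrite !mulr_ge0.
  + by apply: mc.
  + by move=> y y'; rewrite (le_trans (bF _ _ _ _))// -!mulrA ler_wpM2l// ler_wpM2l// mulrCA.
 - by rewrite !mulr_ge0.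
 - apply: (@measurable_Lf _ (X * X)%type B2 (fun a y' => F x a.1 a.2 y')).
  by apply: mc => //; apply: mcomp.
 - move=> y x'; rewrite mulrAC; apply: (Lf_bound mio om1 iom); first by rewrite !mulr_ge0.
  + by apply: mc.
  + by move=> y'; rewrite (le_trans (bF _ _ _ _))// !mulrA.
rewrite (Lf_swap mio om1 iom B1 B2 (f := fun x x' => Lf B2 (fun y' => Lf B1 (fun y => F x y x' y'))) (C := C * Lmass io om B1 * Lmass io om B2)).
- apply: Lf_eq => x'.
 rewrite (Lf_swap mio om1 iom B1 B2 (f := fun x y' => Lf B1 (fun y => F x y x' y')) (C := C * wt x' * Lmass io om B1))//.
 + by rewrite !mulr_ge0.
 + apply: (@measurable_Lf _ (X * X)%type B1 (fun a y => F a.1 y x' a.2)).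
  by apply: mc => //; apply: mcomp.
 + move=> x y'; rewrite mulrAC; apply: (Lf_bound mio om1 iom); first by rewrite !mulr_ge0.
  * by apply: mc.
  * move=> y; rewrite (le_trans (bF _ _ _ _))//; apply: le_of_eq; ring.
- by rewrite !mulr_ge0.
- apply: (@measurable_Lf _ (X * X)%type B2 (fun a y' => Lf B1 (fun y => F a.1 y a.2 y'))).
 apply: (@measurable_Lf _ (X * X * X)%type B1 (fun a y => F a.1.1 y a.1.2 a.2)).
 by apply: mc => //; do ?apply: mcomp => //.
- move=> x x'; rewrite mulrAC; apply: (Lf_bound mio om1 iom); first by rewrite !mulr_ge0.
 + apply: (@measurable_Lf _ X B1 (fun y' y => F x y x' y')).
  by apply: mc.
 + move=> y'; rewrite [leRHS](_ : _ = C * (wt x * wt x' * wt y') * Lmass io om B1); last by ring.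
  apply: (Lf_bound mio om1 iom); first by rewrite !mulr_ge0.
  * by apply: mc.
  * by move=> y; rewrite (le_trans (bF _ _ _ _))//; apply: le_of_eq; ring.
Qed.

(** Stable under transport by kernels, and sufficient for pairing through any [slow] kernel. *)
Definition fast (f : X -> R) := mfunT f /\
 forall r : nat, exists C, 0 <= C /\ forall x, `|f x| * om x ^+ r <= C.

Definition slow (k : X -> X -> R) := mfunT (fun x : X * X => k x.1 x.2) /\
 exists r C, 0 <= C /\ forall x y, `|k x y| <= C * (om x ^+ r * om y ^+ r).

Lemma fast_le f r : fast f -> exists C, 0 <= C /\ forall x, `|f x| <= C * (om x ^+ r)^-1.
move=> [_ /(_ r)[C [C0 h]]]; exists C; split=> // x.
by rewrite ler_pdivlMr ?exprn_gt0.
Qed.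

Lemma goodp_le (p : X -> X -> R) r : goodp om p ->
 exists C, 0 <= C /\ forall w x, `|p w x| <= C * om w ^+ r * (om x ^+ r)^-1.
move=> [_ /(_ r)[C [C0 h]]]; exists C; split=> // w x.
by rewrite ler_pdivlMr ?exprn_gt0.
Qed.

Lemma fast_push B phi p : fast phi -> goodp om p -> fast (fun y => Lf B (fun x => phi x * p x y)).
move=> fp gp; split.
 apply: (@measurable_Lf _ X B (fun y x => phi x * p x y)).
 apply: mfunM; first by apply: mcomp => //; case: fp.
 by case: gp => mp _; apply: (mcomp2 mp).
move=> r; have [a [a0 ha]] := fast_le r.+1 fp; have [C [C0 h]] := goodp_le r gp.
exists (a * C * Lmass io om B); split; first by rewrite !mulr_ge0// Lmass_ge0.
move=> y; rewrite -ler_pdivlMr ?exprn_gt0// mulrAC; apply: (Lf_bound mio om1 iom).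
- by rewrite !mulr_ge0// invr_ge0 exprn_ge0.
- case: fp => mphi _; case: gp => mp _; apply: mfunM => //.
 exact: (measurable_fun_pair1 y mp).
move=> x; rewrite normrM (le_trans (ler_pM _ _ (ha x) (h x y)))//.
have e z : om z ^+ r * (om z ^+ r.+1)^-1 = wt z.
 by rewrite exprS invfM mulrCA mulfV ?mulr1// expf_neq0// gt_eqF.
by rewrite -(e x); apply: le_of_eq; ring.
Qed.

(** The kernel [k] seen one transition earlier: integrating out a level turns the Pfaffian of [k]
    into that of [kstep]. *)
Definition kstep B (p k : X -> X -> R) x y :=
 Lf B (fun x' => Lf B (fun y' => p x x' * k x' y' * p y y')).

Lemma slow_kstep B p k : goodp om p -> slow k -> slow (kstep B p k).
move=> gp [mk [r [C [C0 h]]]]; have [a [a0 ha]] := goodp_le r.+1 gp.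
case: gp => mp _; split.
 apply: (@measurable_Lf _ (X * X)%type B (fun a x' => Lf B (fun y' => p a.1 x' * k x' y' * p a.2 y'))).
 apply: (@measurable_Lf _ (X * X * X)%type B (fun a y' => p a.1.1 a.2 * k a.2 y' * p a.1.2 y')).
 apply: mfunM; last by apply: (mcomp2 mp) => //; do ?apply: mcomp => //.
 apply: mfunM; first by apply: (mcomp2 mp) => //; do ?apply: mcomp => //.
 by apply: (mcomp2 mk) => //; do ?apply: mcomp => //.
exists r.+1, (C * a * a * Lmass io om B * Lmass io om B); split.
 by rewrite !mulr_ge0// Lmass_ge0.
have e z : om z ^+ r * (om z ^+ r.+1)^-1 = wt z.
 by rewrite exprS invfM mulrCA mulfV ?mulr1// expf_neq0// gt_eqF.
move=> x y; rewrite [leRHS]mulrAC; apply: (Lf_bound mio om1 iom).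
- by rewrite !mulr_ge0 ?Lmass_ge0 ?exprn_ge0.
- apply: (@measurable_Lf _ X B (fun x' y' => p x x' * k x' y' * p y y')).
 apply: mfunM; last by apply: (mcomp2 mp) => //.
 apply: mfunM; last exact: mk.
 by apply: (mcomp2 mp) => //.
move=> x'; rewrite [leRHS](_ : _ = C * a * a * (om x ^+ r.+1 * om y ^+ r.+1) * wt x' * Lmass io om B); last by ring.
apply: (Lf_bound mio om1 iom).
- by rewrite !mulr_ge0 ?exprn_ge0.
- apply: mfunM; last exact: (measurable_fun_pair2 y mp).
 apply: mfunM => //; exact: (measurable_fun_pair2 x' mk).
move=> y'; rewrite !normrM.
apply: (le_trans (ler_pM _ _ (ler_pM _ _ (ha x x') (h x' y')) (ha y y'))) => //.
by rewrite -(e x') -(e y'); apply: le_of_eq; ring.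
Qed.

(** Fubini moves the two transition kernels from the pairing onto the functions that are paired. *)
Lemma pairing_push B B' phi p k psi : fast phi -> goodp om p -> slow k -> fast psi ->
 Lf B (fun x => Lf B (fun y => phi x * kstep B' p k x y * psi y)) =
 Lf B' (fun x' => Lf B' (fun y' =>
  Lf B (fun x => phi x * p x x') * k x' y' * Lf B (fun y => psi y * p y y'))).
move=> fp gp sk fs; have [_ [r [C [C0 h]]]] := sk.
have [a [a0 ha]] := goodp_le r.+1 gp.
have [c [c0 hc]] := fast_le r.+2 fp; have [e [e0 he]] := fast_le r.+2 fs.
have [mphi _] := fp; have [mpsi _] := fs; have [mp _] := gp; have [mk _] := sk.
have tame_pp x y x' : tame om (fun y' => p x x' * k x' y' * p y y').
 split.
  apply: mfunM; last exact: (measurable_fun_pair2 y mp).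
  by apply: mfunM => //; exact: (measurable_fun_pair2 x' mk).
 exists (`|p x x'| * (C * om x' ^+ r) * (a * om y ^+ r.+1)); split.
  by rewrite !mulr_ge0 ?exprn_ge0.
 move=> y'; rewrite !normrM.
 apply: (le_trans (ler_pM _ _ (ler_wpM2l _ (h x' y')) (ha y y'))) => //.
 rewrite (_ : wt y' = om y' ^+ r * (om y' ^+ r.+1)^-1).
  by apply: le_of_eq; ring.
 by rewrite exprS invfM mulrCA mulfV ?mulr1// expf_neq0// gt_eqF.
have [r1 [C1 [C10 h1]]] := (slow_kstep B' gp sk).2.
transitivity (Lf B (fun x => Lf B (fun y => Lf B' (fun x' => Lf B' (fun y' =>
  (phi x * p x x') * k x' y' * (psi y * p y y')))))).
 apply: Lf_eq => x; apply: Lf_eq => y; rewrite mulrAC /kstep -(LfZ mio iom); last first.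
  split.
   apply: (@measurable_Lf _ X B' (fun x' y' => p x x' * k x' y' * p y y')).
   apply: mfunM; last by apply: (mcomp2 mp).
   apply: mfunM; last exact: mk.
   by apply: (mcomp2 mp).
  exists (a * om x ^+ r.+1 * C * (a * om y ^+ r.+1) * Lmass io om B'); split.
   by rewrite !mulr_ge0 ?exprn_ge0 ?Lmass_ge0.
  move=> x'; rewrite mulrAC; apply: (Lf_bound mio om1 iom).
  - by rewrite !mulr_ge0 ?exprn_ge0.
  - by case: (tame_pp x y x').
  have ee z : om z ^+ r * (om z ^+ r.+1)^-1 = wt z.
   by rewrite exprS invfM mulrCA mulfV ?mulr1// expf_neq0// gt_eqF.
  move=> y'; rewrite !normrM.
  apply: (le_trans (ler_pM _ _ (ler_pM _ _ (ha x x') (h x' y')) (ha y y'))) => //.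
  by rewrite -(ee x') -(ee y'); apply: le_of_eq; ring.
 apply: Lf_eq => x'; rewrite -(LfZ mio iom)//; apply: Lf_eq => y'; ring.
have ee z : om z ^+ r.+1 * (om z ^+ r.+2)^-1 = wt z.
 by rewrite [om z ^+ r.+2]exprS invfM mulrCA mulfV ?mulr1// expf_neq0// gt_eqF.
have ee' z : om z ^+ r * (om z ^+ r.+1)^-1 = wt z.
 by rewrite exprS invfM mulrCA mulfV ?mulr1// expf_neq0// gt_eqF.
rewrite (@Lf_swap4 B B' (fun x y x' y' => (phi x * p x x') * k x' y' * (psi y * p y y')) (c * a * C * e * a)).
- have tp f y : fast f -> tame om (fun x => f x * p x y).
  move=> ff; have [b [b0 hb]] := fast_le r.+2 ff; have [mf _] := ff; split.
   by apply: mfunM => //; exact: (measurable_fun_pair1 y mp).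
  exists (b * a); split; first by rewrite mulr_ge0.
  move=> x; rewrite normrM (le_trans (ler_pM _ _ (hb x) (ha x y)))// -(ee x).
  rewrite [leLHS](_ : _ = b * a * (om x ^+ r.+1 / om x ^+ r.+2) * (om y ^+ r.+1)^-1); last by ring.
  rewrite ler_piMr ?mulr_ge0 ?invr_ge0 ?exprn_ge0// invf_le1 ?exprn_gt0//.
  by rewrite exprn_ege1.
 apply: Lf_eq => x'; apply: Lf_eq => y'.
 transitivity (Lf B (fun x => (k x' y' * Lf B (fun y => psi y * p y y')) * (phi x * p x x'))).
  apply: Lf_eq => x; rewrite [RHS](_ : _ = (phi x * p x x') * k x' y' * Lf B (fun y => psi y * p y y')); last by ring.
  by rewrite -(LfZ mio iom)//; exact: tp.
 by rewrite (LfZ mio iom); [ring|exact: tp].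
- by rewrite !mulr_ge0.
- apply: mfunM; last first.
  apply: mfunM; first by do ?apply: mcomp => //.
  by apply: (mcomp2 mp) => //; do ?apply: mcomp => //.
 apply: mfunM; last by apply: (mcomp2 mk) => //; do ?apply: mcomp => //.
 apply: mfunM; first by do ?apply: mcomp => //.
 by apply: (mcomp2 mp) => //; do ?apply: mcomp => //.
- move=> x y x' y'; rewrite !normrM.
 apply: (le_trans (ler_pM _ _ (ler_pM _ _ (ler_pM _ _ (hc x) (ha x x')) (h x' y')) (ler_pM _ _ (he y) (ha y y')))) => //; rewrite ?mulr_ge0//.
 by rewrite -(ee x) -(ee y) -(ee' x') -(ee' y'); apply: le_of_eq; ring.
Qed.
End Transfer.

(** * The multi-level integral as a single Pfaffian at the final time *)

Section TransferNest.
Variables (R : realType) (d : measure_display) (X : measurableType d).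
Variables (io : R -> X) (om : X -> R).
Hypotheses (mio : mfunT io) (mom : mfunT om).
Hypotheses (om1 : forall x, 1 <= om x) (iom : itg (fun u => (om (io u))^-1)).
Variables (n : nat) (ka : X -> X -> R) (Ck : R).
Hypotheses (mka : mfunT (fun x : X * X => ka x.1 x.2)) (bka : forall x y, `|ka x y| <= Ck).
Variables (p : nat -> X -> X -> R) (B : nat -> seq (X * R)).
Hypothesis gp : forall m, goodp om (p m).
Local Notation N := (n.*2).
Local Notation wt x := ((om x)^-1).
Local Notation Lf := (Lf io).
Local Notation goodf := (@goodf _ _ _ om N).

Let omg x : 0 < om x. exact: lt_le_trans (om1 x). Qed.
Let omg0 x : 0 <= om x. exact/ltW/omg. Qed.
Local Hint Resolve omg omg0 : core.

Lemma goodf_fast phi i : goodf phi -> fast om (phi i).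
by move=> [mp bp]; split=> // r; have [C [C0 h]] := bp r; exists C. Qed.

Lemma goodf_pairing phi k : goodf phi -> slow om k ->
 exists C, 0 <= C /\ forall i j x y, `|phi i x * k x y * phi j y| <= C * (wt x * wt y).
move=> [_ gf] [_ [r [C [C0 h]]]]; have [a [a0 ha]] := gf r.+1.
exists (a * C * a); split; first by rewrite !mulr_ge0.
have ha' i x : `|phi i x| <= a * (om x ^+ r.+1)^-1 by rewrite ler_pdivlMr ?exprn_gt0.
move=> i j x y; rewrite !normrM.
apply: (le_trans (ler_pM _ _ (ler_pM _ _ (ha' i x) (h x y)) (ha' j y))) => //.
have e z : om z ^+ r * (om z ^+ r.+1)^-1 = wt z.
 by rewrite [om z ^+ r.+1]exprS invfM mulrCA mulfV ?mulr1// expf_neq0// gt_eqF.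
by rewrite -(e x) -(e y); apply: le_of_eq; ring.
Qed.

Lemma nest1_pf phi k b : goodf phi -> slow om k ->
 nest1 io phi [::] b (fun w => pfs (\matrix_(i < N, j < N) k (w i) (w j))) =
 pfs (\matrix_(i, j) Lf b (fun x => Lf b (fun y => phi i x * k x y * phi j y))).
move=> gphi sk; have [C [C0 h]] := goodf_pairing gphi sk; have [mphi _] := gphi; have [mk _] := sk.
rewrite /nest1 subn0 /= /dphi (@lint_det_pf _ _ _ io om mio om1 iom n phi k C C0 mphi mk h b).
by rewrite mulrA mulVf ?mul1r// pnatr_eq0 -lt0n fact_gt0.
Qed.

Definition kap ms : X -> X -> R := foldr (fun m k => kstep io (B m) (p m) k) ka ms.

Lemma slow_kap ms : slow om (kap ms).
elim: ms => [|m ms IH] /=; last exact: (slow_kstep mio om1 iom).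
split=> //; exists 0%N, `|Ck|; split=> // x y.
by rewrite !expr0 !mulr1 (le_trans (bka _ _))// ler_norm.
Qed.

(** Without prescribed points, de Bruijn's formula integrates out the levels starting from the last
    one, and each leaves a Pfaffian of the same form. *)
Lemma nest_pfs ms w : nest io n ka [seq (p m, [::], B m) | m <- ms] w = pfs (\matrix_(i < N, j < N) kap ms (w i) (w j)).
elim: ms w => [//|m ms IH] w /=.
rewrite (nest1_eq _ _ _ _ IH) (nest1_pf _ _ (slow_kap ms)).
 by congr pfs; apply/matrixP => i j; rewrite !mxE.
exact: (@goodp_f _ _ _ om om1 N (p m) w (gp m)).
Qed.

Fixpoint push m (f : X -> R) : X -> R :=
 if m is m'.+1 then fun y => Lf (B m') (fun x => push m' f x * p m x y) else f.

Lemma fast_pushn m f : fast om f -> fast om (push m f).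
by move=> ff; elim: m => [//|m IH]; exact: (fast_push mio om1 iom). Qed.

Lemma pairing_pushn a k f g : fast om f -> fast om g ->
 Lf (B a) (fun x => Lf (B a) (fun y => push a f x * kap (iota a.+1 k) x y * push a g y)) =
 Lf (B (a + k)) (fun x => Lf (B (a + k)) (fun y => push (a + k) f x * ka x y * push (a + k) g y)).
move=> ff fg; elim: k a => [|k IH] a; first by rewrite addn0.
rewrite addnS -addSn -IH /= (pairing_push mio om1 iom (B a) (B a.+1) (fast_pushn a ff) (gp a.+1) (slow_kap _) (fast_pushn a fg)).
by [].
Qed.

(** Carrying the kernel back over M levels is exchanged for carrying the functions forward. *)
Lemma nest_pf_push phi M : goodf phi ->
 nest1 io phi [::] (B 0%N) (nest io n ka [seq (p m, [::], B m) | m <- iota 1 M]) =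
 pfs (\matrix_(i, j) Lf (B M) (fun x => Lf (B M) (fun y => push M (phi i) x * ka x y * push M (phi j) y))).
move=> gphi; rewrite (nest1_eq _ _ _ _ (nest_pfs _)) (nest1_pf _ gphi (slow_kap _)).
congr pfs; apply/matrixP => i j; rewrite !mxE.
exact: (@pairing_pushn 0 M (phi i) (phi j) (goodf_fast i gphi) (goodf_fast j gphi)).
Qed.
End TransferNest.

(** * Sums over permutations with a weight per orbit *)

Section OrbitSums.
Variables (R : realType) (I : finType) (q : I -> I -> 'M[R]_2).
Implicit Types (p : {perm I}) (A B S O : {set I}).

Definition stable p A := [forall x, (p x \in A) == (x \in A)].
Lemma stableP p A : reflect (forall x, (p x \in A) = (x \in A)) (stable p A).
by apply: (iffP forallP) => h x; [apply/eqP|rewrite h]. Qed.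

Lemma agree_exp p p1 A x k : stable p A -> {in A, p1 =1 p} -> x \in A ->
 (p1 ^+ k)%g x = (p ^+ k)%g x /\ (p ^+ k)%g x \in A.
move=> /stableP sA e xA; elim: k => [|k [IH1 IH2]]; first by rewrite !expg0 perm1.
by rewrite !expgSr !permM IH1 e// sA.
Qed.

Lemma porbit_agree p p1 A x : stable p A -> {in A, p1 =1 p} -> x \in A -> porbit p1 x = porbit p x.
move=> sA e xA; apply/porbit_setP => y.
by apply/porbitP/porbitP => -[k ->]; exists k; have [] := agree_exp k sA e xA.
Qed.

Lemma porbit_sub p A x : stable p A -> x \in A -> porbit p x \subset A.
move=> sA xA; apply/fsubsetP => y /porbitP[k ->].
by have [] := @agree_exp p p A x k sA (fun _ _ => erefl) xA.
Qed.

Definition orbs p S := [set O in porbits p | O \subset S].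

Lemma orbsP p S O : stable p S -> reflect (exists2 x, x \in S & O = porbit p x) (O \in orbs p S).
move=> sS; rewrite inE; apply: (iffP andP) => [[/imsetP[x _ ->] s]|[x xS ->]].
 by exists x => //; exact: (fsubsetP s _ (porbit_id p x)).
by split; [apply: imset_f|exact: porbit_sub].
Qed.

Lemma orbs_agree p p1 A : stable p A -> stable p1 A -> {in A, p1 =1 p} -> orbs p1 A = orbs p A.
move=> sA s1A e; apply/fsetP => O; apply/orbsP/orbsP => // -[x xA ->]; exists x => //.
 exact: (porbit_agree sA e xA).
by apply/esym; exact: (porbit_agree sA e xA).
Qed.

Lemma cycprod_agree p p1 A O : stable p A -> {in A, p1 =1 p} -> O \subset A -> cycprod q p1 O = cycprod q p O.
move=> sA e OA; rewrite /cycprod; case: pickP => [a aO|//].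
have aA := fsubsetP OA _ aO.
by apply: eq_bigr => k _; rewrite !(agree_exp _ sA e aA).1.
Qed.

Definition oweight c S p : R := (-1) ^+ p * \prod_(O in orbs p S) (c * \tr (cycprod q p O)).
(** The weight [c] per cycle stays free: 1/2 gives the quaternion determinant, half the trace being
    the scalar part, and 1 is what squaring produces. *)
Definition osum c S : R := \sum_(p | perm_on S p) oweight c S p.
Lemma perm_on_stable p A : perm_on A p -> stable p A.
by move=> pA; apply/stableP => x; exact: perm_closed. Qed.

Lemma pairD A B p1 p2 : (A :&: B)%SET = fset0 -> perm_on A p1 -> perm_on B p2 ->
 [/\ {in A, (p1 * p2)%g =1 p1}, {in B, (p1 * p2)%g =1 p2}, stable (p1 * p2)%g A, stable (p1 * p2)%g B
  & perm_on (A :|: B)%SET (p1 * p2)%g].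
move=> dAB pA pB.
have AB x : x \in A -> x \notin B.
 by move=> xA; apply/negP => xB; have := finset.in_set0 x; rewrite -dAB inE xA xB.
have eA : {in A, (p1 * p2)%g =1 p1}.
 by move=> x xA; rewrite permM (out_perm pB)// AB// perm_closed.
have eB : {in B, (p1 * p2)%g =1 p2}.
 move=> x xB; rewrite permM (out_perm pA)//; by apply/negP => /AB; rewrite xB.
have eO x : x \notin A -> x \notin B -> (p1 * p2)%g x = x.
 by move=> xA xB; rewrite permM (out_perm pA xA) (out_perm pB).
split=> //.
- apply/stableP => x; have [xA|xA] := boolP (x \in A); first by rewrite eA// perm_closed// xA.
 have [xB|xB] := boolP (x \in B); last by rewrite eO// (negbTE xA).
 rewrite eB//; apply/negP => /AB; by rewrite perm_closed// xB.
- apply/stableP => x; have [xB|xB] := boolP (x \in B); first by rewrite eB// perm_closed// xB.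
 have [xA|xA] := boolP (x \in A); last by rewrite eO// (negbTE xB).
 by rewrite eA//; apply/negbTE/AB; rewrite perm_closed.
- apply/fsubsetP => x; rewrite !inE; apply: contraR.
 by rewrite negb_or => /andP[xA xB]; rewrite eO.
Qed.

Lemma orbsU p A B : (A :&: B)%SET = fset0 -> stable p A -> stable p B ->
 orbs p (A :|: B)%SET = (orbs p A :|: orbs p B)%SET /\ (orbs p A :&: orbs p B)%SET = fset0.
move=> dAB sA sB.
have sU : stable p (A :|: B)%SET.
 by apply/stableP => x; rewrite !inE (stableP _ _ sA) (stableP _ _ sB).
split; apply/fsetP => O.
 rewrite finset.in_setU; apply/orbsP/orP => // [[x]|[/orbsP-/(_ sA)[x xA ->]|/orbsP-/(_ sB)[x xB ->]]].
 - by rewrite inE => /orP[xA ->|xB ->]; [left|right]; apply/orbsP => //; exists x.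
 - by exists x => //; rewrite inE xA.
 - by exists x => //; rewrite inE xB orbT.
rewrite finset.in_setI finset.in_set0; apply/negP => /andP[/orbsP-/(_ sA)[x xA ->] ].
rewrite inE => /andP[_ /fsubsetP/(_ _ (porbit_id p x)) xB].
by have := finset.in_set0 x; rewrite -dAB inE xA xB.
Qed.

Lemma prod_orbs_agree c p p1 A : stable p A -> stable p1 A -> {in A, p1 =1 p} ->
 \prod_(O in orbs p1 A) (c * \tr (cycprod q p1 O)) = \prod_(O in orbs p A) (c * \tr (cycprod q p O)).
move=> sA s1 e; rewrite (orbs_agree sA s1 e); apply: eq_bigr => O.
by rewrite inE => /andP[_ OA]; rewrite (cycprod_agree sA e OA).
Qed.

Lemma oweightM c A B p1 p2 : (A :&: B)%SET = fset0 -> perm_on A p1 -> perm_on B p2 ->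
 oweight c A p1 * oweight c B p2 = oweight c (A :|: B)%SET (p1 * p2)%g.
move=> dAB pA pB; have [eA eB sA sB _] := pairD dAB pA pB.
have [oU oI] := orbsU dAB sA sB.
rewrite /oweight oU [in RHS](@finset.big_setID _ _ _ _ _ (orbs (p1 * p2)%g A)) /=.
rewrite finset.setIUl finset.setIid [(orbs _ B :&: _)%SET]finset.setIC oI finset.setU0.
rewrite finset.setDUl finset.setDv finset.set0U.
rewrite (_ : (orbs _ B :\: orbs _ A)%SET = orbs (p1 * p2)%g B); last first.
 by apply/finset.setDidPl; rewrite -finset.setI_eq0 finset.setIC oI.
rewrite -(prod_orbs_agree c (perm_on_stable pA) sA eA).
rewrite -(prod_orbs_agree c (perm_on_stable pB) sB eB).
by rewrite odd_permM signr_addb mulrACA.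
Qed.

Lemma restr_stable p A x : stable p A -> x \in A -> restr_perm A p x = p x.
by move=> /stableP sA xA; apply: restr_permE => //; apply/astabsP => y; exact: sA. Qed.
Lemma stableD p S A : stable p S -> stable p A -> stable p (S :\: A).
by move=> /stableP sS /stableP sA; apply/stableP => x; rewrite !inE sS sA. Qed.

(** Pairs of permutations, one of [A] and one of its complement, are the permutations of [S] that
    keep [A] stable; signs multiply and orbits are put together. *)
Lemma osum_split c S A : A \subset S ->
 osum c A * osum c (S :\: A) = \sum_(p | perm_on S p && stable p A) oweight c S p.
move=> AS; have dA : (A :&: (S :\: A))%SET = fset0.
 by apply/fsetP => x; rewrite !inE; case: (x \in A).
have UA : (A :|: (S :\: A))%SET = S.
 apply/fsetP => x; rewrite !inE; have [xA|//] := boolP (x \in A).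
 by rewrite (fsubsetP AS).
rewrite /osum big_distrlr pair_big /=.
rewrite [RHS](reindex_onto (fun pq : {perm I} * {perm I} => (pq.1 * pq.2)%g)
 (fun p => (restr_perm A p, restr_perm (S :\: A) p))) /=; last first.
 move=> p /andP[pS sA]; apply/permP => x.
 have [e1 e2 _ _ pU] := pairD dA (restr_perm_on A p) (restr_perm_on (S :\: A) p).
 have [xA|xA] := boolP (x \in A); first by rewrite e1// restr_stable.
 have [xS|xS] := boolP (x \in S).
  by rewrite e2 ?inE ?xA// restr_stable ?inE ?xA//; apply: stableD => //; exact: perm_on_stable.
 by rewrite (out_perm pU) ?UA// (out_perm pS).
apply: eq_big => [[p1 p2]|[p1 p2] /andP[/= h1 h2]]; last by rewrite oweightM// UA.
apply/andP/andP => /= [[h1 h2]|[_ /eqP [<- <-]]]; last by split; exact: restr_perm_on.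
have [e1 e2 s1 s2 pU] := pairD dA h1 h2; rewrite UA in pU.
split; first by apply/andP.
apply/eqP; congr (_, _); apply/permP => x.
 have [xA|xA] := boolP (x \in A); first by rewrite restr_stable// e1.
 by rewrite (out_perm (restr_perm_on _ _))// (out_perm h1).
have [xA|xA] := boolP (x \in (S :\: A)); first by rewrite restr_stable// e2.
by rewrite (out_perm (restr_perm_on _ _))// (out_perm h2).
Qed.

(** A stable subset is a union of orbits, and the set of those orbits is recovered from it. *)
Lemma card_stable p S : perm_on S p -> #|[set A : {set I} | (A \subset S) && stable p A]%SET| = (2 ^ #|orbs p S|)%N.
move=> pS; have sS := perm_on_stable pS; rewrite -card_powerset.
have tI : finset.trivIset (orbs p S).
 apply/finset.trivIsetP => O O' /orbsP-/(_ sS)[x xS ->] /orbsP-/(_ sS)[y yS ->] ne.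
 rewrite -finset.setI_eq0; apply/eqP/fsetP => z; rewrite !inE; apply/negP => /andP[].
 by rewrite -!eq_porbit_mem => /eqP -> /eqP e; rewrite e eqxx in ne.
rewrite -(@card_in_imset _ _ (@finset.cover I) (powerset (orbs p S))); last first.
 have sub Q Q' : Q \in powerset (orbs p S) -> Q' \in powerset (orbs p S) ->
   finset.cover Q = finset.cover Q' -> Q \subset Q'.
  rewrite !inE => sQ sQ' e; apply/fsubsetP => O OQ.
  have Oo := fsubsetP sQ _ OQ.
  have [x xS Ox] := orbsP O sS Oo.
  have : x \in finset.cover Q' by rewrite -e; apply/finset.bigcupP; exists O; rewrite // Ox porbit_id.
  case/finset.bigcupP => O' O'Q' xO'.
  have [y yS Oy] := orbsP O' sS (fsubsetP sQ' _ O'Q').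
  by rewrite Ox (_ : porbit p x = O')// Oy; apply/eqP; rewrite eq_porbit_mem -Oy.
 by move=> Q Q' h h' e; apply/eqP; rewrite finset.eqEsubset !sub.
congr #|pred_of_set _|; apply/fsetP => A; rewrite inE; apply/andP/imsetP => [[AS sA]|[Q]].
 exists (orbs p A).
  rewrite inE; apply/fsubsetP => O; rewrite !inE => /andP[-> OA] /=.
  exact: fintype.subset_trans OA AS.
 apply/fsetP => x; apply/idP/finset.bigcupP => [xA|[V]].
  by exists (porbit p x); rewrite ?porbit_id//; apply/orbsP => //; exists x.
 by rewrite inE => /andP[_ /fsubsetP h /h].
rewrite inE => /fsubsetP sQ ->; split.
 by apply/finset.bigcupsP => O /sQ; rewrite inE => /andP[].
apply/stableP => x; apply/finset.bigcupP/finset.bigcupP => -[V VQ xV]; exists V => //.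
 have [y _ Oy] := orbsP V sS (sQ _ VQ); move: xV; rewrite Oy -!eq_porbit_mem => /eqP <-.
 by rewrite -(porbit_perm p 1 x) expg1.
have [y _ Oy] := orbsP V sS (sQ _ VQ); move: xV; rewrite Oy -!eq_porbit_mem => /eqP <-.
by rewrite -(porbit_perm p 1 x) expg1.
Qed.

(** Each permutation is counted once per stable subset, that is 2^orbits times, which doubles the
    weight of every orbit. *)
Lemma osum_conv c S : \sum_(A : {set I} | A \subset S) osum c A * osum c (S :\: A) = osum (2 * c) S.
rewrite (eq_bigr _ (@osum_split c S)) (exchange_big_dep (fun p => perm_on S p)) /=; last by move=> A p _ /andP[].
apply: eq_bigr => p pS.
rewrite (eq_bigl (fun A => A \in [set A : {set I} | (A \subset S) && stable p A]%SET)); last first.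
 by move=> A; rewrite inE pS.
rewrite sumr_const card_stable// /oweight -[LHS]mulr_natl natrX mulrCA; congr (_ * _).
by rewrite -prodr_const -big_split /=; apply: eq_bigr => O _; rewrite mulrA.
Qed.

Lemma Tdet_osum : Tdet q = osum 2^-1 fsetT.
rewrite /Tdet /osum; apply: eq_big => [p|p _].
 by apply/esym/fsubsetP => x _; rewrite inE.
rewrite /oweight; congr (_ * _); last first.
 by apply: eq_bigl => O; rewrite inE finset.subsetT andbT.
rewrite -signr_odd oddB; last exact: leq_imset_card.
by rewrite /odd_perm.
Qed.

(** The convolution square determines [c]: in the equation for a nonempty [S] the value [c S] occurs
    only in the terms for the empty set and for [S] itself, and the others are known by
    induction. *)
Lemma osum_unique (c : {set I} -> R) : c fset0 = 1 ->
 (forall S, \sum_(A : {set I} | A \subset S) c A * c (S :\: A) = osum 1 S) ->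
 c fsetT = Tdet q.
move=> c0 cS; rewrite Tdet_osum.
have o0 : osum 2^-1 fset0 = 1.
 rewrite /osum (big_pred1 1%g) /=; last first.
  move=> p; apply/idP/eqP => [/perm_on_id->//|->]; rewrite ?finset.cards0//; exact: perm_on1.
 rewrite /oweight odd_perm1 mul1r big_pred0// => O.
 apply/negP => /orbsP [|x]; last by rewrite inE.
 by apply/stableP => x; rewrite perm1.
suff h k S : (#|S| < k)%N -> c S = osum 2^-1 S by exact: (h _ _ (ltnSn _)).
elim: k S => // k IH S; rewrite ltnS => cSk.
have := cS S; rewrite -[1 in RHS](@mulfV _ 2%:R) ?pnatr_eq0// -osum_conv.
have [->|S0] := eqVneq S fset0; first by rewrite c0 o0.
have s0 : fset0 \subset S by exact: finset.sub0set.
rewrite (bigD1 fset0)//= [in RHS](bigD1 fset0)//= c0 o0 !mul1r !finset.setD0.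
rewrite (bigD1 S)/=; last by rewrite S0 andbT.
rewrite [in RHS](bigD1 S)/=; last by rewrite S0 andbT.
rewrite finset.setDv c0 o0 !mulr1 !addrA => e.
have {e} : c S + c S = osum 2^-1 S + osum 2^-1 S.
 apply: (addIr (\sum_(i : {set I} | (i \subset S) && (i != fset0) && (i != S)) c i * c (S :\: i)%SET)).
 rewrite e; congr (_ + _); apply/esym.
 apply: eq_bigr => A /andP[/andP[AS A0] AnS].
 have cA : (#|A| < #|S|)%N.
  by apply: proper_card; rewrite finset.properEneq AnS.
 rewrite !IH ?(leq_trans cA)//.
 rewrite cardsD (finset.setIidPr AS).
 have : (0 < #|A|)%N by rewrite card_gt0.
 by have := subset_leq_card AS; lia.
by move=> e; lra.
Qed.
End OrbitSums.

Lemma sum_subsetU (T : finType) (V : zmodType) (F : {set T} -> V) (A B : {set T}) : (A :&: B)%SET = fset0 ->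
 \sum_(C : {set T} | C \subset (A :|: B)%SET) F C =
 \sum_(C : {set T} | C \subset A) \sum_(D : {set T} | D \subset B) F (C :|: D)%SET.
move=> dAB; have nAB x : x \in A -> x \in B -> False.
 by move=> xA xB; have := finset.in_set0 x; rewrite -dAB inE xA xB.
rewrite pair_big /= (reindex_onto (fun cd : {set T} * {set T} => (cd.1 :|: cd.2)%SET)
 (fun C => ((C :&: A)%SET, (C :&: B)%SET))) /=; last first.
 move=> C sC; apply/fsetP => x; rewrite !inE -andb_orr.
 by case xC: (x \in C) => //=; have := fsubsetP sC x xC; rewrite !inE.
apply: eq_bigl => -[C D] /=; apply/andP/andP => [[_ /eqP[<- <-]]|[CA DB]].
 by split; exact: finset.subsetIr.
split; first exact: finset.setUSS.
apply/eqP; congr (_, _); apply/fsetP => x; rewrite !inE.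
 have [xC|xC] /= := boolP (x \in C); first by rewrite (fsubsetP CA).
 by apply/negbTE/negP => /andP[xD xA]; exact: (nAB x xA (fsubsetP DB _ xD)).
have [xD|xD] /= := boolP (x \in D); first by rewrite orbT (fsubsetP DB).
by rewrite orbF; apply/negbTE/negP => /andP[xC xB]; exact: (nAB x (fsubsetP CA _ xC) xB).
Qed.

(** * Traces of cyclic products as sums over index choices *)

Section TraceOrbits.
Variables (R : realType) (I : finType) (q : I -> I -> 'M[R]_2).

Definition b2o (b : bool) : 'I_2 := if b then ord_max else ord0.
Lemma sum_b2o (V : zmodType) (F : 'I_2 -> V) : \sum_i F i = F (b2o false) + F (b2o true).
by rewrite big_ord_recr big_ord1 /=; congr (F _ + F _); apply: val_inj. Qed.

Section Path.
Variables (a : nat -> I) (n : nat).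
Hypothesis ia : forall k l, (k < n)%N -> (l < n)%N -> a k = a l -> k = l.
Local Notation Aset m := [set a (val k) | k in 'I_m]%SET.

(** A path of two-valued matrix indices is encoded by the set [al] of vertices where the second
    value is taken; the last column index [j] stays free for the induction. *)
Definition pathw m (al : {set I}) (j : 'I_2) : R :=
 (\prod_(k < m) q (a k) (a k.+1) (b2o (a k \in al)) (b2o (a k.+1 \in al))) * q (a m) (a m.+1) (b2o (a m \in al)) j.

Lemma AsetS m : (Aset m.+1 = a m |: Aset m)%SET.
apply/fsetP => x; rewrite !inE; apply/imsetP/orP => [[k _ ->]|[/eqP ->|/imsetP[k _ ->]]].
- have [km|km] := ltnP k m; first by right; apply/imsetP; exists (Ordinal km).
 by left; apply/eqP; congr a; apply/eqP; rewrite eqn_leq km -ltnS ltn_ord.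
- by exists ord_max.
- by exists (widen_ord (leqnSn m) k).
Qed.

Lemma Aset_notin m : (m < n)%N -> a m \notin Aset m.
move=> mn; apply/imsetP => -[k _ /(ia mn)]; rewrite (ltn_trans (ltn_ord k) mn) => /(_ isT) e.
by have := ltn_ord k; rewrite -e ltnn.
Qed.

Lemma prod_path m i j : (m < n)%N ->
 (\prod_(k < m.+1) q (a k) (a k.+1)) i j =
 \sum_(al : {set I} | al \subset Aset m.+1) (b2o (a 0%N \in al) == i)%:R * pathw m al j.
elim: m j => [|m IH] j mn.
 rewrite big_ord1 AsetS sum_subsetsU1; last exact: Aset_notin.
 have -> : (Aset 0 = fset0)%SET.
  by apply/fsetP => x; rewrite !inE; apply/imsetP => -[[]].
 under eq_bigl do rewrite finset.subset0.
 under [X in _ = _ + X]eq_bigl do rewrite finset.subset0.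
 rewrite !big_pred1_eq /pathw !big_ord0 !mul1r !inE eqxx /=.
 case: i => -[|[|//]] hi /=; rewrite -?val_eqE /= ?mul1r ?mul0r ?add0r ?addr0; congr (q _ _ _ _); exact: val_inj.
rewrite big_ord_recr /= mxE sum_b2o !IH ?(ltnW mn)// (AsetS m.+1) sum_subsetsU1; last exact: Aset_notin.
rewrite !mulr_suml; congr (_ + _); apply: eq_bigr => C sC.
 have -> : pathw m.+1 C j = pathw m C (b2o false) * q (a m.+1) (a m.+2) (b2o false) j.
  rewrite /pathw big_ord_recr /=; have -> // : (a m.+1 \in C) = false.
  by apply/negbTE; apply: contra (Aset_notin mn) => /(fsubsetP sC).
 by rewrite mulrA.
have eC k : (k <= m)%N -> (a k \in a m.+1 |: C)%SET = (a k \in C).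
 move=> km; rewrite !inE; have [/ia e|//] := eqVneq (a k) (a m.+1).
 by have h := e (leq_ltn_trans km (ltnW mn)) mn; move: km; rewrite h ltnn.
have -> : pathw m.+1 (a m.+1 |: C)%SET j = pathw m C (b2o true) * q (a m.+1) (a m.+2) (b2o true) j.
 rewrite /pathw big_ord_recr /= finset.setU11 eC//; congr (_ * _ * _).
 by apply: eq_bigr => k _; rewrite !eC// ltnW.
by rewrite mulrA eC.
Qed.

Lemma tr_path : (0 < n)%N -> a n = a 0%N ->
 \tr (\prod_(k < n) q (a k) (a k.+1)) =
 \sum_(al : {set I} | al \subset Aset n) \prod_(k < n) q (a k) (a k.+1) (b2o (a k \in al)) (b2o (a k.+1 \in al)).
move=> n0; rewrite -(prednK n0) /mxtrace => an.
under eq_bigr => i _ do rewrite prod_path ?ltn_predL//.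
rewrite exchange_big /=; apply: eq_bigr => al _.
rewrite (bigD1 (b2o (a 0%N \in al)))//= eqxx mul1r big1 ?addr0; last first.
 by move=> i; rewrite eq_sym => /negbTE ->; rewrite mul0r.
by rewrite /pathw big_ord_recr /= an.
Qed.
End Path.

(** Expanding the trace means choosing one of two indices at each point of the orbit, hence a subset
    of it. The starting point picked in [cycprod] disappears. *)
Lemma tr_porbit (p : {perm I}) x :
 \tr (cycprod q p (porbit p x)) =
 \sum_(al : {set I} | al \subset porbit p x) \prod_(i in porbit p x) q i (p i) (b2o (i \in al)) (b2o (p i \in al)).
rewrite /cycprod; case: pickP => [y|/(_ x)]; last by rewrite porbit_id.
rewrite -eq_porbit_mem => /eqP <-.
pose a k := (p ^+ k)%g y.
have n0 : (0 < #|porbit p y|)%N by rewrite lt0n card_porbit_neq0.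
have ta k : (k < #|porbit p y|)%N -> nth y (traject p y #|porbit p y|) k = a k.
 by move=> kn; rewrite nth_traject// /a permX.
have ia k l : (k < #|porbit p y|)%N -> (l < #|porbit p y|)%N -> a k = a l -> k = l.
 move=> kn ln; rewrite -!ta// => /eqP; rewrite nth_uniq ?size_traject ?uniq_traject_porbit//.
 by move/eqP.
have an : a #|porbit p y| = a 0%N by rewrite /a permX iter_porbit expg0 perm1.
rewrite -[X in \tr X]/(\prod_(k < #|porbit p y|) q (a k) (a k.+1)) (tr_path ia)//.
have hset : [set a (val k) | k in 'I_#|porbit p y|]%SET = porbit p y.
 apply/fsetP => z; apply/imsetP/idP => [[k _ ->]|]; first exact: mem_porbit.
 by rewrite porbit_traject => /trajectP[k kn ->]; exists (Ordinal kn); rewrite // /a permX.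
rewrite hset; apply: eq_bigr => al _; rewrite -[in RHS]hset.
rewrite big_imset /=; last by move=> k l _ _ /ia e; apply: val_inj; apply: e.
by apply: eq_big => // k _; rewrite /a expgSr permM.
Qed.

Lemma prod_tr_orbs (p : {perm I}) (S : {set I}) : stable p S ->
 \prod_(V in orbs p S) \tr (cycprod q p V) =
 \sum_(al : {set I} | al \subset S) \prod_(i in S) q i (p i) (b2o (i \in al)) (b2o (p i \in al)).
have [k] := ubnP #|S|; elim: k S => // k IH S; rewrite ltnS => cS sS.
have [->|[x xS]] := finset.set_0Vmem S.
 rewrite big_pred0; last by move=> V; apply/negP => /orbsP[|y]; [apply/stableP => y; rewrite !inE|rewrite inE].
 by under eq_bigl do rewrite finset.subset0; rewrite big_pred1_eq big_set0.
pose A := porbit p x; pose B := (S :\: A)%SET.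
have AS : A \subset S by exact: porbit_sub.
have sA : stable p A.
 by apply/stableP => y; rewrite /A -!eq_porbit_mem -(porbit_perm p 1 y) expg1.
have sB : stable p B by exact: stableD.
have dAB : (A :&: B)%SET = fset0.
 by apply/fsetP => y; rewrite !inE; case: (y \in A).
have UAB : S = (A :|: B)%SET.
 apply/fsetP => y; rewrite !inE; have [yA|//] := boolP (y \in A).
 by rewrite (fsubsetP AS).
have cB : (#|B| < k)%N.
 apply: leq_trans cS; apply: proper_card; apply/properP; split; first exact: finset.subsetDl.
 by exists x; rewrite // !inE negb_and negbK porbit_id.
have oA : orbs p A = [set A]%SET.
 apply/fsetP => V; rewrite inE; apply/orbsP/eqP => // [[y yA ->]|->].
  by apply/eqP; rewrite eq_porbit_mem.
 by exists x; rewrite // porbit_id.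
have [oU oI] := orbsU dAB sA sB; rewrite -UAB in oU.
rewrite oU oA big_setU1/=; last first.
 by apply/negP => h; have := finset.in_set0 A; rewrite -oI inE oA h finset.set11.
rewrite IH// [X in X * _]tr_porbit -/A [in RHS]UAB sum_subsetU// big_distrl /=; apply: eq_bigr => C CA.
rewrite big_distrr /=; apply: eq_bigr => D DB.
have nB y : y \in A -> y \notin D.
 move=> yA; apply/negP => /(fsubsetP DB) yB.
 by have := finset.in_set0 y; rewrite -dAB inE yA yB.
have nA y : y \in B -> y \notin C.
 move=> yB; apply/negP => /(fsubsetP CA) yA.
 by have := finset.in_set0 y; rewrite -dAB inE yA yB.
rewrite [in RHS](@finset.big_setID _ _ _ _ _ A) /= finset.setUK.
have -> : ((A :|: B) :\: A)%SET = B.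
 by rewrite finset.setDUl finset.setDv finset.set0U; apply/finset.setDidPl; rewrite -finset.setI_eq0 finset.setIC dAB.
congr (_ * _); apply: eq_bigr => i iX; rewrite !inE.
 by rewrite (negbTE (nB _ iX)) (negbTE (nB _ _)) ?(stableP _ _ sA)// !orbF.
by rewrite (negbTE (nA _ iX)) (negbTE (nA _ _)) ?(stableP _ _ sB).
Qed.

(** For fixed [al] the inner sum is a principal minor with scalar entries, one row being selected
    over each point. *)
Lemma osum1E (S : {set I}) : osum q 1 S =
 \sum_(al : {set I} | al \subset S) \sum_(p | perm_on S p)
  (-1) ^+ p * \prod_(i in S) q i (p i) (b2o (i \in al)) (b2o (p i \in al)).
rewrite exchange_big /=; apply: eq_bigr => p pS; rewrite /oweight -mulr_sumr; congr (_ * _).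
by rewrite -(prod_tr_orbs (perm_on_stable pS)); apply: eq_bigr => V _; rewrite mul1r.
Qed.
End TraceOrbits.

(** * Extension of permutations along an injection *)

Section LiftPerm.
Variables (I J : finType) (h : I -> J).
Hypothesis hi : injective h.

Definition plift_fun (p : {perm I}) (j : J) : J := if [pick i | h i == j] is Some i then h (p i) else j.
Lemma plift_funE p i : plift_fun p (h i) = h (p i).
by rewrite /plift_fun; case: pickP => [k /eqP/hi ->//|/(_ i)]; rewrite eqxx. Qed.
Lemma plift_fun_out p j : (forall i, h i != j) -> plift_fun p j = j.
by move=> n; rewrite /plift_fun; case: pickP => [k|//]; rewrite (negbTE (n k)). Qed.

Lemma plift_inj p : injective (plift_fun p).
have c j : {i | j = h i} + {forall i, h i != j}.
 case: (pickP (fun i => h i == j)) => [i /eqP <-|n]; first by left; exists i.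
 by right => i; rewrite n.
move=> j j'; case: (c j) => [[i ->]|nj]; case: (c j') => [[i' ->]|nj'].
- by rewrite !plift_funE => /hi /perm_inj ->.
- by rewrite plift_funE (plift_fun_out _ nj') => e; have := nj' (p i); rewrite e eqxx.
- by rewrite plift_funE (plift_fun_out _ nj) => e; have := nj (p i'); rewrite e eqxx.
- by rewrite !plift_fun_out.
Qed.

Definition plift p : {perm J} := perm (@plift_inj p).
Lemma pliftE p i : plift p (h i) = h (p i). by rewrite permE plift_funE. Qed.
Lemma plift_out p j : (forall i, h i != j) -> plift p j = j. by move=> n; rewrite permE plift_fun_out. Qed.

Lemma plift_perm (p : {perm I}) (P : {perm J}) : (forall i, P (h i) = h (p i)) -> (forall j, (forall i, h i != j) -> P j = j) ->
 P = plift p.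
move=> h1 h2; apply/permP => j; case: (pickP (fun i => h i == j)) => [i /eqP <-|n]; first by rewrite pliftE.
by rewrite plift_out ?h2// => i; rewrite n.
Qed.

Lemma pliftM p p' : plift (p * p')%g = (plift p * plift p')%g.
apply/esym/plift_perm => [i|j n]; first by rewrite !permM !pliftE.
by rewrite permM !plift_out.
Qed.

Lemma odd_plift p : odd_perm (plift p) = odd_perm p.
have [ts -> _] := prod_tpermP p; elim: ts => [|[x y] ts IH].
 rewrite big_nil (_ : plift 1%g = 1%g) ?odd_perm1//.
 by apply/esym/plift_perm => [i|j _]; rewrite !perm1.
rewrite big_cons pliftM !odd_permM IH; congr (_ (+) _).
have -> : plift (tperm x y) = tperm (h x) (h y).
 apply/esym/plift_perm => [i|j n]; last by rewrite tpermD.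
 by rewrite (inj_tperm _ _ _ hi).
by rewrite !odd_tperm (inj_eq hi).
Qed.

Lemma plift_injective : injective plift.
by move=> p p' e; apply/permP => i; apply: hi; rewrite -!pliftE e. Qed.

Lemma perm_on_plift (S : {set I}) p : perm_on S p -> perm_on (h @: S) (plift p).
move=> pS; apply/fsubsetP => j; rewrite inE; case: (pickP (fun i => h i == j)) => [i /eqP <-|n].
 rewrite pliftE (inj_eq hi) => n; apply: imset_f.
 by apply: contraR n => iS; rewrite (out_perm pS).
by rewrite plift_out ?eqxx// => i; rewrite n.
Qed.

Lemma sum_plift (V : zmodType) (F : {perm J} -> V) (S : {set I}) :
 \sum_(P | perm_on (h @: S) P) F P = \sum_(p | perm_on S p) F (plift p).
have e : plift @: [set p | perm_on S p]%SET = [set P | perm_on (h @: S) P]%SET.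
 apply/eqP; rewrite eqEcard; apply/andP; split.
  by apply/fsubsetP => P /imsetP[p]; rewrite !inE => /perm_on_plift pS ->.
 by rewrite card_imset ?cardsE ?card_perm ?card_imset//; exact: plift_injective.
transitivity (\sum_(P in [set P | perm_on (h @: S) P]%SET) F P); first by apply: eq_bigl => P; rewrite inE.
rewrite -e big_imset /=; last by move=> p p' _ _ /plift_injective.
by apply: eq_bigl => p; rewrite inE.
Qed.
End LiftPerm.

(** * Multilinear coefficients and the quaternion determinant *)

Section CoefTdet.
Variables (R : realType) (I : finType).
Implicit Types (U A : {set I}) (f : (I -> R) -> R).

(* The coefficient of the monomial [\prod_(i in U) ep i] in [f ep] when the degree of [f] in each variable is at most two. *)
Definition mcoef U f : R := \sum_(H : {set I})
 (\prod_i (if i \in H then (if i \in U then - 2^-1 else 2^-1) else 2^-1)) *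
 f (fun i => if i \in U then (if i \in H then -1 else 1) else 0).

Lemma mcoef_sum U (K : Type) (s : seq K) (P : pred K) (F : K -> (I -> R) -> R) (c : K -> R) :
 mcoef U (fun ep => \sum_(k <- s | P k) c k * F k ep) = \sum_(k <- s | P k) c k * mcoef U (F k).
rewrite /mcoef; under eq_bigr do rewrite mulr_sumr.
rewrite exchange_big /=; apply: eq_bigr => k _; rewrite mulr_sumr; apply: eq_bigr => H _.
by rewrite mulrCA.
Qed.

Lemma mcoef_eq U f g : (forall ep, f ep = g ep) -> mcoef U f = mcoef U g.
by move=> h; apply: eq_bigr => H _; rewrite h. Qed.

(** On [U] the half-difference of the values at 1 and -1 is the linear coefficient of a polynomial
    of degree at most two. Off [U] the variable is set to 0, the two options for [H] giving equal
    halves. *)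
Lemma mcoef_prod U (a : I -> R -> R) :
 mcoef U (fun ep => \prod_i a i (ep i)) = \prod_i (if i \in U then 2^-1 * (a i 1 - a i (-1)) else a i 0).
transitivity (\sum_(H : {set I}) \prod_i ((if i \in H then (if i \in U then - 2^-1 else 2^-1) else 2^-1) *
  a i (if i \in U then (if i \in H then -1 else 1) else 0))).
 by apply: eq_bigr => H _; rewrite big_split.
transitivity (\prod_i ((if i \in U then - 2^-1 * a i (-1) else 2^-1 * a i 0) +
            (if i \in U then 2^-1 * a i 1 else 2^-1 * a i 0))).
 rewrite bigA_distr; apply: eq_big => [H|H _]; first by rewrite inE.
 by apply: eq_bigr => i _; case: (i \in H); case: (i \in U).
by apply: eq_bigr => i _; case: (i \in U); lra.
Qed.

(** A pair of subsets survives only if each point of [U] lies in exactly one of them and no other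
    point in either. *)
Lemma mcoef_sqr U (c : {set I} -> R) :
 mcoef U (fun ep => (\sum_(A : {set I}) (\prod_(i in A) ep i) * c A) ^+ 2) =
 \sum_(A : {set I} | A \subset U) c A * c (U :\: A).
rewrite (@mcoef_eq _ _ (fun ep => \sum_(AB : {set I} * {set I}) (c AB.1 * c AB.2) *
  \prod_i ((if i \in AB.1 then ep i else 1) * (if i \in AB.2 then ep i else 1)))); last first.
 move=> ep; rewrite expr2 big_distrlr pair_big /=; apply: eq_bigr => -[A B] _ /=.
 by rewrite big_split /= -!big_mkcond /=; ring.
rewrite mcoef_sum; under eq_bigr do
 rewrite (mcoef_prod U (fun i x => (if i \in _ then x else 1) * (if i \in _ then x else 1))).
rewrite -(pair_bigA _ (fun A B => (c A * c B) * \prod_i (if i \in U then 2^-1 * ((if i \in A then 1 else 1) * (if i \in B then 1 else 1) -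
 (if i \in A then -1 else 1) * (if i \in B then -1 else 1)) else (if i \in A then 0 else 1) * (if i \in B then 0 else 1)))) /=.
rewrite (bigID (fun A => A \subset U)) /= [X in _ + X]big1 ?addr0; last first.
 move=> A /fintype.subsetPn[i iA iU]; apply: big1 => B _.
 by rewrite (bigD1 i)//= (negbTE iU) iA !mul0r mulr0.
apply: eq_bigr => A AU; rewrite (bigD1 (U :\: A)%SET)//= [X in _ + X]big1.
 rewrite addr0 -[RHS]mulr1; congr (_ * _); apply: big1 => i _; rewrite !inE.
 have [iU|iU] := boolP (i \in U); first by case: (i \in A) => /=; lra.
 have -> : (i \in A) = false by apply: contraNF iU; exact: (fsubsetP AU).
 by rewrite mulr1.
move=> B; apply: contraNeq; rewrite mulf_eq0 negb_or => /andP[_].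
move=> /prodf_neq0 h; apply/eqP/fsetP => i; have := h i isT; rewrite !inE.
have [iU|iU] := boolP (i \in U); last first.
 have -> : (i \in A) = false by apply: contraNF iU; exact: (fsubsetP AU).
 by case: (i \in B); rewrite // mulr0 eqxx.
by case: (i \in A); case: (i \in B) => //= /negP[]; apply/eqP; lra.
Qed.

Section Minors.
Variables (K : nat) (h : I -> bool -> 'I_K) (prj : 'I_K -> I) (Q : 'M[R]_K).
Hypotheses (hprj : forall i b, prj (h i b) = i) (hinj : forall i b b', h i b = h i b' -> b = b') (hsur : forall j, j = h (prj j) true \/ j = h (prj j) false).

Lemma prod_fib (F : 'I_K -> R) : \prod_j F j = \prod_i (F (h i false) * F (h i true)).
rewrite (partition_big prj predT)//=; apply: eq_bigr => i _.
rewrite (bigD1 (h i false)) ?hprj//= (bigD1 (h i true)) ?hprj ?eqxx//=; last first.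
 by apply/eqP => /hinj.
rewrite big1 ?mulr1// => j /andP[/andP[/eqP <- n1] n2].
by case: (hsur j) => e; [rewrite -e eqxx in n2|rewrite -e eqxx in n1].
Qed.

Definition hsel (al : {set I}) (i : I) : 'I_K := h i (i \in al).
Lemma hsel_inj al : injective (hsel al).
by move=> i j e; rewrite -(hprj i (i \in al)) -(hprj j (j \in al)) -/(hsel al i) e. Qed.
Let dl (P : {perm 'I_K}) j : R := (P j == j)%:R.

(** Linear dependence on [ep i] means that one of the two rows over [i] comes from [Q] and the other
    from the identity; [al] records which. *)
Lemma mcoef_det U :
 mcoef U (fun ep => \det (1%:M + \matrix_(j, k) (ep (prj j) * Q j k))) =
 \sum_(al : {set I} | al \subset U) \sum_(p | perm_on U p)
  (-1) ^+ p * \prod_(i in U) Q (hsel al i) (hsel al (p i)).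
rewrite (@mcoef_eq _ _ (fun ep => \sum_(P : {perm 'I_K}) (-1) ^+ P *
 \prod_i ((dl P (h i false) + ep i * Q (h i false) (P (h i false))) *
      (dl P (h i true) + ep i * Q (h i true) (P (h i true)))))); last first.
 move=> ep; apply: eq_bigr => P _; congr (_ * _); rewrite prod_fib; apply: eq_bigr => i _.
 by rewrite !mxE !hprj /dl ![_ == P _]eq_sym.
rewrite mcoef_sum; under eq_bigr do
 rewrite (mcoef_prod U (fun i x => (dl _ (h i false) + x * Q (h i false) _) * (dl _ (h i true) + x * Q (h i true) _))).
transitivity (\sum_(P : {perm 'I_K}) \sum_(al : {set I} | al \subset U) (-1) ^+ P *
  \prod_i (if i \in U then Q (hsel al i) (P (hsel al i)) * dl P (h i (i \notin al)) else dl P (h i false) * dl P (h i true))).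
 apply: eq_bigr => P _; rewrite -mulr_sumr; congr (_ * _).
 transitivity (\prod_i ((if i \in U then Q (h i true) (P (h i true)) * dl P (h i false) else 0) +
   (if i \in U then Q (h i false) (P (h i false)) * dl P (h i true) else dl P (h i false) * dl P (h i true)))).
  by apply: eq_bigr => i _; case: (i \in U); lra.
 rewrite bigA_distr [RHS]big_mkcond /=; apply: eq_big => [al|al _]; first by rewrite inE.
 case: ifPn => [aU|/fintype.subsetPn[i ia iU]]; last by rewrite (bigD1 i)//= ia (negbTE iU) mul0r.
 apply: eq_bigr => i _; rewrite /hsel; have [ia|//] := boolP (i \in al).
 by rewrite (fsubsetP aU).
rewrite exchange_big /=; apply: eq_bigr => al aU.
(* Rows taken from the identity must be fixed points, so the permutation is supported on the
   selected rows. *)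
transitivity (\sum_(P | perm_on (hsel al @: U) P) (-1) ^+ P * \prod_(i in U) Q (hsel al i) (P (hsel al i))).
 rewrite [RHS]big_mkcond; apply: eq_bigr => P _; case: ifPn => [pU|].
  congr (_ * _); rewrite [RHS]big_mkcond; apply: eq_bigr => i _.
  have o b : ~~ ((i \in U) && (b == (i \in al))) -> dl P (h i b) = 1.
   move=> n; rewrite /dl (out_perm pU) ?eqxx//; apply: contra n => /imsetP[k kU e].
   have ik : i = k by rewrite -(hprj i b) e /hsel hprj.
   by move: e; rewrite -ik /hsel => /hinj ->; rewrite ik kU eqxx.
  case: ifPn => iU; first by rewrite o ?mulr1// iU; case: (i \in al).
  by rewrite !o ?mulr1// (negbTE iU).
 move=> /fintype.subsetPn[j]; rewrite inE => Pj jU.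
 rewrite (bigD1 (prj j))//=; case: ifPn => jU'; last first.
  by case: (hsur j) => e; rewrite /dl -e (negbTE Pj) ?mul0r ?mulr0 ?mul0r ?mulr0.
 have nj : j != h (prj j) (prj j \in al) by apply: contra jU => /eqP ->; apply: imset_f.
 have ej : h (prj j) (prj j \notin al) = j.
  by case: (prj j \in al) nj => /=; have [e|e] := hsur j; rewrite -e ?eqxx.
 by rewrite ej /dl (negbTE Pj) mulr0 mul0r mulr0.
rewrite (sum_plift (@hsel_inj al)); apply: eq_bigr => p pU.
by rewrite odd_plift; congr (_ * _); apply: eq_bigr => i _; rewrite pliftE.
Qed.

(** Comparing the coefficients of [U] on both sides shows that the convolution square of [c] is the
    orbit sum of weight 1. *)
Lemma coef_Tdet (c : {set I} -> R) (q : I -> I -> 'M[R]_2) : c fset0 = 1 ->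
 (forall i j b b', q i j (b2o b) (b2o b') = Q (h i b) (h j b')) ->
 (forall ep : I -> R, (\sum_(A : {set I}) (\prod_(i in A) ep i) * c A) ^+ 2 =
   \det (1%:M + \matrix_(j, k) (ep (prj j) * Q j k))) ->
 c fsetT = Tdet q.
move=> c0 qQ hZ; apply: osum_unique => // U.
rewrite -mcoef_sqr (mcoef_eq _ hZ) mcoef_det osum1E; apply: eq_bigr => al _; apply: eq_bigr => p _.
by congr (_ * _); apply: eq_bigr => i _; rewrite qQ.
Qed.
End Minors.
End CoefTdet.

(** * Determinants of low-rank perturbations *)

Section LowRank.
Variable F : fieldType.

(** Sylvester's identity, from two triangular factorisations involving the same block matrices. *)
Lemma det_addmulC m n (A : 'M[F]_(m, n)) (B : 'M[F]_(n, m)) : \det (1%:M + A *m B) = \det (1%:M + B *m A).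
have e1 : block_mx 1%:M (- A) B 1%:M *m block_mx 1%:M A 0 1%:M = block_mx 1%:M 0 B (1%:M + B *m A).
 by rewrite mulmx_block !mulmx1 !mulmx0 !mul1mx !addr0 subrr addrC.
have e2 : block_mx 1%:M A 0 1%:M *m block_mx 1%:M (- A) B 1%:M = block_mx (1%:M + A *m B) 0 B 1%:M.
 by rewrite mulmx_block !mulmx1 !mul1mx !mul0mx !add0r addNr.
have := congr1 determinant e1; have := congr1 determinant e2.
by rewrite !det_mulmx !det_lblock !det_ublock !det1 !mul1r !mulr1 => -> ->.
Qed.

(** A permutation other than the identity cannot raise the level at every point that it moves, so
    its product contains a zero entry of [P]. *)
Lemma det_level q (lev : 'I_q -> nat) (P : 'M[F]_q) : (forall i j, (lev j <= lev i)%N -> P i j = 0) ->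
 \det (1%:M - P) = 1.
move=> h; rewrite /determinant (bigD1 1%g)//= [X in _ + X]big1 ?addr0 => [|s s1].
 rewrite odd_perm1 mul1r; apply: big1 => i _.
 by rewrite !mxE perm1 h// eqxx subr0.
have [i /andP[si li]] : exists i, (s i != i) && (lev (s i) <= lev i)%N.
 apply/existsP; apply: contraR s1 => /existsPn n; apply/eqP/permP => i; rewrite perm1.
 have le j : (lev j <= lev (s j))%N.
  by have [->//|sj] := eqVneq (s j) j; have := n j; rewrite sj /= -ltnNge => /ltnW.
 have : (\sum_j lev (s j) = \sum_j lev j)%N by rewrite [RHS](reindex_perm s).
 rewrite (bigD1 i)//= [RHS](bigD1 i)//= => e.
 have l2 : (\sum_(j | j != i) lev j <= \sum_(j | j != i) lev (s j))%N by apply: leq_sum.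
 apply/eqP; apply: contraT => si; have := n i; rewrite si /= -ltnNge => h1.
 by have := leq_add h1 l2; rewrite e addSn ltnn.
by rewrite (bigD1 i)//= !mxE eq_sym (negbTE si) h// subr0 mul0r mulr0.
Qed.

Variables (N q : nat) (lev : 'I_q -> nat).
Variables (A0 : 'M[F]_N) (Psi : 'M[F]_(q, N)) (P G E : 'M[F]_q) (W b : 'M[F]_(N, q)).
Hypotheses (hP : forall i j, (lev j <= lev i)%N -> P i j = 0) (A0u : A0 \in unitmx) (A0s : A0^T = - A0) (Es : is_diag_mx E) (hW : W = Psi^T + W *m E *m P).

Let c := Psi *m invmx A0 *m b.
Let d := Psi *m invmx A0 *m Psi^T.
Let e := b^T *m invmx A0 *m b.
(** The diagonal blocks are transposes of each other and, for antisymmetric [G], the other two are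
    antisymmetric: this is self-duality of the quaternion kernel. *)
Definition Qhat := block_mx (- (P + c^T)) (G + e) (- d) (- (P^T + c)).

(** By [hW], [W E] is [Psi^T E] times the inverse of [1 - P E], which has determinant 1 because [P]
    raises levels. The perturbation factors through 2q columns, and Sylvester's identity reduces the
    determinant to size 2q. *)
Lemma det_lowrank : \det (A0 + W *m E *m b^T - b *m E *m W^T + W *m E *m G *m E *m W^T) =
 \det A0 * \det (1%:M + block_mx E 0 0 E *m Qhat).
have ET : E^T = E.
 apply/matrixP => i j; rewrite mxE; have [->//|ij] := eqVneq i j.
 by rewrite !(is_diag_mxP Es) //; rewrite // eq_sym.
pose U := 1%:M - P *m E.
have dU : \det U = 1.
 apply: (det_level (lev := lev)) => i j ij; rewrite mxE big1// => k _.
 have [->|jk] := eqVneq k j; first by rewrite hP ?mul0r.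
 by rewrite (is_diag_mxP Es) ?mulr0.
have uU : U \in unitmx by rewrite unitmxE dU unitr1.
pose V := invmx U.
have UV : U *m V = 1%:M by exact: mulmxV.
have VU : V *m U = 1%:M by exact: mulVmx.
have WEU : W *m E *m U = Psi^T *m E.
 rewrite mulmxBr mulmx1 {1}hW mulmxDl -addrA -[RHS]addr0; congr (_ + _).
 by rewrite !mulmxA subrr.
have WE : W *m E = Psi^T *m E *m V by rewrite -WEU -mulmxA UV mulmx1.
have EW : E *m W^T = V^T *m E *m Psi by rewrite -{1}ET -trmx_mul WE !trmx_mul trmxK ET mulmxA.
have iA : (invmx A0)^T = - invmx A0.
 rewrite trmx_inv A0s -[- A0]scaleN1r invmxZ ?invrN ?invr1 ?scaleN1r//.
 by rewrite -scaleN1r unitmxZ ?unitrN ?unitr1.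
have cT : b^T *m invmx A0 *m Psi^T = - c^T.
 by rewrite /c !trmx_mul iA mulNmx mulmxN opprK mulmxA.
(* Chosen so that [X K X^T] is exactly the perturbation of [A0]. *)
pose X := row_mx (W *m E) b; pose K := block_mx G 1%:M (- 1%:M) 0.
have -> : A0 + W *m E *m b^T - b *m E *m W^T + W *m E *m G *m E *m W^T = A0 *m (1%:M + invmx A0 *m X *m (K *m X^T)).
 rewrite mulmxDr mulmx1 -!mulmxA mulKVmx// tr_row_mx mul_block_col mul0mx addr0 mul1mx mulNmx mul1mx.
 rewrite mul_row_col mulmxDr mulmxN trmx_mul ET !mulmxA -!addrA; congr (_ + _).
 by rewrite addrA addrC.
rewrite det_mulmx; congr (_ * _); rewrite [LHS]det_addmulC -[_ *m X^T *m _]mulmxA.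
have {}eX : X^T *m (invmx A0 *m X) = block_mx (V^T *m E *m d *m E *m V) (V^T *m E *m c) (- c^T *m E *m V) e.
 rewrite tr_row_mx mul_mx_row mul_col_row trmx_mul ET EW WE.
 by rewrite /d /c /e -cT !mulmxA.
rewrite eX.
(* Factors of determinant 1 on both sides remove [V], the inverse of [U], from all blocks. *)
have {}eK : block_mx 1%:M 0 0 U^T *m (block_mx 1%:M G 0 1%:M *m (1%:M + K *m block_mx (V^T *m E *m d *m E *m V) (V^T *m E *m c) (- c^T *m E *m V) e) *m
  block_mx U 0 0 1%:M) = 1%:M + block_mx 1%:M 0 0 E *m Qhat *m block_mx E 0 0 1%:M.
 have -> : (1%:M : 'M[F]_(q + q)) = block_mx 1%:M 0 0 1%:M by rewrite -scalar_mx_block.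
 rewrite /K /Qhat !(mulmx_block, add_block_mx, mulmx1, mul1mx, mulmx0, mul0mx, addr0, add0r, mulNmx, mulmxN).
 have UTV : U^T *m V^T = 1%:M by rewrite -trmx_mul VU trmx1.
 have UTe : U^T = 1%:M - E *m P^T by rewrite linearB /= trmx1 trmx_mul ET.
 congr block_mx.
 - rewrite [G *m _ - _]addrC addrA addrK mulmxBl mul1mx -!mulmxA VU mulmx1 /U mulmxDl opprD addrA.
  by rewrite ?mulmxA.
 - by rewrite mulmxBr mulmx1 [_ + e]addrC -addrA [X in e + X]addrC addrNK addrC.
 - by rewrite -!mulmxA VU mulmx1 (mulmxA U^T) UTV mul1mx !mulmxA.
 - by rewrite mulmxBr mulmx1 -[V^T *m E *m c]mulmxA (mulmxA U^T) UTV mul1mx UTe mulmxDr opprD addrA.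
have := congr1 determinant eK; rewrite !det_mulmx !det_ublock !det1 det_tr dU !mul1r !mulr1 => ->.
rewrite -mulmxA [LHS]det_addmulC -mulmxA [RHS]det_addmulC mulmx_block.
by rewrite !mulmx1 !mul1mx !mulmx0 !mul0mx !addr0 !add0r.
Qed.
End LowRank.

(** * From the perturbed determinant to a quaternion determinant *)

Section LowRankTdet.
Variables (R : realType) (I : finType) (N : nat) (lev : I -> nat).
Variables (A0 : 'M[R]_N) (Psi : I -> 'I_N -> R) (b : 'I_N -> I -> R) (PP G : I -> I -> R).

Definition ker_S i j : R := - PP i j - \sum_k \sum_l Psi j k * invmx A0 k l * b l i.
Definition ker_I i j : R := G i j + \sum_k \sum_l b k i * invmx A0 k l * b l j.
Definition ker_D i j : R := - \sum_k \sum_l Psi i k * invmx A0 k l * Psi j l.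
Definition ker_mx i j : 'M[R]_2 := \matrix_(r, s)
 if (r : nat) == 0%N then (if (s : nat) == 0%N then ker_S i j else ker_I i j)
 else (if (s : nat) == 0%N then ker_D i j else ker_S j i).

Lemma mulmx3E m1 m2 m3 m4 (X1 : 'M[R]_(m1, m2)) (X2 : 'M[R]_(m2, m3)) (X3 : 'M[R]_(m3, m4)) (i : 'I_m1) (j : 'I_m4) :
 (X1 *m X2 *m X3) i j = \sum_k \sum_l X1 i k * X2 k l * X3 l j.
rewrite mxE exchange_big /=; apply: eq_bigr => l _; rewrite mxE mulr_suml.
by apply: eq_bigr.
Qed.

Hypotheses (hP : forall i j, (lev j <= lev i)%N -> PP i j = 0) (A0u : A0 \in unitmx) (A0s : A0^T = - A0).
Variables (V : (I -> R) -> I -> 'I_N -> R) (c : {set I} -> R).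
Hypotheses (hV : forall ep i j, V ep i j = Psi i j + \sum_k ep k * V ep k j * PP k i) (c0 : c fset0 = 1).
Hypothesis hZ : forall ep, (\sum_(A : {set I}) (\prod_(i in A) ep i) * c A) ^+ 2 =
 (\det A0)^-1 * \det (\matrix_(j, k) (A0 j k + \sum_i ep i * V ep i j * b k i
  - \sum_i ep i * b j i * V ep i k + \sum_i \sum_i' ep i * ep i' * V ep i j * V ep i' k * G i i')).

Lemma lowrank_Tdet : c fsetT = Tdet ker_mx.
pose ev : 'I_#|I| -> I := enum_val.
pose PsiM : 'M[R]_(#|I|, N) := \matrix_(a, j) Psi (ev a) j.
pose PM : 'M[R]_#|I| := \matrix_(a, a') PP (ev a) (ev a').
pose GM : 'M[R]_#|I| := \matrix_(a, a') G (ev a) (ev a').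
pose bM : 'M[R]_(N, #|I|) := \matrix_(j, a) b j (ev a).
pose Q := Qhat A0 PsiM PM GM bM.
pose h i (s : bool) : 'I_(#|I| + #|I|) := if s then rshift #|I| (enum_rank i) else lshift #|I| (enum_rank i).
pose prj (j : 'I_(#|I| + #|I|)) : I := match fintype.split j with inl a => ev a | inr a => ev a end.
have evK i : ev (enum_rank i) = i by rewrite /ev enum_rankK.
have sumE (V' : zmodType) (f : I -> V') : \sum_i f i = \sum_a f (ev a).
 by rewrite (reindex ev) //; apply: onW_bij; exact: enum_val_bij.
apply: (@coef_Tdet R I (#|I| + #|I|) h prj Q _ _ _ c ker_mx c0).
- by move=> i [] ; rewrite /prj /h /= ?(unsplitK (inl (enum_rank i))) ?(unsplitK (inr (enum_rank i))) evK.
- move=> i s s'; rewrite /h; case: s; case: s' => // /eqP.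
  by rewrite eq_rlshift.
 by rewrite eq_lrshift.
- move=> j; rewrite /prj /h /ev; case: splitP => a ja; rewrite enum_valK; [right|left]; exact: val_inj.
- move=> i j s s'; rewrite mxE /Q /Qhat /h /b2o.
 case: s; case: s' => /=.
 + rewrite block_mxEdr /ker_S 2!mxE mulmx3E [PM^T _ _]mxE [PM _ _]mxE !evK opprD; congr (_ - _).
  by apply: eq_bigr => k _; apply: eq_bigr => l _; rewrite !mxE !evK.
 + rewrite block_mxEdl /ker_D mxE mulmx3E; congr (- _); apply: eq_bigr => k _; apply: eq_bigr => l _.
  by rewrite !mxE !evK.
 + rewrite block_mxEur /ker_I mxE mulmx3E [GM _ _]mxE !evK; congr (_ + _).
  by apply: eq_bigr => k _; apply: eq_bigr => l _; rewrite !mxE !evK.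
 + rewrite block_mxEul /ker_S [RHS]mxE [X in _ = - X]mxE [X in _ = - (_ + X)]mxE mulmx3E [PM _ _]mxE !evK opprD; congr (_ - _).
  by apply: eq_bigr => k _; apply: eq_bigr => l _; rewrite !mxE !evK.
- move=> ep; rewrite hZ.
 pose E : 'M[R]_#|I| := diag_mx (\row_a ep (ev a)).
 pose W : 'M[R]_(N, #|I|) := \matrix_(j, a) V ep (ev a) j.
 have WE j a : (W *m E) j a = ep (ev a) * V ep (ev a) j by rewrite mul_mx_diag !mxE mulrC.
 have := @det_lowrank R N #|I| (fun a => lev (ev a)) A0 PsiM PM GM E W bM _ A0u A0s _ _.
 rewrite (_ : A0 + _ - _ + _ = \matrix_(j, k) (A0 j k + \sum_i ep i * V ep i j * b k i
  - \sum_i ep i * b j i * V ep i k + \sum_i \sum_i' ep i * ep i' * V ep i j * V ep i' k * G i i')); last first.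
  apply/matrixP => j k; rewrite [LHS]mxE [RHS]mxE; congr (_ + _); last first.
   rewrite -mulmxA -[X in _ *m X]trmxK trmx_mul trmxK /E tr_diag_mx -/E mulmx3E sumE; apply: eq_bigr => a _.
   rewrite sumE; apply: eq_bigr => a' _; rewrite [(W *m E)^T _ _]mxE !WE [GM _ _]mxE; ring.
  rewrite mxE [X in _ + X]mxE [X in X - _]mxE; congr (_ + _ - _); rewrite mxE sumE; apply: eq_bigr => a _.
   by rewrite WE !mxE.
  by rewrite mul_mx_diag !mxE [X in X * _]mulrC.
 move=> -> //.
 + rewrite mulrA mulVf ?mul1r; last by rewrite -unitfE -unitmxE.
  congr (\det (_ + _)); apply/matrixP => j k; rewrite /E -diag_mx_row mul_diag_mx !mxE.
  by congr (_ * _); rewrite /prj; case: fintype.split => a; rewrite mxE.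
 + by move=> a a' l; rewrite mxE hP.
 + exact: diag_mx_is_diag.
 + apply/matrixP => j a; rewrite !mxE hV sumE; congr (_ + _); apply: eq_bigr => a' _.
  by rewrite WE mxE.
Qed.
End LowRankTdet.

(** * The kernel of a general multi-level process *)

Section Process.
Variables (R : realType) (d : measure_display) (X : measurableType d).
Variables (io : R -> X) (om : X -> R).
Hypotheses (mio : mfunT io) (mom : mfunT om).
Hypotheses (om1 : forall x, 1 <= om x) (iom : itg (fun u => (om (io u))^-1)).
Variables (n : nat) (ka : X -> X -> R) (Ck : R).
Hypotheses (mka : mfunT (fun x : X * X => ka x.1 x.2)) (bka : forall x y, `|ka x y| <= Ck) (aka : forall x y, ka y x = - ka x y).
Local Notation N := (n.*2).
Local Notation Lf := (Lf io).

Let omg x : 0 < om x. exact: lt_le_trans (om1 x). Qed.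
Let omg0 x : 0 <= om x. exact/ltW/omg. Qed.
Local Hint Resolve omg omg0 : core.

Definition bmeas (f : X -> R) := mfunT f /\ exists C, 0 <= C /\ forall x, `|f x| <= C.

Lemma fast_tame f g : fast om f -> bmeas g -> tame om (fun x => f x * g x).
move=> ff [mg [D [D0 hg]]]; have [mf _] := ff; have [C [C0 h]] := fast_le om1 1 ff.
split; first exact: mfunM.
exists (C * D); split; first exact: mulr_ge0.
move=> x; rewrite normrM mulrAC; exact: ler_pM.
Qed.

Lemma bmeas_ka x : bmeas (ka x).
split; first exact: (measurable_fun_pair2 x mka).
by exists `|Ck|; split=> // y; rewrite (le_trans (bka _ _))// ler_norm.
Qed.

Lemma bmeas_kaV y : bmeas (ka^~ y).
split; first exact: (measurable_fun_pair1 y mka).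
by exists `|Ck|; split=> // x; rewrite (le_trans (bka _ _))// ler_norm.
Qed.

Lemma bmeasD f g : bmeas f -> bmeas g -> bmeas (fun x => f x + g x).
move=> [mf [C [C0 hf]]] [mg [D [D0 hg]]]; split; first exact: measurable_funD.
by exists (C + D); split; [exact: addr_ge0|move=> x; rewrite (le_trans (ler_normD _ _))// lerD].
Qed.

Lemma bmeasZ c f : bmeas f -> bmeas (fun x => c * f x).
move=> [mf [C [C0 hf]]]; split; first exact: mfunM.
by exists (`|c| * C); split; [exact: mulr_ge0|move=> x; rewrite normrM ler_wpM2l].
Qed.

Lemma bmeas_sum (K : Type) (s : seq K) (f : K -> X -> R) : (forall k, bmeas (f k)) ->
 bmeas (fun x => \sum_(k <- s) f k x).
move=> hf; elim: s => [|k s IH].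
 by under eq_fun do rewrite big_nil; split=> //; exists 0; split=> // x; rewrite normr0.
by under eq_fun do rewrite big_cons; apply: bmeasD.
Qed.

Lemma bmeas_Lf B f : fast om f -> bmeas (fun x => Lf B (fun y => f y * ka x y)).
move=> ff; have [mf _] := ff; have [C [C0 h]] := fast_le om1 1 ff; split.
 apply: (@measurable_Lf _ _ _ _ mio _ X B (fun x y => f y * ka x y)).
 by apply: mfunM => //; exact: mcomp.
exists (C * `|Ck| * Lmass io om B); split; first by rewrite !mulr_ge0// Lmass_ge0.
move=> x; apply: (Lf_bound mio om1 iom); first exact: mulr_ge0.
 by case: (fast_tame ff (bmeas_ka x)).
move=> y; rewrite normrM mulrAC; apply: ler_pM => //.
by rewrite (le_trans (bka _ _))// ler_norm.
Qed.

Lemma Lf_skew B1 B2 f g : fast om f -> fast om g ->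
 Lf B1 (fun x => f x * Lf B2 (fun y => g y * ka x y)) = - Lf B2 (fun y => g y * Lf B1 (fun x => f x * ka y x)).
move=> ff fg; have [mf _] := ff; have [mg _] := fg.
have [C [C0 hC]] := fast_le om1 1 ff; have [D [D0 hD]] := fast_le om1 1 fg.
transitivity (Lf B1 (fun x => Lf B2 (fun y => f x * (g y * ka x y)))).
 by apply: Lf_eq => x; rewrite (LfZ mio iom)//; exact: fast_tame fg (bmeas_ka x).
rewrite (Lf_swap mio om1 iom _ _ (C := C * D * `|Ck|)).
- rewrite -[RHS]mulN1r -(LfZ mio iom); last exact: fast_tame fg (bmeas_Lf B1 ff).
 apply: Lf_eq => y; rewrite mulN1r -mulrN -[- Lf _ _]mulN1r -(LfZ mio iom); last exact: fast_tame ff (bmeas_ka y).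
 transitivity (Lf B1 (fun x => g y * (-1 * (f x * ka y x)))).
  by apply: Lf_eq => x; rewrite (aka x y); ring.
 by rewrite (LfZ mio iom)//; apply: tameZ => //; exact: fast_tame ff (bmeas_ka y).
- by rewrite !mulr_ge0.
- apply: mfunM; first exact: mcomp.
 by apply: mfunM => //; exact: mcomp.
- move=> x y; rewrite !normrM.
 have hx := hC x; have hy := hD y; rewrite !expr1 in hx hy.
 have hk : `|ka x y| <= `|Ck| by rewrite (le_trans (bka _ _))// ler_norm.
 apply: (le_trans (ler_pM _ _ hx (ler_pM _ _ hy hk))) => //.
 by apply: le_of_eq; ring.
Qed.

Variables (I : finType) (lev : I -> nat) (pos : I -> X) (e : nat -> seq I).
Hypotheses (ue : forall m, uniq (e m)) (eP : forall m i, (i \in e m) = (lev i == m)).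
Variables (phi : 'I_N -> X -> R) (p : nat -> X -> X -> R) (B0 : seq (X * R)).
Hypotheses (gphi : @goodf _ _ _ om N phi) (gp : forall m, goodp om (p m)) (sN : forall m, (size (e m) <= N)%N).
Variable M : nat.
Hypothesis hM : forall i, (lev i <= M)%N.
Variables (phm : nat -> 'I_N -> X -> R) (pp : nat -> nat -> X -> X -> R).
Hypotheses (phm0 : forall j x, phm 0 j x = phi j x) (phmS : forall m j y, phm m.+1 j y = Lf B0 (fun x => phm m j x * p m.+1 x y)) (pp1 : forall a x y, pp a a.+1 x y = p a.+1 x y) (ppS : forall a m x y, (a < m)%N -> pp a m.+1 x y = Lf B0 (fun x' => pp a m x x' * p m.+1 x' y)).

Lemma fast_phm m j : fast om (phm m j).
elim: m => [|m IH].
 by rewrite (_ : phm 0 j = phi j); [exact: goodf_fast|exact/funext/phm0].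
rewrite (_ : phm m.+1 j = fun y => Lf B0 (fun x => phm m j x * p m.+1 x y)); last exact/funext/phmS.
exact: (fast_push mio om1 iom).
Qed.

Lemma goodp_fast m x : fast om (p m x).
have [mp bp] := gp m; split=> [|r]; first exact: (measurable_fun_pair2 x mp).
by have [C [C0 h]] := bp r; exists (C * om x ^+ r); split; [rewrite mulr_ge0// exprn_ge0|exact: h].
Qed.

Lemma fast_pp a m x : (a < m)%N -> fast om (pp a m x).
elim: m => // m IH; rewrite ltnS leq_eqVlt => /orP[/eqP <-|am].
 by rewrite (_ : pp a a.+1 x = p a.+1 x); [exact: goodp_fast|exact/funext/pp1].
rewrite (_ : pp a m.+1 x = fun y => Lf B0 (fun x' => pp a m x x' * p m.+1 x' y)); last by apply/funext => y; exact: ppS.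
by apply: (fast_push mio om1 iom); first exact: IH.
Qed.

Definition Bep (ep : I -> R) m := [seq (pos i, ep i) | i <- e m] ++ B0.
(** The value at the point [i] of [phi j] carried forward through the atoms of all earlier levels;
    it plays the role of [W] in [det_lowrank]. *)
Definition vv ep i j := push io p (Bep ep) (lev i) (phi j) (pos i).

Lemma Lf_Bep ep m f : Lf (Bep ep m) f = Lf B0 f + \sum_(i | lev i == m) ep i * f (pos i).
rewrite /Lf /Bep big_cat big_map /= -addrA; congr (_ + _); rewrite addrC; congr (_ + _).
by rewrite big_uniq//; apply: eq_bigl => i; rewrite eP.
Qed.

Lemma bmeas_p m y : bmeas (fun x => p m x y).
have [mp bp] := gp m; split; first exact: (measurable_fun_pair1 y mp).
have [C [C0 h]] := bp 0%N; exists C; split=> // x.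
by have := h x y; rewrite !expr0 !mulr1.
Qed.

Lemma pushE ep m j y : push io p (Bep ep) m (phi j) y =
 phm m j y + \sum_(i | (lev i < m)%N) ep i * vv ep i j * pp (lev i) m (pos i) y.
elim: m y => [|m IH] y; first by rewrite big_pred0 ?addr0 ?phm0.
rewrite /= Lf_Bep.
transitivity (Lf B0 (fun x => phm m j x * p m.+1 x y +
  \sum_(i <- [seq i <- index_enum I | (lev i < m)%N]) ep i * vv ep i j * (pp (lev i) m (pos i) x * p m.+1 x y))
  + \sum_(i | lev i == m) ep i * (push io p (Bep ep) m (phi j) (pos i) * p m.+1 (pos i) y)).
 congr (_ + _); apply: Lf_eq => x; rewrite IH mulrDl mulr_suml big_filter.
 by congr (_ + _); apply: eq_bigr => i _; rewrite mulrA.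
rewrite (LfD mio iom); first last.
- pose f i x := if (lev i < m)%N then ep i * vv ep i j * (pp (lev i) m (pos i) x * p m.+1 x y) else 0.
 rewrite (_ : (fun x => _) = (fun x => \sum_(i <- [seq i <- index_enum I | (lev i < m)%N]) f i x)); last first.
  apply/funext => x; rewrite !big_filter; apply: eq_bigr => i im; by rewrite /f im.
 apply: (tame_sum (om := om)) => // i; rewrite /f; have [im|im] := boolP (lev i < m)%N; last exact: tame0.
 by apply: tameZ => //; apply: fast_tame (fast_pp _ im) (bmeas_p _ _).
- exact: fast_tame (fast_phm _ _) (bmeas_p _ _).
rewrite -phmS -addrA; congr (_ + _).
transitivity (\sum_(i | (lev i < m)%N) ep i * vv ep i j * pp (lev i) m.+1 (pos i) y +
  \sum_(i | lev i == m) ep i * vv ep i j * pp (lev i) m.+1 (pos i) y); last first.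
 rewrite [RHS](bigID (fun i => lev i < m)%N) /=; congr (_ + _); apply: eq_bigl => i.
  by rewrite ltnS andbC; case: ltnP => // /ltnW ->.
 by rewrite ltnS -leqNgt eqn_leq.
congr (_ + _); last first.
 by apply: eq_bigr => i /eqP <-; rewrite pp1 -mulrA.
pose f i x := if (lev i < m)%N then ep i * vv ep i j * (pp (lev i) m (pos i) x * p m.+1 x y) else 0.
transitivity (Lf B0 (fun x => \sum_(i <- [seq i <- index_enum I | (lev i < m)%N]) f i x)).
 by apply: Lf_eq => x; rewrite !big_filter; apply: eq_bigr => i im; rewrite /f im.
rewrite (Lf_sum mio iom); last first.
 move=> i; rewrite /f; have [im|im] := boolP (lev i < m)%N; last exact: tame0.
 by apply: tameZ => //; apply: fast_tame (fast_pp _ im) (bmeas_p _ _).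
rewrite big_filter; apply: eq_bigr => i im; rewrite ppS// -(LfZ mio iom); last first.
 by apply: fast_tame (fast_pp _ im) (bmeas_p _ _).
by apply: Lf_eq => x; rewrite /f im.
Qed.

Definition mu j (f : X -> R) := Lf B0 (fun x => phm M j x * f x).
(** Integration at the final level against the unperturbed transition from the point [i], which is a
    point mass if [i] already lies there; [mu j] does the same for [phi j]. *)
Definition lam i (f : X -> R) := if lev i == M then f (pos i) else Lf B0 (fun x => pp (lev i) M (pos i) x * f x).
Let levM i : lev i != M -> (lev i < M)%N.
by move=> h; rewrite ltn_neqAle h hM. Qed.

Lemma push_lam ep j f : bmeas f -> Lf (Bep ep M) (fun x => push io p (Bep ep) M (phi j) x * f x) =
 mu j f + \sum_i ep i * vv ep i j * lam i f.
move=> bf; rewrite Lf_Bep.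
pose g i x := if (lev i < M)%N then ep i * vv ep i j * (pp (lev i) M (pos i) x * f x) else 0.
have tg i : tame om (g i).
 rewrite /g; have [im|im] := boolP (lev i < M)%N; last exact: tame0.
 by apply: tameZ => //; apply: fast_tame (fast_pp _ im) bf.
transitivity (Lf B0 (fun x => phm M j x * f x + \sum_(i <- index_enum I) g i x)
  + \sum_(i | lev i == M) ep i * (push io p (Bep ep) M (phi j) (pos i) * f (pos i))).
 congr (_ + _); apply: Lf_eq => x; rewrite pushE mulrDl mulr_suml [X in _ = _ + X](bigID (fun i => lev i < M)%N) /=.
 rewrite [X in _ = _ + (_ + X)]big1 ?addr0; last by move=> i /negbTE im; rewrite /g im.
 by congr (_ + _); apply: eq_bigr => i im; rewrite /g im mulrA.
rewrite (LfD mio iom); last by apply: (tame_sum (om := om)).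
 rewrite -/(mu j f) -addrA; congr (_ + _); rewrite (Lf_sum mio iom)// [RHS](bigID (fun i => lev i == M)) /= addrC.
 congr (_ + _); first by apply: eq_bigr => i /eqP im; rewrite /lam im eqxx mulrA /vv im.
 rewrite [RHS]big_mkcond; apply: eq_bigr => i _; case: ifPn => im.
  rewrite /lam (negbTE im) -(LfZ mio iom); last exact: fast_tame (fast_pp _ (levM im)) bf.
  by apply: Lf_eq => x; rewrite /g levM.
 rewrite -[RHS](Lf0 mio iom B0); apply: Lf_eq => x; rewrite /g.
 by move: im; rewrite negbK => /eqP ->; rewrite ltnn.
exact: fast_tame (fast_phm _ _) bf.
Qed.

Definition bka_ k i := lam i (fun x => mu k (ka x)).
Definition Gka i i' := lam i (fun x => lam i' (ka x)).
Definition A0ka : 'M[R]_N := \matrix_(j, k) mu j (fun x => mu k (ka x)).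
Lemma bmeas_mu k : bmeas (fun x => mu k (ka x)).
exact: bmeas_Lf (fast_phm _ _). Qed.

Lemma bmeas_lam i : bmeas (fun x => lam i (ka x)).
rewrite /lam; have [im|im] := boolP (lev i == M); first exact: bmeas_kaV.
exact: bmeas_Lf (fast_pp _ (levM im)).
Qed.

Lemma muD j f g : bmeas f -> bmeas g -> mu j (fun x => f x + g x) = mu j f + mu j g.
move=> bf bg; rewrite /mu -(LfD mio iom); last exact: fast_tame (fast_phm _ _) bg.
 by apply: Lf_eq => x; rewrite mulrDr.
exact: fast_tame (fast_phm _ _) bf.
Qed.

Lemma lamD i f g : bmeas f -> bmeas g -> lam i (fun x => f x + g x) = lam i f + lam i g.
move=> bf bg; rewrite /lam; case: ifPn => // im; rewrite -(LfD mio iom); last exact: fast_tame (fast_pp _ (levM im)) bg.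
 by apply: Lf_eq => x; rewrite mulrDr.
exact: fast_tame (fast_pp _ (levM im)) bf.
Qed.

Lemma mu_sum j (c : I -> R) (f : I -> X -> R) : (forall i, bmeas (f i)) ->
 mu j (fun x => \sum_i c i * f i x) = \sum_i c i * mu j (f i).
move=> bf; rewrite /mu; under [RHS]eq_bigr => i _ do rewrite -(LfZ mio iom _ _ (fast_tame (fast_phm M j) (bf i))).
rewrite -(Lf_sum mio iom); last by move=> i; apply: tameZ => //; exact: fast_tame (fast_phm M j) (bf i).
by apply: Lf_eq => x; rewrite mulr_sumr; apply: eq_bigr => i _; rewrite mulrCA.
Qed.

Lemma lam_sum i0 (c : I -> R) (f : I -> X -> R) : (forall i, bmeas (f i)) ->
 lam i0 (fun x => \sum_i c i * f i x) = \sum_i c i * lam i0 (f i).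
move=> bf; rewrite /lam; case: ifPn => // /levM im.
under [RHS]eq_bigr => i _ do rewrite -(LfZ mio iom _ _ (fast_tame (fast_pp _ im) (bf i))).
rewrite -(Lf_sum mio iom); last by move=> i; apply: tameZ => //; exact: fast_tame (fast_pp _ im) (bf i).
by apply: Lf_eq => x; rewrite mulr_sumr; apply: eq_bigr => i _; rewrite mulrCA.
Qed.

Lemma mu_lam j i : mu j (fun x => lam i (ka x)) = - bka_ j i.
rewrite /bka_ /lam; case: ifPn => im.
 rewrite /mu -mulN1r -(LfZ mio iom); last exact: fast_tame (fast_phm _ _) (bmeas_ka _).
 by apply: Lf_eq => x; rewrite (aka (pos i) x); ring.
by rewrite /mu (Lf_skew _ _ (fast_phm _ _) (fast_pp _ (levM im))).
Qed.

Lemma A0ka_skew : A0ka^T = - A0ka.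
by apply/matrixP => j k; rewrite !mxE /mu (Lf_skew _ _ (fast_phm _ _) (fast_phm _ _)).
Qed.

(** The carried functions are affine in the products [ep i * vv ep i j], so their pairings form a
    matrix of the shape treated in [det_lowrank]. *)
Lemma pairing_ep ep j k : Lf (Bep ep M) (fun x => Lf (Bep ep M) (fun y =>
  push io p (Bep ep) M (phi j) x * ka x y * push io p (Bep ep) M (phi k) y)) =
 A0ka j k + \sum_i ep i * vv ep i j * bka_ k i - \sum_i ep i * bka_ j i * vv ep i k
 + \sum_i \sum_i' ep i * ep i' * vv ep i j * vv ep i' k * Gka i i'.
have fF j' : fast om (push io p (Bep ep) M (phi j')).
 by apply: (fast_pushn mio om1 iom (Bep ep) gp); exact: goodf_fast.
have bS : bmeas (fun x => mu k (ka x) + \sum_i (ep i * vv ep i k) * lam i (ka x)).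
 by apply: bmeasD; [exact: bmeas_mu|apply: bmeas_sum => i; apply: bmeasZ; exact: bmeas_lam].
have bS2 : bmeas (fun x => \sum_i (ep i * vv ep i k) * lam i (ka x)).
 by apply: bmeas_sum => i; apply: bmeasZ; exact: bmeas_lam.
transitivity (Lf (Bep ep M) (fun x => push io p (Bep ep) M (phi j) x * (mu k (ka x) + \sum_i (ep i * vv ep i k) * lam i (ka x)))).
 apply: Lf_eq => x; rewrite -push_lam; last exact: bmeas_ka.
 rewrite -(LfZ mio iom); last exact: fast_tame (fF k) (bmeas_ka x).
 by apply: Lf_eq => y; ring.
rewrite push_lam// muD//; last exact: bmeas_mu.
rewrite mu_sum; last exact: bmeas_lam.
have -> : A0ka j k = mu j (fun x => mu k (ka x)) by rewrite mxE.
have -> : \sum_i ep i * vv ep i k * mu j (fun x => lam i (ka x)) = - \sum_i ep i * bka_ j i * vv ep i k.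
 by rewrite -sumrN; apply: eq_bigr => i _; rewrite mu_lam; ring.
have -> : \sum_i ep i * vv ep i j * lam i (fun x => mu k (ka x) + \sum_i0 ep i0 * vv ep i0 k * lam i0 (ka x)) =
  \sum_i ep i * vv ep i j * bka_ k i + \sum_i \sum_i' ep i * ep i' * vv ep i j * vv ep i' k * Gka i i'.
 rewrite -big_split /=; apply: eq_bigr => i _.
 rewrite lamD//; last exact: bmeas_mu.
 rewrite mulrDr -/(bka_ k i) lam_sum; last exact: bmeas_lam.
 congr (_ + _); rewrite mulr_sumr; apply: eq_bigr => i' _.
 by rewrite -/(Gka i i'); ring.
by rewrite addrA; congr (_ + _); rewrite addrAC.
Qed.

Lemma pairing_skew ep j k : Lf (Bep ep M) (fun x => Lf (Bep ep M) (fun y =>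
  push io p (Bep ep) M (phi j) x * ka x y * push io p (Bep ep) M (phi k) y)) =
 - Lf (Bep ep M) (fun x => Lf (Bep ep M) (fun y =>
  push io p (Bep ep) M (phi k) x * ka x y * push io p (Bep ep) M (phi j) y)).
have fF j' : fast om (push io p (Bep ep) M (phi j')).
 by apply: (fast_pushn mio om1 iom (Bep ep) gp); exact: goodf_fast.
have h j1 k1 : Lf (Bep ep M) (fun x => Lf (Bep ep M) (fun y =>
  push io p (Bep ep) M (phi j1) x * ka x y * push io p (Bep ep) M (phi k1) y)) =
 Lf (Bep ep M) (fun x => push io p (Bep ep) M (phi j1) x * Lf (Bep ep M) (fun y => push io p (Bep ep) M (phi k1) y * ka x y)).
 apply: Lf_eq => x; rewrite -(LfZ mio iom); last exact: fast_tame (fF k1) (bmeas_ka x).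
 by apply: Lf_eq => y; ring.
by rewrite !h Lf_skew.
Qed.

Definition Psi i k := phm (lev i) k (pos i).
Definition PPl i j := if (lev i < lev j)%N then pp (lev i) (lev j) (pos i) (pos j) else 0.

Lemma vvE ep i j : vv ep i j = Psi i j + \sum_k ep k * vv ep k j * PPl k i.
rewrite /vv pushE /Psi; congr (_ + _); rewrite big_mkcond; apply: eq_bigr => k _.
by rewrite /PPl; case: ifP => //; rewrite mulr0.
Qed.

Local Notation Z ep U S := (@Zst R d X io n ka I pos e phi p [::] B0 ep U S M).

Lemma Zst_pfs ep : Z ep fsetT fset0 = pfs (\matrix_(j < N, k < N)
 (A0ka j k + \sum_i ep i * vv ep i j * bka_ k i - \sum_i ep i * bka_ j i * vv ep i k
 + \sum_i \sum_i' ep i * ep i' * vv ep i j * vv ep i' k * Gka i i')).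
have eA m : Aof pos e [::] fset0 m = [::].
 by rewrite /Aof (eq_filter (a2 := pred0)) ?filter_pred0// => i; rewrite inE.
have eB m : Bof pos e B0 ep fsetT m = Bep ep m.
 by rewrite /Bof (eq_filter (a2 := predT)) ?filter_predT// => i; rewrite inE.
rewrite /Zst eA eB (_ : lvof _ _ _ _ _ _ _ _ _ = [seq (p m, [::], Bep ep m) | m <- iota 1 M]); last first.
 by apply: eq_map => m; rewrite eA eB.
rewrite (nest_pf_push mio om1 iom mka bka (Bep ep) gp)//.
by congr pfs; apply/matrixP => j k; rewrite !mxE pairing_ep mxE.
Qed.

Lemma Z_expand ep ep' : Z ep fsetT fset0 =
 \sum_(A : {set I}) (\prod_(i in A) ep i) * Z ep' fset0 A.
have sN' m : (size (e m) + size ([::] : seq X) <= N)%N by rewrite addn0.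
rewrite (@Zst_expand R d X io om mio om1 iom n ka Ck mka bka I lev pos e ue eP phi p [::] B0 gphi gp sN' ep
 fsetT fset0 M hM); last by move=> i; rewrite !inE.
apply: eq_big => [A|A _]; first by rewrite finset.subsetT.
by rewrite finset.set0U; congr (_ * _); exact: Zst_ep.
Qed.

Lemma Zst0 ep : Z ep fset0 fset0 = pfs A0ka.
transitivity (Z (fun=> 0) fsetT fset0).
 rewrite (Z_expand _ ep) (bigD1 fset0)//= big_set0 mul1r big1 ?addr0// => T T0.
 by have [i iT] := finset.set0Pn _ T0; rewrite (bigD1 i)//= mul0r mul0r.
rewrite Zst_pfs; congr pfs; apply/matrixP => j k; rewrite mxE !big1 ?subr0 ?addr0//.
- by move=> i _; rewrite big1// => i' _; rewrite !mul0r.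
- by move=> i _; rewrite !mul0r.
- by move=> i _; rewrite !mul0r.
Qed.

(** By [pfs_sq] the square of the generating function is a determinant; [kp] normalises its constant
    term to 1, which also makes [A0ka] invertible. *)
Lemma process_Tdet (kp : R) (ep0 : I -> R) : kp * pfs A0ka = 1 ->
 kp * Z ep0 fset0 fsetT = Tdet (ker_mx A0ka Psi bka_ PPl Gka).
move=> hk; pose c (T : {set I}) := kp * Z ep0 fset0 T.
have pa : pfs A0ka ^+ 2 = (2 ^ n * n`!)%:R ^+ 2 * \det A0ka by exact: pfs_sq A0ka_skew.
have dA : \det A0ka != 0.
 apply/eqP => d0; rewrite d0 mulr0 in pa; move/eqP: hk.
 by move/eqP: pa; rewrite sqrf_eq0 => /eqP ->; rewrite mulr0 eq_sym oner_eq0.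
apply: (@lowrank_Tdet R I N lev A0ka Psi bka_ PPl Gka _ _ A0ka_skew (fun ep i j => vv ep i j) c).
- by move=> i j ij; rewrite /PPl ltnNge ij.
- by rewrite unitmxE unitfE.
- by move=> ep i j; exact: vvE.
- by rewrite /c Zst0.
move=> ep.
have -> : \sum_(A : {set I}) (\prod_(i in A) ep i) * c A = kp * Z ep fsetT fset0.
 by rewrite (Z_expand ep ep0) mulr_sumr; apply: eq_bigr => A _; rewrite /c mulrCA.
rewrite Zst_pfs; set A := (\matrix_(_, _) _).
have sA : A^T = - A.
 have eA j k : A j k = Lf (Bep ep M) (fun x => Lf (Bep ep M) (fun y =>
  push io p (Bep ep) M (phi j) x * ka x y * push io p (Bep ep) M (phi k) y)) by rewrite mxE pairing_ep.
 by apply/matrixP => j k; rewrite mxE [RHS]mxE !eA; exact: pairing_skew.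
rewrite exprMn (pfs_sq sA) mulrA; congr (_ * _).
have k2 : kp ^+ 2 * ((2 ^ n * n`!)%:R ^+ 2 * \det A0ka) = 1 by rewrite -pa -exprMn hk expr1n.
by apply: (mulIf dA); rewrite mulVf// -mulrA k2.
Qed.
End Process.

(** * Limits of integrals, primitives and the sign kernel on the line *)

Section RealIntegrals.
Variable R : realType.
Local Notation leb := (@lebesgue_measure R).
Implicit Types (f F : R -> R) (x y a b L : R).
Local Notation der F f := (forall x : R, is_derive x (1 : R) F (f x)).

Lemma Ri_dct (u : nat -> R -> R) f g : (forall n, mfunT (u n)) -> mfunT f ->
 (forall x, (fun n => u n x) @ \oo --> f x) -> itg g -> (forall n x, `|u n x| <= g x) ->
 (fun n => Ri (u n)) @ \oo --> Ri f.
move=> mu mf uf ig ug.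
have [] := @dominated_convergence _ _ _ leb setT measurableT (fun n x => (u n x)%:E) (fun x => (f x)%:E) (fun x => (g x)%:E).
- by move=> n; have /measurable_EFinP := mu n.
- by have /measurable_EFinP := mf.
- by apply: aeW => x _; apply: cvg_EFin; [exact: nearW|exact: uf].
- exact: ig.
- by apply: aeW => x n _; rewrite lee_fin.
move=> i1 _ c; have iu n : itg (u n) by exact: (itg_dom (mu n) ig).
have {}c : (fun n => (Ri (u n))%:E) @ \oo --> (Ri f)%:E.
 rewrite (EFin_Ri i1) (_ : (fun n => (Ri (u n))%:E) = [sequence (\int[leb]_(x in setT) (u n x)%:E)%E]_n)//.
 by apply/funext => n; rewrite /= EFin_Ri.
by move/fine_cvgP : c => [].
Qed.

Lemma Rint_Ri D f : Rintegral leb D f = Ri (f \_ D).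
exact: Rintegral_mkcond. Qed.
Lemma measurable_patch D f : measurable D -> mfunT f -> mfunT (f \_ D).
move=> mD mf; apply/(measurable_restrictT _ _).1 => //; exact: measurable_funTS.
Qed.

Lemma itg_patch D f : measurable D -> itg f -> itg (f \_ D).
move=> mD itf; apply: (itg_dom (g := fun x => `|f x|)); last 2 first.
- exact: itg_abs.
- by move=> x; rewrite patchE; case: ifP => // _; rewrite normr0.
by apply: measurable_patch => //; exact: itg_meas.
Qed.

(** Reduces integrals over the line to compact windows, where the fundamental theorem of calculus
    applies. *)
Lemma Ri_window f : itg f -> (fun n : nat => Rintegral leb `[- n%:R, n%:R] f) @ \oo --> Ri f.
move=> itf; under eq_fun do rewrite Rint_Ri.
apply: (@Ri_dct _ _ (fun x => `|f x|)); last 2 first.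
- exact: itg_abs.
- by move=> n x; rewrite patchE; case: ifP => // _; rewrite normr0.
- by move=> n; apply: measurable_patch => //; exact: itg_meas.
- exact: itg_meas.
move=> x; apply: (@cvg_near_cst _ _ _ _ _); near=> n.
have nx : `|x| <= n%:R.
 apply: ltW; apply: lt_le_trans (archi_boundP (normr_ge0 x)) _; rewrite ler_nat.
 by near: n; exact: nbhs_infty_ge.
by rewrite patchE mem_set//= in_itv /= -ler_norml.
Unshelve. all: end_near.
Qed.

Lemma continuous_itg_itv f a b : continuous f -> leb.-integrable `[a, b] (EFin \o f).
move=> cf; apply: continuous_compact_integrable; first exact: segment_compact.
exact: continuous_subspaceT.
Qed.

Lemma der_continuous F f : der F f -> continuous F.
move=> dF x; apply: differentiable_continuous; apply/derivable1_diffP.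
exact: (@ex_derive _ _ _ _ _ _ _ (dF x)).
Qed.

Lemma ftc f F a b : a <= b -> continuous f -> der F f ->
 Rintegral leb `[a, b] f = F b - F a.
rewrite le_eqVlt => /predU1P[<-|ab] cf dF; first by rewrite set_itv1 Rintegral_set1 subrr.
have cF := der_continuous dF.
rewrite /Rintegral (@continuous_FTC2 _ f F) //.
- exact: continuous_subspaceT.
- split.
 + by move=> x _; exact: (@ex_derive _ _ _ _ _ _ _ (dF x)).
 + exact/cvg_at_right_filter/cF.
 + exact/cvg_at_left_filter/cF.
- by move=> x _; rewrite derive1E (@derive_val _ _ _ _ _ _ _ (dF x)).
Qed.

Lemma Ri_ftc f F L : continuous f -> itg f -> der F f ->
 (fun n : nat => F n%:R - F (- n%:R)) @ \oo --> L -> Ri f = L.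
move=> cf itf dF cL; apply: (cvg_unique _ (Ri_window itf)) => //.
rewrite (_ : (fun n : nat => _) = (fun n : nat => F n%:R - F (- n%:R)))//; apply/funext => n.
by apply: ftc => //; rewrite (le_trans _ (ler0n _ _))// oppr_le0.
Qed.

(** Half the sign, so that its jump is 1 and integration against it produces an antiderivative. *)
Definition hs (u : R) : R := Num.sg u / 2.

Lemma hsN u : hs (- u) = - hs u. by rewrite /hs sgrN mulNr. Qed.
Lemma hs_bound u : `|hs u| <= 1.
rewrite /hs normrM [`|2^-1|]ger0_norm ?invr_ge0//; have : `|Num.sg u| <= 1 by rewrite normr_sg; case: (_ != _).
by lra.
Qed.

Lemma measurable_hs : mfunT hs.
rewrite (_ : hs = fun u => if 0 < u then 2^-1 else if u < 0 then - 2^-1 else 0); last first.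
 by apply/funext => u; rewrite /hs; case: sgrP; rewrite ?mul0r ?mul1r ?mulN1r.
apply: measurable_fun_ifT => //; first exact: measurable_fun_ltr.
by apply: measurable_fun_ifT => //; exact: measurable_fun_ltr.
Qed.

Lemma measurable_hs_comp d (A : measurableType d) (h : A -> R) : mfunT h ->
 mfunT (fun t : A => hs (h t)).
exact: (mcomp measurable_hs). Qed.

(** The normalisation at infinity holds both for odd primitives of even functions and for decaying
    primitives, the two cases met below. *)
Lemma Ri_sgn f F y : continuous f -> itg f -> der F f ->
 (fun n : nat => F n%:R + F (- n%:R)) @ \oo --> (0 : R) -> Ri (fun x => f x * hs (y - x)) = F y.
move=> cf itf dF cL.
have ig : itg (fun x => f x * hs (y - x)).
 apply: (itg_dom (g := fun x => `|f x|)); last 2 first.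
 - exact: itg_abs.
 - by move=> x; rewrite normrM ler_piMr ?hs_bound.
 by apply: mfunM; [exact: itg_meas|apply: measurable_hs_comp; exact: measurable_funB].
apply: (cvg_unique _ (Ri_window ig)) => //.
have c2 : (fun n : nat => F y - (F n%:R + F (- n%:R)) / 2) @ \oo --> F y.
 rewrite -[X in _ --> X]subr0 -[X in _ - X](mul0r 2^-1).
 by apply: cvgB; [exact: cvg_cst|apply: cvgM => //; exact: cvg_cst].
apply: (cvg_eq_near c2) => {c2}; near=> n.
have nx : `|y| < n%:R.
 apply: lt_le_trans (archi_boundP (normr_ge0 y)) _; rewrite ler_nat.
 by near: n; exact: nbhs_infty_ge.
move: nx; rewrite ltr_norml => /andP[ny yn].
have i1 : leb.-integrable `[- n%:R, n%:R] (EFin \o (fun x => f x * hs (y - x))).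
 exact: (integrableS measurableT _ _ ig).
have e1 : Rintegral leb `[- n%:R, y] (fun x => f x * hs (y - x)) = 2^-1 * (F y - F (- n%:R)).
 rewrite -Rintegral_itv_bndo_bndc; last by apply: (integrableS measurableT _ _ ig).
 transitivity (Rintegral leb `[- n%:R, y[ (fun x => 2^-1 * f x)).
  apply: eq_Rintegral => x; rewrite inE /= in_itv /= => /andP[_ xy]; rewrite /hs gtr0_sg ?subr_gt0//.
  by rewrite mul1r mulrC.
 rewrite Rintegral_itv_bndo_bndc; last first.
  by apply: (integrableS measurableT _ _ (itgZ _ itf)).
 rewrite RintegralZl//; last exact: continuous_itg_itv.
 by rewrite (ftc (ltW ny) cf dF).
have e2 : Rintegral leb `]y, n%:R] (fun x => f x * hs (y - x)) = - 2^-1 * (F n%:R - F y).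
 transitivity (Rintegral leb `]y, n%:R] (fun x => - 2^-1 * f x)).
  apply: eq_Rintegral => x; rewrite inE /= in_itv /= => /andP[xy _]; rewrite /hs ltr0_sg ?subr_lt0//.
  by rewrite mulN1r mulrC.
 rewrite Rintegral_itv_obnd_cbnd; last first.
  by apply: (integrableS measurableT _ _ (itgZ _ itf)).
 rewrite RintegralZl//; last exact: continuous_itg_itv.
 by rewrite (ftc (ltW yn) cf dF).
have := Rintegral_itvB i1 (x := y); rewrite e1 e2 !bnd_simp (ltW ny) (ltW yn) => /(_ isT isT).
move=> /eqP; rewrite subr_eq => /eqP ->; lra.
Unshelve. all: end_near.
Qed.

Definition prim f x : R := if 0 <= x then Rintegral leb `[0, x] f else - Rintegral leb `[x, 0] f.

Lemma primE f F x : continuous f -> der F f -> prim f x = F x - F 0.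
move=> cf dF; rewrite /prim; case: ifPn => x0; first exact: ftc.
by rewrite (@ftc f F)// ?opprB//; rewrite ltW// ltNge.
Qed.

Lemma der_prim f x : continuous f -> is_derive x (1 : R) (prim f) (f x).
(* With a fixed lower end [a] to the left of both 0 and [x], the primitive needs no case distinction
   and differs from [prim] by a constant near [x]. *)
move=> cf; pose a := - `|x| - 1; pose F y := Rintegral leb `[a, y] f.
have a0 : a < 0 by rewrite /a; have := normr_ge0 x; lra.
have ax y : `|y - x| < 1 -> a <= y.
 rewrite ltr_norml => /andP[h1 h2]; rewrite /a.
 have nx : - x <= `|x| by rewrite -normrN ler_norm.
 lra.
have nx : - x <= `|x| by rewrite -normrN ler_norm.
have axx : a < x by rewrite /a; lra.
have x1 : x < x + 1 by rewrite ltrDl.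
have [dF FE] := @continuous_FTC1_closed _ f a x (x + 1) x1 (continuous_itg_itv a _ cf) axx (cf x).
have split b c : a <= b -> b <= c -> F c - F b = Rintegral leb `[b, c] f.
 move=> ab bc; rewrite /F (Rintegral_itvB (x := b)) ?bnd_simp//; last exact: continuous_itg_itv.
 rewrite Rintegral_itv_obnd_cbnd//.
 apply: (integrableS _ _ _ (continuous_itg_itv b c cf)) => //; exact: subset_itv_oc_cc.
have eP y : a <= y -> prim f y = F y - F 0.
 move=> ay; rewrite /prim; case: ifPn => y0; first by rewrite split// ltW.
 by rewrite -split// ?opprB// ltW// ltNge.
have dF' : is_derive x (1 : R) F (f x) by rewrite -FE derive1E; exact: DeriveDef.
have dG : is_derive x (1 : R) (fun y => F y - F 0) (f x).
 by rewrite -[f x]subr0; apply: is_deriveB.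
have near_e : \forall y \near x, F y - F 0 = prim f y.
 near=> y; rewrite eP// ax// distrC; near: y; apply: cvgr_dist_lt => //; exact: cvg_id.
exact: near_eq_is_derive near_e dG.
Unshelve. all: end_near.
Qed.

Lemma prim0 f : prim f 0 = 0.
by rewrite /prim lexx set_itv1 Rintegral_set1. Qed.

Lemma is_derive_opp_arg F (df : R) (x : R) : is_derive (- x) (1 : R) F df -> is_derive x (1 : R) (fun y => F (- y)) (- df).
move=> dF; rewrite -mulrN1 -[X in X * _]/(df).
rewrite (_ : (fun y => F (- y)) = F \o -%R)// mulrC.
have h : is_derive x (1 : R) (-%R : R -> R) (- 1) by apply: is_deriveN.
have := @is_derive1_comp _ F -%R x df (-1) dF h.
by rewrite mulrC.
Qed.

Lemma primN f x : continuous f -> (forall x, f (- x) = f x) -> prim f (- x) = - prim f x.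
move=> cf ef; suff : prim f x = - prim f (- x) by move=> ->; rewrite opprK.
transitivity (- prim f (- x) - - prim f (- 0)); last by rewrite oppr0 prim0 oppr0 subr0.
apply: (@primE f (fun x => - prim f (- x))) => // z; rewrite -[f z]opprK -ef; apply: is_deriveN; apply: is_derive_opp_arg; exact: der_prim.
Qed.

Lemma Ri_sgn_even f y : continuous f -> itg f -> (forall x, f (- x) = f x) ->
 Ri (fun x => f x * hs (y - x)) = prim f y.
move=> cf itf ef; apply: Ri_sgn => // [x|]; first exact: der_prim.
by under eq_fun do rewrite primN// subrr; exact: cvg_cst.
Qed.

Lemma Ri_odd f : continuous f -> itg f -> (forall x, f (- x) = - f x) -> Ri f = 0.
move=> cf itf of_; apply: (@Ri_ftc f (prim f)) => // [x|]; first exact: der_prim.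
under eq_fun => n.
 have -> : prim f (- n%:R) = prim f n%:R.
  transitivity (prim f (- n%:R) - prim f (- 0)); first by rewrite oppr0 prim0 subr0.
  apply/esym; apply: (@primE f (fun x => prim f (- x))) => // z.
  rewrite -[f z]opprK -of_; apply: is_derive_opp_arg; exact: der_prim.
 rewrite subrr; over.
exact: cvg_cst.
Qed.
End RealIntegrals.

(** * Rapid decay and Gaussian integrals *)

Section Gaussian.
Variable R : realType.
Local Notation der F f := (forall x : R, is_derive x (1 : R) F (f x)).
Implicit Types (f F : R -> R) (x y t : R) (p : {poly R}).

Definition omr x : R := 1 + x ^+ 2.
Local Notation sfast := (fast omr).

Lemma omr_ge1 x : 1 <= omr x. by rewrite lerDl sqr_ge0. Qed.
Lemma omr_gt0 x : 0 < omr x. exact: lt_le_trans (omr_ge1 x). Qed.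
Lemma omr_ge0 x : 0 <= omr x. exact/ltW/omr_gt0. Qed.
Local Hint Resolve omr_ge1 omr_gt0 omr_ge0 : core.

Lemma measurable_omr : mfunT omr.
by apply: measurable_funD => //; exact: measurable_funX. Qed.

Lemma sfast_itg f : sfast f -> itg f.
move=> ff; have [mf _] := ff; have [C [C0 h]] := fast_le omr_ge1 1 ff.
apply: (itg_dom (g := fun x => C * (1 + x ^+ 2)^-1)) => //; by apply: itgZ; exact: itg_cauchy.
Qed.

Lemma sfastD f g : sfast f -> sfast g -> sfast (fun x => f x + g x).
move=> [mf hf] [mg hg]; split; first exact: measurable_funD.
move=> r; have [C [C0 h]] := hf r; have [D [D0 k]] := hg r; exists (C + D); split; first exact: addr_ge0.
by move=> x; rewrite (le_trans (ler_wpM2r _ (ler_normD _ _))) ?exprn_ge0// mulrDl lerD.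
Qed.

Lemma sfastZ c f : sfast f -> sfast (fun x => c * f x).
move=> [mf hf]; split; first exact: mfunM.
move=> r; have [C [C0 h]] := hf r; exists (`|c| * C); split; first exact: mulr_ge0.
by move=> x; rewrite normrM -mulrA ler_wpM2l.
Qed.

Lemma sfast_poly p f : sfast f -> sfast (fun x => p.[x] * f x).
move=> ff; elim/poly_ind: p => [|p c IH].
 by under eq_fun do rewrite horner0; exact: sfastZ.
rewrite (_ : (fun x => _) = (fun x => x * (p.[x] * f x) + c * f x)); last first.
 by apply/funext => x; rewrite hornerMXaddC; ring.
apply: sfastD; last exact: sfastZ.
have [mg hg] := IH; split; first exact: mfunM.
move=> r; have [C [C0 h]] := hg r.+1; exists C; split=> // x.
apply: le_trans (h x); rewrite normrM -mulrA exprS [leRHS]mulrCA.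
apply: ler_wpM2r; first by rewrite mulr_ge0// exprn_ge0.
by rewrite /omr -real_normK ?num_real//; have := sqr_ge0 (`|x| - 1); have := normr_ge0 x; nra.
Qed.

Lemma sfast_cvg0 f : sfast f -> (fun n : nat => f n%:R) @ \oo --> 0 /\ (fun n : nat => f (- n%:R)) @ \oo --> 0.
move=> ff; have [C [C0 h]] := fast_le omr_ge1 1 ff.
have c0 : (fun n : nat => C * (n.+1%:R)^-1) @ \oo --> (0 : R).
 by rewrite -[X in _ --> X](mulr0 C); apply: cvgM; [exact: cvg_cst|exact: cvg_harmonic].
have b (e : bool) n : `|f ((-1) ^+ e * n%:R)| <= C * (n.+1%:R)^-1.
 apply: (le_trans (h _)); rewrite expr1 ler_wpM2l// lef_pV2 ?posrE//.
 rewrite /omr exprMn sqrr_sign mul1r -natrX -[1 in leRHS]/(1%:R) -natrD ler_nat add1n ltnS.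
 by case: n => // n; rewrite leq_pmulr.
split; apply/norm_cvg0P; apply: (squeeze_cvgr _ _ c0 (cvg_cst 0)) || idtac.
all: try (apply: (@squeeze_cvgr _ _ _ _ (fun=> 0) (fun n => C * (n.+1%:R)^-1)) => //; last exact: cvg_cst).
- by apply: nearW => n; rewrite normr_ge0 /=; have := b false n; rewrite mul1r.
- by apply: nearW => n; rewrite normr_ge0 /=; have := b true n; rewrite expr1 mulN1r.
Qed.

Lemma Ri_deriv0 f F : continuous f -> sfast f -> sfast F -> der F f -> Ri f = 0.
move=> cf ff fF dF; apply: (@Ri_ftc _ f F) => //; first exact: sfast_itg.
have [h1 h2] := sfast_cvg0 fF; rewrite -[X in _ --> X](subrr 0); exact: cvgB.
Qed.

Definition ga t x : R := (2 * pi * t) `^ (- 2^-1) * expR (- x ^+ 2 / (2 * t)).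
Lemma ptdE t x y : ptd t x y = ga t (x - y). by []. Qed.
Lemma gaN t x : ga t (- x) = ga t x. by rewrite /ga sqrrN. Qed.
Lemma ga_gt0 t x : 0 < t -> 0 < ga t x.
by move=> t0; rewrite mulr_gt0 ?expR_gt0// powR_gt0// !mulr_gt0 ?pi_gt0. Qed.

Lemma der_ga t x : 0 < t -> is_derive x (1 : R) (ga t) (- (x / t) * ga t x).
move=> t0; rewrite /ga.
have dq : is_derive x (1 : R) (fun x => - x ^+ 2 / (2 * t)) (- (x / t)).
 rewrite (_ : (fun x => _) = (fun x => (- (2 * t)^-1) *: (x ^+ 2))); last by apply/funext => z; rewrite /GRing.scale /=; ring.
 apply: is_derive_eq; rewrite /GRing.scale /=; field; exact: lt0r_neq0.
have de := @is_derive1_comp _ expR (fun x => - x ^+ 2 / (2 * t)) x _ _ (is_derive_expR _) dq.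
have := is_deriveZ ((2 * pi * t) `^ (- 2^-1)) de.
by move=> d1; apply: is_derive_eq; rewrite /GRing.scale /=; ring.
Qed.

Lemma continuous_ga t : 0 < t -> continuous (ga t).
by move=> t0; apply: (@der_continuous _ _ (fun x => - (x / t) * ga t x)) => x; exact: der_ga. Qed.
Lemma continuous_polyM p f : continuous f -> continuous (fun x => p.[x] * f x).
by move=> cf x; apply: cvgM; [exact: continuous_horner|exact: cf]. Qed.

Lemma sfast_ga t : 0 < t -> sfast (ga t).
move=> t0; split; first by apply: continuous_mfun; exact: continuous_ga.
move=> r; pose P := (2 * pi * t) `^ (- 2^-1); have P0 : 0 <= P by exact: powR_ge0.
have t20 : 0 < 2 * t by rewrite mulr_gt0.
(* The constant comes from the Taylor bound u^(r+1) / (r+1)! <= exp u at u = (1 + x^2) / (2t). *)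
exists (P * ((r.+1)`!%:R * (2 * t) ^+ r.+1 * expR (2 * t)^-1)); split.
 by rewrite !mulr_ge0 ?expR_ge0// exprn_ge0// ltW.
move=> x; rewrite ger0_norm; last exact/ltW/ga_gt0.
rewrite /ga -/P -[leLHS]mulrA; apply: ler_wpM2l => //.
rewrite (_ : - x ^+ 2 / (2 * t) = (2 * t)^-1 - omr x / (2 * t)); last by rewrite /omr; field; exact: lt0r_neq0.
rewrite expRB mulrAC [leRHS]mulrC -mulrA ler_wpM2l ?expR_ge0// ler_pdivrMr ?expR_gt0//.
have u0 : 0 <= omr x / (2 * t) by rewrite divr_ge0// ltW.
have := expR_ge1Dxn r u0 => h.
apply: (@le_trans _ _ (omr x ^+ r.+1)); first by rewrite exprS ler_peMl// exprn_ge0.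
rewrite -ler_pdivrMl; last by rewrite mulr_gt0// ?ltr0n ?fact_gt0// exprn_gt0.
apply: le_trans h; rewrite [X in _ <= _ + X](_ : _ = ((r.+1)`!%:R * (2 * t) ^+ r.+1)^-1 * omr x ^+ r.+1).
 by rewrite lerDr.
by rewrite expr_div_n invfM; ring.
Qed.

(** Peetre's inequality, which makes rapid decay invariant under translation. *)
Lemma omr_shift x y : omr x <= 2 * omr y * omr (x - y).
by rewrite /omr; have := sqr_ge0 (x - 2 * y); have := sqr_ge0 (y * (x - y)); nra. Qed.

Lemma sfast_shift f y : sfast f -> sfast (fun x => f (x - y)).
move=> [mf hf]; split; first by apply: (mcomp mf); exact: measurable_funB.
move=> r; have [C [C0 h]] := hf r; exists (C * (2 * omr y) ^+ r); split.
 by rewrite mulr_ge0// exprn_ge0// mulr_ge0.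
move=> x; apply: (@le_trans _ _ (`|f (x - y)| * (2 * omr y * omr (x - y)) ^+ r)).
 rewrite ler_wpM2l// lerXn2r ?nnegrE ?mulr_ge0//; exact: omr_shift.
by rewrite exprMn mulrCA mulrC ler_wpM2r// exprn_ge0// mulr_ge0.
Qed.

Lemma Ri_ga t y : 0 < t -> Ri (fun x => ga t (x - y)) = 1.
move=> t0; pose s := sqrt t; have s0 : s != 0 by rewrite gt_eqF// sqrtr_gt0.
have ss : s ^+ 2 = t by rewrite sqr_sqrtr// ltW.
have e : (fun x => ga t (x - y)) = normal_pdf y s.
 apply/funext => x; rewrite normal_pdfE// /ga /normal_peak /normal_fun ss.
 rewrite powRN powR12_sqrt; last by rewrite !mulr_ge0 ?pi_ge0// ltW.
 by congr (_^-1 * expR (_ / _)); [congr sqrt|]; ring.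
by rewrite e /Ri /Rintegral integral_normal_pdf.
Qed.

Definition Eg v mu p : R := Ri (fun x => p.[x] * ga v (x - mu)).

Section Expectation.
Variables (v mu : R).
Hypothesis v0 : 0 < v.

Lemma sfast_gas : sfast (fun x => ga v (x - mu)). exact/sfast_shift/sfast_ga. Qed.

Lemma EgD p q : Eg v mu (p + q) = Eg v mu p + Eg v mu q.
rewrite /Eg -RiD; [|exact/sfast_itg/sfast_poly/sfast_gas|exact/sfast_itg/sfast_poly/sfast_gas].
by apply: Ri_eq => x; rewrite hornerD mulrDl.
Qed.

Lemma EgZ c p : Eg v mu (c *: p) = c * Eg v mu p.
rewrite /Eg -RiZ; last exact/sfast_itg/sfast_poly/sfast_gas.
by apply: Ri_eq => x; rewrite hornerZ; ring.
Qed.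

Lemma Eg1 : Eg v mu 1 = 1.
by rewrite /Eg -[RHS](Ri_ga mu v0); apply: Ri_eq => x; rewrite hornerC mul1r. Qed.
Lemma continuous_gas : continuous (fun x => ga v (x - mu)).
by move=> x; apply: (@continuous_comp _ _ _ (fun x => x - mu)); [apply: cvgB => //; exact: cvg_cst|exact: continuous_ga]. Qed.

Lemma der_gas x : is_derive x (1 : R) (fun x => ga v (x - mu)) (- ((x - mu) / v) * ga v (x - mu)).
have dq : is_derive x (1 : R) (fun x => x - mu) 1 by apply: is_derive_eq; rewrite subr0.
have := @is_derive1_comp _ (ga v) (fun x => x - mu) x _ _ (der_ga _ v0) dq.
by rewrite mulr1.
Qed.

(** Gaussian integration by parts: the derivative of [p] times the density has integral 0. *)
Lemma Eg_stein p : Eg v mu ('X * p) = mu * Eg v mu p + v * Eg v mu p^`().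
suff h : Eg v mu (p^`() + (- v^-1) *: (('X - mu%:P) * p)) = 0.
 move: h; rewrite EgD EgZ mulrBl EgD -mulNr -polyCN mul_polyC EgZ => /eqP.
 move=> /eqP h; have : v * (Eg v mu p^`() + - v^-1 * (Eg v mu ('X * p) + - mu * Eg v mu p)) = 0 by rewrite h mulr0.
 by rewrite mulrDr mulrA mulrN mulfV ?gt_eqF// mulN1r; lra.
apply: (@Ri_deriv0 _ (fun x => p.[x] * ga v (x - mu))).
- exact/continuous_polyM/continuous_gas.
- exact/sfast_poly/sfast_gas.
- exact/sfast_poly/sfast_gas.
move=> x; have d1 := is_deriveM (is_derive_poly p x) (der_gas x).
apply: is_derive_eq; rewrite /GRing.scale /= hornerD hornerZ hornerM hornerD hornerN hornerX hornerC.
by ring.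
Qed.
End Expectation.
End Gaussian.

(** * Hermite functions under the heat flow *)

Section Hermite.
Variable R : realType.
Variable T : R.
Hypothesis T0 : 0 < T.
Local Notation sfast := (fast (@omr R)).
Implicit Types (t x y : R) (q : {poly R}) (j : nat).

(* Rescaled Hermite polynomials: [yp t j * ga t] is the image of the [j]-th Hermite function
  orthogonal at time [T] under the heat flow, for all times [t] simultaneously. *)
Fixpoint yp2 t j : {poly R} * {poly R} :=
 if j is j'.+1 then
  ((yp2 t j').2, (- (2 * T / t)) *: ('X * (yp2 t j').2 + ((2 * T - t) * j'.+1%:R) *: (yp2 t j').1))
 else (1, (- (2 * T / t)) *: 'X).
Definition yp t j := (yp2 t j).1.

Lemma ypS t j : yp t j.+1 = (- (2 * T / t)) *: ('X * yp t j + ((2 * T - t) * j%:R) *: yp t j.-1).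
case: j => [|j]; rewrite /yp /=; first by rewrite mulr0 scale0r addr0 mulr1.
by case: j.
Qed.

Lemma yp0 t : yp t 0 = 1. by []. Qed.

Lemma deriv_yp t j : (yp t j)^`() = (- (2 * T / t) * j%:R) *: yp t j.-1.
suff h k : forall j, (j <= k)%N -> (yp t j)^`() = (- (2 * T / t) * j%:R) *: yp t j.-1 by exact: (h j).
elim: k => [|k IH] [|{}j] //; rewrite ?yp0 ?derivC ?mulr0 ?scale0r// => jk.
rewrite ypS derivZ derivD derivM derivX mul1r derivZ !IH//; last by rewrite (leq_trans (leq_pred _)).
rewrite -!scalerA; congr (_ *: _).
case: j jk => [|j] jk /=; first by rewrite !scale0r !scaler0 mulr0 !addr0 scale1r.
have -> : j.+2%:R = 1 + j.+1%:R :> R by rewrite -[LHS]natr1 addrC.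
rewrite [in RHS]scalerDl scale1r -addrA; congr (_ + _); rewrite ypS /=.
by rewrite -!scalerAr !scalerDr !scalerA; congr (_ *: _ + _ *: _); ring.
Qed.

Lemma ypN t j x : (yp t j).[- x] = (-1) ^+ j * (yp t j).[x].
suff h k : forall j, (j <= k)%N -> (yp t j).[- x] = (-1) ^+ j * (yp t j).[x] by exact: (h j).
elim: k => [|k IH] [|{}j] //; rewrite ?yp0 ?hornerC ?mulr1// => jk.
rewrite ypS !(hornerZ, hornerD, hornerM, hornerX) !IH//; last by rewrite (leq_trans (leq_pred _)).
by case: j jk => [|j] jk /=; rewrite ?mulr0 !exprS; ring.
Qed.

Definition gj t j x : R := (yp t j).[x] * ga t x.
Lemma gjN t j x : gj t j (- x) = (-1) ^+ j * gj t j x.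
by rewrite /gj ypN gaN; ring. Qed.
Lemma sfast_gj t j : 0 < t -> sfast (gj t j).
by move=> t0; apply/sfast_poly/sfast_ga. Qed.
Lemma continuous_gj t j : 0 < t -> continuous (gj t j).
by move=> t0; apply/continuous_polyM/continuous_ga. Qed.
(** The derivative of [gj t j] is a combination of its two neighbours with coefficients independent
    of [t]; it therefore follows the heat flow as well. *)
Definition dgj t j x := gj t j.+1 x / (2 * T) - j%:R * gj t j.-1 x.

Lemma der_gj t j x : 0 < t -> is_derive x (1 : R) (gj t j) (dgj t j x).
move=> t0; have d1 := is_deriveM (is_derive_poly (yp t j) x) (der_ga x t0).
apply: is_derive_eq; rewrite /GRing.scale /= /dgj /gj deriv_yp ypS !(hornerZ, hornerD, hornerM, hornerX).
by field; rewrite !gt_eqF.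
Qed.

Lemma sfast_dgj t j : 0 < t -> sfast (dgj t j).
move=> t0; rewrite (_ : dgj t j = fun x => (2 * T)^-1 * gj t j.+1 x + (- j%:R) * gj t j.-1 x).
 by apply: sfastD; apply: sfastZ; exact: sfast_gj.
by apply/funext => x; rewrite /dgj; ring.
Qed.

Lemma continuous_dgj t j : 0 < t -> continuous (dgj t j).
move=> t0 x; apply: cvgB; apply: cvgM; try exact: cvg_cst; exact: continuous_gj.
Qed.
Lemma dgjN t j x : dgj t j (- x) = - (-1) ^+ j * dgj t j x.
by rewrite /dgj !gjN; case: j => [|j] /=; rewrite ?mul0r ?mulr0 !exprS; ring. Qed.

(** Completing the square: the density at [y] after time t + tau times that of the Brownian bridge
    at time t. *)
Lemma ga_mul t tau x y : 0 < t -> 0 < tau ->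
 ga t x * ga tau (x - y) = ga (t + tau) y * ga (t * tau / (t + tau)) (x - t * y / (t + tau)).
move=> t0 u0; have s0 : 0 < t + tau by exact: addr_gt0.
have v0 : 0 < t * tau / (t + tau) by rewrite divr_gt0// mulr_gt0.
have P s : 0 < s -> 0 <= 2 * pi * s by move=> h; rewrite !mulr_ge0 ?pi_ge0// ltW.
rewrite /ga mulrACA -expRD -powRM ?P// [RHS]mulrACA -expRD -powRM ?P//.
have p0 : (pi : R) != 0 by rewrite gt_eqF// pi_gt0.
congr (_ `^ _ * expR _); first by field; rewrite gt_eqF.
by field; rewrite !gt_eqF.
Qed.

(** Gaussian integration by parts turns the recursion at time t, averaged over the bridge, into the
    recursion at time t + tau. *)
Lemma Eg_yp t tau y j : 0 < t -> 0 < tau ->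
 Eg (t * tau / (t + tau)) (t * y / (t + tau)) (yp t j) = (yp (t + tau) j).[y].
move=> t0 u0; have s0 : 0 < t + tau by exact: addr_gt0.
have v0 : 0 < t * tau / (t + tau) by rewrite divr_gt0// mulr_gt0.
suff h k : forall j, (j <= k)%N -> Eg (t * tau / (t + tau)) (t * y / (t + tau)) (yp t j) = (yp (t + tau) j).[y].
 exact: (h j).
elim: k => [|k IH] [|{}j] //; rewrite ?yp0 ?Eg1 ?hornerC// => jk.
rewrite ypS EgZ// EgD// EgZ// Eg_stein// deriv_yp EgZ// !IH//; last first.
 by rewrite (leq_trans (leq_pred _)).
rewrite ypS !(hornerZ, hornerD, hornerM, hornerX).
by field; rewrite !gt_eqF.
Qed.

Lemma gj_conv t tau j y : 0 < t -> 0 < tau -> Ri (fun x => gj t j x * ga tau (y - x)) = gj (t + tau) j y.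
move=> t0 u0; have s0 : 0 < t + tau by exact: addr_gt0.
have v0 : 0 < t * tau / (t + tau) by rewrite divr_gt0// mulr_gt0.
rewrite /gj -Eg_yp// [RHS]mulrC /Eg -RiZ; last exact/sfast_itg/sfast_poly/sfast_gas.
apply: Ri_eq => x; rewrite -[ga tau _]gaN opprB -[LHS]mulrA ga_mul//; ring.
Qed.

(** The integral of [gj t a.*2], the same for all t because the heat flow preserves mass. *)
Definition mj a : R := \prod_(i < a) (2 * T * (i.*2.+1)%:R).

Lemma Ri_gj_even t a : 0 < t -> Ri (gj t a.*2) = mj a.
move=> t0; have e j : Ri (gj t j) = Eg t 0 (yp t j).
 by apply: Ri_eq => x; rewrite subr0.
rewrite e; elim: a => [|a IH]; first by rewrite yp0 Eg1// /mj big_ord0.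
rewrite doubleS ypS EgZ// EgD// EgZ// Eg_stein// deriv_yp EgZ// /= IH /mj big_ord_recr /=.
by field; rewrite gt_eqF.
Qed.

(** The squared norm of [gj T a.*2]. *)
Definition hj a : R := (a.*2)`!%:R * (2 * T) ^+ a.*2 * ga (2 * T) 0.

(** The product of two densities at time T is a multiple of the density of variance T/2, for which
    the [yp T] are orthogonal: each integration by parts lowers both indices by one. *)
Lemma Eg_ypM a b : Eg (T / 2) 0 (yp T a * yp T b) = (a == b)%:R * (a`!%:R * (2 * T) ^+ a).
have v0 : 0 < T / 2 by rewrite divr_gt0.
have step j q : Eg (T / 2) 0 (yp T j.+1 * q) = - T * Eg (T / 2) 0 (yp T j * q^`()).
 have -> : yp T j.+1 * q = (- (2 * T / T)) *: ('X * (yp T j * q) + ((2 * T - T) * j%:R) *: (yp T j.-1 * q)).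
  by rewrite ypS -(scalerAl (- (2 * T / T))) [('X * _ + _) * q]mulrDl -(scalerAl ((2 * T - T) * j%:R)) mulrA.
 rewrite EgZ// EgD// Eg_stein// derivM deriv_yp -(scalerAl (- (2 * T / T) * j%:R)) EgD// !EgZ//.
 by field; rewrite gt_eqF.
have E0 : Eg (T / 2) 0 (0 : {poly R}) = 0.
 by rewrite -[X in Eg _ _ X](scale0r (0 : {poly R})) EgZ// mul0r.
elim: a b => [|a IH] [|b].
- by rewrite yp0 mulr1 Eg1// eqxx fact0 expr0 !mulr1.
- by rewrite [yp T 0 * _]mulrC step yp0 derivC [_ * 0]mulr0 E0 mulr0 mul0r.
- by rewrite step yp0 derivC [_ * 0]mulr0 E0 mulr0 mul0r.
rewrite step deriv_yp -scalerAr EgZ// IH eqSS; case: eqP => [->|_]; last by rewrite !mul0r !mulr0.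
by rewrite factS natrM exprS; field; rewrite gt_eqF.
Qed.

Lemma Ri_gjM a b : Ri (fun x => gj T a.*2 x * gj T b.*2 x) = (a == b)%:R * hj a.
have v0 : 0 < T / 2 by rewrite divr_gt0.
have g2 x : ga T x * ga T x = ga (2 * T) 0 * ga (T / 2) x.
 have := @ga_mul T T x 0 T0 T0; rewrite subr0 mulr0 mul0r subr0 => ->.
 by congr (ga _ _ * ga _ _); field; rewrite ?gt_eqF// addr_gt0.
transitivity (ga (2 * T) 0 * Eg (T / 2) 0 (yp T a.*2 * yp T b.*2)).
 rewrite /Eg -RiZ; last exact/sfast_itg/sfast_poly/sfast_gas.
 by apply: Ri_eq => x; rewrite /gj mulrACA g2 hornerM subr0; ring.
by rewrite Eg_ypM (inj_eq double_inj) /hj; ring.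
Qed.

Lemma hj_gt0 a : 0 < hj a.
by rewrite /hj mulr_gt0 ?ga_gt0 ?mulr_gt0 ?exprn_gt0 ?ltr0n ?fact_gt0// mulr_gt0. Qed.
Lemma mj_gt0 a : 0 < mj a.
by apply: prodr_gt0 => i _; rewrite !mulr_gt0. Qed.
End Hermite.

(** * The sign kernel smoothed by the heat flow *)

Section SmoothedSign.
Variable R : realType.
Local Notation leb := (@lebesgue_measure R).
Local Notation der F f := (forall x : R, is_derive x (1 : R) F (f x)).
Local Notation sfast := (fast (@omr R)).
Implicit Types (tau x y a : R) (f F : R -> R).
Let og1 := @omr_ge1 R. Let og := @omr_gt0 R. Let og0 := @omr_ge0 R.
Local Hint Resolve og1 og og0 : core.

Lemma continuous_sub f a : continuous f -> continuous (fun x => f (x - a)).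
move=> cf x; apply: (@continuous_comp _ _ _ (fun x => x - a)); last exact: cf.
by apply: cvgB; [exact: cvg_id|exact: cvg_cst].
Qed.

Lemma continuous_rsub f a : continuous f -> continuous (fun x => f (a - x)).
move=> cf x; apply: (@continuous_comp _ _ _ (fun x => a - x)); last exact: cf.
by apply: cvgB; [exact: cvg_cst|exact: cvg_id].
Qed.

Lemma itg_indic a b : itg (\1_(`[a, b]%classic : set R) : R -> R).
rewrite (_ : \1_ _ = (fun=> (1 : R)) \_ `[a, b]%classic); last first.
 by apply/funext => w; rewrite patch_indic /= mul1r.
rewrite /itg -restrict_EFin.
by apply/(integrable_mkcond _ _).1 => //; apply: (continuous_itg_itv a b); exact: cst_continuous.
Qed.

(** By the mean value theorem the difference is [a] times a value of [f] near [n], which decays. *)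
Lemma prim_shift_cvg f a : continuous f -> sfast f ->
 (fun n : nat => prim f (n%:R + a) - prim f n%:R) @ \oo --> 0.
move=> cf ff; have [C [C0 h]] := fast_le (@omr_ge1 R) 1 ff.
have c0 : (fun n : nat => `|a| * (2 * omr a * C) * (n.+1%:R)^-1) @ \oo --> (0 : R).
 by rewrite -[X in _ --> X](mulr0 (`|a| * (2 * omr a * C))); apply: cvgM; [exact: cvg_cst|exact: cvg_harmonic].
have key (n : nat) b c : `|c - n%:R| <= `|b| -> omr b <= omr a -> `|f c| <= 2 * omr a * C * (n.+1%:R)^-1.
 move=> cn ba; apply: (le_trans (h _)); rewrite expr1.
 have h1 : n.+1%:R <= omr n%:R :> R.
  rewrite /omr -natrX -[1 in leRHS]/(1%:R) -natrD ler_nat add1n ltnS.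
  by case: n {cn} => // n; rewrite leq_pmulr.
 have h2 : omr n%:R <= 2 * omr c * omr a.
  apply: (le_trans (omr_shift _ c)); apply: ler_wpM2l; first by rewrite mulr_ge0.
  apply: le_trans ba.
  by rewrite /omr lerD2l -[leLHS]real_normK ?num_real// -[leRHS]real_normK ?num_real// distrC lerXn2r ?nnegrE.
 rewrite ler_pdivrMr// (_ : _ * omr c = C * (2 * omr c * omr a / n.+1%:R)); last by ring.
 by rewrite ler_peMr// ler_pdivlMr ?ltr0n// mul1r (le_trans h1).
apply/norm_cvg0P; apply: (@squeeze_cvgr _ _ _ _ (fun=> 0) (fun n : nat => `|a| * (2 * omr a * C) * (n.+1%:R)^-1)) => //; last exact: cvg_cst.
apply: nearW => n; rewrite normr_ge0 /=.
have mvt b c : b <= c -> exists2 z, b <= z <= c & prim f c - prim f b = f z * (c - b).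
 move=> bc; have [||z zi e] := @MVT_segment _ (prim f) f b c bc.
 - by move=> z _; exact: der_prim.
 - apply: continuous_subspaceT; apply: der_continuous => z; exact: der_prim.
 by exists z => //; move: zi; rewrite in_itv.
have [a0|a0] := leP 0 a.
 have [|z /andP[z1 z2] ->] := mvt n%:R (n%:R + a); first by rewrite lerDl.
 rewrite addrAC subrr add0r normrM [leRHS](_ : _ = 2 * omr a * C * (n.+1%:R)^-1 * `|a|); last by ring.
 rewrite ler_wpM2r// (key n a)// !ger0_norm ?subr_ge0//; lra.
have [|z /andP[z1 z2] e] := mvt (n%:R + a) n%:R; first by rewrite gerDl ltW.
rewrite distrC e opprD addNKr normrM normrN [leRHS](_ : _ = 2 * omr a * C * (n.+1%:R)^-1 * `|a|); last by ring.
rewrite ler_wpM2r// (key n a)// (ltr0_norm a0) (ler0_norm (_ : z - n%:R <= 0)) ?subr_le0//; lra.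
Qed.

(** Translation invariance through primitives: shifting the window changes the primitive at its two
    ends by quantities that tend to 0. *)
Lemma Ri_shift f a : continuous f -> sfast f -> Ri (fun x => f (x - a)) = Ri f.
move=> cf ff.
have itf := sfast_itg ff.
have itfa := sfast_itg (sfast_shift a ff).
have w := Ri_window itf; have e (n : nat) : Rintegral leb `[- n%:R, n%:R] f = prim f n%:R - prim f (- n%:R).
 apply: ftc => //; first by rewrite (le_trans _ (ler0n _ _))// oppr_le0.
 by move=> x; exact: der_prim.
have ew : (fun n : nat => Rintegral leb `[- n%:R, n%:R] f) = fun n : nat => prim f n%:R - prim f (- n%:R) by exact/funext.
rewrite ew in w.
apply: (@Ri_ftc _ _ (fun x => prim f (x - a))); [exact: continuous_sub|exact: itfa| |].
- move=> x; have dq : is_derive x (1 : R) (fun x => x - a) 1 by apply: is_derive_eq; rewrite subr0.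
 have := @is_derive1_comp _ (prim f) (fun x => x - a) x _ _ (der_prim _ cf) dq.
 by rewrite mulr1.
have c1 := prim_shift_cvg (- a) cf ff.
have cN : continuous (fun x => f (- x)).
 by move=> x; apply: (@continuous_comp _ _ _ -%R); [exact: opp_continuous|exact: cf].
have fN : sfast (fun x => f (- x)).
 have [mf hf] := ff; split; first by apply: (mcomp mf); exact: oppr_measurable.
 by move=> r; have [C [C0 hC]] := hf r; exists C; split=> // x; have := hC (- x); rewrite /omr sqrrN.
have c2 := prim_shift_cvg a cN fN.
have pN x : prim (fun x => f (- x)) x = - prim f (- x).
 transitivity (- prim f (- x) - - prim f (- 0)); last by rewrite oppr0 prim0 oppr0 subr0.
 apply: (@primE _ (fun x => f (- x)) (fun x => - prim f (- x))) => // z.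
 rewrite -[f (- z)]opprK; apply: is_deriveN; apply: is_derive_opp_arg; exact: der_prim.
have : (fun n : nat => (prim f n%:R - prim f (- n%:R)) + ((prim f (n%:R - a) - prim f n%:R) +
 (prim (fun x => f (- x)) (n%:R + a) - prim (fun x => f (- x)) n%:R))) @ \oo --> Ri f + (0 + 0).
 by apply: cvgD; [exact: w|apply: cvgD; [exact: c1|exact: c2]].
rewrite !addr0.
apply: cvg_trans; apply: near_eq_cvg; apply: nearW => n; rewrite !pN opprD.
move: (prim f n%:R) (prim f (- n%:R)) (prim f (n%:R - a)) (prim f (- n%:R - a)) => A B C D; ring.
Qed.

(** The half sign convolved with the heat kernel of time [tau]. *)
Definition sgt tau u : R := if tau == 0 then hs u else prim (ga tau) u.

Lemma sgtN tau u : 0 <= tau -> sgt tau (- u) = - sgt tau u.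
rewrite /sgt; case: eqVneq => [_ _|n0 t0]; first exact: hsN.
by apply: primN => [|x]; [apply: continuous_ga; rewrite lt_def n0|exact: gaN].
Qed.

Lemma Ri_hs_ga tau x y : 0 < tau -> Ri (fun z => ga tau (x - z) * hs (y - z)) = prim (ga tau) (y - x).
move=> t0; have cg := continuous_ga t0.
transitivity (Ri (fun z => ga tau (z - x) * hs (y - z))).
 by apply: Ri_eq => z; rewrite -gaN opprB.
apply: (@Ri_sgn _ _ (fun z => prim (ga tau) (z - x))).
- exact: continuous_gas.
- exact/sfast_itg/sfast_gas.
- move=> z; have dq : is_derive z (1 : R) (fun z => z - x) 1 by apply: is_derive_eq; rewrite subr0.
 have := @is_derive1_comp _ (prim (ga tau)) (fun z => z - x) z _ _ (der_prim _ cg) dq.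
 by rewrite mulr1.
have c1 := prim_shift_cvg (- x) cg (sfast_ga t0); have c2 := prim_shift_cvg x cg (sfast_ga t0).
have : (fun n : nat => (prim (ga tau) (n%:R - x) - prim (ga tau) n%:R) -
 (prim (ga tau) (n%:R + x) - prim (ga tau) n%:R)) @ \oo --> (0 - 0 : R) by exact: cvgB.
rewrite subrr.
apply: cvg_trans; apply: near_eq_cvg; apply: nearW => n.
rewrite -opprD primN//; last by move=> z; rewrite gaN.
move: (prim _ (n%:R - x)) (prim _ n%:R) (prim _ (n%:R + x)) => A B C; ring.
Qed.

Lemma prim_le (tau : R) u : 0 < tau -> `|prim (ga tau) u| <= 1.
move=> t0; rewrite -[u]subr0 -Ri_hs_ga//.
have i1 := sfast_itg (sfast_gas 0 t0).
have b x : `|ga tau (0 - x) * hs (u - x)| <= ga tau (x - 0).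
 rewrite normrM -[ga _ (0 - x)]gaN opprB (ger0_norm (ltW (ga_gt0 _ t0))).
 by apply: ler_piMr; [exact/ltW/ga_gt0|exact: hs_bound].
have i2 : itg (fun x => ga tau (0 - x) * hs (u - x)).
 apply: itg_dom i1 b; apply: mfunM; last by apply: measurable_hs_comp; exact: measurable_funB.
 by apply: continuous_mfun; apply: continuous_rsub; exact: continuous_ga.
rewrite -(Ri_ga 0 t0); apply: (le_trans (Ri_norm i2)); apply: Ri_le => //; exact: itg_abs.
Qed.

Lemma continuous_prim f : continuous f -> continuous (prim f).
by move=> cf; apply: der_continuous => x; exact: der_prim. Qed.

Lemma sfastM_bounded f (g : R -> R) (C : R) : sfast f -> mfunT g -> (forall x, `|g x| <= C) -> sfast (fun x => f x * g x).
move=> [mf hf] mg bg; split; first exact: mfunM.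
have C0 : 0 <= C by exact: le_trans (bg 0).
move=> r; have [D [D0 hD]] := hf r; exists (D * C); split; first exact: mulr_ge0.
by move=> x; rewrite normrM mulrAC; apply: ler_pM => //; rewrite mulr_ge0// exprn_ge0.
Qed.

(** Both sides vanish at 0 by parity, and their increments agree by Fubini. *)
Lemma conv_prim f tau y : continuous f -> sfast f -> 0 < tau -> (forall x, f (- x) = f x) ->
 continuous (fun w => Ri (fun z => f z * ga tau (w - z))) ->
 Ri (fun z => f z * prim (ga tau) (y - z)) = prim (fun w => Ri (fun z => f z * ga tau (w - z))) y.
move=> cf ff t0 ef cc; have cg := continuous_ga t0; have cP := continuous_prim cg.
have cs (w : R) (g : R -> R) : continuous g -> continuous (fun z => g (w - z)).
 exact: continuous_rsub.
have sP (w : R) : sfast (fun z => f z * prim (ga tau) (w - z)).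
 apply: (sfastM_bounded (C := 1)) => //; last by move=> x; exact: prim_le.
 by apply: continuous_mfun; exact: cs.
have h0 : Ri (fun z => f z * prim (ga tau) (0 - z)) = 0.
 apply: Ri_odd; [by move=> x; apply: cvgM; [exact: cf|exact: cs]|exact: sfast_itg|].
 by move=> x; rewrite ef !sub0r [in RHS]primN ?mulrN ?opprK// => z; rewrite gaN.
pose h w := Ri (fun z => f z * prim (ga tau) (w - z)).
have inc a b : a <= b -> h b - h a = Rintegral leb `[a, b] (fun w => Ri (fun z => f z * ga tau (w - z))).
 move=> ab; rewrite /h -[- _]mulN1r -RiZ; last exact: sfast_itg.
 rewrite -RiD; [|exact: sfast_itg|by apply: itgZ; exact: sfast_itg].
 pose M := ga tau 0; have gM u : ga tau u <= M.
  rewrite /M /ga ler_wpM2l ?powR_ge0// ler_expR expr0n oppr0 mul0r mulNr oppr_le0.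
  by rewrite divr_ge0 ?sqr_ge0// mulr_ge0// ltW.
 have mab : mfunT (\1_(`[a, b]%classic : set R) : R -> R) by exact: measurable_indic.
 transitivity (Ri (fun z => Ri (fun w => f z * (\1_(`[a, b]%classic) w * ga tau (w - z))))).
  apply: Ri_eq => z; transitivity (f z * Rintegral leb `[a, b] (fun w => ga tau (w - z))).
   have -> : Rintegral leb `[a, b] (fun w => ga tau (w - z)) = prim (ga tau) (b - z) - prim (ga tau) (a - z); last by ring.
   apply: (@ftc _ _ (fun w => prim (ga tau) (w - z))) => //; first exact: continuous_gas.
   move=> w; have dq : is_derive w (1 : R) (fun w => w - z) 1 by apply: is_derive_eq; rewrite subr0.
   have := @is_derive1_comp _ (prim (ga tau)) (fun w => w - z) w _ _ (der_prim _ cg) dq.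
   by rewrite mulr1.
  rewrite Rint_Ri -RiZ; last first.
   by apply: itg_patch => //; exact/sfast_itg/sfast_gas.
  by apply: Ri_eq => w; rewrite patch_indic mulrC /= [in LHS]mulrC; congr (_ * _); rewrite mulrC.
 rewrite Rint_Ri (@Ri_swap _ (fun z w => f z * (\1_(`[a, b]%classic) w * ga tau (w - z))) (fun z => `|f z|) (fun w => M * \1_(`[a, b]%classic) w)).
 - apply: Ri_eq => w; rewrite patch_indic /= [RHS]mulrC -RiZ; last first.
   apply/sfast_itg/(sfastM_bounded (C := M)) => //; first by apply: continuous_mfun; exact: cs.
   by move=> x; rewrite ger0_norm ?gM// ltW// ga_gt0.
  by apply: Ri_eq => z; ring.
 - apply: mfunM; first by apply: mcomp => //; exact: itg_meas (sfast_itg ff).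
  apply: mfunM; first exact: (mcomp mab).
  apply: (mcomp (continuous_mfun cg)); exact: measurable_funB.
 - exact/itg_abs/sfast_itg.
 - by apply: itgZ; exact: itg_indic.
 - by move=> w; rewrite mulr_ge0// ltW// ga_gt0.
 - move=> z w; rewrite normrM ler_wpM2l// normrM mulrC ler_pM//; first by rewrite ger0_norm ?gM// ltW// ga_gt0.
  by rewrite ger0_norm.
have hh0 : h 0 = 0 by exact: h0.
rewrite -/(h y) /prim; case: ifPn => y0; first by rewrite -inc// hh0 subr0.
by rewrite -inc ?hh0 ?sub0r ?opprK//; rewrite ltW// ltNge.
Qed.

(** The condition on [g] says that it is [f] after heat flow for time [tau]; the case 0 is included
    because some points lie at the final time. *)
Lemma Ri_even_sgt f g tau y : continuous f -> sfast f -> 0 <= tau -> (forall x, f (- x) = f x) -> continuous g ->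
 (forall w, (if tau == 0 then f w else Ri (fun z => f z * ga tau (w - z))) = g w) ->
 Ri (fun z => f z * sgt tau (y - z)) = prim g y.
move=> cf ff + ef cg; rewrite /sgt; case: eqVneq => [_ _ h|n0 t0 h].
 by rewrite Ri_sgn_even//; [congr prim; exact/funext|exact: sfast_itg].
have e : (fun w => Ri (fun z => f z * ga tau (w - z))) = g by exact/funext.
by rewrite conv_prim ?e// lt_def n0.
Qed.

(** Integration by parts against the smoothed sign, whose derivative is the heat kernel. *)
Lemma Ri_der_sgt f F tau y : continuous f -> sfast f -> sfast F -> der F f -> 0 <= tau ->
 Ri (fun z => f z * sgt tau (y - z)) = if tau == 0 then F y else Ri (fun z => F z * ga tau (y - z)).
move=> cf ff fF dF; rewrite /sgt; case: eqVneq => [_ _|n0 t0].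
 apply: Ri_sgn => //; first exact: sfast_itg.
 by have [h1 h2] := sfast_cvg0 fF; rewrite -[X in _ --> X](addr0 0); exact: cvgD.
have {}t0 : 0 < tau by rewrite lt_def n0.
have cg := continuous_ga t0; have cP := continuous_prim cg; have cF := der_continuous dF.
have cs (g : R -> R) : continuous g -> continuous (fun z => g (y - z)).
 exact: continuous_rsub.
have b1 x : `|prim (ga tau) (y - x)| <= 1 by exact: prim_le.
have sg' : sfast (fun z => F z * ga tau (y - z)).
 have [C [C0 hC]] := (sfast_ga t0).2 0%N.
 apply: (sfastM_bounded (C := C)) => //; first by apply: continuous_mfun; exact: cs.
 by move=> x; have := hC (y - x); rewrite expr0 mulr1.
have sp : sfast (fun z => f z * prim (ga tau) (y - z)).
 by apply: (sfastM_bounded (C := 1)) => //; apply: continuous_mfun; exact: cs.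
suff : Ri (fun z => f z * prim (ga tau) (y - z) + (-1) * (F z * ga tau (y - z))) = 0.
 by rewrite RiD ?RiZ; [lra|exact: sfast_itg|exact: sfast_itg|apply: itgZ; exact: sfast_itg].
apply: (@Ri_deriv0 _ _ (fun z => F z * prim (ga tau) (y - z))).
- move=> x; apply: cvgD; first by apply: cvgM; [exact: cf|exact: cs].
 by apply: cvgM; [exact: cvg_cst|apply: cvgM; [exact: cF|exact: cs]].
- by apply: sfastD => //; exact: sfastZ.
- by apply: (sfastM_bounded (C := 1)) => //; apply: continuous_mfun; exact: cs.
move=> z; have dq : is_derive z (1 : R) (fun w => y - w) (-1) by rewrite -[-1]add0r; apply: is_deriveB.
have d2 := @is_derive1_comp _ (prim (ga tau)) (fun w => y - w) z _ _ (der_prim _ cg) dq.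
have := is_deriveM (dF z) d2.
by move=> d3; apply: is_derive_eq; rewrite /GRing.scale /=; ring.
Qed.
End SmoothedSign.

(** * Matrices made of skew two-by-two blocks *)

Section PairMatrix.
Variables (F : fieldType) (n : nat).
Implicit Types (r : 'I_n -> F).

Definition pairmx r : 'M[F]_(n.*2) := \matrix_(a, b)
 if (pixV a).1 == (pixV b).1 then
  (if (pixV a).2 then (if (pixV b).2 then 0 else r (pixV a).1) else (if (pixV b).2 then - r (pixV a).1 else 0))
 else 0.

Lemma pairmx_bilin r (u v : 'I_(n.*2) -> F) : \sum_k \sum_l u k * pairmx r k l * v l =
 \sum_a r a * (u (pix (a, true)) * v (pix (a, false)) - u (pix (a, false)) * v (pix (a, true))).
rewrite big_pairs; apply: eq_bigr => a _; rewrite !big_pairs -big_split (bigD1 a)//= big1 ?addr0.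
 by rewrite !mxE !pixK eqxx /=; ring.
by move=> b ba; rewrite !mxE !pixK /= [a == b]eq_sym (negbTE ba); ring.
Qed.

Lemma invmx_pairmx r : (forall a, r a != 0) -> invmx (pairmx r) = pairmx (fun a => - (r a)^-1).
move=> r0; have e : pairmx r *m pairmx (fun a => - (r a)^-1) = 1%:M.
 apply/matrixP => i j; rewrite mxE -[i]pixVK -[j]pixVK !mxE; case: (pixV i) => a s; case: (pixV j) => b s'.
 rewrite (can_eq (@pixK n)) xpair_eqE big_pairs (bigD1 a)//= big1 ?addr0.
  rewrite !mxE !pixK eqxx /=; have [->|ab] := eqVneq a b; case: s; case: s'; rewrite ?mulr0 ?mul0r ?add0r ?addr0 ?opprK ?mulrN ?mulNr ?opprK ?mulfV//.
 by move=> c ca; rewrite !mxE !pixK /= [a == c]eq_sym (negbTE ca) !mul0r addr0.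
have [ua _] := mulmx1_unit e.
by rewrite -[RHS](mulKmx ua) e mulmx1.
Qed.

(** Scaling the first member of each pair turns the symplectic matrix into this one, so the Pfaffian
    is the product of the scalings. *)
Lemma pfs_pairmx (R : numFieldType) (s : 'I_n -> R) (A : 'M[R]_(n.*2)) :
 (forall a b, A a b = if (pixV a).1 == (pixV b).1 then
  (if (pixV a).2 then (if (pixV b).2 then 0 else s (pixV a).1) else (if (pixV b).2 then - s (pixV a).1 else 0))
 else 0) -> pfs A = (\prod_a - s a) * (2 ^ n * n`!)%:R.
move=> hA; rewrite -(pfs_Jpair R n).
pose D : 'M[R]_(n.*2) := diag_mx (\row_a (if (pixV a).2 then 1 else - s (pixV a).1)).
have -> : A = D *m Jpair R n *m D^T.
 apply/matrixP => i j; rewrite /D tr_diag_mx mul_mx_diag mul_diag_mx !mxE hA.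
 rewrite [(pixV j).1 == _]eq_sym; case: eqP => [->|_]; case: (pixV i).2; case: (pixV j).2 => /=; ring.
by rewrite pfs_mul det_diag; congr (_ * _); rewrite big_pairs; apply: eq_bigr => a _; rewrite !mxE !pixK /= mulr1.
Qed.
End PairMatrix.

(** * The line with a frozen particle adjoined *)

Section Setup.
Variable R : realType.
Local Notation X := (R * bool)%type.
Local Notation sfast := (fast (@omr R)).
Implicit Types (x y : X) (t tau u v : R).

Let og1 := @omr_ge1 R. Let og := @omr_gt0 R. Let og0 := @omr_ge0 R.
Local Hint Resolve og1 og og0 : core.

Definition iox u : X := (u, false).
Definition omx x : R := if x.2 then 1 else omr x.1.
Definition none : X := (0, true).

Lemma measurable_ifX d (A : measurableType d) (b : A -> bool) (f g : A -> R) :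
 mfunT b -> mfunT f -> mfunT g ->
 mfunT (fun a => if b a then f a else g a).
by move=> mb mf mg; apply: measurable_fun_ifT. Qed.

Lemma mio : mfunT iox.
exact: measurable_fun_pair. Qed.
Lemma omx1 x : 1 <= omx x. by rewrite /omx; case: ifP. Qed.
Lemma mom : mfunT omx.
apply: measurable_ifX => //; apply: (mcomp (@measurable_omr R)); exact: measurable_fst.
Qed.
Lemma iomx : itg (fun u => (omx (iox u))^-1). exact: itg_cauchy. Qed.
Let ox0 x : 0 <= omx x. exact: le_trans (omx1 x). Qed.
Local Hint Resolve ox0 omx1 : core.

(* The sign kernel, for which the frozen particle [none] lies to the right of all the others. *)
Definition kax x y : R := if x.2 then (if y.2 then 0 else - 2^-1) else (if y.2 then 2^-1 else hs (y.1 - x.1)).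

Lemma mkax : mfunT (fun z : X * X => kax z.1 z.2).
have m1 : mfunT (fun z : X * X => z.1.2) by exact: mcomp.
have m2 : mfunT (fun z : X * X => z.2.2) by exact: mcomp.
apply: measurable_ifX => //; apply: measurable_ifX => //.
by apply: measurable_hs_comp; apply: measurable_funB; exact: mcomp.
Qed.

Lemma bkax x y : `|kax x y| <= 1.
have h2 : `|2^-1 : R| <= 1 by rewrite ger0_norm ?invr_ge0// invf_le1 ?ler1n.
by rewrite /kax; case: x.2; case: y.2; rewrite ?normr0 ?normrN//; exact: hs_bound.
Qed.

Lemma akax x y : kax y x = - kax x y.
by rewrite /kax; case: x.2; case: y.2; rewrite ?oppr0 ?opprK// -hsN opprB. Qed.

Variable o : bool.

Definition pker tau x y : R := if x.2 then (if y.2 then o%:R else 0) else (if y.2 then 0 else ga tau (x.1 - y.1)).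
Definition B0x : seq (X * R) := if o then [:: (none, 1)] else [::].
Lemma LfX f : Lf iox B0x f = Ri (fun u => f (u, false)) + o%:R * f none.
by rewrite /Lf /B0x; case: o; rewrite ?big_seq1 ?big_nil /= ?mul0r. Qed.

Lemma goodp_pker tau : 0 < tau -> goodp omx (pker tau).
move=> t0; split.
 have m1 : mfunT (fun z : X * X => z.1.2) by exact: mcomp.
 have m2 : mfunT (fun z : X * X => z.2.2) by exact: mcomp.
 apply: measurable_ifX => //; apply: measurable_ifX => //.
 apply: (mcomp (continuous_mfun (continuous_ga t0))).
 by apply: measurable_funB; exact: mcomp.
move=> r; have [C [C0 h]] := (sfast_ga t0).2 r.
exists (1 + C * 2 ^+ r); split; first by rewrite addr_ge0// mulr_ge0// exprn_ge0.
have h1 (z : X) : 0 <= (1 + C * 2 ^+ r) * omx z ^+ r by rewrite mulr_ge0 ?exprn_ge0// addr_ge0// mulr_ge0// exprn_ge0.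
move=> [w b] [x b']; rewrite /pker /omx /=; case: b; case: b' => /=.
- rewrite !expr1n !mulr1 ger0_norm//; apply: (@le_trans _ _ 1); first by case: o.
 by rewrite lerDl mulr_ge0// exprn_ge0.
- by rewrite normr0 mul0r; exact: (h1 (w, true)).
- by rewrite normr0 mul0r; exact: (h1 (w, false)).
apply: (@le_trans _ _ (`|ga tau (w - x)| * (2 * omr w * omr (w - x)) ^+ r)).
 rewrite ler_wpM2l// lerXn2r ?nnegrE ?mulr_ge0//.
 by apply: (le_trans (omr_shift x w)); rewrite -[x - w]opprB /omr sqrrN.
rewrite !exprMn mulrCA [_ * omr w ^+ r]mulrC -mulrA [leRHS]mulrC ler_wpM2l ?exprn_ge0//.
apply: (@le_trans _ _ (C * 2 ^+ r)); last by rewrite lerDr.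
by rewrite mulrC ler_wpM2r ?exprn_ge0.
Qed.

Lemma fast_X (f : R -> R) (c : R) : sfast f -> fast omx (fun x : X => if x.2 then c else f x.1).
move=> [mf hf]; split; first by apply: measurable_ifX => //; exact: mcomp.
move=> r; have [C [C0 h]] := hf r; exists (C + `|c|); split; first exact: addr_ge0.
by move=> [u []]; rewrite /omx /= ?expr1n ?mulr1; [rewrite lerDr|rewrite (le_trans (h u))// lerDl].
Qed.

Lemma Ri0 (f : R -> R) : (forall z, f z = 0) -> Ri f = 0.
move=> h; rewrite -[RHS](mul0r (Ri (fun z : R => expR (- z ^+ 2)))) -RiZ; last exact: itg_gauss.
by apply: Ri_eq => z; rewrite h mul0r.
Qed.

Lemma ga_conv t tau u v : 0 < t -> 0 < tau -> Ri (fun z => ga t (u - z) * ga tau (z - v)) = ga (t + tau) (u - v).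
move=> t0 u0; have cg := continuous_ga u0.
have [C [C0 hC]] := (sfast_ga u0).2 0%N.
have := @gj_conv R 1 t tau 0 (v - u) t0 u0; rewrite /gj !yp0 hornerC !mul1r => h.
rewrite -[u - v]opprB gaN -h.
rewrite -(Ri_shift u (f := fun z => (1 : {poly R}).[z] * ga t z * ga tau (v - u - z))).
- by apply: Ri_eq => z; rewrite hornerC mul1r -[ga t (z - u)]gaN opprB -[ga tau (z - v)]gaN; congr (_ * ga _ _); ring.
- move=> x; apply: cvgM; last exact: continuous_rsub.
 by apply: cvgM; [exact: continuous_horner|exact: continuous_ga].
- apply: (sfastM_bounded (C := C)).
 + by apply: sfast_poly; exact: sfast_ga.
 + by apply: continuous_mfun; exact: continuous_rsub.
 by move=> x; have := hC (v - u - x); rewrite expr0 mulr1.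
Qed.

Lemma pker_conv t tau x y : 0 < t -> 0 < tau ->
 Lf iox B0x (fun z => pker t x z * pker tau z y) = pker (t + tau) x y.
move=> t0 u0; rewrite LfX /pker; case: x => [u b]; case: y => [v b'] /=.
case: b; case: b'; rewrite ?(mulr0, mul0r, addr0).
- by rewrite Ri0 // add0r; case: o; rewrite ?mulr1 ?mul0r.
- by rewrite Ri0 // => z; rewrite mul0r.
- by rewrite Ri0 // => z; rewrite mulr0.
- exact: ga_conv.
Qed.
End Setup.

(** * A basis adapted to the sign kernel, for both parities *)

Section Basis.
Variables (R : realType) (T : R) (n : nat) (o : bool).
Hypothesis T0 : 0 < T.
Local Notation X := (R * bool)%type.
Local Notation sfast := (fast (@omr R)).
Implicit Types (a : 'I_n) (t tau u v : R).
Local Notation gj := (gj T).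
Local Notation dgj := (dgj T).
Local Notation mj := (mj T).

Let og1 := @omr_ge1 R. Let og := @omr_gt0 R. Let og0 := @omr_ge0 R.
Local Hint Resolve og1 og og0 : core.

Definition oddlast a := o && (val a == n.-1).
Definition ca a : R := if o && (a < n.-1)%N then mj a / mj n.-1 else 0.
Definition al t a u := gj t a.*2 u - ca a * gj t (n.-1).*2 u.
Definition be t a u := if oddlast a then 0 else dgj t a.*2 u.
Definition realf t (p : 'I_n * bool) u := if p.2 then be t p.1 u else al t p.1 u.
Definition nonef (p : 'I_n * bool) : R := (p.2 && oddlast p.1)%:R.
Definition phix t (k : 'I_(n.*2)) (x : X) : R := if x.2 then nonef (pixV k) else realf t (pixV k) x.1.
Lemma sfast0 : sfast (fun=> 0 : R).
by split=> // r; exists 0; split=> // x; rewrite normr0 mul0r. Qed.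

Lemma sfast_al t a : 0 < t -> sfast (al t a).
move=> t0; rewrite (_ : al t a = fun u => gj t a.*2 u + (- ca a) * gj t (n.-1).*2 u).
 by apply: sfastD; [exact: sfast_gj|apply: sfastZ; exact: sfast_gj].
by apply/funext => u; rewrite /al mulNr.
Qed.

Lemma sfast_be t a : 0 < t -> sfast (be t a).
by move=> t0; rewrite /be; case: (oddlast a); [exact: sfast0|exact: sfast_dgj]. Qed.
Lemma sfast_realf t p : 0 < t -> sfast (realf t p).
by move=> t0; rewrite /realf; case: p.2; [exact: sfast_be|exact: sfast_al]. Qed.

Lemma goodf_phix t : 0 < t -> @goodf _ _ _ (@omx R) n.*2 (phix t).
move=> t0; have f k : fast (@omx R) (phix t k) by apply: fast_X; exact: sfast_realf.
split=> [k|r]; first by case: (f k).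
have /choice[C hC] : forall k, exists C, 0 <= C /\ forall x, `|phix t k x| * omx x ^+ r <= C by move=> k; exact: (f k).2.
exists (\sum_k C k); split; first by apply: sumr_ge0 => k _; case: (hC k).
move=> k x; apply: (le_trans ((hC k).2 x)).
by rewrite (bigD1 k)//= lerDl sumr_ge0// => j _; case: (hC j).
Qed.

Lemma itgMga f tau v : sfast f -> 0 < tau -> sfast (fun z => f z * ga tau (v - z)).
move=> ff t0; have [C [C0 hC]] := (sfast_ga t0).2 0%N.
apply: (sfastM_bounded (C := C)) => //.
 by apply: continuous_mfun; apply: continuous_rsub; exact: continuous_ga.
by move=> x; have := hC (v - x); rewrite expr0 mulr1.
Qed.

Lemma dgj_conv t tau j v : 0 < t -> 0 < tau -> Ri (fun x => dgj t j x * ga tau (v - x)) = dgj (t + tau) j v.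
move=> t0 u0.
transitivity (Ri (fun x => (2 * T)^-1 * (gj t j.+1 x * ga tau (v - x)) + (- j%:R) * (gj t j.-1 x * ga tau (v - x)))).
 by apply: Ri_eq => x; rewrite /dgj; ring.
rewrite RiD; [|by apply/itgZ/sfast_itg/itgMga => //; exact: sfast_gj|by apply/itgZ/sfast_itg/itgMga => //; exact: sfast_gj].
rewrite !RiZ ?gj_conv//; [by rewrite /dgj; ring| |]; by apply/sfast_itg/itgMga => //; exact: sfast_gj.
Qed.

Lemma al_conv t tau a v : 0 < t -> 0 < tau -> Ri (fun x => al t a x * ga tau (v - x)) = al (t + tau) a v.
move=> t0 u0.
transitivity (Ri (fun x => gj t a.*2 x * ga tau (v - x) + (- ca a) * (gj t (n.-1).*2 x * ga tau (v - x)))).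
 by apply: Ri_eq => x; rewrite /al; ring.
rewrite RiD; [|by apply/sfast_itg/itgMga => //; exact: sfast_gj|by apply/itgZ/sfast_itg/itgMga => //; exact: sfast_gj].
by rewrite RiZ ?gj_conv//; [rewrite /al; ring|apply/sfast_itg/itgMga => //; exact: sfast_gj].
Qed.

Lemma be_conv t tau a v : 0 < t -> 0 < tau -> Ri (fun x => be t a x * ga tau (v - x)) = be (t + tau) a v.
by move=> t0 u0; rewrite /be; case: (oddlast a); [rewrite Ri0// => z; rewrite mul0r|exact: dgj_conv].
Qed.
Lemma oddlast_o a : oddlast a -> o. by case/andP. Qed.

Lemma phix_conv t tau k y : 0 < t -> 0 < tau ->
 Lf (@iox R) (B0x R o) (fun x => phix t k x * pker o tau x y) = phix (t + tau) k y.
move=> t0 u0; rewrite LfX /phix /pker /=; case: y => [v []] /=.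
 rewrite Ri0 ?add0r => [|z]; last by rewrite mulr0.
 by rewrite /nonef; case: (pixV k) => a [] /=; rewrite ?mul0r ?mulr0// /oddlast; case: o; rewrite /= ?mul0r ?mul1r ?mulr1.
rewrite mulr0 mulr0 addr0 /realf; case: (pixV k).2.
 by rewrite -(be_conv _ _ t0 u0); apply: Ri_eq => z; rewrite -[ga tau (z - v)]gaN opprB.
by rewrite -(al_conv _ _ t0 u0); apply: Ri_eq => z; rewrite -[ga tau (z - v)]gaN opprB.
Qed.

Lemma alN t a u : al t a (- u) = al t a u.
have e k : (-1) ^+ k.*2 = 1 :> R by rewrite -signr_odd odd_double.
by rewrite /al !gjN !e !mul1r. Qed.

Lemma continuous_al t a : 0 < t -> continuous (al t a).
move=> t0 x; rewrite /al; apply: (@cvgB _ _ _ _ _ (gj t a.*2) (fun u => ca a * gj t (n.-1).*2 u)).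
 exact: (@continuous_gj R T t a.*2 t0).
apply: (@cvgM _ _ _ _ (fun=> ca a) (gj t (n.-1).*2)); first exact: cvg_cst.
exact: (@continuous_gj R T t n.-1.*2 t0).
Qed.

(* [bet] is the antiderivative of [be] (a half-mass at the frozen particle for the last index in the odd case),
  [alt] that of [al]; both are evaluated at the reflected time [2 T - t]. *)
Definition bet t a u := if oddlast a then - 2^-1 else gj t a.*2 u.
Definition alt t a u := prim (al t a) u.

Lemma Ri_al_sgt t tau a v : 0 < t -> 0 <= tau -> Ri (fun z => al t a z * sgt tau (v - z)) = alt (t + tau) a v.
move=> t0 u0; 
have ca1 := @continuous_al t a t0; have ca2 : continuous (al (t + tau) a) by apply: continuous_al; rewrite ltr_wpDr.
apply: (@Ri_even_sgt R (al t a) (al (t + tau) a) tau v ca1 (@sfast_al t a t0) u0 (alN t a) ca2) => w.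
case: eqVneq => [->|n0]; first by rewrite addr0.
by apply: al_conv => //; rewrite lt_def n0.
Qed.

Lemma Ri_be_sgt t tau a v : 0 < t -> 0 <= tau -> ~~ oddlast a ->
 Ri (fun z => be t a z * sgt tau (v - z)) = bet (t + tau) a v.
move=> t0 u0 na; rewrite /be /bet (negbTE na).
rewrite (@Ri_der_sgt R (dgj t a.*2) (gj t a.*2) tau v (@continuous_dgj R T t a.*2 t0) (@sfast_dgj R T t a.*2 t0) (@sfast_gj R T t a.*2 t0) _ u0); last first.
 by move=> x; exact: der_gj.
case: eqVneq => [->|n0]; first by rewrite addr0.
by apply: gj_conv => //; rewrite lt_def n0.
Qed.

Lemma Ri_al t a : 0 < t -> Ri (al t a) = mj a - ca a * mj n.-1.
move=> t0; transitivity (Ri (fun x => gj t a.*2 x + (- ca a) * gj t (n.-1).*2 x)).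
 by apply: Ri_eq => x; rewrite /al mulNr.
rewrite RiD; [|exact/sfast_itg/sfast_gj|exact/itgZ/sfast_itg/sfast_gj].
rewrite RiZ ?Ri_gj_even ?mulNr//; exact/sfast_itg/sfast_gj.
Qed.

Lemma Ri_al_odd t a : 0 < t -> o -> Ri (al t a) = if oddlast a then mj n.-1 else 0.
move=> t0 oo; rewrite Ri_al// /ca /oddlast oo /=; have := ltn_ord a => an.
have m0 : mj n.-1 != 0 by rewrite gt_eqF// mj_gt0.
have [lt|ge] := ltnP a n.-1; first by rewrite ltn_eqF// divfK// subrr.
have e : val a = n.-1 by apply/eqP; rewrite eqn_leq ge andbT; move: an => /=; lia.
by rewrite e eqxx mul0r subr0.
Qed.

Lemma sfastMs f g : sfast f -> sfast g -> sfast (fun x => f x * g x).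
move=> ff fg; have [C [C0 hC]] := fg.2 0%N.
apply: (sfastM_bounded (C := C)) => //; first by case: fg.
by move=> x; have := hC x; rewrite expr0 mulr1.
Qed.

(** Up to sign, the pairing of the two functions of the pair [a] at the final time. *)
Definition rr a : R := if oddlast a then - (2^-1 * mj n.-1) else hj T a.

Lemma rr_neq0 a : rr a != 0.
rewrite /rr; case: ifP => _; last by rewrite gt_eqF// hj_gt0.
by rewrite oppr_eq0 mulf_neq0 ?invr_eq0 ?pnatr_eq0// gt_eqF// mj_gt0.
Qed.

(** The correction in [al] is a multiple of the last [gj], which is orthogonal to all the others. *)
Lemma Ri_al_gj a (b : 'I_n) : ~~ oddlast b -> Ri (fun x => al T a x * gj T b.*2 x) = (a == b)%:R * hj T a.
move=> nb; transitivity (Ri (fun x => gj T a.*2 x * gj T b.*2 x + (- ca a) * (gj T (n.-1).*2 x * gj T b.*2 x))).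
 by apply: Ri_eq => x; rewrite /al; ring.
rewrite RiD; [|by apply/sfast_itg/sfastMs; exact: sfast_gj|by apply/itgZ/sfast_itg/sfastMs; exact: sfast_gj].
rewrite RiZ ?Ri_gjM//; last by apply/sfast_itg/sfastMs; exact: sfast_gj.
rewrite /ca; move: nb; rewrite /oddlast negb_and; case: o => /= [nb|_]; last by rewrite oppr0 mul0r addr0.
by rewrite [n.-1 == _]eq_sym (negbTE nb) mul0r mulr0 addr0.
Qed.
End Basis.

(** * Continuity and parity of the basis functions *)

Section MoreBasis.
Variables (R : realType) (T : R) (n : nat) (o : bool).
Implicit Types (t u : R) (a : 'I_n).

Lemma contM (f g : R -> R) : continuous f -> continuous g -> continuous (fun x => f x * g x).
by move=> cf cg x; apply: (@cvgM _ _ _ _ f g); [exact: cf|exact: cg]. Qed.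

Lemma continuous_be t a : 0 < t -> continuous (be T o t a).
move=> t0; rewrite /be; case: (oddlast o a); last exact: (@continuous_dgj R T t a.*2 t0).
by move=> x; exact: cvg_cst.
Qed.

Lemma continuous_bet t a : 0 < t -> continuous (bet T o t a).
move=> t0; rewrite /bet; case: (oddlast o a); last exact: (@continuous_gj R T t a.*2 t0).
by move=> x; exact: cvg_cst.
Qed.

Lemma beN t a u : be T o t a (- u) = - be T o t a u.
rewrite /be; case: (oddlast o a); first by rewrite oppr0.
by rewrite dgjN -signr_odd odd_double expr0 mulN1r.
Qed.

Lemma betN t a u : bet T o t a (- u) = bet T o t a u.
by rewrite /bet; case: (oddlast o a) => //; rewrite gjN -signr_odd odd_double expr0 mul1r.
Qed.
End MoreBasis.

(** * Explicit pairings and the finite-N kernel *)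

Section Values.
Variables (R : realType) (T : R) (n : nat) (o : bool).
Hypothesis T0 : 0 < T.
Local Notation X := (R * bool)%type.
Local Notation sfast := (fast (@omr R)).
Implicit Types (a : 'I_n) (tau u v s : R).
Local Notation al := (al T o).
Local Notation be := (be T o).
Local Notation alt := (alt T o).
Local Notation bet := (bet T o).
Local Notation rr := (rr T o).
Local Notation realf := (@realf R T n o).
Local Notation phix := (@phix R T n o).

Let og1 := @omr_ge1 R. Let og := @omr_gt0 R. Let og0 := @omr_ge0 R.
Local Hint Resolve og1 og og0 : core.

Definition rint s (p : 'I_n * bool) u := if p.2 then bet s p.1 u else alt s p.1 u.

Lemma Ri_realf_sgt s tau p v : 0 < s -> 0 <= tau ->
 Ri (fun z => realf s p z * sgt tau (v - z)) - o%:R * nonef R o p * 2^-1 = rint (s + tau) p v.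
move=> s0 t0; rewrite /rint /realf /nonef; case: p => a [] /=; last first.
 by rewrite mulr0 mul0r subr0 Ri_al_sgt.
have [h|h] := boolP (oddlast o a).
 rewrite /be /bet h (oddlast_o h) Ri0 => [|z]; last by rewrite mul0r.
 by rewrite !mul1r sub0r.
by rewrite Ri_be_sgt// mulr0 mul0r subr0.
Qed.

Lemma Ri_be s a : 0 < s -> Ri (be s a) = 0.
move=> s0; rewrite /be; case: oddlast; first by rewrite Ri0.
apply: (@Ri_deriv0 R (dgj T s a.*2) (gj T s a.*2)).
- exact: continuous_dgj.
- exact: sfast_dgj.
- exact: sfast_gj.
by move=> x; exact: der_gj.
Qed.

Variables (t : nat -> R) (M : nat).
Hypotheses (t0 : 0 < t 0%N) (tlt : forall m k, (m < k)%N -> t m < t k) (tM : t M = T).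
Variables (I : finType) (lev : I -> nat) (xs : I -> R) (e : nat -> seq I).
Hypotheses (ue : forall m, uniq (e m)) (eP : forall m i, (i \in e m) = (lev i == m)) (sN : forall m, (size (e m) <= n.*2)%N) (hM : forall i, (lev i <= M)%N).

Definition posx i : X := iox (xs i).
(** Writing [m.-1.+1] makes the time step positive at [m = 0] too, so that [goodp] holds for every
    [m]. *)
Definition px m : X -> X -> R := pker o (t m.-1.+1 - t m.-1).
Definition ppx (a m : nat) : X -> X -> R := pker o (t m - t a).
Let tgt0 m : 0 < t m.
by case: m => // m; apply: lt_trans t0 _; exact: tlt. Qed.

Let gphi : goodf (@omx R) (phix (t 0%N)). exact: goodf_phix. Qed.
Let gpx m : goodp (@omx R) (px m).
by apply: goodp_pker; rewrite subr_gt0; exact: tlt. Qed.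
Let phS m j y : phix (t m.+1) j y = Lf (@iox R) (B0x R o) (fun x => phix (t m) j x * px m.+1 x y).
by rewrite /px /= phix_conv ?subr_gt0 ?tlt// subrKC. Qed.
Let ppx1 (a : nat) x y : ppx a a.+1 x y = px a.+1 x y. by []. Qed.
Let ppxS (a m : nat) x y : (a < m)%N -> ppx a m.+1 x y = Lf (@iox R) (B0x R o) (fun x' => ppx a m x x' * px m.+1 x' y).
by move=> am; rewrite /px /ppx /= pker_conv ?subr_gt0 ?tlt//; congr (pker _ _ _ _); ring. Qed.

Local Notation mu := (mu (@iox R) (B0x R o) M (fun m => phix (t m))).
Local Notation lam := (lam (@iox R) lev posx (B0x R o) M ppx).
Local Notation A0k := (@A0ka _ _ _ (@iox R) n (@kax R) (B0x R o) M (fun m => phix (t m))).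

Lemma mu_fin k u : mu k (kax (u, false)) = - rint T (pixV k) u.
rewrite /mu LfX tM -(addr0 T) -(@Ri_realf_sgt T 0 (pixV k) u T0 (lexx 0)) addr0 opprB /phix /kax /=.
rewrite mulrA [RHS]addrC; congr (_ + _).
rewrite -[in RHS]mulN1r -RiZ; last first.
 apply/sfast_itg; apply: (@sfastM_bounded R (realf T (pixV k)) _ 1); first exact: sfast_realf.
  rewrite /sgt eqxx; apply: measurable_hs_comp; exact: measurable_funB.
 by move=> z; rewrite /sgt eqxx; exact: hs_bound.
by apply: Ri_eq => z; rewrite /sgt eqxx -[z - u]opprB hsN; ring.
Qed.

Lemma mu_none k : mu k (kax (none R)) = - (2^-1 * Ri (realf T (pixV k))).
rewrite /mu LfX tM /phix /kax /= !mulr0 addr0 -mulNr -RiZ; last exact/sfast_itg/sfast_realf.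
by apply: Ri_eq => z; ring.
Qed.

Lemma bmeas_rint k : mfunT (rint T (pixV k)) /\ exists C, 0 <= C /\ forall u, `|rint T (pixV k) u| <= C.
have := @bmeas_mu R _ X (@iox R) (@omx R) (@mio R) (@omx1 R) (@iomx R) n (@kax R) 1 (@mkax R) (@bkax R) _ _
 (B0x R o) gphi gpx M (fun m => phix (t m)) (fun j x => erefl) phS k.
move=> [m1 [C [C0 hC]]]; split; last first.
 by exists C; split=> // u; have := hC (u, false); rewrite mu_fin normrN.
rewrite (_ : rint T (pixV k) = fun u => - mu k (kax (u, false))).
 by apply: mcomp => //; apply: (mcomp m1); exact: mio.
by apply/funext => u; rewrite mu_fin opprK.
Qed.

(** Two functions of the same type give an odd integrand, hence 0. Functions of different type are
    covered by orthogonality of the [gj T] and by the choice of [ca]. *)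
Lemma A0_val : A0k = pairmx rr.
have hv j k : A0k j k = Ri (fun u => - (realf T (pixV j) u * rint T (pixV k) u))
  - o%:R * nonef R o (pixV j) * (2^-1 * Ri (realf T (pixV k))).
 rewrite mxE {1}/mu LfX mu_none tM {1 2}/phix /=; congr (_ + _); last by ring.
 by apply: Ri_eq => z; rewrite mu_fin mulrN.
have sr j k : sfast (fun u => realf T (pixV j) u * rint T (pixV k) u).
 have [mr [C [C0 hC]]] := bmeas_rint k.
 by apply: (sfastM_bounded (C := C)) => //; exact: sfast_realf.
have mN f : sfast f -> - Ri f = Ri (fun u => - f u).
 by move=> ff; rewrite -mulN1r -RiZ; [apply: Ri_eq => z; rewrite mulN1r|exact: sfast_itg].
have ab a b : A0k (pix (a, false)) (pix (b, true)) = - ((a == b)%:R * rr b).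
 rewrite hv !pixK /realf /rint /nonef /= mulr0 mul0r subr0.
 rewrite /rr /bet; case: ifPn => [hb|hb]; last first.
  rewrite -mN; last by apply: sfastMs; [exact: sfast_al|exact: sfast_gj].
  by rewrite Ri_al_gj//; case: eqP => [->//|_]; rewrite !mul0r.
 transitivity (Ri (fun u => 2^-1 * al T a u)); first by apply: Ri_eq => u; ring.
 rewrite RiZ; last exact/sfast_itg/sfast_al.
 rewrite (Ri_al_odd T0 a T0 (oddlast_o hb)).
 have -> : oddlast o a = (a == b).
  move: hb; rewrite /oddlast => /andP[-> /eqP hb] /=; rewrite -hb.
  by apply/eqP/eqP => [h|->//]; exact: val_inj.
 by case: eqP => _; rewrite ?mul1r ?mul0r ?mulr0 ?oppr0 ?opprK.
have odd0 p q : (forall u, realf T p (- u) * rint T q (- u) = - (realf T p u * rint T q u)) ->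
  continuous (fun u => realf T p u * rint T q u) -> Ri (fun u => - (realf T p u * rint T q u)) = 0.
 rewrite -[p]pixK -[q]pixK => ho hc; rewrite -mN; last exact: sr.
 by rewrite Ri_odd ?oppr0//; exact/sfast_itg/sr.
apply/matrixP => j k; rewrite [RHS]mxE -[j]pixVK -[k]pixVK; case: (pixV j) => a s1; case: (pixV k) => b s2.
rewrite !pixK /=; case: s1; case: s2.
- rewrite hv !pixK /= if_same /realf /= Ri_be// !mulr0 subr0 -/(realf T (a, true) _).
 rewrite (_ : (fun u => _) = fun u => - (realf T (a, true) u * rint T (b, true) u)) // odd0 //.
  by move=> u; rewrite /realf /rint /= beN betN mulNr.
 by apply: contM; [exact: continuous_be|exact: continuous_bet].
- have := @A0ka_skew R _ X (@iox R) (@omx R) (@mio R) (@omx1 R) (@iomx R) n (@kax R) 1 (@mkax R) (@bkax R) (@akax R) _ _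
  (B0x R o) gphi gpx M (fun m => phix (t m)) (fun j x => erefl) phS.
 move=> /(congr1 (fun A : 'M[R]_(n.*2) => A (pix (a, true)) (pix (b, false)))); rewrite mxE [RHS]mxE => /eqP.
 rewrite -eqr_oppLR ab opprK => /eqP <-; rewrite eq_sym.
 by case: eqP => [->|_]; rewrite ?mul1r ?mul0r.
- by rewrite ab; case: eqP => [->|_]; rewrite ?mul1r ?mul0r ?oppr0.
- rewrite hv !pixK /= if_same mulr0 mul0r subr0 odd0 //.
  by move=> u; rewrite /realf /rint /= alN /alt primN ?mulrN//; [exact: continuous_al|exact: alN].
 by apply: contM; [exact: continuous_al|exact/continuous_prim/continuous_al].
Qed.

Definition ti i := t (lev i).
Lemma tau_ge0 i : 0 <= T - ti i.
rewrite subr_ge0 -tM /ti; have := hM i; rewrite leq_eqVlt => /orP[/eqP->//|h]; exact/ltW/tlt.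
Qed.

Lemma lev_tau i : (lev i == M) = (T - ti i == 0).
rewrite subr_eq0 -tM /ti; have := hM i; rewrite leq_eqVlt => /orP[/eqP->|h]; first by rewrite !eqxx.
by rewrite ltn_eqF// gt_eqF// tlt.
Qed.

Lemma lam_fin i u : lam i (kax (u, false)) = sgt (T - ti i) (xs i - u).
rewrite /lam lev_tau; case: eqVneq => [e0|n0]; first by rewrite /sgt e0 eqxx /kax /=.
have tp : 0 < T - ti i by rewrite lt_def n0 tau_ge0.
rewrite LfX /ppx /pker /posx /iox /= mul0r mulr0 addr0 tM -/(ti i) /sgt (negbTE n0) -[xs i - u]opprB.
rewrite (primN (u - xs i) (continuous_ga tp) (gaN _)) -Ri_hs_ga//.
transitivity (Ri (fun z => -1 * (ga (T - ti i) (xs i - z) * hs (u - z)))).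
 by apply: Ri_eq => z; rewrite /kax /= -[z - u]opprB hsN; ring.
rewrite RiZ ?mulN1r//.
apply/sfast_itg/(sfastM_bounded (C := 1)).
- rewrite (_ : (fun _ => _) = fun x => ga (T - ti i) (x - xs i)); last by apply/funext => z; rewrite -gaN opprB.
 exact/sfast_shift/sfast_ga.
- by apply: measurable_hs_comp; exact: measurable_funB.
by move=> z; exact: hs_bound.
Qed.

Lemma lam_none i : lam i (kax (none R)) = - 2^-1.
rewrite /lam lev_tau; case: eqVneq => [e0|n0]; first by rewrite /kax.
have tp : 0 < T - ti i by rewrite lt_def n0 tau_ge0.
rewrite LfX /ppx /pker /posx /iox /= mul0r mulr0 addr0 tM -/(ti i) /kax /=.
rewrite -[RHS]mulr1 -(Ri_ga (xs i) tp) -RiZ; last first.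
 exact/sfast_itg/sfast_shift/sfast_ga.
by apply: Ri_eq => z; rewrite -gaN opprB mulrC.
Qed.

(** The reflected time 2T - t arises here: the pairing with the sign is taken at time T and is then
    smoothed over the remaining time T - t of the point. *)
Lemma bka_val k i : bka_ (@iox R) (@kax R) lev posx (B0x R o) M (fun m => phix (t m)) ppx k i =
 - rint (2 * T - ti i) (pixV k) (xs i).
have -> : 2 * T - ti i = T + (T - ti i) by ring.
rewrite -[LHS]opprK; congr (- _).
rewrite -(@mu_lam R _ X (@iox R) (@omx R) (@mio R) (@omx1 R) (@iomx R) n (@kax R) 1 (@mkax R) (@bkax R) (@akax R) I lev posx _ px
 (B0x R o) gphi gpx M hM (fun m => phix (t m)) ppx (fun j x => erefl) phS ppx1 ppxS).
rewrite /mu LfX lam_none tM {1 2}/phix /= -(Ri_realf_sgt (pixV k) (xs i) T0 (tau_ge0 i)); congr (_ + _).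
 by apply: Ri_eq => z; rewrite lam_fin.
by ring.
Qed.

(** The sign between two points is smoothed by the remaining times of both. *)
Lemma G_val i i' : Gka (@iox R) (@kax R) lev posx (B0x R o) M ppx i i' = sgt (2 * T - ti i - ti i') (xs i' - xs i).
have -> : 2 * T - ti i - ti i' = (T - ti i) + (T - ti i') by ring.
rewrite /Gka {1}/lam lev_tau; case: eqVneq => [e0|n0]; first by rewrite e0 add0r lam_fin.
have tp : 0 < T - ti i by rewrite lt_def n0 tau_ge0.
pose L x := lam i' (kax x); rewrite -[LHS]/(Lf (@iox R) (B0x R o) (fun x => ppx (lev i) M (posx i) x * L x)).
rewrite LfX /ppx /pker /posx /iox /= mul0r mulr0 addr0 tM -/(ti i).
have LE u : L (u, false) = sgt (T - ti i') (xs i' - u) by exact: lam_fin.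
transitivity (Ri (fun u => ga (T - ti i) u * sgt (T - ti i') (xs i' - xs i - u))); last first.
 rewrite (@Ri_even_sgt R _ (ga (T - ti i + (T - ti i'))) _ _ (continuous_ga tp) (sfast_ga tp) (tau_ge0 i') (gaN _)).
 - by rewrite /sgt gt_eqF// ltr_wpDr// tau_ge0.
 - by apply: continuous_ga; rewrite ltr_wpDr// tau_ge0.
 move=> w; case: eqVneq => [->|n0']; first by rewrite addr0.
 have tp' : 0 < T - ti i' by rewrite lt_def n0' tau_ge0.
 have := ga_conv w 0 tp' tp; rewrite subr0 [T - ti i + _]addrC => <-.
 by apply: Ri_eq => z; rewrite subr0 mulrC.
have [e1|n1] := eqVneq (T - ti i') 0.
 rewrite e1 /sgt eqxx.
 transitivity (prim (ga (T - ti i)) (xs i' - xs i)).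
  by rewrite -Ri_hs_ga//; apply: Ri_eq => z; rewrite LE e1 /sgt eqxx.
 rewrite -[X in _ = Ri X]/(fun u => ga (T - ti i) u * hs (xs i' - xs i - u)).
 have := Ri_hs_ga 0 (xs i' - xs i) tp; rewrite subr0 => <-; apply: Ri_eq => z.
 by rewrite sub0r gaN.
have tp' : 0 < T - ti i' by rewrite lt_def n1 tau_ge0.
rewrite -(Ri_shift (xs i) (f := fun u => ga (T - ti i) u * sgt (T - ti i') (xs i' - xs i - u))).
- by apply: Ri_eq => z; rewrite LE -gaN opprB; congr (_ * sgt _ _); ring.
- apply: contM; first exact: continuous_ga.
 by apply: continuous_rsub; rewrite /sgt (negbTE n1); apply: continuous_prim; exact: continuous_ga.
apply: (sfastM_bounded (C := 1)); first exact: sfast_ga.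
 apply: continuous_mfun; apply: continuous_rsub; rewrite /sgt (negbTE n1); apply: continuous_prim; exact: continuous_ga.
by move=> z; rewrite /sgt (negbTE n1); exact: prim_le.
Qed.

Lemma Zst0_val (ep : I -> R) :
 Zst (@iox R) (@kax R) posx e (phix (t 0%N)) px [::] (B0x R o) ep fset0 fset0 M =
 (\prod_(a < n) - rr a) * (2 ^ n * n`!)%:R.
rewrite (@Zst0 R _ X (@iox R) (@omx R) (@mio R) (@omx1 R) (@iomx R) n (@kax R) 1 (@mkax R) (@bkax R) (@akax R) I lev posx
 e ue eP _ px (B0x R o) gphi gpx sN M hM (fun m => phix (t m)) ppx (fun j x => erefl) phS ppx1 ppxS ep).
by rewrite A0_val (@pfs_pairmx _ R rr) // => a b; rewrite !mxE.
Qed.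

Definition kS s x t' y : R := \sum_(a < n) (rr a)^-1 * (al t' a y * bet (2 * T - s) a x - be t' a y * alt (2 * T - s) a x)
 - (if s < t' then ga (t' - s) (x - y) else 0).
Definition kI s x t' y : R := sgt (2 * T - s - t') (y - x) +
 \sum_(a < n) (rr a)^-1 * (alt (2 * T - s) a x * bet (2 * T - t') a y - bet (2 * T - s) a x * alt (2 * T - t') a y).
Definition kD s x t' y : R := \sum_(a < n) (rr a)^-1 * (be s a x * al t' a y - al s a x * be t' a y).
Definition kmat s x t' y : 'M[R]_2 := \matrix_(i, j)
 if (i : nat) == 0%N then (if (j : nat) == 0%N then kS s x t' y else kI s x t' y)
 else (if (j : nat) == 0%N then kD s x t' y else kS t' y s x).

Lemma process_kmat (kp : R) (ep : I -> R) : kp * ((\prod_(a < n) - rr a) * (2 ^ n * n`!)%:R) = 1 ->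
 kp * Zst (@iox R) (@kax R) posx e (phix (t 0%N)) px [::] (B0x R o) ep fset0 fsetT M =
 Tdet (fun i j => kmat (ti i) (xs i) (ti j) (xs j)).
move=> hk.
rewrite (@process_Tdet R _ X (@iox R) (@omx R) (@mio R) (@omx1 R) (@iomx R) n (@kax R) 1 (@mkax R) (@bkax R) (@akax R) I lev posx
 e ue eP _ px (B0x R o) gphi gpx sN M hM (fun m => phix (t m)) ppx (fun j x => erefl) phS ppx1 ppxS kp ep).
 congr Tdet; apply/funext => i; apply/funext => j.
 have iv : invmx A0k = pairmx (fun a => - (rr a)^-1).
  by rewrite A0_val invmx_pairmx// => a; exact: rr_neq0.
 have hS i1 j1 : ker_S A0k (Psi lev posx (fun m => phix (t m))) (bka_ (@iox R) (@kax R) lev posx (B0x R o) M (fun m => phix (t m)) ppx)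
   (PPl lev posx ppx) i1 j1 = kS (ti i1) (xs i1) (ti j1) (xs j1).
  rewrite /ker_S /kS iv pairmx_bilin /PPl -sumrN addrC; congr (_ + _).
   by apply: eq_bigr => a _; rewrite !bka_val /Psi /phix !pixK /realf /rint /= /ti; ring.
  congr (- _); rewrite /ti.
  have [lt|ge] := ltnP (lev i1) (lev j1); first by rewrite tlt.
  rewrite ltNge; case: ifPn => // /negP[]; move: ge; rewrite leq_eqVlt => /orP[/eqP->|/tlt/ltW->//].
  by rewrite lexx.
 apply/matrixP => r s; rewrite !mxE !hS; case: ifP => _; case: ifP => _ //.
  rewrite /ker_I /kI iv pairmx_bilin G_val; congr (_ + _).
  by apply: eq_bigr => a _; rewrite !bka_val !pixK /rint /= !mulrNN mulNr -mulrN opprB.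
 rewrite /ker_D /kD iv pairmx_bilin -sumrN.
 by apply: eq_bigr => a _; rewrite /Psi /phix !pixK /realf /= /ti; ring.
rewrite A0_val (@pfs_pairmx _ R rr) // => a b; rewrite !mxE //.
Qed.
End Values.

(** * The iterated integral of the definitions as a nest of levels *)

Section IntegralAsNest.
Variable R : realType.

Lemma iint_add a b (F : (nat -> R) -> \bar R) :
 iint (a + b) F = iint a (fun z => iint b (fun z' => F (fun j => if (j < a)%N then z j else z' (j - a)%N))).
elim: a F => [|a IH] F /=.
 by congr (iint b _); apply/funext => z; congr F; apply/funext => j; rewrite subn0.
congr integral; apply/funext => u; rewrite IH; congr (iint a _); apply/funext => z.
congr (iint b _); apply/funext => z'; congr F; by apply/funext => -[|j].
Qed.

Variables (d : measure_display) (X : measurableType d).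
Variables (io : R -> X) (om : X -> R).
Hypotheses (mio : mfunT io) (mom : mfunT om).
Hypotheses (om1 : forall x, 1 <= om x) (iom : itg (fun u => (om (io u))^-1)).
Variables (n : nat) (ka : X -> X -> R) (Ck : R).
Hypotheses (mka : mfunT (fun x : X * X => ka x.1 x.2)) (bka : forall x y, `|ka x y| <= Ck).
Variables (p : nat -> X -> X -> R) (A : nat -> seq X).
Hypothesis gp : forall m, goodp om (p m).
Local Notation N := (n.*2).
Hypothesis sA : forall m, (size (A m) <= N)%N.

Lemma good_nests (A' : nat -> seq X) (B : nat -> seq (X * R)) s : good om N (nest io n ka [seq (p l, A' l, B l) | l <- s]).
by elim: s => [|l s IHs] /=; [exact: (good_ptop om n mka bka)|exact: (good_nest mio om1 iom)].
Qed.
Definition nfree m := (N - size (A m))%N.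

(** The integrand in terms of one sequence of variables, the free particles of successive levels
    occupying consecutive stretches of it. *)
Fixpoint dprod k m (phi : 'I_N -> X -> R) (z : nat -> R) : R :=
 dphi phi (acat (A m) (io \o z)) *
 (if k is k'.+1 then dprod k' m.+1 (fun i => p m.+1 (acat (A m) (io \o z) i)) (fun i => z (nfree m + i)%N)
  else ptop n ka (acat (A m) (io \o z))).

Lemma acat_ext (s : seq X) (z z' : nat -> X) j : (forall i, (i < j - size s)%N -> z i = z' i) ->
 forall i, (i < j)%N -> acat s z i = acat s z' i.
elim: s j => [|x s IH] j h i ij /=; first by apply: h; rewrite subn0.
case: i ij => [|i] ij //=; apply: (IH j.-1) => //; last by case: j ij {h}.
by move=> l lj; apply: h; move: lj; rewrite /=; lia.
Qed.

Lemma dphi_ext (phi : 'I_N -> X -> R) y y' : (forall i, (i < N)%N -> y i = y' i) -> dphi phi y = dphi phi y'.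
by move=> h; congr (\det _); apply/matrixP => i j; rewrite !mxE h//; exact: ltn_ord. Qed.

(** [iint_add] separates the variables of level [m] from the later ones; [c] is free so that it can
    absorb the determinant of the level just fixed. *)
Lemma iint_nest k m phi c : goodf om phi ->
 iint (\sum_(l < k.+1) nfree (m + l)) (fun z => (c * dprod k m phi z)%:E) =
 (c * (\prod_(l < k.+1) (nfree (m + l))`!%:R) *
  nest1 io phi (A m) [::] (nest io n ka [seq (p l, A l, [::]) | l <- iota m.+1 k]))%:E.
elim: k m phi c => [|k IH] m phi c gphi.
 rewrite !big_ord1 addn0 /=.
 have gG : good om N (ptop n ka) by exact: (good_ptop om n mka bka).
 have := @iintE R _ X io om mio om1 iom (nfree m) _ (niceZ c (nice_integrand om1 (A m) gphi gG)).
 rewrite /= => h; rewrite (_ : iint _ _ = iint (nfree m) (fun z => (c * (dphi phi (acat (A m) (fun i => io (z i))) *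
   ptop n ka (acat (A m) (fun i => io (z i)))))%:E)) // h (lintZ mio om1 iom _ _); last exact: nice_integrand.
 by rewrite /nest1 -/(nfree m) -!mulrA; congr (_ * _)%:E; rewrite mulrA divff ?mul1r// pnatr_eq0 -lt0n fact_gt0.
set G := nest io n ka _.
have gG : good om N G.
 exact: (good_nests A (fun=> [::])).
rewrite big_ord_recl addn0 iint_add.
have e (z : nat -> R) : iint (\sum_(i < k.+1) nfree (m + bump 0 i)) (fun z' =>
  (c * dprod k.+1 m phi (fun j => if (j < nfree m)%N then z j else z' (j - nfree m)%N))%:E) =
 (c * (\prod_(l < k.+1) (nfree (m.+1 + l))`!%:R) * (dphi phi (acat (A m) (io \o z)) * G (acat (A m) (io \o z))))%:E.
 rewrite (eq_bigr (fun i : 'I_k.+1 => nfree (m.+1 + i))) => [|i _]; last by rewrite /bump /= add1n addnS addSn.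
 set y := acat (A m) (io \o z).
 have -> : (fun z' => (c * dprod k.+1 m phi (fun j => if (j < nfree m)%N then z j else z' (j - nfree m)%N))%:E) =
   (fun z' => ((c * dphi phi y) * dprod k m.+1 (fun i => p m.+1 (y i)) z')%:E).
  apply/funext => z'; rewrite -mulrA; congr (_ * _)%:E; rewrite [LHS]/=.
  have hy i : (i < N)%N -> acat (A m) (io \o (fun j => if (j < nfree m)%N then z j else z' (j - nfree m)%N)) i = y i.
   by apply: acat_ext => j jN /=; rewrite /nfree jN.
  congr (_ * _); first exact: dphi_ext.
  rewrite [X in dprod _ _ _ X = _](_ : _ = z'); last first.
   by apply/funext => i; rewrite ltnNge leq_addr /= addKn.
  by congr (dprod _ _ _ _); apply/funext => i; rewrite hy.
 rewrite IH; last exact: (goodp_f om1 N y (gp m.+1)).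
 by congr (_%:E); rewrite /G /=; ring.
under [X in iint _ X]eq_fun do rewrite e.
set c' := c * _.
have := @iintE R _ X io om mio om1 iom (nfree m) _ (niceZ c' (nice_integrand om1 (A m) gphi gG)).
rewrite /= => h; rewrite (_ : iint _ _ = iint (nfree m) (fun z => (c' * (dphi phi (acat (A m) (fun i => io (z i))) *
   G (acat (A m) (fun i => io (z i)))))%:E)) // h (lintZ mio om1 iom _ _); last exact: nice_integrand.
rewrite /nest1 -/(nfree m) big_ord_recl addn0; congr (_%:E).
rewrite (eq_bigr (fun i : 'I_k.+1 => (nfree (m.+1 + i))`!%:R)) => [|i _]; last by rewrite lift0 addnS addSn.
set L := lint _ _ _ _; rewrite /c'; set P := \prod_(l < _) _.
have f0 : (nfree m)`!%:R != 0 :> R by rewrite pnatr_eq0 -lt0n fact_gt0.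
by rewrite mulrA; field.
Qed.

Lemma dprodE k m phi z (off := fun l : nat => (\sum_(i < l) nfree (m + i))%N)
  (y := fun l : nat => acat (A (m + l)) (fun i => io (z (off l + i)%N))) :
 dprod k m phi z = dphi phi (y 0%N) * (\prod_(l < k) @dphi _ _ _ N (fun i : 'I_N => p (m + l).+1 (y l i)) (y l.+1)) * ptop n ka (y k).
rewrite /y /off {y off}; elim: k m phi z => [|k IH] m phi z /=.
 rewrite !big_ord0 mulr1 !addn0.
 by congr (dphi _ (acat _ _) * ptop _ _ (acat _ _)); apply/funext => i /=; rewrite add0n.
have e0 : (fun i => io (z (\sum_(i < 0) nfree (m + i) + i)%N)) = io \o z.
 by apply/funext => i; rewrite big_ord0 add0n.
have eS l : (fun i => io (z (\sum_(i < l.+1) nfree (m + i) + i)%N)) =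
  (fun i => io (z (nfree m + (\sum_(i < l) nfree (m.+1 + i) + i))%N)).
 apply/funext => i; rewrite big_ord_recl addn0 -addnA; congr (io (z (_ + (_ + _))%N)).
 by apply: eq_bigr => j _; rewrite lift0 addnS addSn.
rewrite big_ord_recl /bump /= !e0 !eS !addn0 -!mulrA; congr (_ * _).
rewrite IH !addn0 addn1 !addnS !addSn -!mulrA; congr (_ * _).
by congr (_ * _); apply: eq_bigr => l _; rewrite /bump leq0n add1n !addnS !addSn !eS.
Qed.

(** Without atoms the variables range over the image of [io] only. *)
Lemma lint_eq_io k (F G : (nat -> X) -> R) :
 (forall z, (forall i, exists u, z i = io u) -> F z = G z) -> lint io [::] k F = lint io [::] k G.
elim: k F G => [|k IH] F G h /=; first by apply: h => i; exists 0.
rewrite /Lf !big_nil; congr (_ + _); apply: Ri_eq => u; apply: IH => z hz; apply: h => -[|i] /=; last exact: hz.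
by exists u.
Qed.
End IntegralAsNest.

Section FrozenParticle.
Variables (R : realType) (d : measure_display) (X : measurableType d).
Variables (io : R -> X) (om : X -> R).
Hypotheses (mio : mfunT io) (mom : mfunT om).
Hypotheses (om1 : forall x, 1 <= om x) (iom : itg (fun u => (om (io u))^-1)).
Variables (n : nat) (ka : X -> X -> R) (Ck : R).
Hypotheses (mka : mfunT (fun x : X * X => ka x.1 x.2)) (bka : forall x y, `|ka x y| <= Ck).
Variables (p : nat -> X -> X -> R) (A : nat -> seq X).
Hypothesis gp : forall m, goodp om (p m).
Local Notation N := (n.*2).
Variables (x0 : X) (rl : pred X).
Hypotheses (sA : forall m, (size (A m) < N)%N) (rio : forall u, rl (io u)) (rA : forall m, all rl (A m)) (p0 : forall m y, rl y -> p m x0 y = 0).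

Lemma acat_real m z i : (forall i, exists u, z i = io u) -> rl (acat (A m) z i).
move=> hz; have := rA m; elim: (A m) i => [|x s IH] i /=; first by move=> _; have [u ->] := hz i.
by case/andP => rx rs; case: i => [//|i]; exact: IH.
Qed.

(** A row that vanishes at all real points forces a variable onto the atom, and by [nest1_cons] only
    one can be there; the atom of mass 1 may thus be traded for a prescribed point. *)
Lemma nest1_frozen (phi : 'I_N -> X -> R) m G : goodf om phi -> good om N G -> (exists i, forall y, rl y -> phi i y = 0) ->
 @nest1 _ _ _ io N phi (A m) [:: (x0, 1)] G = nest1 io phi (x0 :: A m) [::] G.
move=> gphi gG [i0 hi0]; rewrite (nest1_cons mio om1 iom [::] x0 1 gphi gG (sA m)) mul1r.
rewrite (_ : nest1 io phi (A m) [::] G = 0) ?add0r; last first.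
 rewrite /nest1 (@lint_eq_io R _ X io _ _ (fun=> 0)) ?(lint0 mio om1 iom) ?mulr0// => z hz.
 rewrite (_ : dphi phi _ = 0) ?mul0r// /dphi (expand_det_row _ i0) big1// => j _.
 by rewrite mxE hi0 ?mul0r//; exact: acat_real.
by rewrite -[LHS](@nest1_move _ _ _ _ _ iom N phi [::] x0 (A m) [::] G)//=.
Qed.

(** Once [x0] is among the particles of a level, its transition row vanishes at all real points, so
    the argument repeats at the next level. *)
Lemma nest_frozen m k (w : nat -> X) : (exists2 i, (i < N)%N & w i = x0) ->
 nest io n ka [seq (p l, A l, [:: (x0, 1)]) | l <- iota m k] w =
 nest io n ka [seq (p l, x0 :: A l, [::]) | l <- iota m k] w.
elim: k m w => [//|k IH] m w [i iN wi] /=.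
rewrite nest1_frozen; first last.
- by exists (Ordinal iN) => y ry; rewrite wi p0.
- exact: (good_nests mio om1 iom n mka bka gp A (fun=> [:: (x0, 1)])).
- exact: (goodp_f om1 N w (gp m)).
rewrite /nest1; congr (_ * _); apply: lint_eq => z; congr (_ * _); rewrite IH//.
by exists 0%N => //; exact: leq_ltn_trans (sA 0).
Qed.

Lemma nests_frozen (phi : 'I_N -> X -> R) m k : goodf om phi -> (exists i, forall y, rl y -> phi i y = 0) ->
 @nest1 _ _ _ io N phi (A m) [:: (x0, 1)] (nest io n ka [seq (p l, A l, [:: (x0, 1)]) | l <- iota m.+1 k]) =
 nest1 io phi (x0 :: A m) [::] (nest io n ka [seq (p l, x0 :: A l, [::]) | l <- iota m.+1 k]).
move=> gphi h.
rewrite nest1_frozen//; last exact: (good_nests mio om1 iom n mka bka gp A (fun=> [:: (x0, 1)])).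
rewrite /nest1; congr (_ * _); apply: lint_eq => z; congr (_ * _); rewrite nest_frozen//.
by exists 0%N => //; exact: leq_ltn_trans (sA 0).
Qed.
End FrozenParticle.

(** * Total positivity of the Gaussian kernel *)

Section TotalPositivity.
Variable R : realType.
Implicit Types (x y : R).

(** The determinant is linear in column [k], so the mean value theorem applies to the one function
    obtained by expanding along that column. *)
Lemma det_mvt_step n (f f' : 'I_n -> R -> R) (C : 'M[R]_n) (k : 'I_n) (a b : R) : a < b ->
 (forall i (u : R), is_derive u (1 : R) (f i) (f' i u)) -> (forall i, C i k = f i b - f i a) ->
 exists2 u, a < u < b & \det C = \det (\matrix_(i, j) if j == k then (b - a) * f' i u else C i j).
move=> ab df hC.
pose G u := \sum_i cofactor C i k * f i u.
have dG (u : R) : is_derive u (1 : R) G (\sum_i cofactor C i k * f' i u).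
 have -> : G = \sum_i (fun u => cofactor C i k * f i u) by apply/funext => v; rewrite fct_sumE.
 by apply: is_derive_sum => i; apply: is_deriveZ.
have [u uab hu] : exists2 u, u \in `]a, b[ & G b - G a = (\sum_i cofactor C i k * f' i u) * (b - a).
 apply: MVT => //.
 apply: derivable_within_continuous => u _; by have [] := dG u.
exists u; first by move: uab; rewrite in_itv.
rewrite (expand_det_col _ k) (expand_det_col (\matrix_(i, j) _) k).
transitivity (G b - G a).
 rewrite /G -sumrB; apply: eq_bigr => i _; rewrite hC; ring.
rewrite hu mulr_suml; apply: eq_bigr => i _; rewrite !mxE eqxx.
have -> : cofactor (\matrix_(i, j) (if j == k then (b - a) * f' i u else C i j)) i k = cofactor C i k.
 rewrite /cofactor; congr (_ * \det _); apply/matrixP => s t; rewrite !mxE.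
 by rewrite eq_sym (negbTE (neq_lift k t)).
by ring.
Qed.

Lemma det_colscale n (c : 'I_n -> R) (A : 'M[R]_n) : \det (\matrix_(i, j) (A i j * c j)) = \det A * \prod_j c j.
rewrite -[\prod_j c j](_ : \det (diag_mx (\row_j c j)) = _); last by rewrite det_diag; apply: eq_bigr => j _; rewrite mxE.
by rewrite -det_mulmx; congr (\det _); apply/matrixP => i j; rewrite mul_mx_diag !mxE.
Qed.

Lemma det_rowscale n (c : 'I_n -> R) (A : 'M[R]_n) : \det (\matrix_(i, j) (c i * A i j)) = (\prod_i c i) * \det A.
rewrite -det_tr -[in RHS]det_tr mulrC -det_colscale; congr (\det _).
by apply/matrixP => i j; rewrite !mxE mulrC.
Qed.

Lemma det_mvt n (f f' : 'I_n -> R -> R) (a b : 'I_n -> R) : (forall j, a j < b j) ->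
 (forall i (u : R), is_derive u (1 : R) (f i) (f' i u)) ->
 exists2 u : 'I_n -> R, (forall j, a j < u j < b j) &
  \det (\matrix_(i, j) (f i (b j) - f i (a j))) = (\prod_j (b j - a j)) * \det (\matrix_(i, j) f' i (u j)).
move=> ab df.
have h k : (k <= n)%N -> exists2 u : 'I_n -> R, (forall j, a j < u j < b j) &
  \det (\matrix_(i, j) (f i (b j) - f i (a j))) =
  \det (\matrix_(i, j) if (j < k)%N then (b j - a j) * f' i (u j) else f i (b j) - f i (a j)).
 elim: k => [_|k IH kn].
  exists (fun j => (a j + b j) / 2); last by congr (\det _); apply/matrixP => i j; rewrite !mxE ltn0.
  by move=> j; rewrite !midf_lt.
 have [u hu ->] := IH (ltnW kn); pose k0 := Ordinal kn.
 set C := \matrix_(i, j) _.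
 have [|v hv ->] := @det_mvt_step n f f' C k0 _ _ (ab k0) df.
  by move=> i; rewrite !mxE ltnn.
 exists (fun j => if j == k0 then v else u j); first by move=> j; case: eqP => [->|_].
 congr (\det _); apply/matrixP => i j; rewrite !mxE.
 have [->|jk] := eqVneq j k0; first by rewrite ltnSn.
 by have -> : (j < k.+1)%N = (j < k)%N by move: jk; rewrite -(inj_eq val_inj) /=; lia.
have [u hu ->] := h n (leqnn n); exists u => //.
rewrite mulrC -det_colscale; congr (\det _); apply/matrixP => i j; rewrite !mxE ltn_ord mulrC //.
Qed.

(** After the first row is scaled to 1, differences of neighbouring columns leave a determinant of
    increments. The mean value theorem turns it into one of the same kind and smaller size, at
    intermediate points that are again increasing. *)
Lemma det_exp_gt0 n (x y : 'I_n -> R) : (forall i j : 'I_n, (i < j)%N -> x i < x j) ->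
 (forall i j : 'I_n, (i < j)%N -> y i < y j) -> 0 < \det (\matrix_(i, j) expR (x i * y j)).
elim: n x y => [|n IH] x y hx hy; first by rewrite det_mx00.
pose x' (i : 'I_n) := x (lift ord0 i) - x ord0.
have x'0 i : 0 < x' i by rewrite subr_gt0; apply: hx.
pose f (i : 'I_n) u := expR (x' i * u).
have df i (u : R) : is_derive u (1 : R) (f i) (x' i * expR (x' i * u)).
 have dl : is_derive u (1 : R) (fun u => x' i * u) (x' i).
  have d1 := is_deriveZ (x' i) (is_derive_id u (1 : R)).
  by apply: is_derive_eq; rewrite /GRing.scale /= mulr1.
 by rewrite mulrC; exact: (@is_derive1_comp R expR (fun u => x' i * u) u _ _ (is_derive_expR _) dl).
pose E : 'M[R]_n.+1 := \matrix_(i, j) expR ((x i - x ord0) * y j).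
have -> : \det (\matrix_(i, j) expR (x i * y j)) = \det E * \prod_j expR (x ord0 * y j).
 rewrite -det_colscale; congr (\det _); apply/matrixP => i j; rewrite !mxE -expRD; congr expR; ring.
rewrite pmulr_lgt0; last by apply: prodr_gt0 => j _; exact: expR_gt0.
(* Multiplication by [B] subtracts from each column its left neighbour, so the constant first row of
   [E] becomes (1, 0, ..., 0). *)
pose B : 'M[R]_n.+1 := \matrix_(i, j) ((i == j)%:R - (i.+1 == j :> nat)%:R).
have dB : \det B = 1.
 rewrite -det_tr det_trig; first by rewrite big1// => i _; rewrite !mxE eqxx gtn_eqF// subr0.
 by apply/is_trig_mxP => i j ij; rewrite !mxE -(inj_eq val_inj) /= !gtn_eqF ?subr0// ltnW.
rewrite -[\det E]mulr1 -dB -det_mulmx (expand_det_row _ ord0) big_ord_recl.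
have EB0 i : (E *m B) i ord0 = E i ord0.
 rewrite mxE (bigD1 ord0)//= big1 ?addr0; first by rewrite !mxE eqxx /= subr0 mulr1.
 by move=> k /negbTE k0; rewrite [B _ _]mxE k0 /= subr0 mulr0.
have EBS i (j : 'I_n) : (E *m B) i (lift ord0 j) = E i (lift ord0 j) - E i (widen_ord (leqnSn n) j).
 rewrite mxE (bigD1 (lift ord0 j))//= (bigD1 (widen_ord (leqnSn n) j))/=; last first.
  by rewrite -(inj_eq val_inj) /= /bump; lia.
 rewrite big1 ?addr0 => [|k /andP[/negbTE k1 /negbTE k2]].
  have -> : B (lift ord0 j) (lift ord0 j) = 1 by rewrite mxE eqxx gtn_eqF ?subr0.
  have -> : B (widen_ord (leqnSn n) j) (lift ord0 j) = - 1.
   by rewrite mxE -(inj_eq val_inj) /= /bump leq0n add1n ltn_eqF// eqxx sub0r.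
  by rewrite mulr1 mulrN1.
 rewrite [B _ _]mxE k1 [k.+1 == _](_ : _ = false) ?subrr ?mulr0//.
rewrite big1 ?addr0 => [|j _]; last by rewrite EBS !mxE !subrr !mul0r subrr mul0r.
rewrite EB0 mxE subrr mul0r expR0 mul1r /cofactor expr0 mul1r.
have [|u hu hd] := @det_mvt n f _ (fun j => y (widen_ord (leqnSn n) j)) (fun j => y (lift ord0 j)) _ df.
 by move=> j; apply: hy => /=; rewrite /bump.
have -> : row' ord0 (col' ord0 (E *m B)) = \matrix_(i, j) (f i (y (lift ord0 j)) - f i (y (widen_ord (leqnSn n) j))).
 by apply/matrixP => i j; rewrite mxE mxE EBS !mxE.
rewrite hd mulr_gt0//.
 by apply: prodr_gt0 => j _; rewrite subr_gt0; apply: hy => /=; rewrite /bump.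
have -> : \matrix_(i, j) (x' i * expR (x' i * u j)) = \matrix_(i, j) (x' i * (\matrix_(i, j) expR (x' i * u j)) i j).
 by apply/matrixP => i j; rewrite !mxE.
rewrite det_rowscale mulr_gt0//; first exact: prodr_gt0.
apply: IH => i j ij; first by rewrite ltrD2r; apply: hx => /=; rewrite /bump !leq0n !add1n.
have /andP[_ h1] := hu i; have /andP[h2 _] := hu j.
apply: (lt_le_trans h1); apply: le_trans (ltW h2).
have := hy (lift ord0 i) (widen_ord (leqnSn n) j); rewrite /= /bump leq0n add1n.
have [lt|ge] := ltnP i.+1 j; first by move=> /(_ isT)/ltW.
move=> _; have e : i.+1 = j by lia.
by apply: le_of_eq; congr y; apply: val_inj; rewrite /= /bump leq0n add1n.
Qed.

Lemma fN_gt0 n (t : R) (x y : 'I_n -> R) : 0 < t -> inW x -> inW y -> 0 < fN t x y.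
move=> t0 /forallP hx /forallP hy.
have c0 : 0 < (2 * pi * t) `^ (- 2^-1) :> R by rewrite powR_gt0// !mulr_gt0// pi_gt0.
have -> : fN t x y = \det (\matrix_(i, j) (((2 * pi * t) `^ (- 2^-1) * expR (- (x i) ^+ 2 / (2 * t))) *
  (\matrix_(i, j) (expR (x i / t * y j) * expR (- (y j) ^+ 2 / (2 * t)))) i j)).
 congr (\det _); apply/matrixP => i j; rewrite !mxE /ptd -[RHS]mulrA -!expRD; congr (_ * expR _).
 by field; exact: lt0r_neq0.
rewrite det_rowscale mulr_gt0//; first by apply: prodr_gt0 => i _; rewrite mulr_gt0// expR_gt0.
have -> : \matrix_(i, j) (expR (x i / t * y j) * expR (- (y j) ^+ 2 / (2 * t))) =
  \matrix_(i, j) ((\matrix_(i, j) expR (x i / t * y j)) i j * expR (- (y j) ^+ 2 / (2 * t))).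
 by apply/matrixP => i j; rewrite !mxE.
rewrite det_colscale mulr_gt0//; last by apply: prodr_gt0 => i _; exact: expR_gt0.
apply: det_exp_gt0 => i j ij; last by have /forallP/(_ j)/implyP := hy i; exact.
by rewrite ltr_pM2r ?invr_gt0//; have /forallP/(_ j)/implyP := hx i; exact.
Qed.

Lemma Ri_gt0 (f : R -> R) (a b : R) : itg f -> (forall u, 0 <= f u) -> a < b ->
 (forall u, a <= u <= b -> 0 < f u) -> 0 < Ri f.
move=> If f0 ab fp.
have Rf0 : 0 <= Ri f by rewrite -(Ri0 (f := fun=> 0 : R))//; apply: Ri_le => //; rewrite (_ : (fun _ => _) = fun x => 0 * f x); [exact: itgZ|apply/funext => x; rewrite mul0r].
rewrite lt_def Rf0 andbT; apply/eqP => h0.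
have : (\int[@lebesgue_measure R]_x `|(f x)%:E| = 0)%E.
 under eq_integral do rewrite gee0_abs ?lee_fin//.
 by rewrite -EFin_Ri// h0.
move=> /(ae_eq_integral_abs (@lebesgue_measure R) measurableT (measurable_int _ If)) [N [mN N0 hN]].
have sN : `[a, b]%classic `<=` N.
 move=> u /=; rewrite in_itv /= => uab; apply: hN => /= /(_ I) [] e.
 by have := fp u uab; rewrite e ltxx.
have : (lebesgue_measure (`[a, b]%classic : set R) <= 0)%E.
 apply: (le_trans (le_measure (@lebesgue_measure R) (mem_set (measurable_itv `[a, b])) (mem_set mN) sN)).
 by apply: le_of_eq; exact: N0.
by rewrite lebesgue_measure_itv /= lte_fin ab -EFinD lee_fin subr_le0 leNgt ab.
Qed.

Local Notation lint1 := (@lint R _ R id [::]).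

Let og1 := @omr_ge1 R. Let og := @omr_gt0 R. Let og0 := @omr_ge0 R.
Local Hint Resolve og1 og og0 : core.

Lemma lint_ge0 k (F : (nat -> R) -> R) : (forall z, 0 <= F z) -> nice (@omr R) k F -> 0 <= lint1 k F.
elim: k F => [|k IH] F F0 nF /=; first exact: F0.
rewrite /Lf big_nil addr0; rewrite -(Ri0 (f := fun=> 0 : R))//; apply: Ri_le.
- by rewrite (_ : (fun _ => _) = fun x => 0 * (omr x)^-1); [exact/itgZ/itg_cauchy|apply/funext => x; rewrite mul0r].
- have tm := nice_tame (@measurable_id _ R setT) og1 (@itg_cauchy R) [::] nF.
 have := tame_itg (@measurable_id _ R setT) (@itg_cauchy R) tm; exact.
by move=> u; apply: IH => //; exact: nice_scons.
Qed.

Lemma lint_gt0 k (F : (nat -> R) -> R) (a b : nat -> R) : (forall z, 0 <= F z) -> nice (@omr R) k F ->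
 (forall i, a i < b i) -> (forall z, (forall i, (i < k)%N -> a i <= z i <= b i) -> 0 < F z) -> 0 < lint1 k F.
elim: k F a b => [|k IH] F a b F0 nF ab Fp /=; first exact: Fp.
rewrite /Lf big_nil addr0; apply: (@Ri_gt0 _ (a 0%N) (b 0%N)) => //.
- have tm := nice_tame (@measurable_id _ R setT) og1 (@itg_cauchy R) [::] nF.
 have := tame_itg (@measurable_id _ R setT) (@itg_cauchy R) tm; exact.
- by move=> u; apply: lint_ge0 => //; exact: nice_scons.
move=> u uab; apply: (IH _ (fun i => a i.+1) (fun i => b i.+1)) => //; first exact: nice_scons.
by move=> z hz; apply: Fp => -[|i] //= ik; exact: hz.
Qed.

Lemma inW_prod n (y : 'I_n -> R) (c : R) : (if inW y then c else 0) =
 c * \prod_(i < n) \prod_(j < n) (if (i < j)%N then (if y i < y j then 1 else 0) else 1).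
case: ifPn => [/forallP h|].
 by rewrite big1 ?mulr1// => i _; rewrite big1// => j _; case: ifP => // ij; have /forallP/(_ j) := h i; rewrite ij /= => ->.
rewrite negb_forall => /existsP[i]; rewrite negb_forall => /existsP[j]; rewrite negb_imply => /andP[ij /negbTE h].
by rewrite (bigD1 i)//= (bigD1 j)//= ij h !mul0r mulr0.
Qed.

(** Needed because the transition density divides by this quantity. *)
Lemma NN_gt0 n (t : R) (x : 'I_n -> R) : 0 <= t -> inW x -> 0 < NN t x.
move=> t_ge0 hx; rewrite /NN; case: eqVneq => // tn0.
have t0 : 0 < t by rewrite lt_def tn0.
pose F (z : nat -> R) : R := if inW (fun i : 'I_n => z i) then fN t x (fun i => z i) else 0.
have fE z : fN t x (fun i => z (val i)) = @dphi _ _ _ n (fun i u => ptd t (x i) u) z by [].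
have sp i : fast (@omr R) (fun u => ptd t (x i) u).
 rewrite (_ : (fun u => _) = fun u => ga t (u - x i)); first exact/sfast_shift/sfast_ga.
 by apply/funext => u; rewrite ptdE -gaN opprB.
have F0 z : 0 <= F z by rewrite /F; case: ifP => // hy; exact/ltW/fN_gt0.
have nF : nice (@omr R) n F.
 split.
  move=> d' A z mz; rewrite (_ : (fun a => F (z a)) = fun a => dphi (fun i u => ptd t (x i) u) (z a) *
   \prod_(i < n) \prod_(j < n) (if (i < j)%N then (if z a i < z a j then 1 else 0) else 1)); last first.
   by apply/funext => a; rewrite /F inW_prod fE.
  apply: mfunM; first by apply: (pm_dphi _ mz) => i; case: (sp i).
  apply: (@measurable_prod _ _ _ _ _ _ (fun (i : 'I_n) a => \prod_(j < n) (if (i < j)%N then (if z a i < z a j then 1 else 0) else 1))) => i _.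
  apply: (@measurable_prod _ _ _ _ _ _ (fun (j : 'I_n) (a : A) => (if (i < j)%N then (if z a i < z a j then 1 else 0) else 1) : R)) => j _; case: (i < j)%N => //.
  by apply: measurable_fun_ifT => //; exact: measurable_fun_ltr.
 have /choice[C hC] : forall i, exists C, 0 <= C /\ forall u, `|ptd t (x i) u| * omr u ^+ 1 <= C by move=> i; exact: (sp i).2.
 exists (n`!%:R * \prod_i C i); split; first by rewrite mulr_ge0// prodr_ge0// => i _; case: (hC i).
 move=> z; rewrite -mulrA; apply: le_trans (dphi_bound (phi := fun i u => ptd t (x i) u) (a := C) (b := fun u => (omr u)^-1) z _ _).
 - by rewrite /F; case: ifP => _; rewrite ?fE// normr0.
 - by move=> i; case: (hC i).
 - by move=> i u; rewrite ler_pdivlMr//; have := (hC i).2 u; rewrite expr1.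
rewrite /intRn (_ : (fun z => _) = fun z => (F z)%:E); last by apply/funext => z; rewrite /F; case: ifP.
have := @iintE R _ R id (@omr R) (@measurable_id _ R setT) og1 (@itg_cauchy R) n F nF; rewrite /= => ->.
(* The intervals [i, i + 1/2] are ordered and disjoint, so their product is a box inside the
   chamber, where the integrand is positive. *)
apply: (@lint_gt0 n F (fun i => i%:R) (fun i => i%:R + 2^-1)) => //.
 by move=> i; rewrite ltrDl invr_gt0.
move=> z hz; have hW : inW (fun i : 'I_n => z i).
 apply/forallP => i; apply/forallP => j; apply/implyP => ij.
 have /andP[_ h1] := hz i (ltn_ord i); have /andP[h2 _] := hz j (ltn_ord j).
 apply: (le_lt_trans h1); apply: lt_le_trans h2.
 apply: (@lt_le_trans _ _ (i.+1%:R)); last by rewrite ler_nat.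
 by rewrite -[i.+1%:R]natr1 ltrD2l invf_lt1// ltr1n.
by rewrite /F hW; exact: fN_gt0.
Qed.

Lemma srtP n (x : 'I_n -> R) : exists s : 'S_n, forall i, srt x i = x (s i).
have /tuple_permP[s hs] : perm_eq (sort <=%R [seq x j | j <- enum 'I_n]) [tuple x i | i < n] by rewrite perm_sort.
exists s => i; rewrite /srt hs (nth_map i) ?size_enum_ord//= nth_ord_enum tnth_mktuple //.
Qed.

Lemma srt_inW n (x : 'I_n -> R) : distinct x -> inW (srt x).
rewrite /distinct -sort_lt_sorted => h; apply/forallP => i; apply/forallP => j; apply/implyP => ij.
rewrite /srt; apply: (sorted_ltn_nth lt_trans 0 h) => //; rewrite inE size_sort size_map size_enum_ord//.
Qed.
End TotalPositivity.

(** * The density as a product of determinants and a Pfaffian *)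

Section Pointwise.
Variables (R : realType) (T : R) (n nn : nat) (o : bool).
Hypotheses (T0 : 0 < T) (hn : n.*2 = (o + nn)%N).
Local Notation X := (R * bool)%type.
Local Notation N := (n.*2).
Implicit Types (t tau : R) (y w : 'I_nn -> R).

Definition cfg y (j : nat) : X :=
 if o && (j == 0)%N then none R else if insub (j - o)%N is Some i then iox (y i) else none R.

Lemma cfgS y (i : 'I_nn) : o -> cfg y i.+1 = iox (y i).
by move=> oo; rewrite /cfg oo subn1 /= valK. Qed.
Lemma cfgF y (i : 'I_nn) : ~~ o -> cfg y i = iox (y i).
by move=> /negbTE oo; rewrite /cfg oo subn0 valK. Qed.
Lemma cfg0 y : o -> cfg y 0 = none R. by rewrite /cfg => ->. Qed.
Let hnT : o -> n.*2 = nn.+1. by rewrite hn => ->. Qed.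
Let hnF : ~~ o -> n.*2 = nn. by rewrite hn => /negbTE ->. Qed.

Lemma ordT (i : 'I_N) : o -> (i = 0%N :> nat) \/ exists a : 'I_nn, i = a.+1 :> nat.
move=> oo; have := ltn_ord i; rewrite [X in (_ < X)%N](hnT oo); case: (val i) => [|k] kn; [by left|right].
by exists (Ordinal (kn : (k < nn)%N)).
Qed.

Lemma ordF (i : 'I_N) : ~~ o -> exists a : 'I_nn, i = a :> nat.
by move=> oo; have := ltn_ord i; rewrite [X in (_ < X)%N](hnF oo) => h; exists (Ordinal h). Qed.

(** The sizes [n.*2] and [nn] or [nn.+1] are equal only by hypothesis; entries given by functions on
    nat allow the change of size. *)
Lemma det_nat (N' N'' : nat) (F : nat -> nat -> R) : N' = N'' ->
 \det (\matrix_(i < N', j < N') F i j) = \det (\matrix_(i < N'', j < N'') F i j).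
by move=> ->. Qed.

Lemma det_cfg (G : X -> X -> R) w y : (o -> G (none R) (none R) = 1) -> (o -> forall u, G (none R) (iox u) = 0) ->
 \det (\matrix_(i < N, j < N) G (cfg w i) (cfg y j)) = \det (\matrix_(i, j) G (iox (w i)) (iox (y j))).
move=> h1 h2; have [oo|oo] := boolP o; last first.
 rewrite (det_nat (fun i j => G (cfg w i) (cfg y j)) (hnF oo)).
 by congr (\det _); apply/matrixP => i j; rewrite !mxE !cfgF.
rewrite (det_nat (fun i j => G (cfg w i) (cfg y j)) (hnT oo)).
rewrite (expand_det_row _ ord0) big_ord_recl big1 ?addr0 => [|j _]; last first.
 by rewrite mxE cfg0// lift0 cfgS// h2// mul0r.
rewrite mxE !cfg0// h1// mul1r /cofactor addn0 expr0 mul1r; congr (\det _); apply/matrixP => i j.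
by rewrite !mxE !lift0 !cfgS.
Qed.

Lemma dphi_pker tau w y : dphi (fun i : 'I_N => pker o tau (cfg w i)) (cfg y) = fN tau w y.
by rewrite /dphi det_cfg //= /pker /= => ->.
Qed.

(* The polynomial of degree k such that the k-th (unreduced) basis function is this polynomial times [ga t]. *)
Definition qp t k : {poly R} := if odd k then (2 * T)^-1 *: yp T t k - (k.-1%:R) *: yp T t k.-2 else yp T t k.
(** The leading coefficient of [qp t k]. *)
Definition lq t k : R := (if odd k then (2 * T)^-1 else 1) * (- (2 * T / t)) ^+ k.

Lemma size_yp t k : (size (yp T t k) <= k.+1)%N /\ (yp T t k)`_k = (- (2 * T / t)) ^+ k.
elim/ltn_ind: k => -[|k] IH; first by rewrite yp0 size_poly1 coef1.
have [s1 c1] := IH k (ltnSn k).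
have s2 : (size (yp T t k.-1) <= k.+1)%N.
 case: k IH {s1 c1} => [|k] IH; first by rewrite yp0 size_poly1.
 by have [s _] := IH k (ltnW (ltnSn _)); exact: leq_trans s _.
rewrite ypS; split.
 apply: (leq_trans (size_scale_leq _ _)); apply: (leq_trans (size_polyD _ _)); rewrite geq_max.
 rewrite (leq_trans (size_scale_leq _ _))//; last exact: leqW.
 by rewrite andbT (leq_trans (size_polyMleq _ _))// size_polyX.
rewrite coefZ coefD coefXM /= c1 coefZ [_`_k.+1]nth_default ?mulr0 ?addr0 ?exprS//.
Qed.

Lemma size_qp t k : (size (qp t k) <= k.+1)%N /\ (qp t k)`_k = lq t k.
rewrite /qp /lq; have [s c] := size_yp t k; case: ifP => [ok|_]; last by rewrite mul1r.
have k0 : (0 < k)%N by case: k ok {s c}.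
have [s2 _] := size_yp t k.-2; have s3 : (size (yp T t k.-2) <= k)%N by apply: leq_trans s2 _; lia.
split; last by rewrite coefB !coefZ c [X in _ - _ * X]nth_default// mulr0 subr0.
apply: (leq_trans (size_polyD _ _)); rewrite geq_max (leq_trans (size_scale_leq _ _))//=.
by rewrite size_polyN (leq_trans (size_scale_leq _ _))// leqW.
Qed.

(** The coefficient matrix is triangular, which leaves a Vandermonde determinant. *)
Lemma det_polys (q : nat -> {poly R}) y : (forall k, (size (q k) <= k.+1)%N) ->
 \det (\matrix_(i < nn, j < nn) (q i).[y j]) = (\prod_(i < nn) (q i)`_i) * hN y.
move=> sq; have -> : hN y = \det (Vandermonde nn (\row_j y j)).
 by rewrite det_Vandermonde; apply: eq_bigr => i _; apply: eq_bigr => j _; rewrite !mxE.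
pose C : 'M[R]_nn := \matrix_(i, k) (q i)`_k.
have -> : \prod_(i < nn) (q i)`_i = \det C.
 rewrite det_trig; first by apply: eq_bigr => i _; rewrite mxE.
 by apply/is_trig_mxP => i j ij; rewrite mxE nth_default// (leq_trans (sq i)).
rewrite -det_mulmx; congr (\det _); apply/matrixP => i j; rewrite !mxE.
rewrite (@horner_coef_wide _ nn); last by rewrite (leq_trans (sq i)).
by apply: eq_bigr => k _; rewrite !mxE.
Qed.

Lemma hN_perm y (s : 'S_nn) : hN (fun i => y (s i)) = (-1) ^+ s * hN y.
have V z : hN z = \det (Vandermonde nn (\row_j z j)).
 by rewrite det_Vandermonde; apply: eq_bigr => i _; apply: eq_bigr => j _; rewrite !mxE.
rewrite !V -det_perm mulrC -[\det (perm_mx s)]det_tr -det_mulmx; congr (\det _).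
rewrite tr_perm_mx -col_permE; apply/matrixP => i j; rewrite !mxE //.
Qed.

Lemma fN_perml t w y (s : 'S_nn) : fN t (fun i => w (s i)) y = (-1) ^+ s * fN t w y.
rewrite /fN -det_perm -det_mulmx -row_permE; congr (\det _); apply/matrixP => i j; rewrite !mxE //.
Qed.
Lemma fN_permr t w y (s : 'S_nn) : fN t w (fun i => y (s i)) = (-1) ^+ s * fN t w y.
rewrite /fN -det_tr -[in RHS]det_tr -det_perm -det_mulmx -row_permE; congr (\det _); apply/matrixP => i j; rewrite !mxE //.
Qed.

(** An odd symmetry of the configuration makes every antisymmetric factor vanish there. *)
Lemma ndistinct_perm y : ~~ distinct y -> exists2 s : 'S_nn, odd_perm s & (fun i => y (s i)) = y.
move=> /injectivePn[i [j ij e]]; exists (tperm i j); first by rewrite odd_tperm ij.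
by apply/funext => k; case: tpermP => [->|->|].
Qed.

Definition rp t k u : R := if odd k then dgj T t k.-1 u else gj T t k u.

Lemma rpE t k u : rp t k u = (qp t k).[u] * ga t u.
rewrite /rp /qp; case: ifP => // ok; rewrite /dgj /gj hornerD hornerN !hornerZ.
have -> : k.-1.+1 = k by case: k ok.
by ring.
Qed.

Lemma det_rp t y : \det (\matrix_(i < nn, j < nn) rp t i (y j)) = (\prod_(i < nn) lq t i) * hN y * \prod_j ga t (y j).
rewrite -(eq_bigr _ (fun (i : 'I_nn) _ => (size_qp t i).2)) -det_polys; last by move=> k; case: (size_qp t k).
by rewrite -det_colscale; congr (\det _); apply/matrixP => i j; rewrite !mxE rpE.
Qed.

Lemma odd_nn : odd nn = o.
by have := congr1 odd hn; rewrite odd_double oddD; case: (o); case: (odd nn). Qed.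

Lemma dphi_phix t y : dphi (@phix R T n o t) (cfg y) = (-1) ^+ o * (\prod_(i < nn) lq t i) * hN y * \prod_j ga t (y j).
pose F (k : nat) (x : X) : R := if x.2 then ((k.+1 == N) && o)%:R else if (k.+1 == N) && o then 0 else rp t k x.1.
pose cc (p q : 'I_n * bool) : R := if p.2 then 0 else if q.2 then 0 else if val q.1 == n.-1 then ca T o p.1 else 0.
(* The correction by [ca] as a triangular change of basis with unit diagonal. *)
pose L : 'M[R]_N := \matrix_(k, l) ((k == l)%:R - cc (pixV k) (pixV l)).
have caL (a : 'I_n) : val a = n.-1 -> ca T o a = 0 by rewrite /ca => ->; rewrite ltnn andbF.
have dL : \det L = 1.
 rewrite -det_tr det_trig.
  rewrite big1// => k _; rewrite !mxE eqxx /cc; case: (pixV k).2; rewrite ?subr0//; case: eqP => [/caL->|_]; by rewrite subr0.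
 apply/is_trig_mxP => l k lk; rewrite !mxE.
 have -> : (k == l) = false by apply/negbTE; rewrite -(inj_eq val_inj) gtn_eqF.
 rewrite sub0r; move: lk; rewrite -[k]pixVK -[l]pixVK !pixK.
 case: (pixV k) => a s1; case: (pixV l) => b s2; rewrite /cc /=; case: s1; case: s2; rewrite ?oppr0// !add0n ltn_double => ba.
 by case: eqP => [e|]; rewrite ?oppr0//; move: ba; rewrite e; have := ltn_ord a; lia.
have kN (k : 'I_N) : oddlast o (pixV k).1 && (pixV k).2 = ((k.+1 == N) && o).
 rewrite /oddlast -[k]pixVK !pixK; case: (pixV k) => a s /=; have := ltn_ord a.
 by case: o; case: s; rewrite ?andbT ?andbF //= => an; apply/idP/idP => /eqP h; apply/eqP; lia.
have FE (k : 'I_N) x : F k x = if x.2 then nonef R o (pixV k) else if (pixV k).2 then be T o t (pixV k).1 x.1 else gj T t (pixV k).1.*2 x.1.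
 rewrite /F -kN /nonef andbC; case: x.2 => //; rewrite /be /rp.
 have e : val k = ((pixV k).2 + (pixV k).1.*2)%N by rewrite -[k in LHS]pixVK.
 have ek : (pixV k).2 = odd k by [].
 by rewrite -ek e; case: (pixV k).2; rewrite ?andbF//= andbT.
have -> : dphi (@phix R T n o t) (cfg y) = \det (\matrix_(i < N, j < N) F i (cfg y j)).
 rewrite -[RHS]mul1r -dL -det_mulmx; congr (\det _); apply/matrixP => k j; rewrite !mxE.
 rewrite (eq_bigr (fun l => (k == l)%:R * F l (cfg y j) - cc (pixV k) (pixV l) * F l (cfg y j))); last by move=> l _; rewrite !mxE mulrBl.
 rewrite sumrB (bigD1 k)//= eqxx mul1r big1 ?addr0; last by move=> l /negbTE lk; rewrite eq_sym lk mul0r.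
 rewrite FE /phix /realf; case: (pixV k) => a [].
  by rewrite big1 ?subr0// => l _; rewrite /cc mul0r.
 have an := ltn_ord a; have n1 : (n.-1 < n)%N by lia.
 rewrite big_pairs (bigD1 (Ordinal n1)) // big1 ?addr0; last first.
  move=> b; rewrite -(inj_eq val_inj) /= => /negbTE bn; rewrite [pixV _]pixK [pixV _]pixK /cc /= bn !mul0r addr0 //.
 rewrite FE !pixK /cc /= eqxx mul0r addr0.
 by case: (cfg y j).2; rewrite /nonef /= ?mulr0 addr0 ?subr0.
have [oo|oo] := boolP o; last first.
 rewrite (det_nat (fun i j => F i (cfg y j)) (hnF oo)) mul1r -det_rp; congr (\det _); apply/matrixP => i j.
 by rewrite !mxE cfgF// /F (negbTE oo) andbF.
rewrite (det_nat (fun i j => F i (cfg y j)) (hnT oo)).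
rewrite (expand_det_row _ ord_max) big_ord_recl big1 ?addr0 => [|j _]; last first.
 by rewrite mxE lift0 cfgS// /F /= hnT// oo eqxx /= mul0r.
rewrite mxE cfg0// /F /= hnT// oo eqxx mul1r /cofactor /= addn0 -signr_odd odd_nn oo -!mulrA; congr (_ * _).
rewrite mulrA -det_rp; congr (\det _); apply/matrixP => i j; rewrite !mxE lift0 cfgS// /=.
by rewrite /bump leqNgt ltn_ord add0n eqSS ltn_eqF.
Qed.

Lemma lift_cfg (s : 'S_nn) : exists2 s' : 'S_N, odd_perm s' = s & forall y (i : 'I_N), cfg (fun i => y (s i)) i = cfg y (s' i).
have cast (N' : nat) (s1 : 'S_N') : N = N' ->
  exists2 s' : 'S_N, odd_perm s' = s1 & forall i : 'I_N, exists2 j : 'I_N', i = j :> nat & s' i = s1 j :> nat.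
 by move=> e; subst N'; exists s1 => // i; exists i.
have [oo|oo] := boolP o; last first.
 have [s' os' hs'] := cast _ s (hnF oo); exists s'; first by rewrite os'.
 by move=> y i; have [j ij sj] := hs' i; rewrite sj ij !cfgF.
have [s' os' hs'] := cast _ (lift_perm ord0 ord0 s) (hnT oo); exists s'; first by rewrite os' odd_lift_perm.
move=> y i; have [j ij sj] := hs' i; rewrite sj ij.
case: (unliftP ord0 j) => [k ->|->]; first by rewrite lift_perm_lift !lift0 !cfgS.
by rewrite lift_perm_id !cfg0.
Qed.

Lemma ptop_perm y (s : 'S_nn) : ptop n (@kax R) (cfg (fun i => y (s i))) = (-1) ^+ s * ptop n (@kax R) (cfg y).
have [s' os' hs'] := lift_cfg s; rewrite -os' /ptop -pfs_perm; congr pfs; apply/matrixP => i j.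
by rewrite !mxE !hs'.
Qed.

(** The value of the unnormalised Pfaffian on sorted configurations; only its square will be
    evaluated. *)
Definition cpf : R := (-1) ^+ o * (2 ^- n * pfs (sgn_mx R n)).

Lemma ptop_sorted y : inW y -> ptop n (@kax R) (cfg y) = cpf.
move=> /forallP hy; pose D : 'M[R]_N := diag_mx (\row_j (if o && (nat_of_ord j == 0)%N then -1 else 1)).
have dD : \det D = (-1) ^+ o.
 rewrite det_diag (eq_bigr (fun j : 'I_N => if o && (nat_of_ord j == 0)%N then -1 else 1)); last by move=> j _; rewrite mxE.
 have [oo|oo] := boolP o; last by rewrite big1// => j _; rewrite (negbTE oo).
 rewrite -(big_mkord xpredT (fun j => if true && (j == 0)%N then -1 else 1)) hnT// big_nat_recl// big1 ?mulr1//.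
rewrite /cpf -dD.
have -> : 2 ^- n * pfs (sgn_mx R n) = pfs (2^-1 *: sgn_mx R n).
 rewrite /pfs /pfsv mulr_sumr; apply: eq_bigr => s _; rewrite mulrCA; congr (_ * _).
 rewrite [in RHS](eq_bigr (fun i => 2^-1 * sgn_mx R n (s (pix (i, false))) (s (pix (i, true))))); last by move=> i _; rewrite mxE.
 by rewrite big_split /= prodr_const card_ord exprVn.
rewrite -pfs_mul; congr pfs; apply/matrixP => i j; rewrite /D tr_diag_mx mul_mx_diag mul_diag_mx !mxE.
have hs (a b : 'I_nn) : hs (y b - y a) = 2^-1 * ((a < b)%N%:R - (b < a)%N%:R).
 rewrite /hs mulrC; congr (_ * _); have [ab|ba|ab] := ltngtP a b.
 - by rewrite subr0 gtr0_sg// subr_gt0; have /forallP/(_ b)/implyP := hy a; exact.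
 - by rewrite sub0r ltr0_sg// subr_lt0; have /forallP/(_ a)/implyP := hy b; exact.
 - by rewrite (val_inj ab) !subrr sgr0.
have [oo|oo] := boolP o; last first.
 have [a ->] := ordF i oo; have [b ->] := ordF j oo.
 by rewrite !cfgF// /kax /= hs mul1r mulr1.
have [->|[a ->]] := ordT i oo; have [->|[b ->]] := ordT j oo.
- by rewrite !cfg0// /kax /= !subrr !mulr0 mul0r.
- by rewrite cfg0// cfgS// /kax /= subr0 !mulr1 mulN1r.
- by rewrite cfg0// cfgS// /kax /=; ring.
by rewrite !cfgS// /kax /= hs !ltnS mul1r mulr1.
Qed.

Lemma cpf_sq : cpf ^+ 2 = n`!%:R ^+ 2.
rewrite /cpf exprMn sqrr_sign mul1r exprMn pfs_sq; last first.
 by apply/matrixP => i j; rewrite !mxE opprB.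
rewrite det_sgn_mx mulr1 natrM natrX exprMn mulrA -exprMn mulVf ?expr1n ?mul1r//.
Qed.

(** The survival factors [NN] telescope and cancel the one in [g0]. The signs from sorting cancel
    between neighbouring determinants, and at the last level against the Pfaffian. *)
Lemma rhoN_dprod (M : nat) (tt : 'I_M.+1 -> R) (x : 'I_M.+1 -> 'I_nn -> R) :
 (forall m, 0 < tt m) -> (forall m1 m2 : 'I_M.+1, (m1 < m2)%N -> tt m1 < tt m2) -> tt ord_max = T ->
 rhoN T tt x = CNT nn T (tt ord0) / ((-1) ^+ o * (\prod_(i < nn) lq (tt ord0) i)) / cpf *
  (dphi (@phix R T n o (tt ord0)) (cfg (x ord0)) *
  (\prod_(m < M) dphi (fun i : 'I_N => pker o (tt (inord m.+1) - tt (inord m)) (cfg (x (inord m)) i)) (cfg (x (inord m.+1)))) *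
  ptop n (@kax R) (cfg (x ord_max))).
move=> tt0 ttlt ttM.
have L0 : (-1) ^+ o * (\prod_(i < nn) lq (tt ord0) i) != 0.
 rewrite mulf_neq0 ?signr_eq0//; apply/prodf_neq0 => i _; rewrite /lq mulf_neq0//; last first.
  by rewrite expf_neq0// oppr_eq0 !mulf_neq0 ?invr_eq0 ?pnatr_eq0 ?gt_eqF.
 by case: ifP => // _; rewrite invr_eq0 mulf_neq0 ?pnatr_eq0 ?gt_eqF.
have C0 : cpf != 0.
 by have := cpf_sq; apply: contra_eq_neq => ->; rewrite expr0n /= eq_sym expf_neq0// pnatr_eq0 -lt0n fact_gt0.
rewrite dphi_phix (eq_bigr (fun m : 'I_M => fN (tt (inord m.+1) - tt (inord m)) (x (inord m)) (x (inord m.+1)))); last first.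
 by move=> m _; rewrite dphi_pker.
set L := (-1) ^+ o * _ in L0 *.
transitivity (CNT nn T (tt ord0) * (hN (x ord0) * (\prod_j ga (tt ord0) (x ord0 j)) *
  (\prod_(m < M) fN (tt (inord m.+1) - tt (inord m)) (x (inord m)) (x (inord m.+1))) * (ptop n (@kax R) (cfg (x ord_max)) / cpf))); last first.
 by field; rewrite C0 L0.
rewrite /rhoN; case: ifPn => [/forallP hd|]; last first.
 (* At coinciding points the density is 0 by definition; on the right the Vandermonde factor
    vanishes if they occur at the first level, a transition determinant if later. *)
 rewrite negb_forall => /existsP[m /ndistinct_perm[s os hs]].
 have [m0|m0] := posnP m.
  have em : m = ord0 by apply: val_inj.
  have := hN_perm (x m) s; rewrite hs os expr1 em => h.
  have -> : hN (x ord0) = 0 by apply/eqP; rewrite -eqr_opp oppr0 -[X in X == 0]mulN1r -h -[X in X == 0]/(hN _); lra.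
  by rewrite !(mul0r, mulr0).
 have mM : (m.-1 < M)%N by have := ltn_ord m; rewrite ltnS; lia.
 have em : inord (Ordinal mM).+1 = m by apply: val_inj; rewrite /= inordK ?prednK.
 rewrite (bigD1 (Ordinal mM))//= em.
 have := fN_permr (tt m - tt (inord m.-1)) (x (inord m.-1)) (x m) s; rewrite hs os expr1 => h.
 have -> : fN (tt m - tt (inord m.-1)) (x (inord m.-1)) (x m) = 0 by lra.
 by rewrite !(mul0r, mulr0).
have /choice[s hs] : forall m, exists s : 'S_nn, srt (x m) = fun i => x m (s i).
 by move=> m; have [s hs] := srtP (x m); exists s; exact/funext.
have W m : inW (srt (x m)) by exact: srt_inW.
pose a k := NN (T - tt (inord k)) (srt (x (inord k))).
have T_ge m : 0 <= T - tt m.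
 rewrite subr_ge0 -ttM; have [lt|ge] := ltnP m (@ord_max M); first exact/ltW/ttlt.
 by have -> : m = ord_max by apply: val_inj => /=; apply/eqP; rewrite eqn_leq ge -ltnS ltn_ord.
have a0 k : a k != 0 by rewrite gt_eqF// NN_gt0.
have -> : \prod_(m < M) gT T (tt (inord m)) (srt (x (inord m))) (tt (inord m.+1)) (srt (x (inord m.+1))) =
  (\prod_(m < M) fN (tt (inord m.+1) - tt (inord m)) (srt (x (inord m))) (srt (x (inord m.+1)))) * (a M / a 0%N).
 rewrite (eq_bigr (fun m : 'I_M => fN (tt (inord m.+1) - tt (inord m)) (srt (x (inord m))) (srt (x (inord m.+1))) * (a m.+1 / a m))).
  rewrite big_split /=; congr (_ * _).
  elim: (M) => [|k IH]; first by rewrite big_ord0 divff.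
  by rewrite big_ord_recr /= IH; field; rewrite !a0.
 by move=> m _; rewrite /gT /a mulrA.
have e0 : inord 0 = ord0 :> 'I_M.+1 by apply: val_inj; rewrite /= inordK.
have eM : inord M = ord_max :> 'I_M.+1 by apply: val_inj; rewrite /= inordK.
have aM : a M = 1 by rewrite /a eM ttM subrr /NN eqxx.
have sgs : \prod_(m < M) ((-1) ^+ s (inord m) * (-1) ^+ s (inord m.+1)) = (-1) ^+ s ord0 * (-1) ^+ s ord_max :> R.
 pose b k : R := (-1) ^+ s (inord k).
 suff h k : \prod_(m < k) (b m * b m.+1) = b 0%N * b k by rewrite -e0 -eM; exact: h.
 elim: k => [|k IH]; first by rewrite big_ord0 -expr2 sqrr_sign.
 by rewrite big_ord_recr /= IH mulrA -[_ * _ * b k]mulrA -expr2 sqrr_sign mulr1.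
rewrite /g0 aM div1r [X in _ * (X * _)](eq_bigr (fun m : 'I_M => ((-1) ^+ s (inord m) * (-1) ^+ s (inord m.+1)) *
 fN (tt (inord m.+1) - tt (inord m)) (x (inord m)) (x (inord m.+1)))); last first.
 by move=> m _; rewrite !hs fN_perml fN_permr mulrA.
rewrite [X in _ * (X / _)]big_split /= sgs hs hN_perm.
have -> : \prod_(i < nn) ptd (tt ord0) 0 (x ord0 (s ord0 i)) = \prod_j ga (tt ord0) (x ord0 j).
 by rewrite [RHS](reindex_perm (s ord0)); apply: eq_bigr => j _; rewrite ptdE sub0r gaN.
have -> : ptop n (@kax R) (cfg (x ord_max)) / cpf = (-1) ^+ s ord_max.
 apply: (mulfI C0); rewrite mulrC divfK// -(ptop_sorted (W ord_max)) hs ptop_perm mulrAC -expr2 sqrr_sign mul1r //.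
have a00 := a0 0%N; rewrite /a e0 hs in a00 *.
have gen (c e h d P f F : R) : d != 0 -> c * (e * h) * d * P * (e * f * F / d) = c * (e ^+ 2 * (h * P * F * f)).
 by move=> d0; field.
by rewrite gen// sqrr_sign mul1r.
Qed.
End Pointwise.

(** * Correlation functions as coefficients of the generating function *)

Section CorrelationProcess.
Variables (R : realType) (T : R) (n nn M : nat) (o : bool).
Hypotheses (T0 : 0 < T) (hn : n.*2 = (o + nn)%N).
Local Notation X := (R * bool)%type.
Local Notation N := (n.*2).
Variables (Nm : 'I_M.+1 -> nat) (x : forall m : 'I_M.+1, 'I_(Nm m) -> R) (tt : 'I_M.+1 -> R).
Hypotheses (Nnn : forall m, (Nm m <= nn)%N) (n0 : (0 < nn)%N) (tt0 : forall m, 0 < tt m) (ttlt : forall m1 m2 : 'I_M.+1, (m1 < m2)%N -> tt m1 < tt m2) (ttM : tt ord_max = T).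

Let og1 := @omr_ge1 R. Let og := @omr_gt0 R. Let og0 := @omr_ge0 R.
Local Hint Resolve og1 og og0 : core.

Local Notation I := {m : 'I_M.+1 & 'I_(Nm m)}.
Definition levI (i : I) : nat := tag i.
Definition xsI (i : I) : R := x (tagged i).
Definition eI (m : nat) : seq I := if insub m : option 'I_M.+1 is Some m' then [seq Tagged (fun m => 'I_(Nm m)) j | j <- enum 'I_(Nm m')] else [::].
(** Beyond level M the times are continued increasingly, so that every transition kernel has a
    positive time step. *)
Definition tI (k : nat) : R := if insub k is Some m then tt m else T + k%:R.

Lemma ueI m : uniq (eI m).
rewrite /eI; case: insub => // m'; rewrite map_inj_uniq ?enum_uniq// => i j /eqP.
by rewrite eq_Tagged => /eqP.
Qed.

Lemma eIP m i : (i \in eI m) = (levI i == m).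
rewrite /eI /levI; case: insubP => [m' _ <-|]; last first.
 by rewrite in_nil; case: eqP => // <-; rewrite ltn_ord.
case: i => m1 j /=; apply/mapP/eqP => [[j' _] /(congr1 tag) /= ->//|/val_inj e].
by subst m'; exists j; rewrite ?mem_enum.
Qed.

Lemma size_eI m : (size (eI m) <= nn)%N.
by rewrite /eI; case: insubP => // m' _ _; rewrite size_map size_enum_ord. Qed.
Lemma tIE (m : 'I_M.+1) : tI m = tt m. by rewrite /tI valK. Qed.

Lemma tt_le m : tt m <= T.
rewrite -ttM; have [lt|ge] := ltnP m (@ord_max M); first exact/ltW/ttlt.
by have -> : m = ord_max by apply: val_inj => /=; apply/eqP; rewrite eqn_leq ge -ltnS ltn_ord.
Qed.

Lemma tI0 : 0 < tI 0. by rewrite (tIE ord0). Qed.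
Lemma tIlt m k : (m < k)%N -> tI m < tI k.
rewrite /tI => mk; case: insubP => [m' _ em|]; case: insubP => [k' _ ek|].
- by apply: ttlt; rewrite em ek.
- move=> _; apply: (le_lt_trans (tt_le m')); rewrite ltrDl ltr0n; lia.
- by move=> /negP[]; have := ltn_ord k'; rewrite -[nat_of_ord k']/(val k') ek; lia.
by move=> _ _; rewrite ltrD2l ltr_nat.
Qed.
Lemma tIM : tI M = T. by rewrite (tIE ord_max). Qed.

Let posI := posx xsI.
Let pI := px o tI.
Let gpI m : goodp (@omx R) (pI m).
by apply: goodp_pker; rewrite subr_gt0; exact: tIlt. Qed.
Let gphiI : goodf (@omx R) (@phix R T n o (tI 0)). exact: goodf_phix tI0. Qed.
Definition Asub m : seq X := [seq posI i | i <- eI m].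
Definition Afull m : seq X := nseq o (none R) ++ Asub m.
Lemma size_Asub m : (size (Asub m) + o <= N)%N.
by rewrite size_map hn addnC leq_add2l size_eI. Qed.

Lemma Zst_frozen (ep : I -> R) :
 Zst (@iox R) (@kax R) posI eI (@phix R T n o (tI 0)) pI [::] (B0x R o) ep fset0 fsetT M =
 nest1 (@iox R) (@phix R T n o (tI 0)) (Afull 0) [::] (nest (@iox R) n (@kax R) [seq (pI l, Afull l, [::]) | l <- iota 1 M]).
have eA m : Aof posI eI [::] fsetT m = Asub m.
 by rewrite /Aof /= (eq_filter (a2 := xpredT)) ?filter_predT// => i; rewrite inE.
have eB m : Bof posI eI (B0x R o) ep fset0 m = B0x R o.
 by rewrite /Bof (eq_filter (a2 := pred0)) ?filter_pred0// => i; rewrite inE.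
rewrite /Zst /lvof eA eB; under [X in nest _ _ _ X]eq_map do rewrite eA eB.
rewrite /Afull /B0x; have [oo|oo] := boolP o; last by [].
apply: (@nests_frozen R _ X (@iox R) (@omx R) (@mio R) (@omx1 R) (@iomx R) n (@kax R) 1 (@mkax R) (@bkax R) pI Asub gpI
 (none R) (fun z => ~~ z.2)).
- by move=> m; have := size_Asub m; rewrite oo addn1.
- by [].
- by move=> m; rewrite all_map; apply/allP.
- by move=> m [u []] //= _; rewrite /pI /px /pker.
- exact: goodf_phix tI0.
have n1 : (n.-1 < n)%N by case: n hn => // /eqP; rewrite oo.
exists (pix (Ordinal n1, true)) => -[u []] //= _.
by rewrite /phix pixK /realf /= /be /oddlast /= eqxx.
Qed.

Lemma acatE (s : seq X) (w : nat -> X) j : acat s w j = if (j < size s)%N then nth (none R) s j else w (j - size s)%N.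
by elim: s j => [|a s IH] [|j] //=; rewrite ?subn0// IH ltnS subSS. Qed.
Lemma nfreeE (m : 'I_M.+1) : nfree n Afull m = (nn - Nm m)%N.
by rewrite /nfree /Afull size_cat size_nseq hn subnDl size_map /eI valK size_map size_enum_ord.
Qed.

Definition ycfg (z : nat -> R) (m : 'I_M.+1) (j : 'I_nn) : R :=
 match (insub (nat_of_ord j) : option 'I_(Nm m)) with
 | Some i => x i
 | None => z ((\sum_(l < M.+1 | (l < m)%N) (nn - Nm l)) + (j - Nm m))%N
 end.

Lemma cfg_acat z (m : 'I_M.+1) j : (j < N)%N ->
 acat (Afull (0 + m)) (fun i => iox (z (\sum_(i < m) nfree n Afull (0 + i) + i)%N)) j = cfg o (ycfg z m) j.
have eoff : (\sum_(i < m) nfree n Afull (0 + i))%N = (\sum_(l < M.+1 | (l < m)%N) (nn - Nm l))%N.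
 rewrite (big_ord_widen M.+1 (fun i => nfree n Afull (0 + i))) 1?ltnW//; apply: eq_bigr => l _.
 by rewrite add0n nfreeE.
rewrite eoff add0n hn => jN.
rewrite acatE /Afull nth_cat size_cat size_nseq size_map.
have se : size (eI m) = Nm m by rewrite /eI valK size_map size_enum_ord.
rewrite se /cfg; have [oj|jo] := ltnP j o.
 have [oo j0] : o /\ j = 0%N by move: oj; case: o => //; case: j {jN}.
 by rewrite (leq_trans oj (leq_addr _ _)) oo j0 eqxx.
have -> : o && (j == 0)%N = false by move: jo; case: o; case: j {jN}.
have jn : (j - o < nn)%N by rewrite ltn_subLR.
rewrite (insubT (fun k => k < nn)%N jn) /ycfg /=.
have -> : (j < o + Nm m)%N = (j - o < Nm m)%N by rewrite ltn_subLR.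
case: insubP => [i iN ei|/negbTE ->]; last by rewrite /iox; congr (z _, _); rewrite subnDA.
rewrite iN /Asub /eI valK -map_comp (nth_map i) ?size_enum_ord//= /posI /posx /xsI /=.
congr (iox (x _)); apply: val_inj; rewrite /= nth_enum_ord //.
Qed.

Definition kkon : R := CNT nn T (tt ord0) / ((-1) ^+ o * (\prod_(i < nn) lq T (tt ord0) i)) / cpf R n o.

(** The weights 1 / (n - Nm m)! in [corr] cancel the factorials produced by [iint_nest]. *)
Lemma corrE (ep : I -> R) : corr nn T tt x =
 (kkon * Zst (@iox R) (@kax R) posI eI (@phix R T n o (tI 0)) pI [::] (B0x R o) ep fset0 fsetT M)%:E.
rewrite /corr -/(ycfg _).
have sA m : (size (Afull m) <= N)%N by rewrite /Afull size_cat size_nseq addnC size_Asub.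
rewrite (_ : (fun z => _) = fun z => (kkon * dprod (@iox R) (@kax R) pI Afull M 0 (@phix R T n o (tI 0)) z)%:E); last first.
 apply/funext => z; rewrite -[fun m j => _]/(ycfg z) (rhoN_dprod T0 hn _ tt0 ttlt ttM) -/kkon dprodE; congr (_ * _)%:E.
 have eq_cfg (m : 'I_M.+1) := @cfg_acat z m.
 have e0 : inord 0 = ord0 :> 'I_M.+1 by apply: val_inj; rewrite /= inordK.
 congr (_ * _ * _).
 - by rewrite -(tIE ord0); apply: dphi_ext => j jN; rewrite -(eq_cfg ord0 j jN).
 - apply: eq_bigr => l _; rewrite add0n.
  have l1 : (l.+1 < M.+1)%N by rewrite ltnS.
  have l2 : (l < M.+1)%N by rewrite ltnW.
  have -> : inord l = Ordinal l2 by apply: val_inj; rewrite /= inordK.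
  have -> : inord l.+1 = Ordinal l1 by apply: val_inj; rewrite /= inordK.
  have -> : tt (Ordinal l1) - tt (Ordinal l2) = tI l.+1 - tI l by rewrite -!tIE.
  rewrite -[RHS](@dphi_ext _ _ _ _ _ (cfg o (ycfg z (Ordinal l1)))).
   congr dphi; apply/funext => i; rewrite /pI /px /=; congr pker.
   by rewrite -(eq_cfg (Ordinal l2)).
  by move=> j jN; rewrite -(eq_cfg (Ordinal l1)).
 congr pfs; apply/matrixP => i j; rewrite !mxE.
 by rewrite -(eq_cfg ord_max _ (ltn_ord i)) -(eq_cfg ord_max _ (ltn_ord j)).
have -> : (\sum_(l < M.+1) (nn - Nm l))%N = (\sum_(l < M.+1) nfree n Afull (0 + l))%N.
 by apply: eq_bigr => l _; rewrite add0n nfreeE.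
rewrite (@iint_nest R _ X (@iox R) (@omx R) (@mio R) (@omx1 R) (@iomx R) n (@kax R) 1 (@mkax R) (@bkax R) pI Afull gpI)//.
rewrite -EFinM Zst_frozen; congr (_%:E).
have gen (a b k z : R) : a * b = 1 -> a * (k * b * z) = k * z.
 by move=> ab; rewrite -[RHS]mul1r -ab; ring.
apply: gen; rewrite -big_split /= big1// => l _; rewrite add0n nfreeE mulVf// pnatr_eq0 -lt0n fact_gt0 //.
Qed.
End CorrelationProcess.

(** * The Gamma function at half-integers *)

Section GammaValues.
Variable R : realType.
Local Notation leb := (@lebesgue_measure R).
Local Notation sfast := (fast (@omr R)).

Let og1 := @omr_ge1 R. Let og := @omr_gt0 R. Let og0 := @omr_ge0 R.
Local Hint Resolve og1 og og0 : core.

(** Compact windows away from 0, where the power in the Gamma integrand may be singular. *)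
Definition vwin (n : nat) : set R := `[n.+1%:R^-1, n.+1%:R]%classic.
Lemma vwin_pos n (v : R) : vwin n v -> 0 < v.
by rewrite /vwin /= in_itv /= => /andP[h _]; apply: lt_le_trans h; rewrite invr_gt0. Qed.

Lemma vwin_near (v : R) : 0 < v -> \forall n \near \oo, vwin n v.
move=> v0; near=> n; rewrite /vwin /= in_itv /=; apply/andP; split.
 rewrite invf_ple ?posrE//; apply: (@le_trans _ _ n%:R); last by rewrite ler_nat.
 near: n; exact: nbhs_infty_ger.
apply: (@le_trans _ _ n%:R); last by rewrite ler_nat.
by near: n; exact: nbhs_infty_ger.
Unshelve. all: end_near.
Qed.

Lemma vwin_cvg (f : R -> R) : itg f ->
 (fun n : nat => Rintegral leb (vwin n) f) @ \oo --> Ri (fun v => if 0 < v then f v else 0).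
move=> itf; under eq_fun do rewrite Rint_Ri.
apply: (@Ri_dct _ _ _ (fun x => `|f x|)).
- by move=> n; apply: measurable_patch; [exact: measurable_itv|exact: itg_meas].
- by apply: measurable_fun_ifT => //; [exact: measurable_fun_ltr|exact: itg_meas].
- move=> x; apply: (@cvg_near_cst _ _ _ _ _); case: ifPn => [x0|nx0]; last first.
  apply: nearW => n; rewrite patchE ifF//; apply/negbTE/negP => /set_mem /vwin_pos h.
  by rewrite h in nx0.
 by apply: filterS (vwin_near x0) => n h; rewrite patchE mem_set.
- exact: itg_abs.
by move=> n x; rewrite patchE; case: ifP => // _; rewrite normr0.
Qed.

Definition Kg (k : nat) : R := Ri (fun v => if 0 < v then v ^+ k * expR (- v ^+ 2) else 0).

Lemma sfast_gk k : sfast (fun v : R => v ^+ k * expR (- v ^+ 2)).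
have h2 : 0 < 2^-1 :> R by rewrite invr_gt0.
have := sfast_poly ('X^k) (sfastZ ((2 * pi * 2^-1) `^ 2^-1) (sfast_ga h2)).
rewrite (_ : (fun x => _) = fun v : R => v ^+ k * expR (- v ^+ 2))//; apply/funext => v.
rewrite hornerXn /ga; congr (_ * _); rewrite mulrA powRN mulfV ?mul1r; last first.
 by rewrite gt_eqF// powR_gt0// !mulr_gt0// pi_gt0.
by rewrite divff// divr1.
Qed.

Lemma der_gk k (v : R) : is_derive v (1 : R) (fun v : R => v ^+ k * expR (- v ^+ 2))
 (k%:R * v ^+ k.-1 * expR (- v ^+ 2) - 2 * (v ^+ k.+1 * expR (- v ^+ 2))).
have dq : is_derive v (1 : R) (fun x : R => - x ^+ 2) (- (2 * v)).
 by apply: is_derive_eq; rewrite /GRing.scale /=; ring.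
have de := @is_derive1_comp _ expR (fun x : R => - x ^+ 2) v _ _ (is_derive_expR _) dq.
have d1 := is_deriveM (is_derive_poly 'X^k v) de.
rewrite (_ : (fun v : R => _) = horner ('X^k : {poly R}) * (expR \o (fun x : R => - x ^+ 2))); last first.
 by apply/funext => w; rewrite fctE /= hornerXn.
apply: (is_derive_eq d1); rewrite /GRing.scale /= hornerXn derivXn hornerMn hornerXn [v ^+ k.+1]exprS -mulr_natl; ring.
Qed.

Lemma continuous_gk k : continuous (fun v : R => v ^+ k * expR (- v ^+ 2)).
by apply: der_continuous => v; exact: der_gk. Qed.

(** Integration by parts; the boundary term at 0 survives only for [k = 0]. *)
Lemma Kg_rec k : k%:R * Kg k.-1 - 2 * Kg k.+1 = - (k == 0)%N%:R.
pose f v : R := k%:R * v ^+ k.-1 * expR (- v ^+ 2) - 2 * (v ^+ k.+1 * expR (- v ^+ 2)).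
have fE : f = fun v => k%:R * (v ^+ k.-1 * expR (- v ^+ 2)) + (- 2) * (v ^+ k.+1 * expR (- v ^+ 2)).
 by apply/funext => v; rewrite /f; ring.
have i1 j : itg (fun v : R => if 0 < v then v ^+ j * expR (- v ^+ 2) else 0).
 have gj := sfast_itg (sfast_gk j).
 apply: (itg_dom (g := fun v => `|v ^+ j * expR (- v ^+ 2)|)); last 2 first.
 - exact: itg_abs.
 - by move=> x; case: ifP => // _; rewrite normr0.
 by apply: measurable_fun_ifT => //; [exact: measurable_fun_ltr|exact: itg_meas].
have if_ : itg f by rewrite fE; apply: itgD; apply: itgZ; apply: sfast_itg; exact: sfast_gk.
have -> : k%:R * Kg k.-1 - 2 * Kg k.+1 = Ri (fun v => if 0 < v then f v else 0).
 rewrite /Kg -RiZ// -mulNr -RiZ// -RiD; [|exact: itgZ|exact: itgZ].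
 by apply: Ri_eq => v; rewrite fE; case: ifP => // _; rewrite !mulr0 addr0.
have cf : continuous f.
 by rewrite fE => v; apply: cvgD; apply: cvgM; [exact: cvg_cst|exact: continuous_gk|exact: cvg_cst|exact: continuous_gk].
have h1 := vwin_cvg if_.
suff h2 : (fun n : nat => Rintegral leb (vwin n) f) @ \oo --> (- (k == 0)%N%:R : R).
 by apply: (cvg_unique _ h1 h2).
pose F v : R := v ^+ k * expR (- v ^+ 2).
have -> : (fun n : nat => Rintegral leb (vwin n) f) = (fun n : nat => F n.+1%:R - F n.+1%:R^-1).
 apply/funext => n; apply: (ftc _ cf); last by move=> v; exact: der_gk.
 by apply: (@le_trans _ _ 1); rewrite ?invf_le1// ler1n.
rewrite (_ : - (k == 0)%N%:R = 0 - F 0); last first.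
 by rewrite /F expr0n /= expr0n /= oppr0 expR0 mulr1 sub0r.
apply: cvgB.
 have [h _] := sfast_cvg0 (sfast_gk k).
 by rewrite (cvg_shiftS (fun n : nat => F n%:R)).
exact: (@cvg_comp _ _ _ (fun n : nat => n.+1%:R^-1 : R) F _ (nbhs (0 : R)) _ (@cvg_harmonic R) (@continuous_gk k 0)).
Qed.

Lemma Kg0 : Kg 0 = sqrt pi / 2.
have := @integral0y_gauss R; rewrite -integral_itv_obnd_cbnd; last first.
 by apply/measurable_EFinP; apply: measurable_funTS; exact: measurable_gauss_fun.
move=> h; have := congr1 fine h; rewrite -/(Rintegral _ _ _) Rint_Ri /= => <-.
apply: Ri_eq => v; rewrite patchE mem_setE /= in_itv /= andbT /gauss_fun expr0 mul1r //.
Qed.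

Lemma Kg1 : Kg 1 = 2^-1.
by have := Kg_rec 0; rewrite /= mul0r; lra. Qed.
Lemma KgSS k : Kg k.+2 = k.+1%:R / 2 * Kg k.
have := Kg_rec k.+1; rewrite /= oppr0 => /eqP; rewrite subr_eq0 => /eqP h; lra. Qed.

(** The substitution u = v^2 is made on the windows; then monotone convergence is used on the left
    and dominated convergence on the right. *)
Lemma Gamma_half k : Gamma (k.+1%:R / 2) = 2 * Kg k :> R.
pose g u : R := u `^ (k.+1%:R / 2 - 1) * expR (- u).
pose W n : set R := `[n.+1%:R^-1 ^+ 2, n.+1%:R ^+ 2]%classic.
pose f v : R := 2 * (v ^+ k * expR (- v ^+ 2)).
have sf : itg f by apply/itgZ/sfast_itg/sfast_gk.
have cg u : 0 < u -> {for u, continuous g}.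
 move=> u0; apply: cvgM; last by apply: continuous_cvg; [exact: continuous_expR|exact: cvgN].
 have e : {near u, (fun u => expR ((k.+1%:R / 2 - 1) * ln u)) =1 (fun u => u `^ (k.+1%:R / 2 - 1))}.
  near=> w; rewrite /powR gt_eqF//; near: w; exact: lt_nbhsr.
 rewrite -(nbhs_singleton e); apply: cvg_trans (near_eq_cvg e) _.
 apply: (@continuous_cvg _ _ _ _ _ (fun u => (k.+1%:R / 2 - 1) * ln u) expR); first exact: continuous_expR.
 by apply: cvgM; [exact: cvg_cst|exact: continuous_ln].
have Wpos n u : W n u -> 0 < u.
 by rewrite /W /= in_itv /= => /andP[h _]; apply: lt_le_trans h; rewrite exprn_gt0// invr_gt0.
have ie n : (0 : R) < n.+1%:R^-1 /\ (n.+1%:R^-1 <= n.+1%:R :> R).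
 by split; [rewrite invr_gt0|apply: (@le_trans _ _ 1); rewrite ?invf_le1// ler1n].
have sub n : (\int[leb]_(u in W n) (g u)%:E)%E = (Rintegral leb (vwin n) f)%:E.
 have [e0 e1] := ie n; pose F (v : R) := v ^+ 2.
 have dF v : is_derive v (1 : R) F (2 * v).
  by rewrite /F; apply: is_derive_eq; rewrite /GRing.scale /=; ring.
 have F' : derive1 F = fun v => 2 * v.
  by apply/funext => v; rewrite derive1E; case: (dF v).
 have cF' : continuous (fun v : R => 2 * v) by move=> v; apply: cvgM; [exact: cvg_cst|exact: cvg_id].
 have cF : continuous F by exact: der_continuous dF.
 rewrite (@integration_by_substitution_increasing R F g n.+1%:R^-1 n.+1%:R e1).
 - rewrite /Rintegral fineK; last first.
   apply: integrable_fin_num; first exact: measurable_itv.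
   by apply: continuous_itg_itv => v; apply: cvgM; [exact: cvg_cst|exact: continuous_gk].
  apply: eq_integral => v /set_mem /vwin_pos v0; congr (_%:E); rewrite fctE /= F' /g /f /F.
  have -> : (v ^+ 2) `^ (k.+1%:R / 2 - 1) = v ^+ k / v.
   rewrite -powR_mulrn ?ltW// -powRrM mulrBr mulrCA divff// mulr1 mulr1.
   rewrite (_ : k.+1%:R - 2 = k%:R + (-1)); last by rewrite -natr1; ring.
   by rewrite powRD ?(gt_eqF v0) ?implybT// powR_mulrn ?ltW// powR_inv1 ?ltW.
  by field; rewrite gt_eqF.
 - move=> a b; rewrite !in_itv /= => /andP[a0 _] _ ab; rewrite ltrXn2r// ?nnegrE; first exact: ltW (lt_le_trans e0 a0).
 - by move=> v _; rewrite F'; exact: (cF' v).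
 - by rewrite F'; apply/cvg_ex; eexists; apply: cvg_at_right_filter; exact: cF'.
 - by rewrite F'; apply/cvg_ex; eexists; apply: cvg_at_left_filter; exact: cF'.
 - split; first by move=> v _; case: (dF v).
   by apply: cvg_at_right_filter; exact: cF.
  by apply: cvg_at_left_filter; exact: cF.
 apply: continuous_in_subspaceT => u /set_mem Wu; apply: cg; exact: (Wpos n).
have lim1 : (\int[leb]_(u in W n) (g u)%:E)%E @[n --> \oo] --> (\int[leb]_(u in \bigcup_n W n) (g u)%:E)%E.
 apply: ge0_nondecreasing_set_cvg_integral.
 - move=> a b ab; apply/subsetPset => u; rewrite /W /= !in_itv /= => /andP[h1 h2]; apply/andP; split.
   by apply: le_trans h1; rewrite lerXn2r ?nnegrE ?invr_ge0// lef_pV2 ?posrE// ler_nat.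
  by apply: (le_trans h2); rewrite lerXn2r ?nnegrE// ler_nat.
 - by move=> n; exact: measurable_itv.
 - move=> n; apply/measurable_EFinP; apply: measurable_funTS; apply: mfunM; first exact: measurable_powR.
  by apply: mcomp => //; exact: measurable_oppr.
 by move=> n u _; rewrite lee_fin mulr_ge0// ?powR_ge0 ?expR_ge0.
have uW : [set u : R | 0 < u] = \bigcup_n W n.
 apply/seteqP; split => u /=; last by move=> [n _]; exact: Wpos.
 move=> u0; have s0 : 0 < sqrt u by rewrite sqrtr_gt0.
 have [n _ /(_ n (leqnn n))] := vwin_near s0; rewrite /vwin /= in_itv /= => /andP[h1 h2].
 exists n => //; rewrite /W /= in_itv /= -(sqr_sqrtr (ltW u0)); apply/andP; split.
  by rewrite lerXn2r ?nnegrE ?invr_ge0// ltW.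
 by rewrite lerXn2r ?nnegrE// ltW.
rewrite /Gamma uW.
have e1 : (fun n => \int[leb]_(u in W n) (g u)%:E)%E = (fun n => (Rintegral leb (vwin n) f)%:E).
 by apply/funext => n; rewrite sub.
rewrite e1 in lim1.
have lim2 : (fun n => (Rintegral leb (vwin n) f)%:E) @ \oo --> (2 * Kg k)%:E.
 apply: cvg_EFin; first exact: nearW.
 have := vwin_cvg sf; rewrite (_ : Ri _ = 2 * Kg k)//.
 rewrite /Kg -RiZ; first by apply: Ri_eq => v; case: ifP => // _; rewrite mulr0.
 apply: (itg_dom (g := fun v => `|v ^+ k * expR (- v ^+ 2)|)); last 2 first.
 - by apply: itg_abs; apply: sfast_itg; exact: sfast_gk.
 - by move=> x; case: ifP => // _; rewrite normr0.
 by apply: measurable_fun_ifT => //; [exact: measurable_fun_ltr|apply: itg_meas; apply: sfast_itg; exact: sfast_gk].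
by rewrite (cvg_unique _ lim1 lim2).
Unshelve. all: end_near.
Qed.
End GammaValues.

(** * The normalising constant *)

Section Normalization.
Variables (R : realType) (T : R) (n nn : nat) (o : bool).
Hypotheses (T0 : 0 < T) (hn : n.*2 = (o + nn)%N) (nn0 : (0 < nn)%N).
Implicit Types (t : R).

Definition gh k : R := Gamma (k.+1%:R / 2).
Lemma ghSS k : gh k.+2 = k.+1%:R / 2 * gh k.
by rewrite /gh !Gamma_half KgSS; ring. Qed.
Lemma gh0 : gh 0 = sqrt pi. by rewrite /gh Gamma_half Kg0 mulrCA divff ?mulr1. Qed.
Lemma gh1 : gh 1 = 1. by rewrite /gh Gamma_half Kg1 divff. Qed.

Lemma gh_even a : gh a.*2 = sqrt pi * \prod_(i < a) ((i.*2.+1)%:R / 2).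
elim: a => [|a IH]; first by rewrite big_ord0 mulr1 gh0.
by rewrite doubleS ghSS IH big_ord_recr /=; ring.
Qed.

(** Legendre's duplication formula at half-integers. *)
Lemma gh_pair a : gh a.*2 * gh a.*2.+1 = sqrt pi * (a.*2)`!%:R / 2 ^+ a.*2.
elim: a => [|a IH]; first by rewrite double0 gh0 gh1 fact0 expr0 divr1.
rewrite doubleS !ghSS mulrACA IH !factS !natrM !exprS; field.
by rewrite expf_neq0.
Qed.

Lemma gh_gt0 k : 0 < gh k.
have h k' : 0 < gh k' /\ 0 < gh k'.+1.
 elim: k' => [|k' [h1 h2]]; first by split; [rewrite gh0 sqrtr_gt0 pi_gt0|rewrite gh1 ltr01].
 by split; [exact: h2|rewrite ghSS; apply: mulr_gt0; [exact: divr_gt0|exact: h1]].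
by have [] := h k.
Qed.

(** The share of index [k] in the square of [CNT] over the leading coefficients. Squaring makes all
    exponents of the constant integral, so that it splits into such a product. *)
Definition fk t k : R := pi / gh k ^+ 2 * T ^+ k / t ^+ k.*2 / lq T t k ^+ 2.

Lemma sumk k : (\sum_(i < k) i)%:R = k%:R * (k%:R - 1) / 2 :> R.
elim: k => [|k IH]; first by rewrite big_ord0 mul0r mul0r.
by rewrite big_ord_recr /= natrD IH -natr1; field.
Qed.

Lemma powR_sqr (a r : R) : (a `^ r) ^+ 2 = a `^ (r * 2).
by rewrite -powR_mulrn ?powR_ge0// -powRrM. Qed.

Lemma CNT_sq t : 0 < t -> (CNT nn T t) ^+ 2 / (\prod_(i < nn) lq T t i) ^+ 2 = \prod_(k < nn) fk t k.
move=> t0; rewrite /fk prodf_div prodrXl; congr (_ / _).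
rewrite prodf_div (@big_split _ _ _ _ _ _ (fun k : 'I_nn => pi / gh k ^+ 2) (fun k : 'I_nn => T ^+ k)) /=.
rewrite prodf_div prodr_const card_ord prodrXl -/(\prod_(j < nn) Gamma _).
rewrite /CNT exprMn exprMn exprMn !powR_sqr exprVn.
have -> : nn%:R / 2 * 2 = nn%:R :> R by rewrite divfK.
have -> : nn%:R * (nn%:R - 1) / 4 * 2 = (\sum_(i < nn) i)%:R :> R by rewrite sumk; field.
have -> : - (nn%:R * (nn%:R - 1) / 2) * 2 = - (\sum_(i < nn) i.*2)%:R :> R.
 rewrite (eq_bigr (fun i : 'I_nn => i * 2)%N); last by move=> i _; rewrite muln2.
 by rewrite -big_distrl /= natrM sumk mulNr.
rewrite powRN !powR_mulrn ?pi_ge0 ?ltW// !expr_sum //.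
Qed.

Lemma fk_pair_field (p g0 g1 S A B P F t : R) : p != 0 -> g0 != 0 -> g1 != 0 -> S != 0 -> A != 0 -> B != 0 ->
 P != 0 -> t != 0 -> p / g0 ^+ 2 * A / B ^+ 2 / (P * A / B) ^+ 2 *
 (p / g1 ^+ 2 * (S * A) / (t ^+ 2 * B ^+ 2) / (- (P * A / B) / t) ^+ 2) * ((F * P * A) ^+ 2 / (4 * p * S) * 4) =
 p ^+ 2 / (g0 * g1) ^+ 2 * F ^+ 2 / P ^+ 2 / p.
by move=> h1 h2 h3 h4 h5 h6 h7 h8; field; rewrite h1 h2 h3 h4 h5 h6 h7 h8. Qed.

(** The indices 2a and 2a + 1 combine by duplication and cancel the squared norm [hj]. *)
Lemma fk_pair t a : 0 < t -> fk t a.*2 * fk t a.*2.+1 * (hj T a ^+ 2 * 4) = 1.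
move=> t0.
have g2 : ga (2 * T) 0 ^+ 2 = (4 * pi * T)^-1.
 rewrite /ga expr0n oppr0 mul0r expR0 mulr1 powR_sqr mulNr mulVf ?pnatr_eq0//.
 by rewrite powR_inv1; [congr (_^-1); ring|rewrite !mulr_ge0 ?pi_ge0 ?ltW].
have gp := gh_pair a.
set A := T ^+ a.*2; set B := t ^+ a.*2; set P : R := 2 ^+ a.*2; set F : R := (a.*2)`!%:R.
have expNd (c : R) : (- c) ^+ a.*2 = c ^+ a.*2 by rewrite -mul2n !exprM sqrrN.
have l0 : lq T t a.*2 = P * A / B by rewrite /lq odd_double mul1r expNd exprMn exprMn exprVn.
have l1 : lq T t a.*2.+1 = - (P * A / B) / t.
 rewrite /lq /= odd_double /= exprS expNd exprMn exprMn exprVn -/A -/B -/P; field; rewrite !gt_eqF// exprn_gt0//.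
have hE : hj T a ^+ 2 = (F * P * A) ^+ 2 * (4 * pi * T)^-1.
 by rewrite /hj exprMn g2 [(2 * T) ^+ _]exprMn mulrA.
have sp : sqrt pi ^+ 2 = pi :> R by rewrite sqr_sqrtr ?pi_ge0.
have sp0 : sqrt pi != 0 :> R by rewrite gt_eqF// sqrtr_gt0 pi_gt0.
have e1 : (gh a.*2 * gh a.*2.+1) ^+ 2 = pi * F ^+ 2 / P ^+ 2 by rewrite gp exprMn exprMn sp exprVn.
have A0 : A != 0 by rewrite expf_neq0// gt_eqF.
have B0 : B != 0 by rewrite expf_neq0// gt_eqF.
have P0 : P != 0 by rewrite expf_neq0.
have F0 : F != 0 by rewrite pnatr_eq0 -lt0n fact_gt0.
have p0 : pi != 0 :> R by rewrite gt_eqF// pi_gt0.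
have Tn : T != 0 by rewrite gt_eqF.
have tn : t != 0 by rewrite gt_eqF.
have ga0 := gh_gt0 a.*2; have gb0 := gh_gt0 a.*2.+1.
rewrite /fk l0 l1 hE -/A.
have -> : T ^+ a.*2.+1 = T * A by rewrite exprS.
have -> : t ^+ a.*2.*2 = B ^+ 2 by rewrite -muln2 exprM.
have -> : t ^+ a.*2.+1.*2 = t ^+ 2 * B ^+ 2 by rewrite doubleS -addn2 exprD mulrC -[a.*2.*2]muln2 exprM.
rewrite fk_pair_field//; [|by rewrite gt_eqF..].
have gen (p F' P' : R) : p != 0 -> F' != 0 -> P' != 0 -> p ^+ 2 / (p * F' ^+ 2 / P' ^+ 2) * F' ^+ 2 / P' ^+ 2 / p = 1.
 by move=> h1 h2 h3; field; rewrite h1 h2 h3.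
by rewrite e1 gen.
Qed.

(** For odd N the last index has no partner; it cancels the mass [mj], which replaces the norm in
    [rr]. *)
Lemma fk_last t b : 0 < t -> fk t b.*2 * ((2^-1 * mj T b) ^+ 2 * 4) = 1.
move=> t0; rewrite /fk.
set A := T ^+ b.*2; set B := t ^+ b.*2; set P : R := 2 ^+ b.*2.
have expNd (c : R) : (- c) ^+ b.*2 = c ^+ b.*2 by rewrite -mul2n !exprM sqrrN.
have -> : lq T t b.*2 = P * A / B by rewrite /lq odd_double mul1r expNd exprMn exprMn exprVn.
have -> : t ^+ b.*2.*2 = B ^+ 2 by rewrite -muln2 exprM.
have sp : sqrt pi ^+ 2 = pi :> R by rewrite sqr_sqrtr ?pi_ge0.
have hm : pi * mj T b ^+ 2 = gh b.*2 ^+ 2 * (P ^+ 2 * A).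
 have -> : mj T b = (4 * T) ^+ b * \prod_(i < b) ((i.*2.+1)%:R / 2).
  have -> : (4 * T) ^+ b = \prod_(i < b) (4 * T) by rewrite prodr_const card_ord.
  by rewrite /mj -big_split /=; apply: eq_bigr => i _; field.
 rewrite gh_even !exprMn sp; have -> : ((4 ^+ b) ^+ 2 : R) = P ^+ 2.
  by rewrite /P -[4]/((2 * 2)%:R) natrM -expr2 -!exprM; congr (_ ^+ _); lia.
 have -> : (T ^+ b) ^+ 2 = A by rewrite -exprM muln2.
 by ring.
have A0 : A != 0 by rewrite expf_neq0// gt_eqF.
have B0 : B != 0 by rewrite expf_neq0// gt_eqF.
have P0 : P != 0 by rewrite expf_neq0.
have ga0 := gh_gt0 b.*2.
transitivity ((pi * mj T b ^+ 2) / (gh b.*2 ^+ 2 * (P ^+ 2 * A))).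
 by field; rewrite A0 B0 P0 gt_eqF.
by rewrite hm divff// !mulf_neq0// ?expf_neq0 // gt_eqF.
Qed.

Lemma fk_rr t : 0 < t -> (\prod_(k < nn) fk t k) * (\prod_(a < n) rr T o a) ^+ 2 * 4 ^+ n = 1.
move=> t0; rewrite -mulrA -prodrXl -[n in 4 ^+ n]card_ord -prodr_const -big_split /=.
have [oo|oo] := boolP o; last first.
 have e : nn = n.*2 by rewrite hn (negbTE oo).
 rewrite e big_pairs -big_split /= big1// => a _.
 by rewrite add0n add1n /rr /oddlast /= fk_pair.
have en : exists b, n = b.+1 by case: n hn => [|b] //; [rewrite oo|exists b].
have [b eb] := en; have e : nn = b.*2.+1 by have := hn; rewrite oo eb doubleS add1n => -[].
rewrite e eb big_ord_recr /= big_pairs [X in _ * _ * X]big_ord_recr /= mulrACA.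
rewrite [X in X * _](_ : _ = 1) ?mul1r; last first.
 rewrite -big_split /= big1// => a _.
 by rewrite add0n add1n /rr /oddlast /= ltn_eqF ?andbF ?fk_pair.
by rewrite /rr /oddlast /= eqxx /= sqrrN fk_last.
Qed.

Lemma CNT_ge0 t : 0 <= CNT nn T t.
rewrite /CNT !mulr_ge0 ?powR_ge0// invr_ge0 prodr_ge0// => i _; exact/ltW/(gh_gt0 i).
Qed.

Lemma kkon_sq (M : nat) (tt : 'I_M.+1 -> R) : 0 < tt ord0 ->
 (kkon T n nn o tt * ((\prod_(a < n) - rr T o a) * (2 ^ n * n`!)%:R)) ^+ 2 = 1.
move=> t0; have h := fk_rr t0; rewrite -CNT_sq// in h.
have f0 : n`!%:R != 0 :> R by rewrite pnatr_eq0 -lt0n fact_gt0.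
rewrite /kkon; set L := \prod_(i < nn) lq T (tt ord0) i in h *; set C := CNT nn T (tt ord0) in h *.
have e : (\prod_(a < n) - rr T o a) ^+ 2 = (\prod_(a < n) rr T o a) ^+ 2 by rewrite -!prodrXl; apply: eq_bigr => a _; rewrite sqrrN.
rewrite exprMn [X in _ * X]exprMn e natrM natrX [X in _ * (_ * X)]exprMn.
rewrite [(_ / cpf R n o) ^+ 2]exprMn exprVn cpf_sq [(C / _) ^+ 2]exprMn exprVn [(_ * L) ^+ 2]exprMn sqrr_sign mul1r.
have e4 : (2 ^+ n) ^+ 2 = 4 ^+ n :> R.
 by rewrite -[4]/((2 * 2)%:R) natrM -expr2 -!exprM mulnC.
rewrite e4 -[RHS]h.
have gen (c l r q f : R) : f != 0 -> c / l / f ^+ 2 * (r * (q * f ^+ 2)) = c / l * r * q.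
 have gg (a d g k : R) : g != 0 -> a / g * (d * (k * g)) = a * d * k by move=> g0; field.
 by move=> h0; rewrite gg ?expf_neq0.
by rewrite gen.
Qed.

Lemma rhoN_ge0 (M : nat) (tt : 'I_M.+1 -> R) (x : 'I_M.+1 -> 'I_nn -> R) :
 (forall m, 0 < tt m) -> (forall m1 m2 : 'I_M.+1, (m1 < m2)%N -> tt m1 < tt m2) -> tt ord_max = T ->
 0 <= rhoN T tt x.
move=> tt0 ttlt ttM; rewrite /rhoN; case: ifPn => // /forallP hd.
have W m : inW (srt (x m)) by exact: srt_inW.
have T_ge m : 0 <= T - tt m.
 rewrite subr_ge0 -ttM; have [lt|ge] := ltnP m (@ord_max M); first exact/ltW/ttlt.
 by have -> : m = ord_max by apply: val_inj => /=; apply/eqP; rewrite eqn_leq ge -ltnS ltn_ord.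
apply: mulr_ge0.
 rewrite /g0 mulr_ge0//; last by apply: prodr_ge0 => i _; rewrite ptdE; exact/ltW/ga_gt0.
 rewrite mulr_ge0//; last exact/ltW/NN_gt0.
 rewrite mulr_ge0 ?CNT_ge0// /hN; apply: prodr_ge0 => i _; apply: prodr_ge0 => j ij.
 by rewrite subr_ge0 ltW//; have /forallP/(_ i)/forallP/(_ j)/implyP := W ord0; exact.
apply: prodr_ge0 => m _; rewrite /gT divr_ge0 ?mulr_ge0//; try exact/ltW/NN_gt0.
apply/ltW/fN_gt0 => //; rewrite subr_gt0 ttlt// !inordK ?ltnS//; exact: ltnW.
Qed.

Lemma iint_ge0 k (F : (nat -> R) -> \bar R) : (forall z, (0 <= F z)%E) -> (0 <= iint k F)%E.
by elim: k F => [|k IH] F h //=; apply: integral_ge0 => u _; exact: IH. Qed.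

Lemma corr_ge0 (M : nat) (tt : 'I_M.+1 -> R) (Nm : 'I_M.+1 -> nat) (x : forall m : 'I_M.+1, 'I_(Nm m) -> R) :
 (forall m, 0 < tt m) -> (forall m1 m2 : 'I_M.+1, (m1 < m2)%N -> tt m1 < tt m2) -> tt ord_max = T ->
 (0 <= corr nn T tt x)%E.
move=> tt0 ttlt ttM; rewrite /corr mule_ge0//.
 by rewrite lee_fin prodr_ge0// => m _; rewrite invr_ge0.
by apply: iint_ge0 => z; rewrite lee_fin rhoN_ge0.
Qed.

(** Only the sign of the normalisation remains open after [kkon_sq], and positivity of the density
    settles it. *)
Lemma corr_Tdet (M : nat) (tt : 'I_M.+1 -> R) (Nm : 'I_M.+1 -> nat) (x : forall m : 'I_M.+1, 'I_(Nm m) -> R) :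
 (forall m, (Nm m <= nn)%N) ->
 (forall m, 0 < tt m) -> (forall m1 m2 : 'I_M.+1, (m1 < m2)%N -> tt m1 < tt m2) -> tt ord_max = T ->
 corr nn T tt x = (Tdet (fun a b : {m : 'I_M.+1 & 'I_(Nm m)} =>
  kmat T n o (tt (tag a)) (x (tag a) (tagged a)) (tt (tag b)) (x (tag b) (tagged b))))%:E.
move=> Nnn tt0 ttlt ttM.
have tI0' := @tI0 R T M tt tt0; have tIlt' := tIlt T0 hn nn0 ttlt ttM; have tIM' := @tIM R T M tt ttM.
have k1 : kkon T n nn o tt * ((\prod_(a < n) - rr T o a) * (2 ^ n * n`!)%:R) = 1.
 have := kkon_sq (tt0 ord0); set K := _ * _ => /eqP; rewrite sqrf_eq1 => /orP[/eqP//|/eqP Km1].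
 (* With no point prescribed, the correlation function is the total mass and equals the constant in
    question; being nonnegative it cannot be -1. *)
 have := @corr_ge0 M tt (fun=> 0%N) (fun m (i : 'I_0) => 0) tt0 ttlt ttM.
 rewrite (@corrE R T n nn M o T0 hn _ _ tt (fun=> leq0n _) nn0 tt0 ttlt ttM (fun=> 1)).
 have -> : [set: {m : 'I_M.+1 & 'I_0}]%SET = fset0.
  by apply/setP => -[m []].
 have se0 m : (size (@eI M (fun=> 0%N) m) <= n.*2)%N.
  by apply: (leq_trans (@size_eI nn M (fun=> 0%N) (fun=> leq0n nn) m)); rewrite hn leq_addl.
 rewrite (Zst0_val o T0 tI0' tIlt' tIM' _ (@ueI M (fun=> 0%N)) (@eIP M (fun=> 0%N)) se0) -/K ?Km1 => [|i]; last exact: (ltn_ord (tag i)).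
 by rewrite lee_fin oppr_ge0 ler10.
rewrite (@corrE R T n nn M o T0 hn _ _ tt Nnn nn0 tt0 ttlt ttM (fun=> 1)).
have se m : (size (@eI M Nm m) <= n.*2)%N.
 by apply: (leq_trans (size_eI Nnn m)); rewrite hn leq_addl.
rewrite (process_kmat T0 tI0' tIlt' tIM' _ (@ueI M Nm) (@eIP M Nm) se _ _ k1) => [|i]; last exact: (ltn_ord (tag i)).
by congr (Tdet _)%:E; apply/funext => a; apply/funext => b; rewrite /ti !tIE.
Qed.
End Normalization.

(** * Hermite polynomials as hypergeometric sums *)

Section HermiteExplicit.
Variables (R : realType).
Implicit Types (z t x : R) (a j : nat).

(** A hypergeometric sum, terminating because of the falling factorial. For a large and z small with
    a z tending to y it approaches the alternating series of y^j / (d j)!. *)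
Definition Fa (d : nat -> nat) a z : R := \sum_(j < a.+1) (-1) ^+ j * (a ^_ j)%:R * z ^+ j / (d j)`!%:R.

Lemma Fa_ext d a m z : (a < m)%N -> Fa d a z = \sum_(j < m) (-1) ^+ j * (a ^_ j)%:R * z ^+ j / (d j)`!%:R.
move=> am; rewrite /Fa (big_ord_widen m (fun j => (-1) ^+ j * (a ^_ j)%:R * z ^+ j / (d j)`!%:R)) //.
rewrite big_mkcond /=; apply: eq_bigr => j _; case: ifPn => //; rewrite -leqNgt => aj.
by rewrite ffact_small// mulr0 !mul0r.
Qed.

(** In that regime with y = u^2, [Ca] tends to cos u and [Da] to sin u / u. *)
Definition Ca := Fa double.
Definition Da := Fa (fun j => j.*2.+1).

(** This and [DaE] are the contiguity relations that match the even and the odd steps of the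
    recursion for [yp]. *)
Lemma CaS a z : Ca a.+1 z = Ca a z - z / 2 * Da a z.
rewrite /Ca /Da (@Fa_ext _ a a.+2)// (@Fa_ext _ a a.+1)//= /Fa [LHS]big_ord_recl [X in _ = X - _]big_ord_recl.
rewrite !ffactn0 -addrA; congr (_ + _); rewrite mulr_sumr -sumrB; apply: eq_bigr => j _.
rewrite lift0 ffactnS [a ^_ j.+1]ffactnSr.
have -> : (a.+1.-1 ^_ j)%:R = (a ^_ j)%:R :> R by [].
have f0 : (j.*2)`!%:R != 0 :> R by rewrite pnatr_eq0 -lt0n fact_gt0.
have [aj|ja] := ltnP a j; first by rewrite ffact_small// !(mul0n, muln0, mulr0, mul0r, subr0).
rewrite doubleS !factS !natrM !exprS natrB//.
have e1 := natr_double2 R j.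
have e2 := natr_double1 R j.
have p1 : 2 * j%:R + 2 != 0 :> R by rewrite -e1 pnatr_eq0.
have p2 : 2 * j%:R + 1 != 0 :> R by rewrite -e2 pnatr_eq0.
rewrite e1 e2 -natr1; move: f0 p1 p2; set f := (j.*2)`!%:R; set k := j%:R; set b := a%:R; set g := (a ^_ j)%:R.
by move=> f0 p1 p2; field; rewrite f0 p1 p2.
Qed.

Lemma DaE a z : (2 * a%:R + 1) * Da a z = Ca a z + 2 * a%:R * Da a.-1 z.
rewrite /Ca /Da !(@Fa_ext _ a a.+1)// (@Fa_ext _ a.-1 a.+1)/=; last by case: a.
rewrite !mulr_sumr -big_split /=; apply: eq_bigr => j _.
have f0 : (j.*2)`!%:R != 0 :> R by rewrite pnatr_eq0 -lt0n fact_gt0.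
have e2 := natr_double1 R j.
have p2 : 2 * j%:R + 1 != 0 :> R by rewrite -e2 pnatr_eq0.
have h : a%:R * (a.-1 ^_ j)%:R = (a%:R - j%:R) * (a ^_ j)%:R :> R.
 rewrite -natrM -ffactnS ffactnSr natrM mulrC.
 by have [aj|ja] := ltnP a j; [rewrite ffact_small// !mulr0|rewrite natrB].
rewrite factS natrM e2; set f := (j.*2)`!%:R in f0 *; set g := (a ^_ j)%:R in h *; set g' := (a.-1 ^_ j)%:R in h *.
transitivity ((-1) ^+ j * z ^+ j / f * ((2 * a%:R + 1) * g) / (2 * j%:R + 1)); first by field; rewrite f0 p2.
have -> : (2 * a%:R + 1) * g = (2 * j%:R + 1) * g + 2 * (a%:R * g') by rewrite h; ring.
by field; rewrite f0 p2.
Qed.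

(** The double factorial (2a - 1)!!. *)
Definition dfac a : R := \prod_(i < a) (i.*2.+1)%:R.
Lemma dfacS b : dfac b.+1 = dfac b * (2 * b%:R + 1).
by rewrite /dfac big_ord_recr /= natr_double1. Qed.

Lemma yp_explicit (T t x : R) a : 0 < t -> t < 2 * T -> let c := 2 * T / t in let d := 2 * T - t in let z := 2 * c * x ^+ 2 / d in
 (yp T t a.*2).[x] = (-1) ^+ a * dfac a * (c * d) ^+ a * Ca a z /\
 (yp T t a.*2.+1).[x] = (-1) ^+ a.+1 * dfac a.+1 * c * (c * d) ^+ a * x * Da a z.
move=> t0 tT c d z.
have d0 : d != 0 by rewrite gt_eqF// subr_gt0.
have c0 : c != 0 by rewrite mulf_neq0 ?invr_eq0 ?gt_eqF//; lra.
have dS := dfacS.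
have yS k : (yp T t k.+1).[x] = - c * (x * (yp T t k).[x] + d * k%:R * (yp T t k.-1).[x]).
 by rewrite ypS !(hornerE, hornerZ) -/c -/d; ring.
have odd_step b : (yp T t b.*2).[x] = (-1) ^+ b * dfac b * (c * d) ^+ b * Ca b z ->
  ((b != 0)%N -> (yp T t b.*2.-1).[x] = (-1) ^+ b * dfac b * c * (c * d) ^+ b.-1 * x * Da b.-1 z) ->
  (yp T t b.*2.+1).[x] = (-1) ^+ b.+1 * dfac b.+1 * c * (c * d) ^+ b * x * Da b z.
 move=> h1 h2; rewrite yS h1.
 have -> : d * (b.*2)%:R * (yp T t b.*2.-1).[x] = 2 * b%:R * ((-1) ^+ b * dfac b * (c * d) ^+ b * x * Da b.-1 z).
  rewrite -mul2n natrM mul2n; case: b h1 h2 => [|b] _ h2; first by rewrite !(mul0r, mulr0).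
  by rewrite (h2 isT) /= [(c * d) ^+ b.+1]exprS; ring.
 rewrite dS -[_ * x * Da b z]mulrA.
 transitivity (- ((-1) ^+ b * dfac b * c * (c * d) ^+ b * x) * (Ca b z + 2 * b%:R * Da b.-1 z)); first by ring.
 by rewrite -DaE exprS; ring.
elim: a => [|a [IH1 IH2]].
 have h0 : (yp T t 0.*2).[x] = (-1) ^+ 0 * dfac 0 * (c * d) ^+ 0 * Ca 0 z.
  by rewrite double0 yp0 hornerC /dfac big_ord0 /Ca /Fa big_ord1 ffactn0 double0 fact0 !expr0 !mul1r invr1.
 by split => //; apply: odd_step.
have h0 : (yp T t a.+1.*2).[x] = (-1) ^+ a.+1 * dfac a.+1 * (c * d) ^+ a.+1 * Ca a.+1 z.
 rewrite doubleS yS IH2 /= IH1 CaS dS.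
 rewrite natr_double1.
 rewrite /z; set A := (-1) ^+ a.+1; rewrite !exprS.
 by rewrite /A exprS; field; rewrite d0.
by split => //; apply: odd_step => // _; rewrite doubleS /= IH2.
Qed.
End HermiteExplicit.

(** * Dominated convergence for sums of growing length *)

Section Tannery.
Variable R : realType.

(** A head of fixed length converges term by term, and the bound [b] makes all tails uniformly
    small. *)
Lemma tannery (f : nat -> nat -> R) (b g : nat -> R) (l : R) (m : nat -> nat) :
 (\forall n \near \oo, forall j, `|f n j| <= b j) -> cvgn (series b) -> (forall j, (fun n => f n j) @ \oo --> g j) ->
 series g @ \oo --> l -> (forall k, \forall n \near \oo, (k <= m n)%N) ->
 (fun n => \sum_(j < m n) f n j) @ \oo --> l.
move=> fb cb fg gl mk.
have gb j : `|g j| <= b j.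
 apply/ler_addgt0Pr => e e0; near \oo => n.
 have h1 : `|f n j| <= b j by near: n; apply: filterS fb => n; exact.
 have h2 : `|g j - f n j| < e by near: n; have /cvgrPdist_lt := fg j; exact.
 by rewrite -(subrK (f n j) (g j)) (le_trans (ler_normD _ _))// addrC lerD// ltW.
have b0 j : 0 <= b j by exact: le_trans (normr_ge0 _) (gb j).
have nb : nondecreasing_seq (series b) by apply: nondecreasing_series.
apply/cvgrPdist_lt => e e0; have e4 : 0 < e / 4 by rewrite divr_gt0.
near \oo => k.
have hk1 : `|lim (series b @ \oo) - series b k| < e / 4 by near: k; have /cvgrPdist_lt := cb; exact.
have hk2 : `|l - series g k| < e / 4 by near: k; have /cvgrPdist_lt := gl; exact.
have tail q : (k <= q)%N -> series b q - series b k <= e / 4.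
 move=> kq; apply: le_trans (ltW hk1); apply: le_trans (ler_norm _).
 by rewrite lerD2r; exact: nondecreasing_cvgn_le.
have cfin : (fun n => \sum_(0 <= j < k) f n j) @ \oo --> series g k.
 rewrite /series /=; elim: (k) => [|q IH].
  by rewrite big_geq//; under eq_fun do rewrite big_geq//; exact: cvg_cst.
 by rewrite big_nat_recr//=; under eq_fun do rewrite big_nat_recr//=; exact: cvgD.
near=> n.
have h1 : `|series g k - \sum_(0 <= j < k) f n j| < e / 4 by near: n; have /cvgrPdist_lt := cfin; exact.
have km : (k <= m n)%N by near: n; exact: mk.
have fbn : forall j, `|f n j| <= b j by near: n; exact: fb.
rewrite -(big_mkord xpredT (f n)) (big_cat_nat _ km)//=.
have h3 : `|\sum_(k <= j < m n) f n j| <= e / 4.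
 apply: le_trans (tail _ km); rewrite /series /= [X in _ <= X - _](big_cat_nat _ km)//= addrAC subrr add0r.
 by apply: (le_trans (ler_norm_sum _ _ _)); apply: ler_sum => j _; exact: fbn.
have -> : l - (\sum_(0 <= j < k) f n j + \sum_(k <= j < m n) f n j) =
 (l - series g k) + (series g k - \sum_(0 <= j < k) f n j) - \sum_(k <= j < m n) f n j by ring.
apply: (le_lt_trans (ler_normB _ _)); have h4 := ler_normD (l - series g k) (series g k - \sum_(0 <= j < k) f n j).
by lra.
Unshelve. all: end_near.
Qed.
End Tannery.

(** * Scaling limits of the hypergeometric sums *)

Section HermiteLimits.
Variable R : realType.
Implicit Types (z : nat -> R) (a : nat -> nat).

Lemma ffact_le (a j : nat) : ((a ^_ j)%:R : R) <= a%:R ^+ j.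
elim: j => [|j IH]; first by rewrite ffactn0.
by rewrite ffactnSr natrM exprSr ler_pM// ler_nat leq_subr.
Qed.

Lemma leq_fact i j : (i <= j)%N -> (i`! <= j`!)%N.
by elim: j => [|j IH]; [rewrite leqn0 => /eqP->|rewrite leq_eqVlt => /orP[/eqP->//|/IH h]; rewrite factS (leq_trans h)// leq_pmull]. Qed.

Lemma Fa_term_bound d (a j : nat) (z K : R) : (j <= d j)%N -> 0 <= z -> a%:R * z <= K ->
 `|(-1) ^+ j * (a ^_ j)%:R * z ^+ j / (d j)`!%:R| <= K ^+ j / j`!%:R.
move=> jd z0 azK; have f0 i : 0 < i`!%:R :> R by rewrite ltr0n fact_gt0.
rewrite !normrM normrX normrN1 expr1n mul1r ger0_norm// normrX (ger0_norm z0) ger0_norm ?invr_ge0//.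
apply: ler_pM => //; rewrite ?mulr_ge0 ?exprn_ge0 ?invr_ge0//.
 apply: (@le_trans _ _ ((a%:R * z) ^+ j)); last by rewrite lerXn2r ?nnegrE ?mulr_ge0// (le_trans _ azK)// mulr_ge0.
 by rewrite exprMn ler_wpM2r ?exprn_ge0// ffact_le.
by rewrite lef_pV2 ?posrE// ler_nat leq_fact.
Qed.

Lemma cvg_exp_series (K : R) : cvgn (series (fun j => K ^+ j / j`!%:R)).
exact: is_cvg_series_exp_coeff. Qed.

Lemma exp_partial (K : R) m : 0 <= K -> \sum_(j < m) K ^+ j / j`!%:R <= expR K.
move=> K0; rewrite -(big_mkord xpredT (fun j => K ^+ j / j`!%:R)).
apply: (nondecreasing_cvgn_le (u_ := series (exp_coeff K))); last exact: is_cvg_series_exp_coeff.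
by apply: nondecreasing_series => j _ _; exact: exp_coeff_ge0.
Qed.

Lemma Fa_bound d (a : nat) (z K : R) : (forall j, (j <= d j)%N) -> 0 <= z -> a%:R * z <= K -> `|Fa d a z| <= expR K.
move=> jd z0 azK; have K0 : 0 <= K by apply: le_trans azK; rewrite mulr_ge0.
apply: (le_trans (ler_norm_sum _ _ _)); apply: le_trans (exp_partial a.+1 K0).
by apply: ler_sum => j _; exact: Fa_term_bound.
Qed.

Lemma leq_double j : (j <= j.*2)%N. by rewrite -addnn leq_addr. Qed.
Lemma leq_doubleS j : (j <= j.*2.+1)%N. by rewrite leqW// leq_double. Qed.

Lemma cvg_ffact a z (y : R) j : (fun n => (a n)%:R * z n) @ \oo --> y -> z @ \oo --> (0 : R) ->
 (fun n => (a n ^_ j)%:R * z n ^+ j) @ \oo --> y ^+ j.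
move=> ay z0; elim: j => [|j IH].
 by under eq_fun do rewrite ffactn0 expr0 mulr1; exact: cvg_cst.
have -> : (fun n => (a n ^_ j.+1)%:R * z n ^+ j.+1) = (fun n => (a n ^_ j)%:R * z n ^+ j * ((a n)%:R * z n - j%:R * z n)).
 apply/funext => n; rewrite ffactnSr natrM exprS.
 have [aj|ja] := ltnP (a n) j; first by rewrite ffact_small// !mul0r.
 by rewrite natrB//; ring.
rewrite exprS mulrC; apply: cvgM => //; rewrite -[X in _ --> X]subr0 -(mulr0 (j%:R : R)); apply: cvgB => //.
by apply: cvgM => //; exact: cvg_cst.
Qed.

Lemma near_azK a z (y : R) : (fun n => (a n)%:R * z n) @ \oo --> y ->
 \forall n \near \oo, (a n)%:R * z n <= `|y| + 1.
move=> ay; near=> n.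
have h : `|y - (a n)%:R * z n| < 1 by near: n; have /cvgrPdist_lt := ay; apply.
have := ler_norm y; move: h; rewrite distrC => h1 h2; have := ler_norm ((a n)%:R * z n - y); lra.
Unshelve. all: end_near.
Qed.

Lemma cvg_Fa d a z (y l : R) : (forall j, (j <= d j)%N) -> (forall n, 0 <= z n) -> (fun n => (a n)%:R * z n) @ \oo --> y ->
 z @ \oo --> (0 : R) -> series (fun j => (-1) ^+ j * y ^+ j / (d j)`!%:R) @ \oo --> l -> (fun n => Fa d (a n) (z n)) @ \oo --> l.
move=> jd z0 ay zc hl; have hK := near_azK ay.
(* The sum is prolonged by zero terms, so that its range grows with [n] even when [a n] stays
   bounded. *)
have -> : (fun n => Fa d (a n) (z n)) = (fun n => \sum_(j < maxn (a n) n + 1) (-1) ^+ j * (a n ^_ j)%:R * z n ^+ j / (d j)`!%:R).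
 by apply/funext => n; apply: Fa_ext; rewrite addn1 ltnS leq_maxl.
apply: (@tannery R (fun n j => (-1) ^+ j * (a n ^_ j)%:R * z n ^+ j / (d j)`!%:R) (fun j => (`|y| + 1) ^+ j / j`!%:R)
 (fun j => (-1) ^+ j * y ^+ j / (d j)`!%:R)) => //.
- by apply: filterS hK => n h j; exact: Fa_term_bound.
- exact: cvg_exp_series.
- move=> j; apply: cvgM; last exact: cvg_cst.
 by under eq_fun do rewrite -mulrA; apply: cvgM; [exact: cvg_cst|exact: cvg_ffact].
- by move=> k; near=> n; rewrite addn1 leqW// leq_max; apply/orP; right; near: n; exact: nbhs_infty_ge.
Unshelve. all: end_near.
Qed.

Lemma cvg_Ca a z (u : R) : (forall n, 0 <= z n) -> (fun n => (a n)%:R * z n) @ \oo --> u ^+ 2 -> z @ \oo --> (0 : R) ->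
 (fun n => Ca (a n) (z n)) @ \oo --> cos u.
move=> z0 ay zc; apply: (cvg_Fa leq_double z0 ay zc); have := @cvg_cos_coeff' R u.
rewrite (_ : series _ = series (fun j => (-1) ^+ j * (u ^+ 2) ^+ j / (j.*2)`!%:R))//.
by congr series; apply/funext => j; rewrite -exprM mul2n.
Qed.

(** The entire function with sin u = u dsin (u^2); it avoids a division by u in the limit of the odd
    functions. *)
Definition dsin (y : R) : R := limn (series (fun j => (-1) ^+ j * y ^+ j / (j.*2.+1)`!%:R)).

Lemma dsinE (u : R) : u * dsin (u ^+ 2) = sin u.
have := @cvg_sin_coeff' R u.
rewrite (_ : series _ = (fun m => u * series (fun j => (-1) ^+ j * (u ^+ 2) ^+ j / (j.*2.+1)`!%:R) m)); last first.
 apply/funext => m; rewrite /series /= mulr_sumr; apply: eq_bigr => j _.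
 have -> : sin_coeff' u j = (-1) ^+ j * u ^+ j.*2.+1 / (j.*2.+1)`!%:R by [].
 by rewrite -exprM mul2n exprS; ring.
have [->|u0] := eqVneq u 0; first by rewrite mul0r sin0.
move=> h; have h2 : series (fun j => (-1) ^+ j * (u ^+ 2) ^+ j / (j.*2.+1)`!%:R) @ \oo --> u^-1 * sin u.
 have -> : series (fun j => (-1) ^+ j * (u ^+ 2) ^+ j / (j.*2.+1)`!%:R) =
   (fun m => u^-1 * (u * series (fun j => (-1) ^+ j * (u ^+ 2) ^+ j / (j.*2.+1)`!%:R) m)).
  by apply/funext => m; rewrite mulKf.
 by apply: cvgM => //; exact: cvg_cst.
by rewrite /dsin (cvg_lim _ h2)// mulVKf.
Qed.

Lemma cvg_Da a z (y : R) : (forall n, 0 <= z n) -> (fun n => (a n)%:R * z n) @ \oo --> y -> z @ \oo --> (0 : R) ->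
 (fun n => Da (a n) (z n)) @ \oo --> dsin y.
move=> z0 ay zc; apply: (cvg_Fa leq_doubleS z0 ay zc).
apply: normed_cvg; apply: (@series_le_cvg R _ (fun j => `|y| ^+ j / j`!%:R)); last exact: cvg_exp_series.
- by move=> j /=.
- by move=> j; rewrite divr_ge0 ?exprn_ge0.
move=> j /=; rewrite !normrM normrX normrN1 expr1n mul1r normrX ler_wpM2l ?exprn_ge0// ger0_norm ?invr_ge0//.
by rewrite lef_pV2 ?posrE ?ltr0n ?fact_gt0// ler_nat leq_fact// leq_doubleS.
Qed.
End HermiteLimits.

(** * Wallis' inequalities *)

Section Wallis.
Variable R : realType.
Local Notation leb := (@lebesgue_measure R).
Implicit Types (a k : nat).

(** The central binomial coefficient divided by 4^a. *)
Definition wal a : R := \prod_(i < a) ((i.*2.+1)%:R / (i.*2.+2)%:R).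
Definition sI k : R := Rintegral leb `[0, pi] (fun x => sin x ^+ k).
Lemma walS a : wal a.+1 = wal a * ((2 * a%:R + 1) / (2 * a%:R + 2)).
by rewrite /wal big_ord_recr /= -[a.*2.+2]addn2 -[a.*2.+1]addn1 !natrD -mul2n natrM. Qed.
Lemma wal_gt0 a : 0 < wal a. by apply: prodr_gt0 => i _; rewrite divr_gt0. Qed.

Lemma wal_decr a : wal a.+1 <= wal a.
have a0 : 0 <= a%:R :> R by [].
rewrite walS ler_piMr ?(ltW (wal_gt0 a))// ler_pdivrMr; lra.
Qed.

Lemma wal_le1 a : wal a <= 1.
by elim: a => [|a IH]; [rewrite /wal big_ord0|exact: le_trans (wal_decr a) IH]. Qed.

Lemma is_derive_sinX k (x : R) : is_derive x (1 : R) (fun x => sin x ^+ k.+1) (k.+1%:R * cos x * sin x ^+ k).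
elim: k => [|k IH].
 by have h := is_derive_sin x; apply: (is_derive_eq h); rewrite expr0 mul1r mulr1.
have -> : (fun x : R => sin x ^+ k.+2) = (fun x : R => sin x * sin x ^+ k.+1) by apply/funext => y; rewrite exprS.
have := is_deriveM (is_derive_sin x) IH => h; apply: (is_derive_eq h).
by rewrite /GRing.scale /= [sin x ^+ k.+1]exprS -[k.+2%:R]natr1; ring.
Qed.

Lemma continuous_sinX k : continuous (fun x : R => sin x ^+ k).
by move=> x; apply: (@continuous_comp _ _ _ sin (fun y => y ^+ k)); [exact: continuous_sin|exact: exprn_continuous]. Qed.

Lemma sI_rec k : k.+2%:R * sI k.+2 = k.+1%:R * sI k.
have cf : continuous (fun x : R => k.+1%:R * sin x ^+ k - k.+2%:R * sin x ^+ k.+2).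
 move=> x; apply: (@cvgB _ _ _ _ _ (fun x => k.+1%:R * sin x ^+ k) (fun x => k.+2%:R * sin x ^+ k.+2)).
  by apply: cvgM; [exact: cvg_cst|exact: continuous_sinX].
 by apply: cvgM; [exact: cvg_cst|exact: continuous_sinX].
have dF (x : R) : is_derive x (1 : R) (fun x => cos x * sin x ^+ k.+1) (k.+1%:R * sin x ^+ k - k.+2%:R * sin x ^+ k.+2).
 have := is_deriveM (is_derive_cos x) (is_derive_sinX k x) => h; apply: (is_derive_eq h).
 have := @cos2sin2 R x => e; rewrite /GRing.scale /= !exprS -[k.+2]addn1 natrD.
 transitivity (k.+1%:R * sin x ^+ k * cos x ^+ 2 - sin x * (sin x * sin x ^+ k)); first by ring.
 by rewrite e; ring.
have := ftc (pi_ge0 R) cf dF; rewrite sinpi sin0 !expr0n !mulr0 subrr.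
rewrite RintegralB//; first last.
- by apply: (continuous_itg_itv 0 pi) => x; apply: cvgM; [exact: cvg_cst|exact: continuous_sinX].
- by apply: (continuous_itg_itv 0 pi) => x; apply: cvgM; [exact: cvg_cst|exact: continuous_sinX].
rewrite !RintegralZl//; try (by apply: (continuous_itg_itv 0 pi); exact: continuous_sinX).
by move/eqP; rewrite subr_eq0 => /eqP.
Qed.

Lemma sI_decr k : sI k.+1 <= sI k.
apply: le_Rintegral => //; try (by apply: (continuous_itg_itv 0 pi); exact: continuous_sinX).
move=> x /=; rewrite in_itv /= => h.
by rewrite exprS ler_piMl ?sin_le1// exprn_ge0// sin_ge0_pi// in_itv.
Qed.

Lemma sI_even a : sI a.*2 = pi * wal a.
elim: a => [|a IH].
 by rewrite /wal big_ord0 mulr1 /sI (@ftc R _ id)// ?pi_ge0// ?subr0// => x; exact: cst_continuous.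
have := sI_rec a.*2; rewrite natr_double2.
rewrite natr_double1.
rewrite IH walS doubleS => h.
have a0 : 2 * a%:R + 2 != 0 :> R by rewrite gt_eqF// ltr_wpDl.
by apply: (mulfI a0); rewrite h; field.
Qed.

Lemma sI_odd a : sI a.*2.+1 * ((2 * a%:R + 1) * wal a) = 2.
elim: a => [|a IH].
 have d (x : R) : is_derive x (1 : R) (fun x => - cos x) (sin x ^+ 1).
  by have := is_deriveN (is_derive_cos x) => h; apply: (is_derive_eq h); rewrite opprK expr1.
 by rewrite /wal big_ord0 mulr0 add0r !mulr1 /sI (ftc (pi_ge0 R) (@continuous_sinX 1%N) d) cospi cos0; ring.
have := sI_rec a.*2.+1; have -> : (a.*2.+3)%:R = 2 * a%:R + 3 :> R by rewrite -addn3 natrD -mul2n natrM.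
rewrite natr_double2.
rewrite walS doubleS => h; have -> : a.+1%:R = a%:R + 1 :> R by rewrite -natr1.
have -> : 2 * (a%:R + 1) + 1 = 2 * a%:R + 3 :> R by ring.
have a0 : 2 * a%:R + 2 != 0 :> R by rewrite gt_eqF// ltr_wpDl.
transitivity ((2 * a%:R + 3) * sI a.*2.+3 * (wal a * ((2 * a%:R + 1) / (2 * a%:R + 2)))); first by ring.
by rewrite h -[RHS]IH; field.
Qed.

(** Wallis' argument, here and in [wal_hi]: the integrals of sin^k over [0, pi] decrease in k; for
    even k they contain [wal], for odd k its inverse. *)
Lemma wal_lo a : 2 <= pi * wal a ^+ 2 * (2 * a%:R + 1).
apply: (@le_trans _ _ (sI a.*2.+1 * ((2 * a%:R + 1) * wal a))); first by rewrite sI_odd.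
apply: (@le_trans _ _ (sI a.*2 * ((2 * a%:R + 1) * wal a))).
 by rewrite ler_wpM2r ?sI_decr// mulr_ge0 ?(ltW (wal_gt0 a))// addr_ge0.
by rewrite sI_even; apply: le_of_eq; ring.
Qed.

Lemma wal_hi a : pi * wal a ^+ 2 * a%:R <= 1.
have h : sI a.+1.*2 * ((2 * a%:R + 1) * wal a) <= 2.
 apply: (@le_trans _ _ (sI a.*2.+1 * ((2 * a%:R + 1) * wal a))); last by rewrite sI_odd.
 by rewrite ler_wpM2r ?doubleS ?sI_decr// mulr_ge0 ?(ltW (wal_gt0 a))// addr_ge0.
have a0 : 0 <= a%:R :> R by [].
have e : sI a.+1.*2 * ((2 * a%:R + 1) * wal a) * (2 * a%:R + 2) = pi * wal a ^+ 2 * (2 * a%:R + 1) ^+ 2.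
 by rewrite sI_even walS; field; rewrite gt_eqF//; lra.
have {e}h : pi * wal a ^+ 2 * (2 * a%:R + 1) ^+ 2 <= 2 * (2 * a%:R + 2) by rewrite -e ler_wpM2r//; lra.
move: h; set X := pi * wal a ^+ 2; have X0 : 0 <= X by rewrite mulr_ge0 ?pi_ge0 ?sqr_ge0.
move: a0; set A : R := a%:R; move=> a0 h.
have h2 : X * (4 * A * (A + 1)) <= 4 * (A + 1).
 apply: le_trans (_ : X * (2 * A + 1) ^+ 2 <= _); last by apply: (le_trans h); lra.
 by apply: ler_wpM2l => //; have -> : (2 * A + 1) ^+ 2 = 4 * A * (A + 1) + 1; [ring|lra].
have A1 : 0 < 4 * (A + 1) by lra.
by rewrite -(ler_pM2r A1) mul1r; apply: le_trans h2; apply: le_of_eq; ring.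
Qed.

End Wallis.

(** * Scaling of the summation index, and the weights *)

Section Riem.
Variable R : realType.
Implicit Types (F : nat -> nat -> R) (Phi : R -> R) (l : R).

Definition TT (N : nat) : R := 2 * N%:R.
(** The end of the range, a = N/2 with T = 2N, corresponds to l = 1, where the limiting integrals
    end. *)
Definition idx (a : nat -> nat) l := (forall N, (a N <= N./2)%N) /\ (fun N => (a N)%:R / TT N) @ \oo --> l ^+ 2 / 4.
(** A uniform bound with convergence along every index sequence is what dominated convergence needs,
    and it is stable under sums and products. *)
Definition ncvg F Phi := (exists C, \forall N \near \oo, forall a, (a <= N./2)%N -> `|F N a| <= C) /\
 forall a l, idx a l -> (fun N => F N (a N)) @ \oo --> Phi l.
(** What is left of [1 / hj] once the basis functions are normalised ([sc_cw]); asymptotically 1/pi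
    times the spacing of the nodes in l. *)
Definition cw N a : R := wal R a / sqrt (pi * TT N).

Lemma ncvg_mul F G Phi Psi : ncvg F Phi -> ncvg G Psi -> ncvg (fun N a => F N a * G N a) (fun l => Phi l * Psi l).
move=> [[C bF] cF] [[C' bG] cG]; split.
 exists (C * C'); apply: filterS2 bF bG => N h1 h2 a aN.
 by rewrite normrM; apply: ler_pM => //; [exact: h1|exact: h2].
by move=> a l i; apply: cvgM; [exact: cF|exact: cG].
Qed.

Lemma ncvg_add F G Phi Psi : ncvg F Phi -> ncvg G Psi -> ncvg (fun N a => F N a + G N a) (fun l => Phi l + Psi l).
move=> [[C bF] cF] [[C' bG] cG]; split.
 exists (C + C'); apply: filterS2 bF bG => N h1 h2 a aN.
 by apply: (le_trans (ler_normD _ _)); apply: lerD; [exact: h1|exact: h2].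
by move=> a l i; apply: cvgD; [exact: cF|exact: cG].
Qed.

Lemma ncvg_cst (c : nat -> R) (c' : R) : c @ \oo --> c' -> ncvg (fun N a => c N) (fun=> c').
move=> h; split; last by [].
exists (`|c'| + 1); near=> N => a _.
have h1 : `|c' - c N| < 1 by near: N; have /cvgrPdist_lt := h; apply.
have -> : c N = c' - (c' - c N) by ring.
by apply: (le_trans (ler_normB _ _)); rewrite lerD2l ltW.
Unshelve. all: end_near.
Qed.

Lemma ncvg_ext F G Phi Psi : ncvg F Phi -> (\forall N \near \oo, forall a, (a <= N./2)%N -> F N a = G N a) ->
 (forall l, Phi l = Psi l) -> ncvg G Psi.
move=> [[C bF] cF] e eP; split.
 by exists C; apply: filterS2 bF e => N h1 h2 a aN; rewrite -h2// h1.
move=> a l i; rewrite -eP; apply: cvg_trans (cF _ _ i); apply: near_eq_cvg.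
by apply: filterS e => N h; rewrite h//; case: i.
Qed.

Lemma near_TT (K : R) : \forall N \near \oo, K < TT N.
near=> N; rewrite /TT; have h : `|K| < N%:R by near: N; exact: nbhs_infty_gtr.
have := ler_norm K; have := normr_ge0 K; lra.
Unshelve. all: end_near.
Qed.

Lemma cvg_inv_TT : (fun N => (TT N)^-1) @ \oo --> (0 : R).
apply/cvgrPdist_lt => e e0; near=> N; have h : e^-1 < TT N by near: N; exact: near_TT.
have h0 : 0 < TT N by apply: lt_trans h; rewrite invr_gt0.
by rewrite sub0r normrN normfV gtr0_norm// invf_plt ?posrE.
Unshelve. all: end_near.
Qed.

Lemma half_TT (N : nat) : (N./2)%:R <= TT N / 4 /\ TT N / 4 - 1 <= (N./2)%:R.
have := odd_double_half N; rewrite /TT => h.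
have e : N%:R = (odd N)%:R + 2 * (N./2)%:R :> R by rewrite -{1}h natrD -mul2n natrM.
have : 0 <= ((odd N)%:R : R) <= 1 by case: odd; rewrite !(ler01, lexx).
rewrite e => /andP[h1 h2]; lra.
Qed.

Lemma cvg_half_TT : (fun N => (N./2)%:R / TT N) @ \oo --> (4^-1 : R).
apply: (@squeeze_cvgr _ _ _ _ (fun N => 4^-1 - (TT N)^-1) (fun=> 4^-1)).
- near=> N; have [h1 h2] := half_TT N; have T0 : 0 < TT N by near: N; exact: near_TT.
 rewrite ler_pdivlMr// ler_pdivrMr// mulrBl mulVf ?gt_eqF//; lra.
- by rewrite -[X in _ --> X]subr0; apply: cvgB; [exact: cvg_cst|exact: cvg_inv_TT].
exact: cvg_cst.
Unshelve. all: end_near.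
Qed.

Lemma idx_shift a b l : idx a l -> (forall N, (b N <= N./2)%N) -> (forall N, (a N <= b N + 1)%N /\ (b N <= a N + 1)%N) -> idx b l.
move=> [_ ha] hb ab; split => //.
apply: (@squeeze_cvgr _ _ _ _ (fun N => (a N)%:R / TT N - (TT N)^-1) (fun N => (a N)%:R / TT N + (TT N)^-1)).
- near=> N; have [h1 h2] := ab N; have T0 : 0 < TT N by near: N; exact: near_TT.
 move: h1 h2; rewrite -!(ler_nat R) !natrD => h1 h2.
 have e u : u / TT N - (TT N)^-1 = (u - 1) / TT N by ring.
 have e' u : u / TT N + (TT N)^-1 = (u + 1) / TT N by ring.
 by rewrite e e' !ler_pM2r ?invr_gt0//; apply/andP; split; lra.
- by rewrite -[X in _ --> X]subr0; apply: cvgB => //; exact: cvg_inv_TT.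
by rewrite -[X in _ --> X]addr0; apply: cvgD => //; exact: cvg_inv_TT.
Unshelve. all: end_near.
Qed.

(** The weight divided by the spacing of the nodes, with the difference of square roots
    rationalised. *)
Definition rn N a : R := wal R a * (sqrt a.+1%:R + sqrt a%:R) * sqrt ((N./2)%:R / (pi * TT N)).
Definition node N a : R := sqrt (a%:R / (N./2)%:R).

Lemma cw_rn N a : (0 < N./2)%N -> cw N a = rn N a * (node N a.+1 - node N a).
move=> p0; have p0R : 0 < (N./2)%:R :> R by rewrite ltr0n.
have T0 : 0 < TT N by have [] := half_TT N; lra.
have pT : 0 < pi * TT N by rewrite mulr_gt0 ?pi_gt0.
have sq (u v : R) : 0 <= u -> 0 <= v -> sqrt (u / v) = sqrt u / sqrt v.
 by move=> u0 v0; rewrite sqrtrM// sqrtrV.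
rewrite /cw /rn /node !sq ?(ltW pT)//.
have s0 : sqrt (N./2)%:R != 0 :> R by rewrite gt_eqF// sqrtr_gt0.
have s1 : sqrt (pi * TT N) != 0 by rewrite gt_eqF// sqrtr_gt0.
have e1 : sqrt a.+1%:R ^+ 2 = a%:R + 1 :> R by rewrite sqr_sqrtr ?natr1.
have e2 : sqrt a%:R ^+ 2 = a%:R :> R by rewrite sqr_sqrtr.
move: s0 s1 e1 e2; set S := sqrt (N./2)%:R; set S' := sqrt (pi * TT N); set A := sqrt _; set B := sqrt _.
move=> s0 s1 e1 e2; transitivity (wal R a * (A ^+ 2 - B ^+ 2) / S').
 by rewrite e1 e2; field.
by field; rewrite s0 s1.
Qed.

Lemma rn_bound N a : 0 <= rn N a <= 4.
rewrite /rn; have w0 := wal_gt0 R a; rewrite !mulr_ge0 ?addr_ge0 ?sqrtr_ge0 ?(ltW w0)//=.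
have h1 : sqrt ((N./2)%:R / (pi * TT N)) <= 1.
 rewrite -[leRHS]sqrtr1 ler_wsqrtr//; have [h _] := half_TT N.
 have [T0|T0] := ltP 0 (TT N); last first.
  have -> : TT N = 0 by apply/eqP; rewrite eq_le T0 mulr_ge0.
  by rewrite mulr0 invr0 mulr0.
 have pT : 0 < pi * TT N by rewrite mulr_gt0 ?pi_gt0.
 rewrite ler_pdivrMr// mul1r; have : 1 * TT N <= pi * TT N by rewrite ler_wpM2r ?(ltW T0)//; have := pi_ge2 R; lra.
 lra.
have h2 : wal R a * sqrt a.+1%:R <= 2.
 have e : (wal R a * sqrt a.+1%:R) ^+ 2 <= 2 ^+ 2.
  rewrite exprMn sqr_sqrtr// -natr1.
  have := wal_hi R a; have := wal_le1 R a; have := pi_ge2 R; set w := wal R a in w0 *; move=> p2 w1 hi.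
  have w2 : w ^+ 2 <= 1 by rewrite -(expr1n R 2) lerXn2r ?nnegrE//; exact: ltW.
  have : w ^+ 2 * a%:R <= 1.
   apply: le_trans hi; rewrite -mulrA ler_peMl ?mulr_ge0 ?sqr_ge0//; lra.
  rewrite mulrDr mulr1; lra.
 by rewrite -(@lerXn2r_iff _ 2) ?nnegrE ?mulr_ge0 ?sqrtr_ge0 ?(ltW w0)// || by move: e; rewrite ler_sqr ?nnegrE ?mulr_ge0 ?sqrtr_ge0 ?(ltW w0).
have h3 : sqrt a%:R <= sqrt a.+1%:R :> R by rewrite ler_wsqrtr// ler_nat.
have h4 : wal R a * (sqrt a.+1%:R + sqrt a%:R) <= 4.
 rewrite mulrDr; have := ler_wpM2l (ltW w0) h3; lra.
by rewrite -[4]mulr1; apply: ler_pM => //; rewrite ?mulr_ge0 ?addr_ge0 ?sqrtr_ge0 ?(ltW w0).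
Qed.

Lemma cvg_rn a l : l != 0 -> idx a l -> (fun N => rn N (a N)) @ \oo --> (pi^-1 : R).
move=> l0 [_ ha].
have ainf (K : R) : \forall N \near \oo, K < (a N)%:R.
 near=> N; have T0 : 0 < TT N by near: N; exact: near_TT.
 have l2 : 0 < l ^+ 2 / 4 by rewrite divr_gt0// exprn_even_gt0.
 have : `|l ^+ 2 / 4 - (a N)%:R / TT N| < l ^+ 2 / 8 by near: N; have /cvgrPdist_lt := ha; apply; rewrite divr_gt0// exprn_even_gt0.
 move=> h; have h2 : l ^+ 2 / 8 < (a N)%:R / TT N by have := ler_norm (l ^+ 2 / 4 - (a N)%:R / TT N); lra.
 move: h2; rewrite ltr_pdivlMr//; apply: lt_trans.
 rewrite -ltr_pdivrMl ?divr_gt0 ?exprn_even_gt0//; near: N; exact: near_TT.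
have ainv : (fun N => ((a N)%:R : R)^-1) @ \oo --> (0 : R).
 apply/cvgrPdist_lt => e e0; near=> N; have h : e^-1 < (a N)%:R by near: N; exact: ainf.
 have h0 : 0 < (a N)%:R :> R by apply: lt_trans h; rewrite invr_gt0.
 by rewrite sub0r normrN normfV ger0_norm// invf_plt ?posrE.
have p0 := pi_gt0 R.
have E (N : nat) : 0 < (a N)%:R :> R ->
 2 * sqrt ((1 - (a N)%:R^-1) / pi) <= wal R (a N) * (sqrt (a N).+1%:R + sqrt (a N)%:R) <= 2 * sqrt ((1 + (a N)%:R^-1) / pi).
 set A := a N => A0; have w0 := wal_gt0 R A.
 have -> : wal R A = sqrt (wal R A ^+ 2) by rewrite sqrtr_sqr ger0_norm// ltW.
 rewrite mulrDr -!sqrtrM ?sqr_ge0//.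
 have m (u v : R) : u <= v -> sqrt u <= sqrt v by exact: ler_wsqrtr.
 have hA : wal R A ^+ 2 * A%:R <= wal R A ^+ 2 * A.+1%:R by rewrite ler_wpM2l ?sqr_ge0// ler_nat.
 have hlo : (1 - A%:R^-1) / pi <= wal R A ^+ 2 * A%:R.
  rewrite ler_pdivrMr//; have := wal_lo R A; set X := pi * _ => h.
  have -> : wal R A ^+ 2 * A%:R * pi = X * A%:R by rewrite /X; ring.
  have A1 : 0 < 2 * A%:R + 1 :> R by lra.
  rewrite -(ler_pM2r A1); have -> : X * A%:R * (2 * A%:R + 1) = X * (2 * A%:R + 1) * A%:R by ring.
  apply: (@le_trans _ _ (2 * A%:R)); last by rewrite ler_wpM2r.
  have -> : (1 - A%:R^-1) * (2 * A%:R + 1) = 2 * A%:R - 1 - A%:R^-1 :> R by field; rewrite gt_eqF.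
  have : 0 < A%:R^-1 :> R by rewrite invr_gt0.
  lra.
 have hhi : wal R A ^+ 2 * A.+1%:R <= (1 + A%:R^-1) / pi.
  rewrite ler_pdivlMr//; have := wal_hi R A; set X := pi * _ => h.
  have -> : wal R A ^+ 2 * A.+1%:R * pi = X * A%:R * (1 + A%:R^-1).
   by rewrite /X -natr1; field; rewrite gt_eqF.
  by rewrite ler_piMl// addr_ge0// invr_ge0 ltW.
 have := m _ _ hlo; have := m _ _ hhi; have := m _ _ hA; lra.
have pn : pi != 0 :> R by rewrite gt_eqF.
(* The first factor is the limit of the part bounded by Wallis' inequalities, the second that of the
   remaining square root in [rn]. *)
have -> : pi^-1 = 2 * sqrt ((1 : R) / pi) * sqrt (4^-1 / pi).
 rewrite -mulrA -sqrtrM ?divr_ge0 ?ltW//.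
 have gen1 (p : R) : p != 0 -> 1 / p * (4^-1 / p) = (2 * p)^-1 ^+ 2 by move=> h; field.
 have gen2 (p : R) : p != 0 -> p^-1 = 2 * (2 * p)^-1 by move=> h; field.
 rewrite gen1//.
 by rewrite sqrtr_sqr ger0_norm ?invr_ge0 ?mulr_ge0 ?(ltW p0)//; exact: gen2.
have csq (f : nat -> R) (y : R) : f @ \oo --> y -> (fun N => sqrt (f N)) @ \oo --> sqrt y.
 by move=> h; apply: (@cvg_comp _ _ _ f sqrt _ (nbhs y) _ h); exact: sqrt_continuous.
apply: cvgM; last first.
 apply: csq; have -> : (fun N => (N./2)%:R / (pi * TT N)) = (fun N => (N./2)%:R / TT N / pi).
  by apply/funext => N; rewrite invfM; ring.
 by apply: cvgM; [exact: cvg_half_TT|exact: cvg_cst].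
apply: (squeeze_cvgr (f := fun N => 2 * sqrt ((1 - (a N)%:R^-1) / pi)) (h := fun N => 2 * sqrt ((1 + (a N)%:R^-1) / pi))).
- by near=> N; apply: E; near: N; exact: ainf.
- apply: cvgM; first exact: cvg_cst.
 by apply: csq; apply: cvgM; last exact: cvg_cst; rewrite -[X in _ --> X]subr0; apply: cvgB => //; exact: cvg_cst.
apply: cvgM; first exact: cvg_cst.
by apply: csq; apply: cvgM; last exact: cvg_cst; rewrite -[X in _ --> X]addr0; apply: cvgD => //; exact: cvg_cst.
Unshelve. all: end_near.
Qed.
End Riem.

(** * Kernel sums as Riemann sums, and alternating sums *)

Section RiemSum.
Variable R : realType.
Local Notation leb := (@lebesgue_measure R).
Local Notation idx := (@idx R).
Local Notation ncvg := (@ncvg R).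
Local Notation TT := (TT R).
Local Notation cw := (@cw R).
Local Notation node := (@node R).
Implicit Types (F : nat -> nat -> R) (Phi : R -> R) (l : R).

Lemma indic_oc (a b : R) : \1_(`]a, b]%classic : set R) = (fun=> (1 : R)) \_ `]a, b]%classic.
by apply/funext => w; rewrite patch_indic /= mul1r. Qed.
Lemma itg_itv_oc (f : R -> R) (a b : R) : continuous f -> leb.-integrable `]a, b] (EFin \o f).
by move=> cf; apply: (integrableS _ _ _ (continuous_itg_itv a b cf)) => //; exact: subset_itv_oc_cc.
Qed.

Lemma itg_oc (a b : R) : itg (\1_(`]a, b]%classic : set R) : R -> R).
rewrite indic_oc /itg -restrict_EFin; apply/(integrable_mkcond _ _).1 => //.
by apply: itg_itv_oc; exact: cst_continuous.
Qed.

Lemma Ri_oc (a b : R) : a <= b -> Ri (\1_(`]a, b]%classic : set R) : R -> R) = b - a.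
move=> ab; rewrite indic_oc -Rint_Ri Rintegral_itv_obnd_cbnd; last by apply: itg_itv_oc; exact: cst_continuous.
by rewrite (@ftc R _ id)// => x; exact: cst_continuous.
Qed.

Definition stepf (m : nat) (c nd : nat -> R) (l : R) : R := \sum_(a < m) c a * \1_(`]nd a, nd a.+1]%classic : set R) l.

Lemma itg_stepf m c nd : itg (stepf m c nd).
elim: m => [|m IH].
 rewrite (_ : stepf 0 c nd = fun l => 0 * \1_(`]0, 1]%classic : set R) l); first exact/itgZ/itg_oc.
 by apply/funext => l; rewrite /stepf big_ord0 mul0r.
rewrite (_ : stepf m.+1 c nd = fun l => stepf m c nd l + c m * \1_(`]nd m, nd m.+1]%classic : set R) l).
 by apply: itgD => //; exact/itgZ/itg_oc.
by apply/funext => l; rewrite /stepf big_ord_recr.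
Qed.

Lemma Ri_stepf m c nd : (forall a, nd a <= nd a.+1) -> Ri (stepf m c nd) = \sum_(a < m) c a * (nd a.+1 - nd a).
move=> h; elim: m => [|m IH].
 rewrite big_ord0 (@Ri_eq _ _ (fun l => 0 * \1_(`]0, 1]%classic : set R) l)).
  by rewrite RiZ ?mul0r//; exact: itg_oc.
 by move=> l; rewrite /stepf big_ord0 mul0r.
rewrite (@Ri_eq _ _ (fun l => stepf m c nd l + c m * \1_(`]nd m, nd m.+1]%classic : set R) l)); last first.
 by move=> l; rewrite /stepf big_ord_recr.
rewrite RiD; [|exact: itg_stepf|exact/itgZ/itg_oc].
by rewrite IH RiZ ?Ri_oc ?big_ord_recr//; exact: itg_oc.
Qed.

Lemma node_in N a l : (0 < N./2)%N ->
 (l \in `]node N a, node N a.+1]) = [&& 0 < l, a%:R < (N./2)%:R * l ^+ 2 & (N./2)%:R * l ^+ 2 <= a.+1%:R].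
move=> p0; have p0R : 0 < (N./2)%:R :> R by rewrite ltr0n.
rewrite in_itv /= /node; have [l0|l0] := ltP 0 l; last first.
 by rewrite (le_gtF (le_trans l0 (sqrtr_ge0 _))).
have e : l = sqrt (l ^+ 2) by rewrite sqrtr_sqr gtr0_norm.
rewrite {1 2}e ltr_sqrt ?exprn_gt0// ler_sqrt ?divr_ge0//.
by rewrite ltr_pdivrMr// ler_pdivlMr// mulrC.
Qed.

(** The index of the node interval containing [l]. These intervals are open on the left, so at an
    exact integer the truncation is one too large. *)
Definition idxf N l : nat := let b := Num.trunc ((N./2)%:R * l ^+ 2) in if b%:R == (N./2)%:R * l ^+ 2 then b.-1 else b.

Lemma idxf_le N l : (idxf N l)%:R <= (N./2)%:R * l ^+ 2.
have x0 : 0 <= (N./2)%:R * l ^+ 2 by rewrite mulr_ge0 ?sqr_ge0.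
have /andP[h1 h2] := truncn_itv x0; rewrite /idxf; case: ifP => // _.
by apply: le_trans h1; rewrite ler_nat leq_pred.
Qed.

Lemma idxfP N l : (0 < N./2)%N -> 0 < l <= 1 ->
 [/\ (idxf N l < N./2)%N, (idxf N l)%:R < (N./2)%:R * l ^+ 2 & (N./2)%:R * l ^+ 2 <= (idxf N l).+1%:R].
move=> p0 /andP[l0 l1]; have p0R : 0 < (N./2)%:R :> R by rewrite ltr0n.
have x0 : 0 < (N./2)%:R * l ^+ 2 by rewrite mulr_gt0 ?exprn_gt0.
have xp : (N./2)%:R * l ^+ 2 <= (N./2)%:R by rewrite ler_piMr ?(ltW p0R)// -(expr1n R 2) lerXn2r ?nnegrE// ltW.
have h : (idxf N l)%:R < (N./2)%:R * l ^+ 2 /\ (N./2)%:R * l ^+ 2 <= (idxf N l).+1%:R.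
 rewrite /idxf; have /andP[h1 h2] := truncn_itv (ltW x0).
 case: ifP => [/eqP e|/negbT ne]; last by rewrite (ltW h2) lt_neqAle ne h1.
 move: e; case: Num.trunc h1 h2 => [|b] h1 h2 e; first by rewrite -e ltxx in x0.
 by rewrite -e /= ltr_nat.
by case: h => h1 h2; split => //; rewrite -(ltr_nat R) (lt_le_trans h1).
Qed.

Lemma stepf_val N c l : (0 < N./2)%N -> 0 < l <= 1 -> stepf N./2 c (node N) l = c (idxf N l).
move=> p0 l01; have [ip h1 h2] := idxfP p0 l01.
have ind a : \1_(`]node N a, node N a.+1]%classic : set R) l = (l \in `]node N a, node N a.+1])%:R :> R.
 by rewrite indicE mem_setE.
have /andP[l0 _] := l01.
rewrite /stepf (bigD1 (Ordinal ip)) //= ind (node_in _ _ p0) l0 h1 h2 mulr1 big1 ?addr0// => i ii.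
rewrite ind node_in// l0 /=; case: (boolP (_ && _)) => [/andP[k1 k2]|_]; last by rewrite mulr0.
case/eqP: ii; apply: val_inj => /=; apply/eqP; rewrite eqn_leq -ltnS -(ltnS (idxf N l)) -!(ltr_nat R).
by rewrite (lt_le_trans k1 h2) (lt_le_trans h1 k2).
Qed.

Lemma stepf_out N c l : ~~ (0 < l <= 1) -> stepf N./2 c (node N) l = 0.
move=> l01; rewrite /stepf big1// => i _; have p0 : (0 < N./2)%N by apply: leq_ltn_trans (ltn_ord i).
rewrite indicE mem_setE node_in//; case: (boolP [&& _, _ & _]) => [/and3P[l0 k1 k2]|_]; last by rewrite mulr0.
case/negP: l01; rewrite l0 /=; have p0R : 0 < (N./2)%:R :> R by rewrite ltr0n.
have : (N./2)%:R * l ^+ 2 <= (N./2)%:R by apply: (le_trans k2); rewrite ler_nat.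
rewrite ger_pMr// => h; rewrite leNgt; apply/negP => l1.
by have := exprn_egt1 2 l1 => /=; rewrite ltNge h.
Qed.

Lemma idx_idxf l : 0 < l <= 1 -> idx (idxf^~ l) l.
move=> l01; split.
 move=> N; have [p0|p0] := posnP N./2; last by have [/ltnW] := idxfP p0 l01.
 by have := idxf_le N l; rewrite p0 mul0r -(ler_nat R).
apply: (@squeeze_cvgr _ _ _ _ (fun N => l ^+ 2 * ((N./2)%:R / TT N) - (TT N)^-1) (fun N => l ^+ 2 * ((N./2)%:R / TT N))).
- near=> N; have T0 : 0 < TT N by near: N; exact: near_TT.
 have p0 : (0 < N./2)%N.
  have [_ h] := half_TT R N; rewrite -(ltr_nat R); apply: lt_le_trans h.
  have : 4 < TT N by near: N; exact: near_TT.
  lra.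
 have [_ h1 h2] := idxfP p0 l01.
 have -> : l ^+ 2 * ((N./2)%:R / TT N) - (TT N)^-1 = ((N./2)%:R * l ^+ 2 - 1) / TT N by ring.
 have -> : l ^+ 2 * ((N./2)%:R / TT N) = ((N./2)%:R * l ^+ 2) / TT N by ring.
 by rewrite !ler_pM2r ?invr_gt0// (ltW h1) andbT lerBlDr natr1.
- rewrite -[X in _ --> X]subr0; apply: cvgB; last exact: cvg_inv_TT.
 by apply: cvgM; [exact: cvg_cst|exact: cvg_half_TT].
by apply: cvgM; [exact: cvg_cst|exact: cvg_half_TT].
Unshelve. all: end_near.
Qed.

Lemma near_half : \forall N \near \oo, (0 < N./2)%N.
by exists 2%N => // -[|[|N]]. Qed.
Lemma node_le N a : node N a <= node N a.+1.
by rewrite ler_wsqrtr// ler_wpM2r ?invr_ge0// ler_nat. Qed.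

(** The sum is the integral of a step function on ]0, 1], which converges pointwise under a constant
    bound. *)
Lemma Riem F Phi : ncvg F Phi -> continuous Phi ->
 (fun N => \sum_(a < N./2) cw N a * F N a) @ \oo --> pi^-1 * int01 Phi.
move=> [[C bF] cF] cP; have [N0 _ hN] := filterI bF near_half.
(* The bound on [F] holds from [N0] on only; before that the step function is replaced by 0. *)
pose u N := if (N0 <= N)%N then stepf N./2 (fun a => rn R N a * F N a) (node N) else stepf 0 (fun=> 0) (node 0).
pose f := (fun l => pi^-1 * Phi l) \_ (`]0, 1]%classic : set R).
have cg : continuous (fun l => pi^-1 * Phi l) by move=> l; apply: cvgM; [exact: cvg_cst|exact: cP].
have fE : Ri f = pi^-1 * int01 Phi.
 rewrite /f -Rint_Ri Rintegral_itv_obnd_cbnd; last exact: itg_itv_oc.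
 by rewrite RintegralZl//; exact: continuous_itg_itv.
have C0 : 0 <= C.
 have [h p0] := hN N0 (leqnn _); exact: le_trans (normr_ge0 _) (h 0%N _).
have fo l : ~~ (0 < l <= 1) -> f l = 0.
 by move=> h; rewrite /f /patch; case: ifP => //; rewrite mem_setE in_itv /= (negbTE h).
have fi l : 0 < l <= 1 -> f l = pi^-1 * Phi l by move=> h; rewrite /f /patch mem_setE in_itv /= h.
have uo N l : ~~ (0 < l <= 1) -> u N l = 0.
 by move=> h; rewrite /u; case: ifP => _; [exact: stepf_out|rewrite /stepf big_ord0].
have lim : (fun N => Ri (u N)) @ \oo --> Ri f.
 apply: (@Ri_dct R u f (fun l => 4 * C * \1_(`]0, 1]%classic : set R) l)).
 - by move=> N; rewrite /u; case: ifP => _; exact: (itg_meas (itg_stepf _ _ _)).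
 - by apply: measurable_patch => //; exact: continuous_mfun.
 - move=> l; have [l01|l01] := boolP (0 < l <= 1); last first.
   rewrite fo// (_ : (fun N => u N l) = fun=> 0); first exact: cvg_cst.
   by apply/funext => N; rewrite uo.
  rewrite fi//; have il := idx_idxf l01.
  have h : (fun N => rn R N (idxf N l) * F N (idxf N l)) @ \oo --> pi^-1 * Phi l.
   apply: cvgM; last exact: cF.
   by apply: (@cvg_rn R (idxf^~ l) l) => //; case/andP: l01 => l0 _; rewrite gt_eqF.
  apply: (cvg_eq_near h) => {h}; near=> N.
  have NN : (N0 <= N)%N by near: N; exact: nbhs_infty_ge.
  by rewrite /u NN stepf_val//; have [] := hN N NN.
 - exact/itgZ/itg_oc.
 move=> N l; have [l01|l01] := boolP (0 < l <= 1); last first.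
  by rewrite uo// normr0 mulr_ge0// mulr_ge0.
 rewrite indicE mem_setE in_itv /= l01 mulr1 /u; case: ifPn => NN; last first.
  by rewrite /stepf big_ord0 normr0 mulr_ge0.
 have [hb p0] := hN N NN; rewrite stepf_val// normrM; have /andP[r0 r4] := rn_bound R N (idxf N l).
 apply: ler_pM => //; first by rewrite ger0_norm.
 by apply: hb; apply/ltnW; have [] := idxfP p0 l01.
rewrite -fE; apply: (cvg_eq_near lim) => {lim}; near=> N.
have NN : (N0 <= N)%N by near: N; exact: nbhs_infty_ge.
rewrite /u NN Ri_stepf; last by move=> a; exact: node_le.
by apply: eq_bigr => a _; rewrite cw_rn; [ring|have [] := hN N NN].
Unshelve. all: end_near.
Qed.

Lemma alt_sum (m : nat) (c : nat -> R) : 2 * \sum_(a < m) (-1) ^+ a * c a =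
 \sum_(a < m) (-1) ^+ a * (c a - c a.+1) + c 0%N - (-1) ^+ m * c m.
by elim: m => [|m IH]; [rewrite !big_ord0; ring|rewrite !big_ord_recr mulrDr IH /= exprS; ring]. Qed.

Lemma cvg_cw0 : (fun N => cw N 0) @ \oo --> (0 : R).
have -> : (fun N => cw N 0) = (fun N => sqrt (pi^-1 * (TT N)^-1)).
 by apply/funext => N; rewrite /cw /wal big_ord0 mul1r -invfM sqrtrV// mulr_ge0 ?pi_ge0 ?mulr_ge0.
rewrite -(@sqrtr0 R); apply: (@cvg_comp _ _ _ (fun N => pi^-1 * (TT N)^-1) sqrt _ (nbhs (0 : R))); last exact: sqrt_continuous.
by rewrite -(mulr0 (pi^-1 : R)); apply: cvgM; [exact: cvg_cst|exact: cvg_inv_TT].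
Qed.

(** Summation by parts leaves differences of [cw], which telescope, differences of [q], whose
    weighted sum is a Riemann sum with limit 0, and boundary terms controlled by [cw N 0]. *)
Lemma alternating q Phi : ncvg q Phi -> (fun N => \sum_(a < N./2) (-1) ^+ a * (cw N a * q N a)) @ \oo --> (0 : R).
move=> nq; have [[C bq] cq] := nq.
(* At the last index the successor leaves the range where [q] is bounded, whence the cut-off. *)
pose F N a := if (a < N./2)%N then `|q N a - q N a.+1| else 0.
have nF : ncvg F (fun=> 0).
 split.
  exists (C + C); apply: filterS bq => N h a aN; rewrite /F; case: ifPn => ap.
   by rewrite normr_id (le_trans (ler_normB _ _))// lerD// h.
  by rewrite normr0 addr_ge0// (le_trans (normr_ge0 _) (h _ aN)).
 move=> a l ia; have ib : idx (fun N => if (a N < N./2)%N then (a N).+1 else a N) l.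
  apply: (idx_shift ia) => N; first by case: ifP => // _; case: ia.
  by case: ifP => _; split; lia.
 have h : (fun N => `|q N (a N) - q N (if (a N < N./2)%N then (a N).+1 else a N)|) @ \oo --> (0 : R).
  rewrite -[X in _ --> X](normr0 R) -(subrr (Phi l)); apply: cvg_norm.
  by apply: cvgB; [exact: cq|exact: (cq _ _ ib)].
 apply: (cvg_eq_near h) => {h}; apply: nearW => N; rewrite /F; case: ifP => //.
 by rewrite subrr normr0.
have := Riem nF (@cst_continuous _ _ (0 : R)).
have -> : int01 (fun _ : R => (0 : R)) = 0 by rewrite /int01 Rintegral_cst// mul0r.
rewrite mulr0 => h1.
have h2 : (fun N => \sum_(a < N./2) cw N a * F N a + 2 * (C * cw N 0)) @ \oo --> (0 : R).
 rewrite -[X in _ --> X]addr0; apply: cvgD => //; rewrite -(mulr0 (2 : R)); apply: cvgM; first exact: cvg_cst.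
 by rewrite -(mulr0 C); apply: cvgM; [exact: cvg_cst|exact: cvg_cw0].
apply/cvgrPdist_le => e e0; near=> N.
have h3 : `|0 - (\sum_(a < N./2) cw N a * F N a + 2 * (C * cw N 0))| <= e.
 by near: N; have /cvgrPdist_le := h2; apply.
have hb : forall a, (a <= N./2)%N -> `|q N a| <= C by near: N.
rewrite sub0r normrN in h3 *.
have cw0 a : 0 <= cw N a by rewrite /cw divr_ge0 ?sqrtr_ge0 ?(ltW (wal_gt0 _ _)).
have cwd a : cw N a.+1 <= cw N a by rewrite /cw ler_wpM2r ?invr_ge0 ?sqrtr_ge0 ?wal_decr.
have C0 : 0 <= C by apply: le_trans (normr_ge0 _) (hb 0%N _).
have tel : forall m, (m <= N./2)%N -> `|\sum_(a < m) (-1) ^+ a * (cw N a * q N a - cw N a.+1 * q N a.+1)| <=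
  \sum_(a < m) cw N a * F N a + C * (cw N 0 - cw N m).
 elim=> [|m IH] mN; first by rewrite !big_ord0 subrr mulr0 addr0 normr0.
 rewrite !big_ord_recr /=; apply: (le_trans (ler_normD _ _)).
 have h4 : `|(-1) ^+ m * (cw N m * q N m - cw N m.+1 * q N m.+1)| <= cw N m * F N m + C * (cw N m - cw N m.+1).
  rewrite normrM normrX normrN1 expr1n mul1r /F mN.
  have -> : cw N m * q N m - cw N m.+1 * q N m.+1 = cw N m * (q N m - q N m.+1) + (cw N m - cw N m.+1) * q N m.+1 by ring.
  apply: (le_trans (ler_normD _ _)); rewrite [X in X + _]normrM [X in _ + X]normrM (ger0_norm (cw0 m)) lerD2l.
  by rewrite ger0_norm ?subr_ge0// mulrC ler_wpM2r ?subr_ge0// hb.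
 by have := lerD (IH (ltnW mN)) h4; move/le_trans; apply; apply: le_of_eq; ring.
have := alt_sum N./2 (fun a => cw N a * q N a) => e2.
set S := \sum_(a < _) _ in e2 *.
have : `|2 * S| <= \sum_(a < N./2) cw N a * F N a + 2 * (C * cw N 0).
 rewrite e2; apply: (le_trans (ler_normB _ _)).
 apply: (@le_trans _ _ ((\sum_(a < N./2) cw N a * F N a + C * (cw N 0 - cw N N./2)) + cw N 0 * C + cw N N./2 * C)).
  apply: lerD; last by rewrite normrM normrX normrN1 expr1n mul1r normrM (ger0_norm (cw0 _)) ler_wpM2l// hb.
  apply: (le_trans (ler_normD _ _)); apply: lerD; first exact: tel.
  by rewrite normrM (ger0_norm (cw0 _)) ler_wpM2l// hb.
 by apply: le_of_eq; ring.
rewrite normrM ger0_norm// sub0r normrN => h5; have := le_trans (ler_norm _) h3 => h6; have := normr_ge0 S; lra.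
Unshelve. all: end_near.
Qed.
End RiemSum.

(* Limits of the normalised basis functions *)
Opaque TT.
Section Families.
Variable R : realType.
Local Notation idx := (@idx R).
Local Notation ncvg := (@ncvg R).
Local Notation TT := (TT R).
Implicit Types (F : nat -> nat -> R) (Phi : R -> R) (l x sg : R).

Lemma cvg_inv_TTD sg : (fun N => (TT N + sg)^-1) @ \oo --> (0 : R).
apply/cvgrPdist_lt => e e0; near=> N; have h : e^-1 < TT N + sg by rewrite -ltrBlDr; near: N; exact: near_TT.
have h0 : 0 < TT N + sg by apply: lt_trans h; rewrite invr_gt0.
by rewrite sub0r normrN normfV gtr0_norm// invf_plt ?posrE.
Unshelve. all: end_near.
Qed.

Definition rt sg N : R := TT N / (TT N + sg).

Lemma near_TTD sg : \forall N \near \oo, 0 < TT N + sg /\ 0 < TT N - sg.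
near=> N; have h : `|sg| < TT N by near: N; exact: near_TT.
have := ler_norm sg; have := ler_norm (- sg); rewrite normrN => h1 h2; split; lra.
Unshelve. all: end_near.
Qed.

Lemma cvg_rt sg : rt sg @ \oo --> (1 : R).
have h : (fun N => 1 - sg * (TT N + sg)^-1) @ \oo --> (1 : R).
 rewrite -[X in _ --> X]subr0 -(mulr0 sg); apply: cvgB; first exact: cvg_cst.
 by apply: cvgM; [exact: cvg_cst|exact: cvg_inv_TTD].
apply: (cvg_eq_near h) => {h}; near=> N; have [h _] : 0 < TT N + sg /\ 0 < TT N - sg by near: N; exact: near_TTD.
by rewrite /rt; field; rewrite gt_eqF.
Unshelve. all: end_near.
Qed.

Lemma ncvg_aT : ncvg (fun N a => a%:R / TT N) (fun l => l ^+ 2 / 4).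
split; last by move=> a l [].
exists 1; near=> N => a aN; have T0 : 0 < TT N by near: N; exact: near_TT.
have [h _] := half_TT R N; rewrite ger0_norm ?divr_ge0 ?(ltW T0)// ler_pdivrMr// mul1r.
by apply: (le_trans (_ : _ <= (N./2)%:R)); [rewrite ler_nat|lra].
Unshelve. all: end_near.
Qed.

(** What the base of the power in [yp_explicit] becomes after division by that of the mass [mj]. *)
Definition theta sg N : R := (TT N - sg) / (TT N + sg).

(** Both bounds are 1 + x <= exp x, applied to [theta] and to its inverse. *)
Lemma theta_sandwich sg N a : 0 < TT N + sg -> 0 < TT N - sg ->
 expR (- (2 * sg * (a%:R / TT N * rt (- sg) N))) <= theta sg N ^+ a <= expR (- (2 * sg * (a%:R / TT N * rt sg N))).
move=> h1 h2; have T0 : 0 < TT N by lra.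
have p1 : TT N + sg != 0 by rewrite gt_eqF.
have p2 : TT N - sg != 0 by rewrite gt_eqF.
have p3 : TT N != 0 by rewrite gt_eqF.
have t0 : 0 < theta sg N by rewrite divr_gt0.
have -> : - (2 * sg * (a%:R / TT N * rt (- sg) N)) = a%:R * - (2 * sg / (TT N - sg)) by rewrite /rt; field; rewrite p2 p3.
have -> : - (2 * sg * (a%:R / TT N * rt sg N)) = a%:R * - (2 * sg / (TT N + sg)) by rewrite /rt; field; rewrite p1 p3.
rewrite !expRM_natl !lerXn2r ?nnegrE ?expR_ge0 ?(ltW t0)//.
 rewrite (le_trans _ (expR_ge1Dx _))// /theta; suff -> : (TT N - sg) / (TT N + sg) = 1 - 2 * sg / (TT N + sg) by [].
 by field.
rewrite expRN -[theta sg N]invrK lef_pV2 ?posrE ?invr_gt0 ?expR_gt0// (le_trans _ (expR_ge1Dx _))//.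
suff -> : (theta sg N)^-1 = 1 + 2 * sg / (TT N - sg) by [].
by rewrite /theta; field; rewrite p1 p2.
Qed.

Lemma ncvg_theta sg : ncvg (fun N a => theta sg N ^+ a) (fun l => expR (- (sg * l ^+ 2 / 2))).
split.
 have [C hC] := (ncvg_mul ncvg_aT (ncvg_cst (cvg_rt sg))).1.
 exists (expR (2 * `|sg| * C)); near=> N => a aN.
 have [h1 h2] : 0 < TT N + sg /\ 0 < TT N - sg by near: N; exact: near_TTD.
 have /andP[_ h] := theta_sandwich a h1 h2.
 have hb : forall a, (a <= N./2)%N -> `|a%:R / TT N * rt sg N| <= C by near: N.
 rewrite ger0_norm ?exprn_ge0 ?divr_ge0 ?(ltW h1) ?(ltW h2)// (le_trans h)// ler_expR.
 apply: (le_trans (ler_norm _)); rewrite normrN normrM; apply: ler_pM => //; last exact: hb.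
 by rewrite normrM ger0_norm.
move=> a l [ha hl].
have lim s' : (fun N => expR (- (2 * sg * ((a N)%:R / TT N * rt s' N)))) @ \oo --> expR (- (sg * l ^+ 2 / 2)).
 apply: (@cvg_comp _ _ _ (fun N => - (2 * sg * ((a N)%:R / TT N * rt s' N))) expR _ (nbhs (- (sg * l ^+ 2 / 2)))); last exact: continuous_expR.
 have -> : - (sg * l ^+ 2 / 2) = - (2 * sg * (l ^+ 2 / 4 * 1)) by field.
 apply: cvgN; apply: cvgM; first exact: cvg_cst.
 by apply: cvgM => //; exact: cvg_rt.
apply: (squeeze_cvgr _ (lim (- sg)) (lim sg)).
near=> N; have [h1 h2] : 0 < TT N + sg /\ 0 < TT N - sg by near: N; exact: near_TTD.
exact: theta_sandwich.
Unshelve. all: end_near.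
Qed.

Lemma sq4_ge0 x (c : R) : 0 <= c -> 0 <= 4 * x ^+ 2 * c.
by move=> c0; apply: mulr_ge0 => //; apply: mulr_ge0 => //; exact: sqr_ge0. Qed.
(** The argument of the hypergeometric sums at time T + sg. The absolute value is harmless for large
    N and gives the nonnegativity for all N that [cvg_Ca] asks for. *)
Definition zz sg x N : R := `|4 * x ^+ 2 * rt sg N / (TT N - sg)|.

Lemma cvg_zz sg x : zz sg x @ \oo --> (0 : R).
rewrite -(normr0 R); apply: cvg_norm; rewrite -(mulr0 (4 * x ^+ 2 * 1)).
by apply: cvgM; [apply: cvgM; [exact: cvg_cst|exact: cvg_rt]|exact: cvg_inv_TTD].
Qed.

Lemma a_zz sg x N (a : nat) : 0 < TT N -> a%:R * zz sg x N = 4 * x ^+ 2 * (a%:R / TT N) * `|rt sg N * rt (- sg) N|.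
move=> T0; have a0 : 0 <= 4 * x ^+ 2 * (a%:R / TT N) by apply: sq4_ge0; apply: divr_ge0 => //; exact: ltW.
rewrite -[in RHS](ger0_norm a0) -normrM -[in LHS](ger0_norm (ler0n R a)) -normrM; congr `|_|.
rewrite /rt; have gen (A X r T d : R) : T != 0 -> A * (4 * X * r * d) = 4 * X * (A / T) * (r * (T * d)) by move=> h; field.
by apply: gen; rewrite gt_eqF.
Qed.

Lemma cvg_a_zz sg x a l : idx a l -> (fun N => (a N)%:R * zz sg x N) @ \oo --> (l * x) ^+ 2.
move=> [ha hl].
have h : (fun N => 4 * x ^+ 2 * ((a N)%:R / TT N) * `|rt sg N * rt (- sg) N|) @ \oo --> (l * x) ^+ 2.
 have -> : (l * x) ^+ 2 = 4 * x ^+ 2 * (l ^+ 2 / 4) * `|1 * 1| by rewrite mulr1 normr1; field.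
 apply: cvgM; first by apply: cvgM => //; exact: cvg_cst.
 by apply: cvg_norm; apply: cvgM; exact: cvg_rt.
apply: (cvg_eq_near h) => {h}; near=> N; rewrite a_zz//; near: N; exact: near_TT.
Unshelve. all: end_near.
Qed.

Lemma a_zz_bound sg : \forall N \near \oo, forall a x, (a <= N./2)%N -> a%:R * zz sg x N <= 2 * x ^+ 2.
have h : (fun N => `|rt sg N * rt (- sg) N|) @ \oo --> `|1 * 1 : R| by apply: cvg_norm; apply: cvgM; exact: cvg_rt.
near=> N => a x aN; have T0 : 0 < TT N by near: N; exact: near_TT.
have h2 : `|rt sg N * rt (- sg) N| <= 2.
 have : `| `|1 * 1| - `|rt sg N * rt (- sg) N| | < 1 by near: N; have /cvgrPdist_lt := h; apply.
 by rewrite mulr1 normr1 ltr_norml => /andP[k1 k2]; lra.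
rewrite a_zz//; have [hT _] := half_TT R N.
have h3 : 4 * (a%:R / TT N) <= 1.
 by rewrite mulrA ler_pdivrMr// mul1r; have : a%:R <= (N./2)%:R :> R by [rewrite ler_nat]; lra.
rewrite mulrC; apply: ler_pM => //.
- by apply: sq4_ge0; apply: divr_ge0 => //; exact: ltW.
by rewrite mulrAC ler_piMl ?sqr_ge0.
Unshelve. all: end_near.
Qed.

Lemma ncvg_Ca sg x : ncvg (fun N a => Ca a (zz sg x N)) (fun l => cos (l * x)).
split.
 exists (expR (2 * x ^+ 2)); have := a_zz_bound sg; apply: filterS => N h a aN; apply: (Fa_bound leq_double); [exact: normr_ge0|exact: h].
by move=> a l i; apply: cvg_Ca => //; [move=> N; exact: normr_ge0|exact: cvg_a_zz|exact: cvg_zz].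
Qed.

Lemma ncvg_Da sg x : ncvg (fun N a => Da a (zz sg x N)) (fun l => dsin ((l * x) ^+ 2)).
split.
 exists (expR (2 * x ^+ 2)); have := a_zz_bound sg; apply: filterS => N h a aN; apply: (Fa_bound leq_doubleS); [exact: normr_ge0|exact: h].
by move=> a l i; apply: cvg_Da => //; [move=> N; exact: normr_ge0|exact: cvg_a_zz|exact: cvg_zz].
Qed.

Lemma ncvg_pred F Phi : ncvg F Phi -> ncvg (fun N a => F N a.-1) Phi.
move=> [[C bF] cF]; split.
 by exists C; apply: filterS bF => N h a aN; apply: h; exact: leq_trans (leq_pred _) aN.
move=> a l i; apply: (cF (fun N => (a N).-1)); have [ha _] := i; apply: (idx_shift i) => N.
 by apply: leq_trans (ha N); exact: leq_pred.
by split; lia.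
Qed.

Definition Gr sg x N : R := ga (TT N + sg) x / ga (TT N) 0.

Lemma GrE sg x N : 0 < TT N -> 0 < TT N + sg -> Gr sg x N = sqrt (rt sg N) * expR (- x ^+ 2 / 2 * (TT N + sg)^-1).
move=> T0 t0; have p0 := pi_gt0 R; have t20 : 0 < 2 * pi * (TT N + sg) by apply: mulr_gt0 => //; apply: mulr_gt0.
have T20 : 0 < 2 * pi * TT N by apply: mulr_gt0 => //; apply: mulr_gt0.
rewrite /Gr /ga !powRN !powR12_sqrt ?ltW// expr0n oppr0 mul0r expR0 mulr1 invrK.
have -> : - x ^+ 2 / 2 * (TT N + sg)^-1 = - x ^+ 2 / (2 * (TT N + sg)) by rewrite invfM; ring.
rewrite mulrAC; congr (_ * _); rewrite -sqrtrV ?ltW// -sqrtrM ?invr_ge0 ?ltW//; congr sqrt.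
have gen (p T t : R) : p != 0 -> t != 0 -> (2 * p * t)^-1 * (2 * p * T) = T / t by move=> k1 k2; field; rewrite k1 k2.
by rewrite gen ?gt_eqF.
Qed.

Lemma cvg_Gr sg x : Gr sg x @ \oo --> (1 : R).
have h : (fun N => sqrt (rt sg N) * expR (- x ^+ 2 / 2 * (TT N + sg)^-1)) @ \oo --> (1 : R).
 have e : sqrt 1 * expR (- x ^+ 2 / 2 * 0) = 1 by rewrite sqrtr1 mulr0 expR0 mulr1.
 rewrite -[X in _ --> X]e.
 apply: cvgM.
  by apply: (@cvg_comp _ _ _ (rt sg) sqrt _ (nbhs (1 : R)) _ (cvg_rt sg)); exact: sqrt_continuous.
 apply: (@cvg_comp _ _ _ (fun N => - x ^+ 2 / 2 * (TT N + sg)^-1) expR _ (nbhs (- x ^+ 2 / 2 * 0))); last exact: continuous_expR.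
 by apply: cvgM; [exact: cvg_cst|exact: cvg_inv_TTD].
apply: (cvg_eq_near h) => {h}; near=> N; have [h1 h2] : 0 < TT N + sg /\ 0 < TT N - sg by near: N; exact: near_TTD.
by rewrite GrE//; lra.
Unshelve. all: end_near.
Qed.

Lemma Gr_bound sg : \forall N \near \oo, forall x, `|Gr sg x N| <= 2.
near=> N => x; have [h1 h2] : 0 < TT N + sg /\ 0 < TT N - sg by near: N; exact: near_TTD.
have h : `|1 - rt sg N| < 1 by near: N; have /cvgrPdist_lt := @cvg_rt sg; apply.
rewrite GrE//; last by lra.
rewrite ger0_norm ?mulr_ge0 ?sqrtr_ge0 ?expR_ge0// -[leRHS]mulr1; apply: ler_pM; rewrite ?sqrtr_ge0 ?expR_ge0//.
 have -> : 2 = sqrt (2 ^+ 2) :> R by rewrite sqrtr_sqr ger0_norm.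
 by apply: ler_wsqrtr; move: h; rewrite ltr_norml => /andP[k1 k2]; rewrite expr2; lra.
rewrite -expR0 ler_expR mulNr mulNr oppr_le0; apply: mulr_ge0; [apply: divr_ge0 => //; exact: sqr_ge0|by rewrite invr_ge0 ltW].
Unshelve. all: end_near.
Qed.

(** Removes the alternating sign, the mass and the height of the Gaussian, so that what is left
    converges. *)
Definition sc (N a : nat) : R := (-1) ^+ a / (mj (TT N) a * ga (TT N) 0).
Definition fv sg x N a : R := sc N a * gj (TT N) (TT N + sg) a.*2 x.
Definition fd sg x N a : R := sc N a * dgj (TT N) (TT N + sg) a.*2 x.
Definition fp sg x N a : R := sc N a * prim (gj (TT N) (TT N + sg) a.*2) x.
Lemma mjE (T : R) a : mj T a = (2 * T) ^+ a * dfac R a.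
by elim: a => [|a IH]; rewrite /mj /dfac ?big_ord0 ?mulr1// !big_ord_recr /= -/(mj T a) IH exprS /dfac; ring. Qed.
Lemma dfac_neq0 a : dfac R a != 0.
by apply/prodf_neq0 => i _; rewrite pnatr_eq0. Qed.

Lemma zz_explicit sg x N : 0 < TT N + sg -> 0 < TT N - sg ->
 2 * (2 * TT N / (TT N + sg)) * x ^+ 2 / (2 * TT N - (TT N + sg)) = zz sg x N.
move=> h1 h2; have T0 : 0 < TT N by lra.
rewrite /zz ger0_norm; first by rewrite /rt opprD addrA (_ : 2 * TT N - TT N = TT N); ring.
by apply: divr_ge0; [apply: sq4_ge0; apply: divr_ge0; exact: ltW|exact: ltW].
Qed.

Lemma theta_explicit sg N k : 0 < TT N + sg -> 0 < TT N - sg ->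
 theta sg N ^+ k = (2 * TT N / (TT N + sg) * (2 * TT N - (TT N + sg))) ^+ k / (2 * TT N) ^+ k.
move=> h1 h2; have T0 : 0 < TT N by lra.
rewrite -expr_div_n; congr (_ ^+ k); rewrite /theta; field; rewrite !gt_eqF//.
Qed.

Lemma fvE sg x N a : 0 < TT N + sg -> 0 < TT N - sg -> fv sg x N a = Gr sg x N * (theta sg N ^+ a * Ca a (zz sg x N)).
move=> h1 h2; have T0 : 0 < TT N by lra.
have t2 : TT N + sg < 2 * TT N by lra.
have [+ _] := yp_explicit x a h1 t2; rewrite /fv /gj /sc /Gr => ->; rewrite mjE.
rewrite zz_explicit// theta_explicit//.
have g0 : ga (TT N) 0 != 0 by rewrite gt_eqF ?ga_gt0.
have e0 : (2 * TT N) ^+ a != 0 by rewrite expf_neq0// mulf_neq0 ?gt_eqF.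
have d0 := dfac_neq0 a; have s2 : (-1) ^+ a * (-1) ^+ a = 1 :> R by rewrite -exprMn mulrNN mulr1 expr1n.
have gen (s D c C E g g' : R) : s * s = 1 -> E != 0 -> D != 0 -> g' != 0 ->
 s / (E * D * g') * (s * D * c * C * g) = g / g' * (c / E * C).
 move=> ss k1 k2 k3; transitivity (s * s * (g / g' * (c / E * C))); last by rewrite ss mul1r.
 by field; rewrite k1 k2 k3.
exact: gen.
Qed.

Lemma ncvg_fv sg x : ncvg (fv sg x) (fun l => cos (l * x) * expR (- (sg * l ^+ 2 / 2))).
apply: (ncvg_ext (ncvg_mul (ncvg_cst (cvg_Gr sg x)) (ncvg_mul (ncvg_theta sg) (ncvg_Ca sg x)))).
 by have := near_TTD sg; apply: filterS => N [h1 h2] a _; rewrite fvE.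
by move=> l; ring.
Qed.

Lemma fdE sg x N a : 0 < TT N + sg -> 0 < TT N - sg ->
 fd sg x N a = - (x * Gr sg x N) * (theta sg N ^+ a * ((2 * (a%:R / TT N) + (TT N)^-1) * rt sg N * Da a (zz sg x N)
   + 2 * (a%:R / TT N) * rt (- sg) N * Da a.-1 (zz sg x N))).
move=> h1 h2; have T0 : 0 < TT N by lra.
have t2 : TT N + sg < 2 * TT N by lra.
rewrite /fd /dgj /gj /sc /Gr mjE.
have zE := zz_explicit x h1 h2.
have [_ ->] := yp_explicit x a h1 t2; rewrite zE.
have tE k := theta_explicit k h1 h2.
have g0 : ga (TT N) 0 != 0 by rewrite gt_eqF ?ga_gt0.
have e0 k : (2 * TT N) ^+ k != 0 by rewrite expf_neq0// mulf_neq0 ?gt_eqF.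
have d0 := dfac_neq0; have s2 k : (-1) ^+ k * (-1) ^+ k = 1 :> R by rewrite -exprMn mulrNN mulr1 expr1n.
have dS := @dfacS R.
have p1 : TT N + sg != 0 by rewrite gt_eqF.
have p2 : TT N - sg != 0 by rewrite gt_eqF.
have p3 : TT N != 0 by rewrite gt_eqF.
have gen1 (s D k c C E g g' T r : R) : s * s = 1 -> E != 0 -> D != 0 -> g' != 0 -> T != 0 ->
 s / (E * D * g') * (-1 * s * (D * (2 * k + 1)) * (2 * T * r) * c * x * C * g / (2 * T)) =
 - (x * (g / g')) * (c / E * ((2 * (k / T) + T^-1) * (T * r) * C)).
 move=> ss k1 k2 k3 k4; transitivity (s * s * (- (x * (g / g')) * (c / E * ((2 * (k / T) + T^-1) * (T * r) * C)))); last by rewrite ss mul1r.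
 by field; rewrite k1 k2 k3 k4.
have A1 := gen1 _ _ a%:R ((2 * TT N / (TT N + sg) * (2 * TT N - (TT N + sg))) ^+ a) (Da a (zz sg x N)) _
 (ga (TT N + sg) x) _ _ (TT N + sg)^-1 (s2 a) (e0 a) (d0 a) g0 p3.
rewrite mulrBr [(-1) ^+ a.+1]exprS dS mulrAC -[_ * _ * x]mulrA -[in LHS]mulrA.
rewrite [X in X - _ = _](_ : _ = - (x * (ga (TT N + sg) x / ga (TT N) 0)) * (theta sg N ^+ a * ((2 * (a%:R / TT N) + (TT N)^-1) * rt sg N * Da a (zz sg x N)))); last first.
 by rewrite tE /rt -A1; ring.
rewrite [RHS]mulrA [in RHS]mulrDr -[in X in _ = X + _]mulrA; congr (_ + _).
case: a {A1} => [|b]; first by rewrite double0 !(mul0r, mulr0) oppr0.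
have [_ hb] := yp_explicit x b h1 t2; rewrite doubleS /= hb zE.
have gen2 (s D k c C E g g' T t d : R) : s * s = 1 -> E != 0 -> D != 0 -> g' != 0 -> T != 0 -> d != 0 ->  t != 0 ->
 - (s / (2 * T * E * D * g') * (2 * k * (s * D * (2 * T / t) * c * x * C * g))) =
 - (x * (g / g')) * ((2 * T / t * d * c) / (2 * T * E)) * (2 * (k / T) * (T / d) * C).
 move=> ss k1 k2 k3 k4 k5 k6; transitivity (- (s * s * ((x * (g / g')) * ((2 * T / t * d * c) / (2 * T * E)) * (2 * (k / T) * (T / d) * C)))); last by rewrite ss mul1r !mulNr.
 by field; rewrite k1 k2 k3 k4 k5 k6.
have A2 := gen2 _ _ b.+1%:R ((2 * TT N / (TT N + sg) * (2 * TT N - (TT N + sg))) ^+ b) (Da b (zz sg x N)) _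
 (ga (TT N + sg) x) _ _ (TT N + sg) (TT N - sg) (s2 b.+1) (e0 b) (d0 b.+1) g0 p3 p2 p1.
have -> : (b.*2.+2)%:R = 2 * b.+1%:R :> R by rewrite -doubleS -mul2n natrM.
rewrite tE !exprS -(exprS (-1)) /rt; apply: etrans A2 _.
have -> : 2 * TT N - (TT N + sg) = TT N - sg by ring.
by ring.
Qed.

(** In the limit the two neighbours in [dgj] contribute l^2 / 2 each, and l^2 x dsin ((l x)^2) = l
    sin (l x). *)
Lemma ncvg_fd sg x : ncvg (fd sg x) (fun l => - (l * sin (l * x)) * expR (- (sg * l ^+ 2 / 2))).
have n2 : ncvg (fun N a => 2 * (a%:R / TT N)) (fun l => 2 * (l ^+ 2 / 4)).
 by apply: (@ncvg_mul R (fun _ _ => 2) _ (fun _ => 2) _ (ncvg_cst (@cvg_cst _ (2 : R) _ \oo _)) ncvg_aT).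
have nx : ncvg (fun N a => - (x * Gr sg x N)) (fun l => - (x * 1)).
 by apply: ncvg_cst; apply: cvgN; apply: cvgM; [exact: cvg_cst|exact: cvg_Gr].
have nA := ncvg_mul (ncvg_mul (ncvg_add n2 (ncvg_cst (@cvg_inv_TT R))) (ncvg_cst (cvg_rt sg))) (ncvg_Da sg x).
have nB := ncvg_mul (ncvg_mul n2 (ncvg_cst (cvg_rt (- sg)))) (ncvg_pred (ncvg_Da sg x)).
apply: (ncvg_ext (ncvg_mul nx (ncvg_mul (ncvg_theta sg) (ncvg_add nA nB)))).
 by have := near_TTD sg; apply: filterS => N [h1 h2] a _; rewrite fdE.
by move=> l /=; rewrite -dsinE; field.
Qed.
End Families.

(** * Limits of the primitives of the basis functions *)

Section Primitive.
Variable R : realType.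
Local Notation leb := (@lebesgue_measure R).
Local Notation idx := (@idx R).
Local Notation ncvg := (@ncvg R).
Local Notation TT := (TT R).
Implicit Types (l x sg : R).

(** Uniformity in the point [u] allows dominated convergence under the primitive. *)
Lemma fv_bound sg x : exists C, \forall N \near \oo, forall a u, (a <= N./2)%N -> `|u| <= `|x| -> `|fv sg u N a| <= C.
have [[C1 h1] _] := ncvg_theta sg.
exists (2 * (C1 * expR (2 * x ^+ 2))); near=> N => a u aN ux.
have [p1 p2] : 0 < TT N + sg /\ 0 < TT N - sg by near: N; exact: near_TTD.
have hG : forall x, `|Gr sg x N| <= 2 by near: N; exact: Gr_bound.
have hT : forall a, (a <= N./2)%N -> `|theta sg N ^+ a| <= C1 by near: N.
have hz : forall a x, (a <= N./2)%N -> a%:R * zz sg x N <= 2 * x ^+ 2 by near: N; exact: a_zz_bound.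
rewrite fvE// normrM; apply: ler_pM => //; rewrite normrM; apply: ler_pM => //; first exact: hT.
apply: (Fa_bound leq_double); first exact: normr_ge0.
apply: (le_trans (hz a u aN)); rewrite ler_wpM2l//.
by rewrite -(real_normK (num_real u)) -(real_normK (num_real x)) lerXn2r ?nnegrE.
Unshelve. all: end_near.
Qed.

(** The primitive at [x] of the function cos (l u) of u; the value at l = 0 makes it continuous in
    l. *)
Definition sinc x l : R := if l == 0 then x else sin (l * x) / l.
Lemma sincN x l : sinc (- x) l = - sinc x l.
by rewrite /sinc; case: eqP => // _; rewrite mulrN sinN mulNr. Qed.

Lemma is_derive_sinM (c u : R) : is_derive u (1 : R) (fun u => sin (c * u)) (c * cos (c * u)).
have d := @is_derive1_comp R sin ( *%R c) u (cos (c * u)) c (is_derive_sin (c * u)) _.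
rewrite mulrC; apply: d; have h := is_deriveZ c (is_derive_id u (1 : R)).
by apply: (is_derive_eq h); rewrite /GRing.scale /= mulr1.
Qed.

Lemma is_derive_cosM (c u : R) : is_derive u (1 : R) (fun u => cos (c * u)) (- (c * sin (c * u))).
have d := @is_derive1_comp R cos ( *%R c) u (- sin (c * u)) c (is_derive_cos (c * u)) _.
rewrite mulrC -mulNr; apply: d; have h := is_deriveZ c (is_derive_id u (1 : R)).
by apply: (is_derive_eq h); rewrite /GRing.scale /= mulr1.
Qed.

Lemma continuous_cosM (c : R) : continuous (fun u => cos (c * u)).
by apply: der_continuous => u; exact: is_derive_cosM. Qed.
Lemma continuous_cosMr (c : R) : continuous (fun u : R => cos (u * c)).
by rewrite (_ : (fun u => _) = (fun u => cos (c * u))); [exact: continuous_cosM|apply/funext => u; rewrite mulrC]. Qed.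
Lemma continuous_sinM (c : R) : continuous (fun u => sin (c * u)).
by apply: der_continuous => u; exact: is_derive_sinM. Qed.

Lemma prim_cos l x : prim (fun u => cos (l * u)) x = sinc x l.
rewrite /sinc; have [->|l0] := eqVneq l 0.
 rewrite (_ : (fun u => cos (0 * u)) = fun=> 1); last by apply/funext => u; rewrite mul0r cos0.
 by rewrite (@primE _ _ id) ?subr0// => u; exact: cst_continuous.
have d (u : R) : is_derive u (1 : R) (fun u => l^-1 * sin (l * u)) (cos (l * u)).
 have h := is_deriveZ l^-1 (is_derive_sinM l u); apply: (is_derive_eq h).
 by rewrite /GRing.scale /= mulKf.
by rewrite (primE x (@continuous_cosM l) d) mulr0 sin0 mulr0 subr0 mulrC.
Qed.

Lemma continuous_sinc x : continuous (sinc x).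
move=> l; have [->|l0] := eqVneq l 0.
 apply/continuous_withinNx; rewrite {2}/sinc eqxx.
 (* Continuity at l = 0 is differentiability of sin (x l) there. *)
 have [d dv] := is_derive_sinM x 0.
 have h : (fun h : R => h^-1 *: (sin (x * (h *: (1 : R) + 0)) - sin (x * 0))) @ 0^' --> 'D_(1 : R) (fun u => sin (x * u)) (0 : R) by exact: d.
 rewrite dv mulr0 cos0 mulr1 in h; apply: (cvg_eq_near h) => {h}; near=> k.
 rewrite /sinc ifN; last by near: k; exact: nbhs_dnbhs_neq.
 by rewrite sin0 subr0 addr0 /GRing.scale /= mulr1 mulrC [k * x]mulrC.
have h : (fun k : R => sin (k * x) / k) @ l --> sin (l * x) / l.
 apply: cvgM; last by apply: cvgV => //; exact: cvg_id.
 rewrite [l * x]mulrC; have -> : (fun k : R => sin (k * x)) = (fun k => sin (x * k)) by apply/funext => k; rewrite mulrC.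
 exact: continuous_sinM.
rewrite /continuous_at {2}/sinc (negbTE l0); apply: (cvg_eq_near h) => {h}; near=> k; rewrite /sinc ifN//; near: k.
exact: open_neq.
Unshelve. all: end_near.
Qed.

Lemma ncvg_int sg x : 0 <= x ->
 ncvg (fun N a => Rintegral leb `[0, x] (fun u => fv sg u N a)) (fun l => sinc x l * expR (- (sg * l ^+ 2 / 2))).
move=> x0; have [C hC] := fv_bound sg x.
have [N0 _ hN] := filterI hC (near_TTD sg).
pose I := (\1_(`[0, x]%classic : set R) : R -> R).
have cfv N a : (N0 <= N)%N -> continuous (fun u => fv sg u N a).
 move=> NN u; have [_ [p1 p2]] := hN N NN; apply: cvgM; [exact: cvg_cst|exact: continuous_gj].
have bp N a u : (N0 <= N)%N -> (a <= N./2)%N -> `|((fun u => fv sg u N a) \_ `[0, x]%classic) u| <= C * I u.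
 move=> NN aN; have [hb _] := hN N NN; rewrite /patch /I indicE mem_setE.
 case: ifPn => ux; last by rewrite normr0 mulr0.
 rewrite mulr1; apply: hb => //; move: ux; rewrite in_itv /= => /andP[u0 ux].
 by rewrite !ger0_norm// (le_trans u0).
have mI : itg (fun u => C * I u) by apply/itgZ/itg_indic.
have mp N a : (N0 <= N)%N -> mfunT ((fun u => fv sg u N a) \_ `[0, x]%classic).
 by move=> NN; apply: measurable_patch => //; apply: continuous_mfun; exact: cfv.
split.
 exists (Ri (fun u => C * I u)); exists N0 => // N NN a aN.
 rewrite Rint_Ri; have ip := itg_dom (mp N a NN) mI (fun u => bp N a u NN aN).
 by apply: (le_trans (Ri_norm ip)); apply: Ri_le => //; [exact: itg_abs|move=> u; exact: bp].
move=> a l ia; have [ha _] := ia.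
pose u N v := if (N0 <= N)%N then ((fun u => fv sg u N (a N)) \_ `[0, x]%classic) v else 0.
pose f := (fun u => cos (l * u) * expR (- (sg * l ^+ 2 / 2))) \_ `[0, x]%classic.
have cf : continuous (fun u => cos (l * u) * expR (- (sg * l ^+ 2 / 2))).
 by move=> v; apply: cvgM; [exact: continuous_cosM|exact: cvg_cst].
have fE : Ri f = sinc x l * expR (- (sg * l ^+ 2 / 2)).
 rewrite /f -Rint_Ri RintegralZr//; last by apply: continuous_itg_itv; exact: continuous_cosM.
 by rewrite -prim_cos /prim x0.
rewrite -fE; have lim : (fun N => Ri (u N)) @ \oo --> Ri f.
 apply: (@Ri_dct R u f (fun v => C * I v)) => //.
 - by move=> N; rewrite /u; case: leqP => NN; [exact: mp|exact: measurable_cst].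
 - by apply: measurable_patch => //; exact: continuous_mfun.
 - move=> v; have h : (fun N => ((fun u => fv sg u N (a N)) \_ `[0, x]%classic) v) @ \oo --> f v.
   rewrite /f /patch; case: ifP => _; last exact: cvg_cst.
   by have [_] := ncvg_fv sg v; apply.
  apply: (cvg_eq_near h) => {h}; near=> N; have NN : (N0 <= N)%N by near: N; exact: nbhs_infty_ge.
  by rewrite /u NN.
 move=> N v; rewrite /u; case: leqP => NN; first by apply: bp => //.
 by rewrite normr0; apply: le_trans (normr_ge0 _) (bp N0 0%N v (leqnn _) (leq0n _)).
apply: (cvg_eq_near lim) => {lim}; near=> N; have NN : (N0 <= N)%N by near: N; exact: nbhs_infty_ge.
by rewrite /u NN -Rint_Ri.
Unshelve. all: end_near.
Qed.

Lemma ncvg_fp sg x : ncvg (fp sg x) (fun l => sinc x l * expR (- (sg * l ^+ 2 / 2))).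
have pos y : 0 <= y -> ncvg (fp sg y) (fun l => sinc y l * expR (- (sg * l ^+ 2 / 2))).
 move=> y0; apply: (ncvg_ext (ncvg_int sg y0)) => //; have := near_TTD sg; apply: filterS => N [h1 h2] a _.
 rewrite /fp /prim y0 -RintegralZl//; exact/continuous_itg_itv/continuous_gj.
have [x0|x0] := leP 0 x; first exact: pos.
have n0 : 0 <= - x by rewrite oppr_ge0 ltW.
have c1 : (fun _ : nat => -1 : R) @ \oo --> (-1 : R) by exact: cvg_cst.
apply: (ncvg_ext (ncvg_mul (ncvg_cst c1) (pos _ n0))); last by move=> l; rewrite sincN; ring.
have := near_TTD sg; apply: filterS => N [h1 h2] a _; rewrite /fp.
rewrite primN; [ring|exact: continuous_gj|].
by move=> v; rewrite gjN -signr_odd odd_double expr0 mul1r.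
Qed.
End Primitive.

(** * The common form of the kernel sums and its limit *)

Section MainSum.
Variable R : realType.
Local Notation ncvg := (@ncvg R).
Local Notation TT := (TT R).
Local Notation cw := (@cw R).
Implicit Types (Phi : R -> R) (l : R).

Lemma wal_dfac a : (a.*2)`!%:R * wal R a = dfac R a ^+ 2.
elim: a => [|a IH]; first by rewrite /wal /dfac !big_ord0 mulr1 expr1n.
have dS := @dfacS R.
have e1 := natr_double1 R a.
have e2 := natr_double2 R a.
have p2 : 2 * a%:R + 2 != 0 :> R by rewrite -e2 pnatr_eq0.
rewrite doubleS !factS !natrM e1 e2 walS dS exprMn -IH; field; exact: p2.
Qed.

Lemma ga0E (t : R) : 0 < t -> ga t 0 = (sqrt (2 * pi * t))^-1.
move=> t0; have p0 := pi_gt0 R.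
by rewrite /ga expr0n oppr0 mul0r expR0 mulr1 powRN powR12_sqrt// ltW//; apply: mulr_gt0 => //; apply: mulr_gt0.
Qed.

Lemma sc_cw N a : 0 < TT N -> (hj (TT N) a)^-1 * ((mj (TT N) a * ga (TT N) 0) ^+ 2) = cw N a.
move=> T0; have p0 := pi_gt0 R; have T20 : 0 < 2 * TT N by apply: mulr_gt0.
have pT : 0 < pi * TT N by apply: mulr_gt0.
rewrite /hj mjE !ga0E// /cw.
have -> : 2 * pi * (2 * TT N) = 2 ^+ 2 * (pi * TT N) by ring.
rewrite sqrtrM ?exprn_ge0// sqrtr_sqr ger0_norm// expr_div_n.
have e2 : sqrt (2 * pi * TT N) ^+ 2 = 2 * (pi * TT N) .
 rewrite sqr_sqrtr; first by ring.
 by rewrite ltW// -mulrA; apply: mulr_gt0.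
have S0 : sqrt (pi * TT N) != 0 by rewrite gt_eqF// sqrtr_gt0.
rewrite e2; move: (sqr_sqrtr (ltW pT)) S0; move: (sqrt (pi * TT N)) => S <- S0.
have -> : (2 * TT N) ^+ a.*2 = ((2 * TT N) ^+ a) ^+ 2 by rewrite -exprM muln2.
have f0 : (a.*2)`!%:R != 0 :> R by rewrite pnatr_eq0 -lt0n fact_gt0.
have x0 : (2 * TT N) ^+ a != 0 by rewrite expf_neq0// gt_eqF.
move: S0 f0 x0; set X := (2 * TT N) ^+ a => S0 f0 x0; rewrite [(X * _) ^+ 2]exprMn -wal_dfac; move: S0 f0 x0; set f := _%:R; set w := wal R a.
by move=> S0 f0 x0; field; rewrite S0 f0 x0.
Qed.

Lemma cvg_ga0 : (fun N => ga (TT N) 0) @ \oo --> (0 : R).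
have h : (fun N => sqrt ((2 * pi)^-1 * (TT N)^-1)) @ \oo --> (0 : R).
 rewrite -[X in _ --> X](@sqrtr0 R); apply: (@cvg_comp _ _ _ (fun N => (2 * pi)^-1 * (TT N)^-1) sqrt _ (nbhs (0 : R))); last exact: sqrt_continuous.
 by rewrite -(mulr0 ((2 * pi)^-1 : R)); apply: cvgM; [exact: cvg_cst|exact: cvg_inv_TT].
apply: (cvg_eq_near h) => {h}; near=> N; have T0 : 0 < TT N by near: N; exact: near_TT.
rewrite ga0E// -sqrtrV ?invfM// ltW//; apply: mulr_gt0 => //; apply: mulr_gt0 => //; exact: pi_gt0.
Unshelve. all: end_near.
Qed.

Definition sA f N a : R := (@sc R N a)^-1 * f N a.

Lemma sc_neq0 N a : 0 < TT N -> @sc R N a != 0.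
move=> T0; rewrite /sc mulf_neq0 ?signr_eq0// invr_eq0 mulf_neq0 ?gt_eqF ?ga_gt0//.
exact: mj_gt0.
Qed.

(** All kernel sums have this shape: [f] comes from [al] or its primitive and carries the correction
    [ca]; [q] comes from [be] or its antiderivative and takes the value [b] at the last index when N
    is odd. *)
Definition msum f q (b : R) N : R := \sum_(a < uphalf N) (rr (TT N) (odd N) a)^-1 *
 ((sA f N a - ca (TT N) (odd N) a * sA f N (uphalf N).-1) * (if oddlast (odd N) a then b else sA q N a)).

(** For even N nothing but the main sum is there. For odd N the corrections and the last index
    collect into f at N/2 times an alternating sum plus a term with the height [ga (TT N) 0], which
    tends to 0. *)
Lemma msumE f q b N : 0 < TT N -> msum f q b N = \sum_(a < N./2) cw N a * (f N a * q N a) -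
 (odd N)%:R * ((-1) ^+ N./2 * f N N./2 * (\sum_(a < N./2) (-1) ^+ a * (cw N a * q N a) + 2 * ga (TT N) 0 * b)).
move=> T0; have g0 : ga (TT N) 0 != 0 by rewrite gt_eqF ?ga_gt0.
have m0 a : mj (TT N) a != 0 by rewrite gt_eqF// mj_gt0.
have h0 a : hj (TT N) a != 0 by rewrite gt_eqF// hj_gt0.
have s2 k : (-1) ^+ k * (-1) ^+ k = 1 :> R by rewrite -exprMn mulrNN mulr1 expr1n.
have sAE g a : sA g N a = (-1) ^+ a * (mj (TT N) a * ga (TT N) 0) * g N a.
 rewrite /sA /sc invfM invrK; congr (_ * _ * _).
 by apply: (mulfI (_ : (-1) ^+ a != 0)); rewrite ?signr_eq0// s2 divff// signr_eq0.
have E a : (hj (TT N) a)^-1 * (sA f N a * sA q N a) = cw N a * (f N a * q N a).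
 rewrite -sc_cw// !sAE; have gen (s M h f' q' : R) : s * s = 1 -> h * (s * M * f' * (s * M * q')) = h * M ^+ 2 * (f' * q').
  by move=> ss; transitivity (s * s * (h * M ^+ 2 * (f' * q'))); [ring|rewrite ss mul1r].
 exact: gen.
have hu : uphalf N = (odd N + N./2)%N by rewrite uphalf_half.
rewrite /msum /rr /oddlast /ca; case: (odd N) hu => /= hu; last first.
 rewrite !mul0r subr0 hu add0n; apply: eq_bigr => a _; rewrite subr0; exact: E.
rewrite hu add1n big_ord_recr /= eqxx ltnn !mul0r subr0 mul1r.
under eq_bigr => a _ do rewrite ltn_eqF ?ltn_ord// mulrBl mulrBr E.
rewrite sumrB -addrA; congr (_ + _); rewrite -[RHS]mulNr; rewrite [RHS]mulrDr; congr (_ + _).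
 rewrite mulNr; congr (- _); rewrite mulr_sumr; apply: eq_bigr => a _.
 rewrite -sc_cw// !sAE.
 have gen (s s' M g h f' q' mp : R) : mp != 0 -> h * (M / mp * (s * (mp * g) * f') * (s' * (M * g) * q')) =
  s * f' * (s' * (h * (M * g) ^+ 2 * q')) by move=> k; field.
 exact: gen.
rewrite sAE; have gen (s M g f' : R) : M != 0 -> (- (2^-1 * M))^-1 * (s * (M * g) * f' * b) = - (s * f') * (2 * g * b).
 by move=> k; field.
exact: gen.
Qed.

Lemma main_sum f q b Phi Psi : ncvg f Phi -> ncvg q Psi -> continuous Phi -> continuous Psi ->
 msum f q b @ \oo --> pi^-1 * int01 (fun l => Phi l * Psi l).
move=> nf nq cP cQ.
have h1 := Riem (ncvg_mul nf nq) (contM cP cQ).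
have h2 : (fun N => \sum_(a < N./2) (-1) ^+ a * (cw N a * q N a) + 2 * ga (TT N) 0 * b) @ \oo --> (0 : R).
 rewrite -[X in _ --> X]addr0; apply: cvgD; first exact: alternating nq.
 rewrite -[X in _ --> X](mul0r b) -{2}(mulr0 2); apply: cvgM; last exact: cvg_cst.
 by apply: cvgM; [exact: cvg_cst|exact: cvg_ga0].
have [[C hC] _] := nf.
have h3 : (fun N => (odd N)%:R * ((-1) ^+ N./2 * f N N./2 * (\sum_(a < N./2) (-1) ^+ a * (cw N a * q N a) + 2 * ga (TT N) 0 * b))) @ \oo --> (0 : R).
 apply/norm_cvg0P; apply: (@squeeze_cvgr _ _ _ _ (fun=> 0) (fun N => C * `|\sum_(a < N./2) (-1) ^+ a * (cw N a * q N a) + 2 * ga (TT N) 0 * b|)).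
 - near=> N; rewrite normr_ge0 /= normrM; have hb : forall a, (a <= N./2)%N -> `|f N a| <= C by near: N.
  rewrite -[leRHS]mul1r; apply: ler_pM => //; first by case: odd; rewrite ?normr1 ?normr0.
  by rewrite normrM ler_wpM2r// normrM normrX normrN1 expr1n mul1r hb.
 - exact: cvg_cst.
 have h4 := cvg_norm h2; rewrite normr0 in h4.
 by rewrite -[X in _ --> X](mulr0 C); apply: cvgM; [exact: cvg_cst|exact: (h4 _)].
have h : (fun N => \sum_(a < N./2) cw N a * (f N a * q N a) -
 (odd N)%:R * ((-1) ^+ N./2 * f N N./2 * (\sum_(a < N./2) (-1) ^+ a * (cw N a * q N a) + 2 * ga (TT N) 0 * b))) @ \oo --> pi^-1 * int01 (fun l => Phi l * Psi l).
 by rewrite -[X in _ --> X]subr0; apply: cvgB.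
apply: (cvg_eq_near h) => {h}; near=> N; rewrite msumE//; near: N; exact: near_TT.
Unshelve. all: end_near.
Qed.
End MainSum.

(** * The finite-N kernel in this common form *)

Section KernelSums.
Variable R : realType.
Local Notation TT := (TT R).
Implicit Types (s t x y : R).

Lemma primBZ (f g : R -> R) c x : continuous f -> continuous g -> prim (fun u => f u - c * g u) x = prim f x - c * prim g x.
move=> cf cg; have c1 : continuous (fun u => f u - c * g u).
 by move=> u; apply: cvgB; [exact: cf|apply: cvgM; [exact: cvg_cst|exact: cg]].
have d (u : R) : is_derive u (1 : R) (fun v => prim f v - c * prim g v) (f u - c * g u).
 exact: (is_deriveB (der_prim u cf) (is_deriveZ c (der_prim u cg))).
by rewrite (primE x c1 d) !prim0 mulr0 subr0 subr0.
Qed.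

Lemma sAK (F G : nat -> nat -> R) N a : 0 < TT N -> F N a = @sc R N a * G N a -> sA F N a = G N a.
by move=> T0 e; rewrite /sA e mulKf// sc_neq0. Qed.

Let fvK s x N a : 0 < TT N -> sA (fv s x) N a = gj (TT N) (TT N + s) a.*2 x.
by move=> T0; apply: (@sAK _ (fun N a => gj (TT N) (TT N + s) a.*2 x)). Qed.
Let fdK s x N a : 0 < TT N -> sA (fd s x) N a = dgj (TT N) (TT N + s) a.*2 x.
by move=> T0; apply: (@sAK _ (fun N a => dgj (TT N) (TT N + s) a.*2 x)). Qed.
Let fpK s x N a : 0 < TT N -> sA (fp s x) N a = prim (gj (TT N) (TT N + s) a.*2) x.
by move=> T0; apply: (@sAK _ (fun N a => prim (gj (TT N) (TT N + s) a.*2) x)). Qed.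
Let dblT s N : 2 * TT N - (TT N + s) = TT N + - s. ring. Qed.

Lemma kD_msum s x t y N : 0 < TT N ->
 kD (TT N) (uphalf N) (odd N) (TT N + s) x (TT N + t) y = msum (fv t y) (fd s x) 0 N - msum (fv s x) (fd t y) 0 N.
move=> T0; rewrite /kD /msum -sumrB; apply: eq_bigr => a _.
by rewrite !fvK// !fdK// -mulrBr /al /be; congr (_ * (_ - _)); rewrite mulrC.
Qed.

Lemma kS_msum s x t y N : 0 < TT N -> 0 < TT N + - s ->
 kS (TT N) (uphalf N) (odd N) (TT N + s) x (TT N + t) y =
 msum (fv t y) (fv (- s) x) (- 2^-1) N - msum (fp (- s) x) (fd t y) 0 N - (if s < t then ga (t - s) (x - y) else 0).
move=> T0 p0; have e : TT N + t - (TT N + s) = t - s by ring.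
rewrite /kS ltrD2l e; congr (_ - _).
rewrite /msum -sumrB; apply: eq_bigr => a _.
rewrite !fvK// !fdK// !fpK// dblT -mulrBr /al /be /bet /alt /al; congr (_ * (_ - _)).
by rewrite mulrC primBZ//; exact: continuous_gj.
Qed.

Lemma kI_msum s x t y N : 0 < TT N -> 0 < TT N + - s -> 0 < TT N + - t ->
 kI (TT N) (uphalf N) (odd N) (TT N + s) x (TT N + t) y =
 sgt (- s - t) (y - x) + (msum (fp (- s) x) (fv (- t) y) (- 2^-1) N - msum (fp (- t) y) (fv (- s) x) (- 2^-1) N).
move=> T0 p1 p2; have e : 2 * TT N - (TT N + s) - (TT N + t) = - s - t by ring.
rewrite /kI e; congr (_ + _).
rewrite /msum -sumrB; apply: eq_bigr => a _.
rewrite !fvK// !fpK// !dblT -mulrBr /bet /alt /al; congr (_ * (_ - _)).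
 by rewrite primBZ//; exact: continuous_gj.
by rewrite mulrC primBZ//; exact: continuous_gj.
Qed.
End KernelSums.

(** * Fourier transforms of Gaussians *)

Section GaussianFourier.
Variable R : realType.
Implicit Types (z u v l tau : R).

Lemma fact_dfac k : (k.*2)`!%:R = 2 ^+ k * k`!%:R * dfac R k.
elim: k => [|k IH]; first by rewrite /dfac big_ord0 !mulr1.
have e1 := natr_double1 R k.
have e2 := natr_double2 R k.
have dS : dfac R k.+1 = dfac R k * (2 * k%:R + 1) by rewrite /dfac big_ord_recr /= e1.
have e3 : k.+1%:R = k%:R + 1 :> R by rewrite -natr1.
by rewrite doubleS !factS !natrM IH e1 e2 e3 dS exprS; ring.
Qed.

Lemma Eg_Xn v k : 0 < v -> Eg v 0 'X^(k.*2) = v ^+ k * dfac R k.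
move=> v0; elim: k => [|k IH].
 by rewrite double0 -[X in Eg _ _ X]/(1 : {poly R}) Eg1// /dfac big_ord0 mulr1.
have e1 := natr_double1 R k.
have dS : dfac R k.+1 = dfac R k * (2 * k%:R + 1) by rewrite /dfac big_ord_recr /= e1.
rewrite doubleS exprS Eg_stein// mul0r add0r derivXn /= -scaler_nat EgZ// IH e1 dS exprS; ring.
Qed.

Lemma Ri_Xn_ga v k : 0 < v -> Ri (fun u => u ^+ k.*2 * ga v u) = v ^+ k * dfac R k.
by move=> v0; have := Eg_Xn k v0; rewrite /Eg => <-; apply: Ri_eq => u; rewrite hornerXn subr0. Qed.

Lemma itg_Xn_ga v k : 0 < v -> itg (fun u => u ^+ k * ga v u).
move=> v0; apply: sfast_itg; have -> : (fun u => u ^+ k * ga v u) = (fun u => ('X^k).[u] * ga v u).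
 by apply/funext => u; rewrite hornerXn.
exact: sfast_poly (sfast_ga v0).
Qed.

Definition cosp z m u : R := \sum_(k < m) (-1) ^+ k * (u * z) ^+ k.*2 / (k.*2)`!%:R.

(** A bound independent of [m] that stays integrable against the Gaussian, by [exp_ga]. *)
Lemma cosp_le z m u : `|cosp z m u| <= expR (u * z) + expR (- (u * z)).
have h : `|cosp z m u| <= expR `|u * z|.
 apply: (@le_trans _ _ (\sum_(j < m.*2) `|u * z| ^+ j / j`!%:R)); last exact: exp_partial.
 elim: m => [|m IH]; first by rewrite /cosp !big_ord0 normr0.
 rewrite /cosp doubleS !big_ord_recr /= -addrA; apply: (le_trans (ler_normD _ _)); apply: lerD; first exact: IH.
 apply: ler_wpDr; first by rewrite divr_ge0 ?exprn_ge0.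
 by rewrite normrM normrM normrX normrN1 expr1n mul1r normrX normfV (ger0_norm (ler0n _ _)).
apply: (le_trans h); have [p|p] := ger0P (u * z); first by rewrite lerDl expR_ge0.
by rewrite lerDr expR_ge0.
Qed.

Lemma exp_ga v z u : 0 < v -> expR (u * z) * ga v u = expR (v * z ^+ 2 / 2) * ga v (u - v * z).
move=> v0; rewrite /ga mulrCA [RHS]mulrCA -!expRD; congr (_ * expR _); field; rewrite gt_eqF//.
Qed.

Lemma Ri_cosp v z m : 0 < v -> Ri (fun u => cosp z m u * ga v u) = \sum_(k < m) (- (v * z ^+ 2 / 2)) ^+ k / k`!%:R /\
 itg (fun u => cosp z m u * ga v u).
move=> v0; elim: m => [|m [IH1 IH2]].
 have e : (fun u => cosp z 0 u * ga v u) = fun u => 0 * ga v u by apply/funext => u; rewrite /cosp big_ord0.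
 have i := itgZ 0 (sfast_itg (sfast_ga v0)).
 by rewrite e; split => //; rewrite big_ord0 RiZ ?mul0r//; exact/sfast_itg/sfast_ga.
pose c : R := (-1) ^+ m * z ^+ m.*2 / (m.*2)`!%:R.
have e : (fun u => cosp z m.+1 u * ga v u) = fun u => cosp z m u * ga v u + c * (u ^+ m.*2 * ga v u).
 by apply/funext => u; rewrite /cosp big_ord_recr /= mulrDl exprMn /c; ring.
have i := itgZ c (itg_Xn_ga m.*2 v0).
rewrite e; split; last exact: itgD.
rewrite RiD// RiZ; last exact: itg_Xn_ga.
rewrite IH1 Ri_Xn_ga// big_ord_recr /=; congr (_ + _).
have ez : z ^+ m.*2 = (z ^+ 2) ^+ m by rewrite -exprM mul2n.
rewrite /c ez fact_dfac; move: (z ^+ 2) => y.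
have -> : - (v * y / 2) = -1 * (v * y) / 2 by ring.
rewrite expr_div_n !exprMn.
have f0 : m`!%:R != 0 :> R by rewrite pnatr_eq0 -lt0n fact_gt0.
have x0 : 2 ^+ m != 0 :> R by rewrite expf_neq0.
move: f0 x0 (@dfac_neq0 R m); set f := m`!%:R; set X := 2 ^+ m; set D := dfac R m; move=> f0 x0 D0.
by field; rewrite f0 x0 D0.
Qed.

(** The cosine series is integrated term by term; the even Gaussian moments turn it into an
    exponential series. *)
Lemma Ri_cos_ga v z : 0 < v -> Ri (fun u => cos (u * z) * ga v u) = expR (- (v * z ^+ 2 / 2)).
move=> v0; have cg := @continuous_ga R v v0.
have ccos : continuous (fun u => cos (u * z)).
 exact: continuous_cosMr.
have iE y : itg (fun u => expR (u * y) * ga v u).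
 have -> : (fun u => expR (u * y) * ga v u) = (fun u => expR (v * y ^+ 2 / 2) * ga v (u - v * y)).
  by apply/funext => u; rewrite exp_ga.
 exact/itgZ/sfast_itg/sfast_gas.
have h1 : (fun m => Ri (fun u => cosp z m u * ga v u)) @ \oo --> Ri (fun u => cos (u * z) * ga v u).
 apply: (@Ri_dct R (fun m u => cosp z m u * ga v u) _ (fun u => expR (u * z) * ga v u + expR (u * - z) * ga v u)).
 - by move=> m; apply: itg_meas; have [] := Ri_cosp z m v0.
 - by apply: continuous_mfun; exact: contM.
 - move=> u; apply: cvgM; last exact: cvg_cst.
  have h := @cvg_cos_coeff' R (u * z).
  have e : series (cos_coeff' (u * z)) = fun m => cosp z m u by apply/funext => m; rewrite /series /= big_mkord.
  by rewrite e in h.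
 - exact: itgD.
 move=> m u; rewrite normrM (ger0_norm (ltW (ga_gt0 u v0))) -mulrDl ler_wpM2r ?(ltW (ga_gt0 u v0))// mulrN.
 exact: cosp_le.
have h := @is_cvg_series_exp_coeff R (- (v * z ^+ 2 / 2)).
have e : (fun m => Ri (fun u => cosp z m u * ga v u)) = series (exp_coeff (- (v * z ^+ 2 / 2))).
 by apply/funext => m; rewrite (Ri_cosp z m v0).1 /series /= big_mkord.
by rewrite e in h1; exact: (cvg_unique _ h1 h).
Qed.

(** Rewrites the Gaussian factor as a heat kernel of time 1 / tau, to which [Ri_cos_ga] applies. *)
Lemma gauss_ga tau l : 0 < tau -> expR (- (tau * l ^+ 2 / 2)) = 2 * pi * ga tau 0 * ga tau^-1 l.
move=> t0; have p0 := pi_gt0 R; have t1 : 0 < tau^-1 by rewrite invr_gt0.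
rewrite ga0E// /ga powRN powR12_sqrt; last by rewrite ltW//; apply: mulr_gt0 => //; apply: mulr_gt0.
have -> : - l ^+ 2 / (2 * tau^-1) = - (tau * l ^+ 2 / 2) by field; rewrite gt_eqF.
rewrite -[LHS]mul1r mulrA; congr (_ * _).
have e : sqrt (2 * pi * tau) * sqrt (2 * pi * tau^-1) = 2 * pi.
 rewrite -sqrtrM; last by rewrite ltW//; apply: mulr_gt0 => //; apply: mulr_gt0.
 have -> : 2 * pi * tau * (2 * pi * tau^-1) = (2 * pi) ^+ 2 by field; rewrite gt_eqF.
 by rewrite sqrtr_sqr ger0_norm// ltW//; apply: mulr_gt0.
rewrite -mulrA -invfM [X in X^-1]e divff// gt_eqF//; exact: mulr_gt0.
Qed.

Lemma itg_gauss_tau tau : 0 < tau -> itg (fun l => expR (- (tau * l ^+ 2 / 2))).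
move=> t0; have -> : (fun l => expR (- (tau * l ^+ 2 / 2))) = (fun l => 2 * pi * ga tau 0 * ga tau^-1 l).
 by apply/funext => l; rewrite gauss_ga.
by apply/itgZ/sfast_itg/sfast_ga; rewrite invr_gt0.
Qed.

Lemma continuous_gauss_tau tau : continuous (fun l => expR (- (tau * l ^+ 2 / 2))).
move=> l; apply: (@continuous_comp _ _ _ (fun l => - (tau * l ^+ 2 / 2)) expR); last exact: continuous_expR.
apply: cvgN; apply: cvgM; last exact: cvg_cst.
by apply: cvgM; [exact: cvg_cst|exact: exprn_continuous].
Qed.

Lemma Ri_cos_gauss tau z : 0 < tau -> Ri (fun l => cos (l * z) * expR (- (tau * l ^+ 2 / 2))) = 2 * pi * ga tau z.
move=> t0; have t1 : 0 < tau^-1 by rewrite invr_gt0.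
rewrite (@Ri_eq _ _ (fun l => 2 * pi * ga tau 0 * (cos (l * z) * ga tau^-1 l))); last first.
 by move=> l; rewrite gauss_ga//; ring.
have i : itg (fun l => cos (l * z) * ga tau^-1 l).
 apply: (@itg_dom _ _ (ga tau^-1)).
 - apply: continuous_mfun; apply: contM; last exact: continuous_ga.
  exact: continuous_cosMr.
 - exact/sfast_itg/sfast_ga.
 by move=> l; rewrite normrM (ger0_norm (ltW (ga_gt0 l t1))) ler_piMl ?(ltW (ga_gt0 l t1))// ler_norml cos_geN1 cos_le1.
rewrite RiZ// Ri_cos_ga// -[2 * pi * _ * _]mulrA; congr (_ * _).
rewrite {2}/ga ga0E// powRN powR12_sqrt; last by rewrite ltW//; apply: mulr_gt0 => //; apply: mulr_gt0 => //; exact: pi_gt0.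
by congr (_ * expR _); field; rewrite gt_eqF.
Qed.

Lemma itg_cos_gauss tau z : 0 < tau -> itg (fun l => cos (l * z) * expR (- (tau * l ^+ 2 / 2))).
move=> t0; apply: (itg_dom _ (itg_gauss_tau t0)).
 apply: continuous_mfun; apply: contM; last exact: continuous_gauss_tau.
 exact: continuous_cosMr.
by move=> l; rewrite normrM (ger0_norm (expR_ge0 _)) ler_piMl ?expR_ge0// ler_norml cos_geN1 cos_le1.
Qed.

Lemma sinc_bound z l : `|sinc z l| <= `|z|.
wlog z0 : z / 0 <= z.
 move=> W; have [|zl] := leP 0 z; first exact: W.
 by have := W (- z); rewrite sincN !normrN; apply; rewrite oppr_ge0 ltW.
rewrite -prim_cos /prim z0 Rint_Ri (ger0_norm z0).
have mc : mfunT ((fun u => cos (l * u)) \_ `[0, z]%classic).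
 by apply: measurable_patch => //; apply: continuous_mfun; exact: continuous_cosM.
have b1 u : `|((fun u => cos (l * u)) \_ `[0, z]%classic) u| <= ((fun=> 1 : R) \_ `[0, z]%classic) u.
 by rewrite /patch; case: ifP => _; rewrite ?normr0// ler_norml cos_geN1 cos_le1.
have i1 : itg ((fun=> 1 : R) \_ `[0, z]%classic).
 rewrite /itg -restrict_EFin; apply/(integrable_mkcond _ _).1 => //.
 by apply: (continuous_itg_itv 0 z); exact: cst_continuous.
have ic := itg_dom mc i1 b1.
apply: (le_trans (Ri_norm ic)); apply: (le_trans (Ri_le (itg_abs ic) i1 b1)).
by rewrite -Rint_Ri (@ftc R _ id)// ?subr0// => u; exact: cst_continuous.
Qed.

Lemma itg_sinc_gauss tau z : 0 < tau -> itg (fun l => sinc z l * expR (- (tau * l ^+ 2 / 2))).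
move=> t0; apply: (itg_dom _ (itgZ `|z| (itg_gauss_tau t0))).
 by apply: continuous_mfun; apply: contM; [exact: continuous_sinc|exact: continuous_gauss_tau].
by move=> l; rewrite normrM (ger0_norm (expR_ge0 _)) ler_wpM2r ?expR_ge0// sinc_bound.
Qed.

(** The cosine formula is integrated in the space variable over [0, z] under Fubini; negative [z]
    follows by oddness. *)
Lemma Ri_sinc_gauss tau z : 0 < tau -> Ri (fun l => sinc z l * expR (- (tau * l ^+ 2 / 2))) = 2 * pi * prim (ga tau) z.
move=> t0; wlog z0 : z / 0 <= z.
 move=> W; have [|zl] := leP 0 z; first exact: W.
 have := W (- z); rewrite primN; [|exact: continuous_ga|exact: gaN].
 rewrite oppr_ge0 (ltW zl) mulrN => /(_ isT) h; apply: oppr_inj; rewrite -h -mulN1r -RiZ; last exact: itg_sinc_gauss.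
 by apply: Ri_eq => l; rewrite sincN; ring.
pose f l u := ((fun=> 1 : R) \_ `[0, z]%classic) u * (cos (l * u) * expR (- (tau * l ^+ 2 / 2))).
have i1 : itg ((fun=> 1 : R) \_ `[0, z]%classic).
 rewrite /itg -restrict_EFin; apply/(integrable_mkcond _ _).1 => //.
 by apply: (continuous_itg_itv 0 z); exact: cst_continuous.
have p1 u : 0 <= ((fun=> 1 : R) \_ `[0, z]%classic) u by rewrite /patch; case: ifP.
have := @Ri_swap R f _ _ _ (itg_gauss_tau t0) i1 p1 _.
have -> : (fun l => Ri (f l)) = (fun l => sinc z l * expR (- (tau * l ^+ 2 / 2))).
 apply/funext => l; rewrite -prim_cos /prim z0 mulrC -RintegralZl//; last by apply: continuous_itg_itv; exact: continuous_cosM.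
 by rewrite Rint_Ri; apply: Ri_eq => u; rewrite /f /patch; case: ifP => _; rewrite ?mul0r// mul1r mulrC.
have -> : (fun u => Ri (f^~ u)) = (fun u => (2 * pi * ga tau u)) \_ `[0, z]%classic.
 apply/funext => u; rewrite /f RiZ; last exact: itg_cos_gauss.
 by rewrite Ri_cos_gauss// /patch; case: ifP; rewrite ?mul0r ?mul1r.
move=> ->; first by rewrite -Rint_Ri RintegralZl ?/prim ?z0//; apply: continuous_itg_itv; exact: continuous_ga.
- apply: mfunM.
  by apply: (mcomp (f := (fun=> 1 : R) \_ `[0, z]%classic)) => //; exact: itg_meas.
 apply: mfunM.
  apply: (mcomp (f := cos)); first by apply: continuous_mfun; exact: continuous_cos.
  exact: mfunM.
 apply: (mcomp (f := fun l => expR (- (tau * l ^+ 2 / 2)))) => //.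
 by apply: continuous_mfun; exact: continuous_gauss_tau.
move=> l u; rewrite !normrM (ger0_norm (expR_ge0 _)) (ger0_norm (p1 u)) mulrC ler_wpM2r//.
by rewrite ler_piMl ?expR_ge0// ler_norml cos_geN1 cos_le1.
Qed.
End GaussianFourier.

(** * Improper integrals over [1, oo) *)

Section ImproperIntegrals.
Variable R : realType.
Implicit Types (f : R -> R) (x y z u l s t tau b L : R).

Lemma prim_pinfty f : continuous f -> itg f -> (forall x, f (- x) = f x) -> prim f b @[b --> +oo_R] --> Ri f / 2.
move=> cf itf ev; apply/cvg_pinftyP => u ui.
have hD : (fun n => Ri (f \_ `[- u n, u n]%classic)) @ \oo --> Ri f.
 apply: (@Ri_dct R (fun n => f \_ `[- u n, u n]%classic) f (fun x => `|f x|)).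
 - by move=> n; apply: measurable_patch => //; exact: continuous_mfun.
 - exact: continuous_mfun.
 - move=> x; apply: (cvg_trans _ (@cvg_cst _ (f x) _ \oo _)); apply: near_eq_cvg; near=> n.
  have h : `|x| < u n by near: n; exact: (cvgry_gt ui).
  rewrite /patch ifT// mem_setE in_itv /=; have := ler_norm x; have := ler_norm (- x); rewrite normrN => h1 h2.
  by apply/andP; split; lra.
 - exact: itg_abs.
 by move=> n x; rewrite patchE; case: ifP => // _; rewrite normr0.
have h2 : (fun n => Ri (f \_ `[- u n, u n]%classic) / 2) @ \oo --> Ri f / 2.
 by apply: cvgM => //; exact: cvg_cst.
apply: (cvg_eq_near h2) => {h2}; near=> n; have h : 0 < u n by near: n; exact: (cvgry_gt ui).
have ab : - u n <= u n by lra.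
by rewrite -Rint_Ri (ftc ab cf (fun v => der_prim v cf)) primN// opprK; field.
Unshelve. all: end_near.
Qed.

Lemma int01_prim f : int01 f = prim f 1.
by rewrite /prim ler01. Qed.

(** [g] has to agree with the continuous [f] on [1, oo) only, so 1 / l, singular at 0, may be
    replaced through [sinc]. *)
Lemma int1oo_lim f g L : continuous f -> (forall l, 1 <= l -> g l = f l) -> prim f b @[b --> +oo_R] --> L ->
 int1oo g = L - int01 f.
move=> cf gf fL; rewrite int01_prim /int1oo; apply: cvg_lim => //.
have h : (fun b => prim f b - prim f 1) @ +oo_R --> L - prim f 1 by apply: cvgB => //; exact: cvg_cst.
apply: (cvg_eq_near h) => {h}; near=> b; have b1 : 1 <= b by near: b; exact: nbhs_pinfty_ge.
rewrite -(ftc b1 cf (fun v => der_prim v cf)).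
by apply: eq_Rintegral => l; rewrite mem_setE in_itv /= => /andP[l1 _]; rewrite gf.
Unshelve. all: end_near.
Qed.

Lemma mono_of_deriv (f df : R -> R) (B b : R) : B <= b -> (forall x, B <= x -> is_derive x (1 : R) f (df x)) ->
 (forall x, B <= x -> 0 <= df x) -> f B <= f b.
move=> Bb d d0; have [x|//|c] := @MVT_segment R f df B b Bb.
- by rewrite in_itv /= => /andP[/ltW/d].
- by apply: derivable_within_continuous => x; rewrite in_itv /= => /andP[/d h _]; exact: (@ex_derive _ _ _ _ _ _ _ h).
rewrite in_itv /= => /andP[Bc _] e; rewrite -subr_ge0 e mulr_ge0 ?subr_ge0//; exact: d0.
Qed.

Definition sg_ tau z l : R := sinc z l * expR (- (tau * l ^+ 2 / 2)).
Lemma continuous_sg tau z : continuous (sg_ tau z).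
by apply: contM; [exact: continuous_sinc|exact: continuous_gauss_tau]. Qed.

Lemma is_derive_phi tau l : l != 0 -> is_derive l (1 : R) (fun l => expR (- (tau * l ^+ 2 / 2)) / l)
 (- ((l ^+ 2)^-1 + tau) * expR (- (tau * l ^+ 2 / 2))).
move=> l0; pose p : {poly R} := (- (tau / 2)) *: 'X^2.
have pE v : - (tau * v ^+ 2 / 2) = p.[v] by rewrite /p hornerZ hornerXn; ring.
have dp : is_derive l (1 : R) (fun v => - (tau * v ^+ 2 / 2)) (- (tau * l)).
 have -> : (fun v => - (tau * v ^+ 2 / 2)) = (fun v => p.[v]) by apply/funext => v; rewrite pE.
 apply: (is_derive_eq (is_derive_poly p l)).
 by rewrite /p derivZ derivXn hornerZ hornerMn hornerXn /=; field.
have de := @is_derive1_comp R expR (fun v => - (tau * v ^+ 2 / 2)) l _ _ (is_derive_expR _) dp.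
have di := is_deriveV l0 (is_derive_id l (1 : R)).
have := is_deriveM de di => h; apply: (is_derive_eq h).
by rewrite /GRing.scale /=; field.
Qed.

(** The estimate is uniform in [tau], so it survives the passage to [tau = 0], where the integral
    converges only conditionally. *)
Lemma Dirichlet_tail tau z (B b : R) : 0 <= tau -> 0 < z -> 0 < B -> B <= b ->
 `|prim (sg_ tau z) b - prim (sg_ tau z) B| <= 2 / (B * z).
move=> t0 z0 B0 Bb; pose phi l := expR (- (tau * l ^+ 2 / 2)) / l.
have zn : z != 0 by rewrite gt_eqF.
have phi_bd l : 0 < l -> 0 <= phi l <= l^-1.
 move=> l0; rewrite /phi divr_ge0 ?expR_ge0 ?(ltW l0)//= ler_piMl ?invr_ge0 ?(ltW l0)// -expR0 ler_expR oppr_le0.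
 by apply: divr_ge0 => //; apply: mulr_ge0 => //; exact: sqr_ge0.
(* The added term makes the primitive increasing for k = 1 and decreasing for k = -1, since [phi]
   decreases; the two together bound the tail. *)
pose H k l := prim (sg_ tau z) l + (cos (z * l) - k) * phi l / z.
have dH k l : 0 < l -> is_derive l (1 : R) (H k) ((k - cos (z * l)) * (((l ^+ 2)^-1 + tau) * expR (- (tau * l ^+ 2 / 2))) / z).
 move=> l0; have ln : l != 0 by rewrite gt_eqF.
 have d1 := der_prim l (@continuous_sg tau z).
 have dc : is_derive l (1 : R) (fun l => z^-1 * (cos (z * l) - k)) (z^-1 * - (z * sin (z * l))).
  have h := is_deriveZ z^-1 (is_deriveB (is_derive_cosM z l) (is_derive_cst k l (1 : R))).
  by apply: (is_derive_eq h); rewrite subr0.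
 have h := is_deriveD d1 (is_deriveM dc (is_derive_phi tau ln)).
 have -> : H k = (fun v => prim (sg_ tau z) v + z^-1 * (cos (z * v) - k) * phi v) by apply/funext => v; rewrite /H; ring.
 apply: (is_derive_eq h); rewrite /GRing.scale /= /sg_ /sinc (negbTE ln) [l * z]mulrC.
 by field; rewrite ln zn.
have psi l : B <= l -> 0 <= ((l ^+ 2)^-1 + tau) * expR (- (tau * l ^+ 2 / 2)) / z.
 move=> _; apply: divr_ge0; last exact: ltW.
 by apply: mulr_ge0; [apply: addr_ge0 => //; rewrite invr_ge0; exact: sqr_ge0|exact: expR_ge0].
have hU : H 1 B <= H 1 b.
 apply: (mono_of_deriv Bb) => [l Bl|l Bl]; first by apply: dH; exact: lt_le_trans Bl.
 by rewrite /= -mulrA; apply: mulr_ge0; [rewrite subr_ge0 cos_le1|exact: psi].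
have hV : - H (-1) B <= - H (-1) b.
 apply: (mono_of_deriv (f := fun l => - H (-1) l) Bb) => [l Bl|l Bl].
  by apply: is_deriveN; apply: dH; exact: lt_le_trans Bl.
 rewrite /= -mulrA -mulNr; apply: mulr_ge0; last exact: psi.
 by rewrite opprB subr_ge0 cos_geN1.
have b0 : 0 < b by exact: lt_le_trans Bb.
have /andP[pb0 _] := phi_bd b b0; have /andP[pB0 pB] := phi_bd B B0.
have zi : 0 < z^-1 by rewrite invr_gt0.
move: hU hV; rewrite /H.
have c1 := cos_le1 (z * B); have c2 := cos_le1 (z * b); have c3 := cos_geN1 (z * B); have c4 := cos_geN1 (z * b).
have q1 : (cos (z * b) - 1) * phi b / z <= 0 by rewrite pmulr_lle0//; apply: mulr_le0_ge0 => //; lra.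
have q2 : 0 <= (cos (z * b) - -1) * phi b / z by apply: divr_ge0; [apply: mulr_ge0 => //; lra|exact: ltW].
have e : 2 / (B * z) = 2 * B^-1 / z by rewrite invfM mulrA.
have q3 : - (2 * B^-1 / z) <= (cos (z * B) - 1) * phi B / z.
 rewrite -mulNr; rewrite ler_wpM2r ?(ltW zi)//.
 apply: (@le_trans _ _ (- 2 * phi B)); first by rewrite mulNr lerN2 ler_wpM2l.
 by rewrite ler_wpM2r//; lra.
have q4 : (cos (z * B) - -1) * phi B / z <= 2 * B^-1 / z.
 rewrite ler_wpM2r ?(ltW zi)//; apply: ler_pM => //; lra.
by rewrite e ler_norml => h1 h2; apply/andP; split; lra.
Qed.

Lemma sg_even tau z l : sg_ tau z (- l) = sg_ tau z l.
rewrite /sg_ sqrrN /sinc oppr_eq0; case: eqP => // _; rewrite mulNr sinN invrN mulrNN //.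
Qed.

Lemma sg_tau_lim tau z : 0 < tau -> prim (sg_ tau z) b @[b --> +oo_R] --> pi * prim (ga tau) z.
move=> t0; have -> : pi * prim (ga tau) z = Ri (sg_ tau z) / 2 by rewrite Ri_sinc_gauss//; field.
by apply: prim_pinfty; [exact: continuous_sg|exact: itg_sinc_gauss|exact: sg_even].
Qed.

Lemma gaE t x : 0 < t -> ga t x = (sqrt (2 * pi * t))^-1 * expR (- x ^+ 2 / (2 * t)).
move=> t0; have p0 := pi_gt0 R.
by rewrite /ga powRN powR12_sqrt// ltW//; apply: mulr_gt0 => //; apply: mulr_gt0.
Qed.

Lemma cvg_norm_le (T : Type) (F : set_system T) (FF : ProperFilter F) (v : T -> R) (a c K : R) :
 v @ F --> a -> (\forall t \near F, `|v t - c| <= K) -> `|a - c| <= K.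
move=> va vK; apply/ler_addgt0Pr => e e0; near F => t.
have h1 : `|a - v t| < e by near: t; have /cvgrPdist_lt := va; apply.
have h2 : `|v t - c| <= K by near: t.
have := ler_distD (v t) a c; lra.
Unshelve. all: end_near.
Qed.

Lemma prim_ga_scale z (c : R) : 0 < z -> 0 < c -> prim (ga (z ^+ 2 / c ^+ 2)) z = prim (ga 1) c.
move=> z0 c0; have t0 : 0 < z ^+ 2 / c ^+ 2 by rewrite divr_gt0// exprn_gt0.
have d (u : R) : is_derive u (1 : R) (fun u => prim (ga 1) (c / z * u)) (ga (z ^+ 2 / c ^+ 2) u).
 have h1 := der_prim (c / z * u) (@continuous_ga R 1 ltr01).
 have h2 : is_derive u (1 : R) ( *%R (c / z)) (c / z).
  by have h := is_deriveZ (c / z) (is_derive_id u (1 : R)); apply: (is_derive_eq h); rewrite /GRing.scale /= mulr1.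
 have h := @is_derive1_comp R (prim (ga 1)) ( *%R (c / z)) u _ _ h1 h2; apply: (is_derive_eq h).
 have p0 : 0 < 2 * pi :> R by apply: mulr_gt0 => //; exact: pi_gt0.
 have es : sqrt (2 * pi * (z ^+ 2 / c ^+ 2)) = sqrt (2 * pi) * (z / c).
  by rewrite sqrtrM ?(ltW p0)// -expr_div_n sqrtr_sqr ger0_norm// divr_ge0 ?ltW.
 rewrite !gaE// es mulr1.
 have -> : - (c / z * u) ^+ 2 / (2 * 1) = - u ^+ 2 / (2 * (z ^+ 2 / c ^+ 2)) by field; rewrite !gt_eqF.
 by rewrite mulrAC; congr (_ * _); rewrite [RHS]invfM invf_div.
by rewrite (primE z (@continuous_ga R _ t0) d) mulr0 prim0 subr0 divfK// gt_eqF.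
Qed.

(** With tau = z^2 / (n + 1)^2 the regularised integral is pi times the primitive of the standard
    density at n + 1, which tends to 1/2; at fixed B the integral over [0, B] converges too. *)
Lemma Dirichlet_pos z (B : R) : 0 < z -> 0 < B -> `|pi / 2 - prim (sg_ 0 z) B| <= 2 / (B * z).
move=> z0 B0; pose tn (n : nat) := z ^+ 2 / (n.+1%:R : R) ^+ 2.
have tn0 n : 0 < tn n by rewrite divr_gt0 ?exprn_gt0.
have h1 n : `|pi * prim (ga 1) n.+1%:R - prim (sg_ (tn n) z) B| <= 2 / (B * z).
 have n0 : 0 < n.+1%:R :> R by rewrite ltr0Sn.
 rewrite -(prim_ga_scale z0 n0); apply: (cvg_norm_le _ (@sg_tau_lim (tn n) z (tn0 n))).
 near=> b; have Bb : B <= b by near: b; apply: nbhs_pinfty_ge; rewrite num_real.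
 exact: (Dirichlet_tail (ltW (tn0 n)) z0 B0 Bb).
have c1 : (fun n : nat => pi * prim (ga 1) n.+1%:R) @ \oo --> (pi / 2 : R).
 have /cvg_pinftyP h := prim_pinfty (@continuous_ga R 1 ltr01) (sfast_itg (sfast_ga ltr01)) (@gaN R 1).
 have e : Ri (ga 1) = 1 :> R.
  by rewrite -[RHS](@Ri_ga R 1 0 ltr01); apply: Ri_eq => v; rewrite subr0.
 rewrite e in h; have -> : pi / 2 = pi * (1 / 2) :> R by rewrite mul1r.
 apply: cvgM; first exact: cvg_cst.
 by apply: h; rewrite (cvg_shiftS (fun n => n%:R : R)); exact: cvgr_idn.
have c2 : (fun n => prim (sg_ (tn n) z) B) @ \oo --> prim (sg_ 0 z) B.
 rewrite /prim (ltW B0) Rint_Ri; under eq_fun do rewrite Rint_Ri.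
 apply: (@Ri_dct R (fun n => sg_ (tn n) z \_ `[0, B]%classic) _ (fun l => z * \1_(`[0, B]%classic : set R) l)).
 - by move=> n; apply: measurable_patch => //; apply: continuous_mfun; exact: continuous_sg.
 - by apply: measurable_patch => //; apply: continuous_mfun; exact: continuous_sg.
 - move=> l; rewrite /patch; case: ifP => _; last exact: cvg_cst.
  apply: cvgM; first exact: cvg_cst.
  apply: (@cvg_comp _ _ _ (fun n => - (tn n * l ^+ 2 / 2)) expR _ (nbhs (- (0 * l ^+ 2 / 2)))); last exact: continuous_expR.
  apply: cvgN; apply: cvgM; last exact: cvg_cst.
  apply: cvgM; last exact: cvg_cst.
  have -> : tn = (fun n => z ^+ 2 * (harmonic n * harmonic n)) by apply/funext => n; rewrite /tn /harmonic /= expr2 invfM.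
  rewrite -(mulr0 (z ^+ 2)) -[X in _ * X](mulr0 0); apply: cvgM; first exact: cvg_cst.
  by apply: cvgM; exact: cvg_harmonic.
 - exact/itgZ/itg_indic.
 move=> n l; rewrite /patch indicE mem_setE; case: ifP => _; last by rewrite normr0 mulr0.
 rewrite mulr1 /sg_ normrM (ger0_norm (expR_ge0 _)) -[leRHS]mulr1; apply: ler_pM; rewrite ?expR_ge0//.
  by apply: (le_trans (sinc_bound z l)); rewrite gtr0_norm.
 rewrite -expR0 ler_expR oppr_le0; apply: divr_ge0 => //; apply: mulr_ge0; [exact: ltW|exact: sqr_ge0].
have -> : pi / 2 - prim (sg_ 0 z) B = (pi / 2 - prim (sg_ 0 z) B) - 0 by rewrite subr0.
apply: (cvg_norm_le _ (cvgB c1 c2)); apply: nearW => n; rewrite subr0; exact: h1.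
Unshelve. all: end_near.
Qed.

Lemma Dirichlet z : prim (sg_ 0 z) b @[b --> +oo_R] --> pi * hs z.
have pos y : 0 < y -> prim (sg_ 0 y) b @[b --> +oo_R] --> pi / 2.
 move=> y0; apply/cvgrPdist_le => e e0; near=> b.
 have b0 : 0 < b by near: b; exact: nbhs_pinfty_gt.
 apply: (le_trans (Dirichlet_pos y0 b0)); rewrite invfM mulrA ler_pdivrMr// ler_pdivrMr//.
 have h : 2 / (e * y) <= b by near: b; apply: nbhs_pinfty_ge; rewrite num_real.
 by move: h; rewrite ler_pdivrMr ?mulr_gt0// mulrC.
have sgN y : sg_ 0 (- y) = fun l => - sg_ 0 y l by apply/funext => l; rewrite /sg_ sincN mulNr.
rewrite /hs; have [z0|z0|->] := ltrgt0P z.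
- by rewrite gtr0_sg// mul1r; exact: pos.
- rewrite ltr0_sg// mulN1r mulrN.
 have nz : 0 < - z by rewrite oppr_gt0.
 have e : prim (sg_ 0 z) = fun b => - prim (sg_ 0 (- z)) b.
  apply/funext => b; rewrite sgN.
  have d v : is_derive v (1 : R) (fun b => - prim (sg_ 0 z) b) (- sg_ 0 z v).
   by apply: is_deriveN; apply: der_prim; exact: continuous_sg.
  have cN : continuous (fun l => - sg_ 0 z l) by move=> v; apply: cvgN; exact: continuous_sg.
  by rewrite (primE b cN d) prim0 oppr0 subr0 opprK.
 by rewrite e; apply: cvgN; exact: pos.
rewrite sgr0 mul0r mulr0; have e : sg_ 0 0 = fun=> 0.
 by apply/funext => l; rewrite /sg_ /sinc mulr0 sin0 mul0r; case: ifP; rewrite mul0r.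
rewrite e; have d (v : R) : is_derive v (1 : R) (fun _ : R => 0 : R) 0 by exact: is_derive_cst.
have -> : prim (fun=> 0) = fun _ : R => 0 by apply/funext => b; rewrite (primE b (@cst_continuous _ _ (0 : R)) d) subrr.
exact: cvg_cst.
Unshelve. all: end_near.
Qed.

Lemma sg_lim tau z : 0 <= tau -> prim (sg_ tau z) b @[b --> +oo_R] --> pi * sgt tau z.
by move=> t0; rewrite /sgt; case: eqP => [->|/eqP tn]; [exact: Dirichlet|apply: sg_tau_lim; rewrite lt_neqAle eq_sym tn].
Qed.

(** The integral over the whole half-line is pi times the smoothed sign; what lies below 1 is
    subtracted. *)
Lemma Itil_eq s x t y : s + t <= 0 ->
 Itil s x t y = - sgt (- s - t) (x - y) + pi^-1 * int01 (sg_ (- s - t) (x - y)).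
move=> st; have pn : pi != 0 :> R by rewrite gt_eqF// pi_gt0.
rewrite /Itil (@int1oo_lim (sg_ (- s - t) (x - y)) _ (pi * sgt (- s - t) (x - y))).
- by rewrite mulrBr mulrA mulNr mulVf// mulN1r; ring.
- exact: continuous_sg.
- move=> l l1; have ln : l != 0 by rewrite gt_eqF// (lt_le_trans ltr01).
 rewrite /sg_ /sinc (negbTE ln) [l^-1 * _]mulrC; congr (_ * expR _); ring.
by apply: sg_lim; lra.
Qed.

Definition cs_ tau z l : R := cos (l * z) * expR (- (l ^+ 2 * tau) / 2).
Lemma cs_E tau z : cs_ tau z = fun l => cos (l * z) * expR (- (tau * l ^+ 2 / 2)).
by apply/funext => l; rewrite /cs_; congr (_ * expR _); ring. Qed.

Lemma continuous_cs tau z : continuous (cs_ tau z).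
rewrite cs_E; apply: contM; last exact: continuous_gauss_tau.
exact: continuous_cosMr.
Qed.

(** The three cases of the definition become one integral over [0, 1]; for s < t the integral over
    the half-line contributes the heat kernel. *)
Lemma Stil_eq s x t y : Stil s x t y = pi^-1 * int01 (cs_ (t - s) (x - y)) - (if s < t then ga (t - s) (x - y) else 0).
have pn : pi != 0 :> R by rewrite gt_eqF// pi_gt0.
rewrite /Stil; case: (ltgtP s t) => st; first last.
- rewrite st subrr subr0 int01_prim.
 have -> : cs_ 0 (x - y) = fun u => cos ((x - y) * u).
  by apply/funext => u; rewrite /cs_ mulr0 oppr0 mul0r expR0 mulr1 mulrC.
 rewrite prim_cos /sinc subr_eq0 mulr1; case: ifP => _; first by rewrite mulr1.
 by rewrite invfM; ring.
- by rewrite subr0.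
have t0 : 0 < t - s by rewrite subr_gt0.
rewrite (@int1oo_lim (cs_ (t - s) (x - y)) _ (Ri (cs_ (t - s) (x - y)) / 2))//.
- rewrite {1}cs_E Ri_cos_gauss// mulrBr; have gen (p g : R) : p != 0 -> - p^-1 * (2 * p * g / 2) = - g by move=> h; field.
 by rewrite gen//; ring.
- exact: continuous_cs.
apply: prim_pinfty; [exact: continuous_cs|by rewrite cs_E; exact: itg_cos_gauss|].
by move=> l; rewrite /cs_ mulNr cosN sqrrN.
Qed.
End ImproperIntegrals.

(** * Convergence of the kernel *)

Section KernelLimit.
Variable R : realType.
Local Notation TT := (TT R).
Implicit Types (f g : R -> R) (s t x y l : R).

Lemma int01B f g : continuous f -> continuous g -> int01 f - int01 g = int01 (fun l => f l - g l).
by move=> cf cg; rewrite /int01 RintegralB//; exact: continuous_itg_itv. Qed.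
Lemma mul_sinc x l : l * sinc x l = sin (l * x).
by rewrite /sinc; have [->|l0] := eqVneq l 0; [rewrite !mul0r sin0|rewrite mulrC divfK]. Qed.

Lemma sinc_sub x y l : sinc x l * cos (l * y) - sinc y l * cos (l * x) = sinc (x - y) l.
rewrite /sinc; have [->|l0] := eqVneq l 0; first by rewrite !mul0r cos0 !mulr1.
by rewrite mulrBr sinB; ring.
Qed.

Let Pv s x l : R := cos (l * x) * expR (- (s * l ^+ 2 / 2)).
Let Pd s x l : R := - (l * sin (l * x)) * expR (- (s * l ^+ 2 / 2)).
Let Pp s x l : R := sinc x l * expR (- (s * l ^+ 2 / 2)).

Let cPv s x : continuous (Pv s x).
by apply: contM; [exact: continuous_cosMr|exact: continuous_gauss_tau]. Qed.

Let cPd s x : continuous (Pd s x).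
apply: contM; last exact: continuous_gauss_tau.
have c1 : continuous (fun u : R => sin (u * x)).
 have -> : (fun u => sin (u * x)) = (fun u => sin (x * u)) by apply/funext => v; rewrite mulrC.
 exact: continuous_sinM.
by move=> u; apply: cvgN; apply: (contM (f := id) _ c1) => v; exact: cvg_id.
Qed.

Let cPp s x : continuous (Pp s x).
by apply: contM; [exact: continuous_sinc|exact: continuous_gauss_tau]. Qed.
Let expM (a b c : R) l : a + b = c -> expR (- (a * l ^+ 2 / 2)) * expR (- (b * l ^+ 2 / 2)) = expR (- (c * l ^+ 2 / 2)).
by move=> <-; rewrite -expRD; congr expR; ring. Qed.

Lemma cvg_kD s x t y : (fun N => kD (TT N) (uphalf N) (odd N) (TT N + s) x (TT N + t) y) @ \oo --> DD s x t y.
have h := cvgB (@main_sum R _ _ (0) _ _ (ncvg_fv t y) (ncvg_fd s x) (@cPv t y) (@cPd s x))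
 (@main_sum R _ _ (0) _ _ (ncvg_fv s x) (ncvg_fd t y) (@cPv s x) (@cPd t y)).
have e : DD s x t y = pi^-1 * int01 (fun l => Pv t y l * Pd s x l) - pi^-1 * int01 (fun l => Pv s x l * Pd t y l).
 rewrite -mulrBr int01B; [|exact: contM|exact: contM].
 rewrite /DD mulNr -mulrN; congr (_ * _); rewrite /int01 -mulN1r -RintegralZl//; last first.
  apply: continuous_itg_itv.
  have -> : (fun l => l * sin (l * (x - y)) * expR (- ((s + t) * l ^+ 2) / 2)) = (fun l => - Pd (s + t) (x - y) l).
   by apply/funext => l; rewrite /Pd !mulNr opprK; congr (_ * expR _); ring.
  by move=> u; apply: cvgN; exact: cPd.
 apply: eq_Rintegral => l _; rewrite /Pv /Pd mulrBr sinB.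
 have -> : expR (- ((s + t) * l ^+ 2) / 2) = expR (- (s * l ^+ 2 / 2)) * expR (- (t * l ^+ 2 / 2)).
  by rewrite -expRD; congr expR; ring.
 by ring.
rewrite e; apply: (cvg_trans _ (h _)); apply: near_eq_cvg; near=> N; rewrite kD_msum//; near: N; exact: near_TT.
Unshelve. all: end_near.
Qed.

(** The two limits combine by the addition formula for the cosine, the factor l of the derivative
    cancelling the 1 / l in [sinc]. *)
Lemma cvg_kS s x t y : (fun N => kS (TT N) (uphalf N) (odd N) (TT N + s) x (TT N + t) y) @ \oo --> Stil s x t y.
have h1 := @main_sum R _ _ (- 2^-1) _ _ (ncvg_fv t y) (ncvg_fv (- s) x) (@cPv t y) (@cPv (- s) x).
have h2 := @main_sum R _ _ 0 _ _ (ncvg_fp (- s) x) (ncvg_fd t y) (@cPp (- s) x) (@cPd t y).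
have e : Stil s x t y = pi^-1 * int01 (fun l => Pv t y l * Pv (- s) x l) - pi^-1 * int01 (fun l => Pp (- s) x l * Pd t y l)
  - (if s < t then ga (t - s) (x - y) else 0).
 rewrite Stil_eq; congr (_ - _); rewrite -mulrBr int01B; [|exact: contM|exact: contM].
 congr (_ * int01 _); apply/funext => l; rewrite cs_E /Pv /Pp /Pd -(@expM (- s) t); last by ring.
 by rewrite mulrBr cosB -!mul_sinc; ring.
have h : (fun N => msum (fv t y) (fv (- s) x) (- 2^-1) N - msum (fp (- s) x) (fd t y) 0 N -
  (if s < t then ga (t - s) (x - y) else 0)) @ \oo --> Stil s x t y.
 by rewrite e; apply: cvgB; [exact: cvgB h1 h2|exact: cvg_cst].
apply: (cvg_eq_near h) => {h}; near=> N.
have [k1 k2] : 0 < TT N + s /\ 0 < TT N - s by near: N; exact: near_TTD.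
rewrite kS_msum//; near: N; exact: near_TT.
Unshelve. all: end_near.
Qed.

(** The hypothesis makes the smoothing time - s - t nonnegative. *)
Lemma cvg_kI s x t y : s + t <= 0 -> (fun N => kI (TT N) (uphalf N) (odd N) (TT N + s) x (TT N + t) y) @ \oo --> Itil s x t y.
move=> st.
have h1 := @main_sum R _ _ (- 2^-1) _ _ (ncvg_fp (- s) x) (ncvg_fv (- t) y) (@cPp (- s) x) (@cPv (- t) y).
have h2 := @main_sum R _ _ (- 2^-1) _ _ (ncvg_fp (- t) y) (ncvg_fv (- s) x) (@cPp (- t) y) (@cPv (- s) x).
have e : Itil s x t y = sgt (- s - t) (y - x) +
  (pi^-1 * int01 (fun l => Pp (- s) x l * Pv (- t) y l) - pi^-1 * int01 (fun l => Pp (- t) y l * Pv (- s) x l)).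
 rewrite Itil_eq// -[y - x]opprB sgtN; last by lra.
 congr (_ + _); rewrite -mulrBr int01B; [|exact: contM|exact: contM].
 congr (_ * int01 _); apply/funext => l; rewrite /sg_ /Pv /Pp -sinc_sub -(@expM (- s) (- t) (- s - t))//.
 by ring.
have h : (fun N => sgt (- s - t) (y - x) + (msum (fp (- s) x) (fv (- t) y) (- 2^-1) N - msum (fp (- t) y) (fv (- s) x) (- 2^-1) N))
  @ \oo --> Itil s x t y.
 by rewrite e; apply: cvgD; [exact: cvg_cst|exact: cvgB h1 h2].
apply: (cvg_eq_near h) => {h}; near=> N.
have [k1 k2] : 0 < TT N + s /\ 0 < TT N - s by near: N; exact: near_TTD.
have [k3 k4] : 0 < TT N + t /\ 0 < TT N - t by near: N; exact: near_TTD.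
rewrite kI_msum//; near: N; exact: near_TT.
Unshelve. all: end_near.
Qed.

Lemma cvg_kmat s x t y (i j : 'I_2) : s <= 0 -> t <= 0 ->
 (fun N => kmat (TT N) (uphalf N) (odd N) (TT N + s) x (TT N + t) y i j) @ \oo --> qmat s x t y i j.
move=> s0 t0; rewrite /qmat mxE; under eq_fun do rewrite /kmat mxE.
case: ifP => _; case: ifP => _; [exact: cvg_kS| |exact: cvg_kD|exact: cvg_kS].
by apply: cvg_kI; lra.
Qed.
End KernelLimit.

(** * Continuity of the quaternion determinant *)

Section TdetLimit.
Variables (R : realType) (I : finType).
Implicit Types (q : nat -> I -> I -> 'M[R]_2).

Lemma cvg_bigsum (J : Type) (r : seq J) (P : pred J) (f : nat -> J -> R) (g : J -> R) :
 (forall j, (fun n => f n j) @ \oo --> g j) ->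
 (fun n => \sum_(j <- r | P j) f n j) @ \oo --> \sum_(j <- r | P j) g j.
move=> h; elim: r => [|j r IH].
 by rewrite big_nil; under eq_fun do rewrite big_nil; exact: cvg_cst.
rewrite big_cons; under eq_fun do rewrite big_cons; case: ifP => // _; exact: cvgD.
Qed.

Lemma cvg_bigprod (J : Type) (r : seq J) (P : pred J) (f : nat -> J -> R) (g : J -> R) :
 (forall j, (fun n => f n j) @ \oo --> g j) ->
 (fun n => \prod_(j <- r | P j) f n j) @ \oo --> \prod_(j <- r | P j) g j.
move=> h; elim: r => [|j r IH].
 by rewrite big_nil; under eq_fun do rewrite big_nil; exact: cvg_cst.
rewrite big_cons; under eq_fun do rewrite big_cons; case: ifP => // _; exact: cvgM.
Qed.

Lemma cvg_bigmxprod (J : Type) (r : seq J) (f : nat -> J -> 'M[R]_2) (g : J -> 'M[R]_2) :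
 (forall j i k, (fun n => f n j i k) @ \oo --> g j i k) ->
 forall i k, (fun n => (\prod_(j <- r) f n j) i k) @ \oo --> (\prod_(j <- r) g j) i k.
move=> h; elim: r => [|j r IH] i k.
 by rewrite big_nil; under eq_fun do rewrite big_nil; exact: cvg_cst.
rewrite big_cons mxE; under eq_fun do rewrite big_cons mxE.
by apply: cvg_bigsum => v; apply: cvgM; [exact: h|exact: IH].
Qed.

Lemma cvg_Tdet q (q' : I -> I -> 'M[R]_2) : (forall a b i j, (fun n => q n a b i j) @ \oo --> q' a b i j) ->
 (fun n => Tdet (q n)) @ \oo --> Tdet q'.
move=> h; rewrite /Tdet; apply: cvg_bigsum => p; apply: cvgM; first exact: cvg_cst.
apply: cvg_bigprod => O; apply: cvgM; first exact: cvg_cst.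
rewrite /mxtrace; apply: cvg_bigsum => i; rewrite /cycprod; case: pickP => [a _|_]; last exact: cvg_cst.
by apply: cvg_bigmxprod => k u v; exact: h.
Qed.
End TdetLimit.

(* The limit of the correlation functions *)
Transparent TT.

Theorem theorem1 (R : realType) (M : nat) (Nm : 'I_M.+1 -> nat)
    (s : 'I_M.+1 -> R) (x : forall m : 'I_M.+1, 'I_(Nm m) -> R) :
  (1 <= M)%N ->
  (forall m, (0 < Nm m)%N) ->
  (forall m, s m <= 0) ->
  (forall m1 m2 : 'I_M.+1, (m1 < m2)%N -> s m1 < s m2) ->
  s ord_max = 0 ->
  (fun n : nat => corr n (2 * n%:R) (fun m => 2 * n%:R + s m) x) @ \oo
    --> (Tdet (Qmat s x))%:E.
Proof.
move=> _ _ s0 slt smax.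
have lim : (fun N => (Tdet (fun a b : {m : 'I_M.+1 & 'I_(Nm m)} => kmat (TT R N) (uphalf N) (odd N)
  (TT R N + s (tag a)) (x (tag a) (tagged a)) (TT R N + s (tag b)) (x (tag b) (tagged b))))%:E) @ \oo --> (Tdet (Qmat s x))%:E.
 apply: cvg_EFin; first exact: nearW.
 by apply: cvg_Tdet => a b i j; exact: cvg_kmat.
apply: (cvg_eq_near lim) => {lim}; near=> N.
have T0 : 0 < 2 * N%:R :> R by near: N; exact: (near_TT (0 : R)).
have N0 : (0 < N)%N by move: T0; rewrite pmulr_rgt0// ltr0n.
(* For large N all shifted times are positive and, below, each level has at most N prescribed
   points, as the finite-N formula requires. *)
have st : forall m, 0 < 2 * N%:R + s m.
 have h : \sum_m `|s m| < 2 * N%:R by near: N; exact: (near_TT (\sum_m `|s m| : R)).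
 move=> m; have : `|s m| <= \sum_m `|s m| by rewrite (bigD1 m)//= lerDl sumr_ge0.
 by have := ler_norm (- s m); rewrite normrN => h1 h2; lra.
have Nb m : (Nm m <= N)%N.
 apply: (@leq_trans (\sum_m Nm m)); first by rewrite (bigD1 m)//= leq_addr.
 by near: N; exact: nbhs_infty_ge.
have hn : ((uphalf N).*2 = odd N + N)%N by have := odd_double_half N; rewrite uphalf_half; case: (odd N) => /=; lia.
rewrite (corr_Tdet T0 hn N0)//.
- by move=> m1 m2 h; rewrite ltrD2l; exact: slt.
by rewrite smax addr0.
Unshelve. all: end_near.
Qed.
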